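(* Let $A$ be a separable, simple, unital, monotracial $\mathrm{C}^{*}$-algebra (i.e. $A$ has exactly one tracial state) with $\dim_{\mathrm{nuc}}A < \infty$. Suppose that $A$ is quasidiagonal. Then $A \otimes \mathcal{Q}$ is TAF.
   Context: $\mathcal{Q}$ denotes the universal UHF algebra, i.e. the UHF algebra with $\mathrm{K}_0(\mathcal{Q}) \cong \mathbb{Q}$. Nuclear dimension: a completely positive contractive (c.p.c.) map is order zero if it maps orthogonal positive elements to orthogonal elements. $\dim_{\mathrm{nuc}} A \le m$ if for every finite $\mathcal{F}\subset A$ and $\epsilon>0$ there are a finite dimensional $\mathrm{C}^*$-algebra $F=F^{(0)}\oplus\cdots\oplus F^{(m)}$, a c.p.c. map $\psi: A\to F$ and a completely positive map $\varphi: F\to A$ such that each $\varphi|_{F^{(l)}}$ is c.p.c. order zero and $\|\varphi\psi(a)-a\|<\epsilon$ for $a\in\mathcal{F}$. TAF: a simple unital $\mathrm{C}^*$-algebra $C$ is TAF (tracially approximately finite dimensional) if for every finite subset $\mathcal{F}\subset C$, every $\epsilon>0$ and every nonzero $c\in C_+$ there are a nonzero projection $p\in C$ and a finite dimensional $\mathrm{C}^*$-subalgebra $B\subset pCp$ with $1_B=p$ such that $\|pb-bp\|<\epsilon$ and $\mathrm{dist}(pbp,B)<\epsilon$ for all $b\in\mathcal{F}$, and $1_C-p$ is Murray–von Neumann equivalent to a projection in $\overline{cCc}$. *)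

(* Defs.v *)
From HB Require Import structures.
From mathcomp Require Import all_boot all_order all_algebra.
From mathcomp Require Import complex.
From mathcomp Require Import all_classical all_reals all_analysis.

Set Implicit Arguments.
Unset Strict Implicit.
Unset Printing Implicit Defensive.

Import Order.TTheory GRing.Theory Num.Theory.
Import numFieldNormedType.Exports.

Local Open Scope classical_set_scope.
Local Open Scope ring_scope.
Local Open Scope complex_scope.

(* Unital C*-algebras over C = R[i]. The zero algebra is allowed, so that a
   summand of a finite-dimensional C*-algebra may vanish. As usual over R[i],
   the norm takes its values in R[i]; they are real and nonnegative.
   HB cannot join the library's normed modules with its rings (the join would
   have to be declared before numDomainType), so the multiplication is part of
   the mixin; the ring structure, with its usual notations, is the instance
   declared on the carrier just below. *)
HB.mixin Record isCStarAlgebra (R : realType) A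
    of CompleteNormedModule R[i] A := {
  cstar_mul : A -> A -> A;
  cstar_one : A;
  star : A -> A;
  cstar_mulA : associative cstar_mul;
  cstar_mul1l : left_id cstar_one cstar_mul;
  cstar_mul1r : right_id cstar_one cstar_mul;
  cstar_mulDl : left_distributive cstar_mul +%R;
  cstar_mulDr : right_distributive cstar_mul +%R;
  cstar_scalerAl : forall (a : R[i]) (x y : A),
    a *: cstar_mul x y = cstar_mul (a *: x) y;
  cstar_scalerAr : forall (a : R[i]) (x y : A),
    a *: cstar_mul x y = cstar_mul x (a *: y);
  starD : forall x y : A, star (x + y) = star x + star y;
  starZ : forall (a : R[i]) (x : A), star (a *: x) = Num.conj a *: star x;
  starM : forall x y : A, star (cstar_mul x y) = cstar_mul (star y) (star x);
  starK : involutive star;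
  cstar_normM : forall x y : A, `|cstar_mul x y| <= `|x| * `|y|;
  cstar_norm : forall x : A, `|cstar_mul (star x) x| = `|x| ^+ 2
}.

#[short(type="cstarType")]
HB.structure Definition CStarAlgebra (R : realType) :=
  {A of CompleteNormedModule R[i] A & isCStarAlgebra R A}.

HB.instance Definition _ (R : realType) (A : cstarType R) :=
  GRing.Zmodule_isPzRing.Build (CStarAlgebra.sort A)
    (@cstar_mulA R A) (@cstar_mul1l R A) (@cstar_mul1r R A)
    (@cstar_mulDl R A) (@cstar_mulDr R A).

Section BasicNotions.
Variable R : realType.
Implicit Types A B : cstarType R.

Definition positive_elt A (x : A) : Prop := exists y : A, x = star y * y.

Definition projection A (p : A) : Prop := p * p = p /\ star p = p.

Definition murray_von_neumann A (p q : A) : Prop :=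
  exists v : A, star v * v = p /\ v * star v = q.

Definition star_hom A B (f : A -> B) : Prop :=
  [/\ linear f, {morph f : x y / x * y} & {morph f : x / star x}].

Definition unital_star_hom A B (f : A -> B) : Prop := star_hom f /\ f 1 = 1.

Definition separable A : Prop := exists2 S : set A, countable S & dense S.

Definition closed_ideal A (I : set A) : Prop :=
  [/\ closed I, I 0,
      forall x y, I x -> I y -> I (x + y),
      forall (a : R[i]) x, I x -> I (a *: x)
    & forall x y, I x -> I (x * y) /\ I (y * x)].

Definition simple A : Prop :=
  (1 : A) <> 0 /\
  forall I : set A, closed_ideal I -> I = [set 0] \/ I = setT.

Definition tracial_state A (tau : A -> R[i]) : Prop :=
  [/\ scalar tau, forall x, positive_elt x -> 0 <= tau x, tau 1 = 1
    & forall x y, tau (x * y) = tau (y * x)].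

Definition monotracial A : Prop := exists! tau : A -> R[i], tracial_state tau.

(* Closed under sums, scalars, products and adjoints; need not contain 1. *)
Definition star_subalgebra A (B : set A) : Prop :=
  [/\ B 0, forall x y, B x -> B y -> B (x + y),
      forall (a : R[i]) x, B x -> B (a *: x),
      forall x y, B x -> B y -> B (x * y)
    & forall x, B x -> B (star x)].

Definition finite_dimensional A (B : set A) : Prop :=
  exists (n : nat) (e : 'I_n -> A), forall x, B x ->
    exists c : 'I_n -> R[i], x = \sum_i c i *: e i.

(* [B] is the image of a unital *-embedding of a full matrix algebra M_k(C),
   k >= 1. With B = setT this says that A itself is (isomorphic to) M_k(C),
   whose C*-norm is unique. *)
Definition full_matrix_subalgebra A (B : set A) : Prop :=
  exists (k : nat) (e : 'M[R[i]]_k.+1 -> A),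
    [/\ linear e, {morph e : X Y / X *m Y >-> X * Y},
        forall X, e (map_mx Num.conj X)^T = star (e X),
        e 1%:M = 1
      & injective e /\ range e = B].

End BasicNotions.

Section Matrices.
Variables (R : realType) (A : cstarType R).

Definition adjmx m n (X : 'M[A]_(m, n)) : 'M[A]_(n, m) :=
  (map_mx star X)^T.

Definition positive_mx n (X : 'M[A]_n) : Prop :=
  exists Y : 'M[A]_n, X = adjmx Y *m Y.

Definition projection_mx n (p : 'M[A]_n) : Prop :=
  p *m p = p /\ adjmx p = p.

Definition murray_von_neumann_mx m n (p : 'M[A]_m) (q : 'M[A]_n) : Prop :=
  exists v : 'M[A]_(n, m), adjmx v *m v = p /\ v *m adjmx v = q.

Definition dsum_mx m n (p : 'M[A]_m) (q : 'M[A]_n) : 'M[A]_(m + n) :=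
  block_mx p 0 0 q.

(* [p] and [q] have the same class in K_0(A). *)
Definition stably_equivalent m n (p : 'M[A]_m) (q : 'M[A]_n) : Prop :=
  exists (k : nat) (r : 'M[A]_k),
    projection_mx r /\ murray_von_neumann_mx (dsum_mx p r) (dsum_mx q r).

(* K_0(A) is isomorphic to G as an abelian group. K_0 of a unital algebra is
   the Grothendieck group of the Murray-von Neumann semigroup of projections
   in matrices over A; an isomorphism K_0(A) -> G is written here as the map
   [kappa] that it induces on projections: additive, identifying two
   projections exactly when their K_0-classes agree, and with every element
   of G a formal difference. *)
Definition K0_isomorphic (G : zmodType) : Prop :=
  exists kappa : forall n, 'M[A]_n -> G,
    [/\ forall m n (p : 'M[A]_m) (q : 'M[A]_n),
          projection_mx p -> projection_mx q ->
          kappa (m + n)%N (dsum_mx p q) = kappa m p + kappa n q,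
        forall m n (p : 'M[A]_m) (q : 'M[A]_n),
          projection_mx p -> projection_mx q ->
          (kappa m p = kappa n q <-> stably_equivalent p q)
      & forall g : G, exists (m n : nat) (p : 'M[A]_m) (q : 'M[A]_n),
          [/\ projection_mx p, projection_mx q & g = kappa m p - kappa n q]].

End Matrices.

Section Approximation.
Variable R : realType.
Implicit Types A B F : cstarType R.

Definition completely_positive A B (f : A -> B) : Prop :=
  linear f /\
  forall n (X : 'M[A]_n), positive_mx X -> positive_mx (map_mx f X).

Definition cpc A B (f : A -> B) : Prop :=
  completely_positive f /\ forall x, `|f x| <= `|x|.

(* For positive (hence self-adjoint) elements, orthogonality is x * y = 0. *)
Definition cpc_order_zero A B (f : A -> B) : Prop :=
  cpc f /\
  forall x y, positive_elt x -> positive_elt y -> x * y = 0 -> f x * f y = 0.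

(* [F] is the direct sum of the C*-algebras [G l], with inclusions [i l]. *)
Definition direct_sum n (G : 'I_n -> cstarType R) F
    (i : forall l, G l -> F) : Prop :=
  [/\ forall l, star_hom (i l),
      forall l k (x : G l) (y : G k), l <> k -> i l x * i k y = 0
    & forall z : F, exists! x : forall l, G l, z = \sum_l i l (x l)].

Definition nuclear_dimension_le A (m : nat) : Prop :=
  forall (S : set A) (e : R), finite_set S -> 0 < e ->
  exists (F : cstarType R) (G : 'I_m.+1 -> cstarType R)
    (i : forall l, G l -> F) (psi : A -> F) (phi : F -> A),
    [/\ finite_dimensional [set: F], direct_sum i,
        cpc psi,
        completely_positive phi /\ (forall l, cpc_order_zero (phi \o i l))
      & forall a, S a -> `|phi (psi a) - a| < e%:C].

Definition finite_nuclear_dimension A : Prop :=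
  exists m, nuclear_dimension_le A m.

Definition quasidiagonal A : Prop :=
  forall (S : set A) (e : R), finite_set S -> 0 < e ->
  exists (M : cstarType R) (psi : A -> M),
    [/\ full_matrix_subalgebra [set: M], cpc psi,
        forall a b, S a -> S b -> `|psi (a * b) - psi a * psi b| < e%:C
      & forall a, S a -> `| `|psi a| - `|a| | < e%:C].

Definition UHF A : Prop :=
  exists B : nat -> set A,
    [/\ forall n, full_matrix_subalgebra (B n),
        forall n, B n `<=` B n.+1
      & dense (\bigcup_n B n)].

Definition universal_UHF A : Prop := UHF A /\ K0_isomorphic A rat.

Definition TAF A : Prop :=
  simple A /\
  forall (S : set A) (e : R) (c : A),
    finite_set S -> 0 < e -> positive_elt c -> c <> 0 ->
  exists (p : A) (B : set A),
    [/\ projection p /\ p <> 0,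
        star_subalgebra B /\ finite_dimensional B,
        B p /\ (forall x, B x -> p * x = x /\ x * p = x),
        forall b, S b ->
          `|p * b - b * p| < e%:C /\
          exists2 x, B x & `|p * b * p - x| < e%:C
      & exists2 q : A, projection q /\ closure [set c * x * c | x in setT] q
          & murray_von_neumann (1 - p) q].

End Approximation.

Section TensorProduct.
Variables (R : realType) (A B : cstarType R).

Definition elementary_sum (D : cstarType R) (jA : A -> D) (jB : B -> D)
    n (a : 'I_n -> A) (b : 'I_n -> B) : D := \sum_i jA (a i) * jB (b i).

Definition linearly_independent n (b : 'I_n -> B) : Prop :=
  forall c : 'I_n -> R[i], \sum_i c i *: b i = 0 -> forall i, c i = 0.

(* The *-homomorphism from the algebraic tensor product of A and B to D
   sending a (x) b to jA a * jB b is well defined, unital and injective (every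
   tensor being a sum of a_i (x) b_i with linearly independent b_i); the norm
   of D thus restricts to a C*-norm on the algebraic tensor product. *)
Definition tensor_embedding (D : cstarType R) (jA : A -> D) (jB : B -> D) :
    Prop :=
  [/\ unital_star_hom jA, unital_star_hom jB,
      forall a b, jA a * jB b = jB b * jA a
    & forall n (a : 'I_n -> A) (b : 'I_n -> B), linearly_independent b ->
        elementary_sum jA jB a b = 0 -> forall i, a i = 0].

(* D is the completion of the algebraic tensor product in its least C*-norm,
   i.e. the minimal (spatial) tensor product; it is the only C*-tensor product
   when one of the factors is nuclear. *)
Definition cstar_tensor_product (D : cstarType R) (jA : A -> D) (jB : B -> D) :
    Prop :=
  [/\ tensor_embedding jA jB,
      dense [set z : D | exists n (a : 'I_n -> A) (b : 'I_n -> B),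
               z = elementary_sum jA jB a b]
    & forall (E : cstarType R) (kA : A -> E) (kB : B -> E),
        tensor_embedding kA kB ->
        forall n (a : 'I_n -> A) (b : 'I_n -> B),
        `|elementary_sum jA jB a b| <= `|elementary_sum kA kB a b|].

End TensorProduct.

(* Main.v *)
(* No structure theorem (strict comparison, Z-stability, Voiculescu's theorem)
   is used; the argument compares diagonal matrices over fixed subalgebras in
   the sense of Cuntz, writing [a] <= [b].
   (1) A has finite nuclear dimension m and a unique trace tau. On each block of
   each colour the functional x |-> (lam^2 / n) Tr (psi(1) psi(x)) is nearly
   tracial, hence nearly a multiple of tau. Counting minimal projections, every
   nonzero positive contraction x satisfies M1 [1] <= M2 [x] for suitable M1, M2
   with M2 tau(x) <= c M1, where c depends on m only.
   (2) The relative commutants of the matrix subalgebras of Q contain matrix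
   units of arbitrarily large size, because K_0(Q) = rat is divisible; hence
   K [a] <= K' [b] implies [a] <= C [b] as soon as 2 K' <= C K.
   (3) A quasidiagonal model of A in a matrix algebra, followed by an embedding
   of that algebra in Q, is a map al into a finite-dimensional algebra with unit
   P. By (1) and (2) the order zero maps of A yield columns V_i, their number
   depending on m only, with \sum V_i^* V_i = P and a V_i ~ V_i al(a).
   (4) With the V_i in orthogonal positions, \sum V_i (x) e_i0 carries that
   algebra to a finite-dimensional subalgebra nearly commuting with A. Inside a
   remainder 1 - p its unit p' satisfies (M + 1) [1 - p - p'] <= M [1 - p], so
   by iteration the remainder becomes smaller than any given positive element. *)
From HB Require Import structures.
From mathcomp Require Import all_boot all_order all_algebra.
From mathcomp Require Import complex spectral.
From mathcomp Require Import all_classical all_reals all_analysis.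
From mathcomp Require Import ring lra zify.
Require Import Defs.
Set Implicit Arguments.
Unset Strict Implicit.
Unset Printing Implicit Defensive.
Import Order.TTheory GRing.Theory Num.Theory.
Import numFieldNormedType.Exports.
Local Open Scope classical_set_scope.
Local Open Scope ring_scope.
Local Open Scope complex_scope.

(** * Elementary C*-algebra theory *)

(** The obstacle is the order of quantifiers. The iteration in (4) shrinks the remainder only if the
    factor M / (M + 1) is the same in every round, so the number of columns must be known before the
    finite set, the tolerance and the model. This is why (1) bounds a ratio by a constant in m
    alone, although M1 and M2 themselves are not controlled. Blocks on which an order zero map is
    small carry no usable trace, hence the weight lam^2; the part of the unit that escapes the trace
    count is only shown to fill at most half of it, which the doubling in [key] tolerates.
    Multiplicities can be divided, at the price of a factor two, when a comparison is witnessed by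
    entries commuting with large matrix units of Q. Therefore each comparison records the subalgebra
    of its entries, and square roots, inverses and cuts come with the subalgebras that contain them.
    In a round the columns are chosen first; the previous remainder is then asked to commute with
    them up to a small error. *)

Section NcRing.
Variables (R : realType) (A : cstarType R).

Lemma mulZl (a : R[i]) (x y : A) : (a *: x) * y = a *: (x * y).
Proof. by symmetry; apply: cstar_scalerAl. Qed.

Lemma mulZr (a : R[i]) (x y : A) : x * (a *: y) = a *: (x * y).
Proof. by symmetry; apply: cstar_scalerAr. Qed.

(* Identities in a noncommutative algebra are decided by comparing monomials,
   with the scalars treated as atoms. *)
Inductive nce := N0 | N1 | NV of nat | NA of nce & nce | NO of nce
  | NM of nce & nce | NS of nat & nce.

Variables (sv : seq R[i]) (rv : seq A).

Fixpoint nev e : A := match e with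
  | N0 => 0 | N1 => 1 | NV i => nth 0 rv i | NA a b => nev a + nev b
  | NO a => - nev a | NM a b => nev a * nev b
  | NS k a => nth 0 sv k *: nev a end.

Fixpoint nnf e : seq (int * (seq nat * seq nat)) := match e with
  | N0 => [::]
  | N1 => [:: (1, ([::], [::]))]
  | NV i => [:: (1, ([::], [:: i]))]
  | NA a b => nnf a ++ nnf b
  | NO a => [seq (- t.1, t.2) | t <- nnf a]
  | NM a b => flatten [seq [seq (t.1 * u.1, (t.2.1 ++ u.2.1, t.2.2 ++ u.2.2))
                  | u <- nnf b] | t <- nnf a]
  | NS k a => [seq (t.1, (k :: t.2.1, t.2.2)) | t <- nnf a] end.

Definition nmon (t : seq nat * seq nat) : A :=
  (\prod_(k <- t.1) nth 0 sv k) *: \prod_(i <- t.2) nth 0 rv i.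

Lemma nnfE e : nev e = \sum_(t <- nnf e) nmon t.2 *~ t.1.
Proof.
elim: e => [||i|a IHa b IHb|a IHa|a IHa b IHb|k a IHa] /=.
- by rewrite big_nil.
- by rewrite big_seq1 /nmon !big_nil scale1r.
- by rewrite big_seq1 /nmon big_nil big_seq1 scale1r.
- by rewrite big_cat IHa IHb.
- rewrite big_map IHa -sumrN; apply: eq_bigr => t _ /=; by rewrite mulrNz.
- rewrite IHa IHb big_flatten big_map mulr_suml; apply: eq_bigr => t _.
  rewrite big_map mulr_sumr; apply: eq_bigr => u _ /=.
  rewrite /nmon !big_cat /= -scalerA -mulZr -mulZl.
  by rewrite mulrzAl mulrzAr -mulrzA mulrC.
rewrite IHa big_map scaler_sumr; apply: eq_bigr => t _ /=.
by rewrite -scalerMzr /nmon big_cons scalerA.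
Qed.

(** Scalars commute, so their indices are sorted; the word in the algebra elements keeps its
    order. *)
Definition nkey (t : seq nat * seq nat) := (sort leq t.1, t.2).

Lemma nmon_key t : nmon (nkey t) = nmon t.
Proof. by rewrite /nmon /nkey /=; congr (_ *: _); apply: perm_big; rewrite perm_sort. Qed.

(** Relations between scalars, such as 1/2 + 1/2 = 1, are invisible here; below they are supplied by
    hand through [rcD], [rcM] and [rc1]. *)
Definition ncheck (l : seq (int * (seq nat * seq nat))) :=
  let l' := [seq (t.1, nkey t.2) | t <- l] in
  all (fun k => foldr (fun t s => if t.2 == k then t.1 + s else s) 0 l' == 0)
    (undup (map snd l')).

Lemma ncheckP e1 e2 : ncheck (nnf (NA e1 (NO e2))) -> nev e1 = nev e2.
Proof.
move=> H; apply/eqP; rewrite -subr_eq0; apply/eqP.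
change (nev (NA e1 (NO e2)) = 0); rewrite nnfE.
move: (nnf _) H => l /allP /= H.
transitivity (\sum_(t <- [seq (t.1, nkey t.2) | t <- l]) nmon t.2 *~ t.1).
  by rewrite big_map; apply: eq_bigr => t _ /=; rewrite nmon_key.
move: (map _ l) H => {}l H.
rewrite (eq_big_seq (fun t => \sum_(k <- undup (map snd l)) if t.2 == k then nmon k *~ t.1 else 0)); last first.
  move=> t tl /=.
  rewrite (bigD1_seq t.2) ?undup_uniq ?mem_undup ?map_f //= eqxx big1 ?addr0 //.
  by move=> k /negbTE; rewrite eq_sym => ->.
rewrite exchange_big /=; apply: big1_seq => k /andP[_ kl].
transitivity (nmon k *~ foldr (fun t s => if t.2 == k then t.1 + s else s) 0 l).
  elim: (l) => [|t l' IH]; first by rewrite big_nil /= mulr0z.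
  by rewrite big_cons IH /=; case: eqP => _; rewrite ?add0r // mulrzDr.
by move/eqP: (H _ kl) => ->; rewrite mulr0z.
Qed.
End NcRing.

(** Atoms are identified up to unification. Whatever is not 0, 1, a sum, an opposite, a product or a
    scalar multiple becomes an atom. *)
Ltac nc_mem x l := match l with
  | ?y :: _ => let _ := match goal with _ => unify x y end in constr:(true)
  | _ :: ?l' => nc_mem x l' | _ => constr:(false) end.
Ltac nc_add x l := let b := nc_mem x l in
  lazymatch b with true => constr:(l) | false => constr:(x :: l) end.
Ltac nc_idx x l := match l with
  | ?y :: _ => let _ := match goal with _ => unify x y end in constr:(0%N)
  | _ :: ?l' => let n := nc_idx x l' in constr:(S n) end.
Ltac nc_col e sv rv k := lazymatch e with
  | (?x + ?y)%R => nc_col x sv rv ltac:(fun s r => nc_col y s r k)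
  | (- ?x)%R => nc_col x sv rv k
  | (?x * ?y)%R => nc_col x sv rv ltac:(fun s r => nc_col y s r k)
  | (?a *: ?x)%R => let s := nc_add a sv in nc_col x s rv k
  | (0)%R => k sv rv
  | (1)%R => k sv rv
  | ?x => let r := nc_add x rv in k sv r end.
Ltac nc_rei e sv rv := lazymatch e with
  | (?x + ?y)%R => let a := nc_rei x sv rv in let b := nc_rei y sv rv in constr:(NA a b)
  | (- ?x)%R => let a := nc_rei x sv rv in constr:(NO a)
  | (?x * ?y)%R => let a := nc_rei x sv rv in let b := nc_rei y sv rv in constr:(NM a b)
  | (?a *: ?x)%R => let i := nc_idx a sv in let b := nc_rei x sv rv in constr:(NS i b)
  | (0)%R => constr:(N0)
  | (1)%R => constr:(N1)
  | ?x => let i := nc_idx x rv in constr:(NV i) end.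
Ltac ncring := lazymatch goal with
  | |- @eq ?T ?x ?y =>
    match T with context [?A] =>
    lazymatch type of A with CStarAlgebra.type ?R =>
    let sT := constr:(@nil (complex R)) in let rT := constr:(@nil (CStarAlgebra.sort A)) in
    nc_col x sT rT ltac:(fun s r => nc_col y s r ltac:(fun s r =>
      let a := nc_rei x s r in let b := nc_rei y s r in
      apply: (@ncheckP _ _ s r a b); vm_compute; reflexivity)) end end end.

Local Notation "r *^ x" := (r%:C *: x) (at level 40, left associativity).

Section Norm.
Variables (R : realType) (A : cstarType R).
Implicit Types (x y z w a b h k : A) (r s t e : R).

(** A real-valued copy of the R[i]-valued norm, which brings all estimates into the reach of [lra]
    and [nra]. *)
Definition nrm x : R := complex.Re `|x|.

Lemma nrmE x : `|x| = (nrm x)%:C.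
Proof. by rewrite /nrm RRe_real // ger0_real. Qed.

Lemma nrm_ge0 x : 0 <= nrm x.
Proof. by rewrite -ler0c -nrmE. Qed.

Lemma lecC r s : (r%:C <= s%:C :> R[i]) = (r <= s).
Proof. by rewrite lecE /= eqxx. Qed.

Lemma ltcC r s : (r%:C < s%:C :> R[i]) = (r < s).
Proof. by rewrite ltcE /= eqxx. Qed.

Lemma nrm_le x r : (`|x| <= r%:C) = (nrm x <= r).
Proof. by rewrite nrmE lecC. Qed.

Lemma nrm_lt x r : (`|x| < r%:C) = (nrm x < r).
Proof. by rewrite nrmE ltcE /= eqxx. Qed.

Lemma nrmD x y : nrm (x + y) <= nrm x + nrm y.
Proof. by rewrite -lecC rmorphD /= -!nrmE ler_normD. Qed.

Lemma nrmN x : nrm (- x) = nrm x.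
Proof. by rewrite /nrm normrN. Qed.

Lemma nrmB x y : nrm (x - y) = nrm (y - x).
Proof. by rewrite /nrm distrC. Qed.

Lemma nrm_tri x y z e f : nrm (x - y) <= e -> nrm (y - z) <= f -> nrm (x - z) <= e + f.
Proof.
move=> h1 h2; have := nrmD (x - y) (y - z).
by rewrite addrA subrK => h; apply: le_trans h _; apply: lerD.
Qed.

Lemma nrm0 : nrm (0 : A) = 0.
Proof. by rewrite /nrm normr0. Qed.

Lemma nrm_eq0 x : nrm x = 0 -> x = 0.
Proof. by move=> h; apply/eqP; rewrite -normr_eq0 nrmE h. Qed.

Lemma nrm_gt0 x : x <> 0 -> 0 < nrm x.
Proof. by move=> h; rewrite lt_neqAle nrm_ge0 andbT; apply/eqP => e; apply: h; apply: nrm_eq0. Qed.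

Lemma nrmM x y : nrm (x * y) <= nrm x * nrm y.
Proof. by rewrite -lecC rmorphM /= -!nrmE; apply: cstar_normM. Qed.

Lemma nrmM_le x y r s : nrm x <= r -> nrm y <= s -> nrm (x * y) <= r * s.
Proof. by move=> h1 h2; apply: le_trans (nrmM _ _) _; apply: ler_pM => //; apply: nrm_ge0. Qed.

Definition cnm (a : R[i]) : R := complex.Re `|a|.

Lemma cnmE (a : R[i]) : `|a| = (cnm a)%:C.
Proof. by rewrite /cnm RRe_real // ger0_real. Qed.

Lemma nrmZ (a : R[i]) x : nrm (a *: x) = cnm a * nrm x.
Proof. by apply: complexI; rewrite rmorphM /= -!nrmE -cnmE normrZ. Qed.

Lemma cnm_real r : cnm r%:C = `|r|.
Proof. by rewrite /cnm normc_def /= expr0n addr0 sqrtr_sqr. Qed.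

Lemma nrmZr r x : nrm (r *^ x) = `|r| * nrm x.
Proof. by rewrite nrmZ cnm_real. Qed.

Lemma nrmZ0 r x : 0 <= r -> nrm (r *^ x) = r * nrm x.
Proof. by move=> h; rewrite nrmZr ger0_norm. Qed.

Lemma nrm_cs x : nrm (star x * x) = nrm x ^+ 2.
Proof. by apply: complexI; rewrite rmorphXn /= -!nrmE; apply: cstar_norm. Qed.

Lemma star0 : star (0 : A) = 0.
Proof. by have := starZ 0 (0 : A); rewrite !scale0r rmorph0 scale0r. Qed.

Lemma starN x : star (- x) = - star x.
Proof. by have := starZ (-1) x; rewrite !scaleN1r rmorphN1 scaleN1r. Qed.

Lemma starB x y : star (x - y) = star x - star y.
Proof. by rewrite starD starN. Qed.

Lemma starMr x y : star (x * y) = star y * star x.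
Proof. exact: starM. Qed.

Lemma star1 : star (1 : A) = 1.
Proof.
have e := starMr (star 1) (1 : A); rewrite mulr1 !starK mulr1 in e.
by rewrite -e.
Qed.

Lemma conj_real r : Num.conj (r%:C : R[i]) = r%:C.
Proof. by apply/CrealP; rewrite complex_real. Qed.

Lemma starZr r x : star (r *^ x) = r *^ star x.
Proof. by rewrite starZ conj_real. Qed.

Lemma star_sum I (P : seq I) (Q : pred I) (F : I -> A) :
  star (\sum_(i <- P | Q i) F i) = \sum_(i <- P | Q i) star (F i).
Proof. by elim/big_rec2: _ => [|i y1 y2 _ <-]; rewrite ?star0 ?starD. Qed.

Lemma nrm_star x : nrm (star x) = nrm x.
Proof.
have H z : nrm z <= nrm (star z).
  case: (eqVneq (nrm z) 0) => [->|nz]; first exact: nrm_ge0.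
  have z0 : 0 < nrm z by rewrite lt_neqAle eq_sym nz nrm_ge0.
  rewrite -(ler_pM2r z0) -expr2 -nrm_cs; exact: nrmM.
by apply/eqP; rewrite eq_le H andbT -{2}[x]starK H.
Qed.

Lemma nrm_sa x : star x = x -> nrm (x * x) = nrm x ^+ 2.
Proof. by move=> h; rewrite -nrm_cs h. Qed.

Lemma nrm_sqr_le x r : 0 <= r -> nrm (star x * x) <= r ^+ 2 -> nrm x <= r.
Proof. by move=> r0; rewrite nrm_cs ler_pXn2r // nnegrE nrm_ge0. Qed.

(** Only an inequality, because the zero algebra is allowed. *)
Lemma nrm1 : nrm (1 : A) <= 1.
Proof.
have := nrm_cs (1 : A); rewrite star1 mulr1 => h.
case: (leP (nrm (1:A)) 1) => // h1; have : nrm (1:A) < nrm (1:A) ^+ 2 by rewrite expr2 ltr_pMr // (lt_trans ltr01).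
by rewrite -h ltxx.
Qed.

Lemma nrm1Z r : 0 <= r -> nrm (r *^ (1 : A)) <= r.
Proof. by move=> h; rewrite nrmZ0 // ler_piMr // nrm1. Qed.

Lemma nrm_sum I (P : seq I) (Q : pred I) (F : I -> A) :
  nrm (\sum_(i <- P | Q i) F i) <= \sum_(i <- P | Q i) nrm (F i).
Proof.
elim/big_rec2: _ => [|i y1 y2 _ h]; first by rewrite nrm0.
by apply: le_trans (nrmD _ _) _; rewrite lerD2l.
Qed.

Lemma nrm_sum_const (I : finType) (F : I -> A) e :
  (forall i, nrm (F i) <= e) -> nrm (\sum_i F i) <= #|I|%:R * e.
Proof.
move=> h; apply: le_trans (nrm_sum _ _ _) _.
by apply: le_trans (ler_sum _ (fun i _ => h i)) _; rewrite sumr_const mulr_natl.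
Qed.

Lemma nrm_small x : (forall e, 0 < e -> nrm x <= e) -> x = 0.
Proof.
move=> h; apply: nrm_eq0; apply/eqP; rewrite eq_le nrm_ge0 andbT.
by apply/ler_addgt0Pl => e e0; rewrite addr0; apply: h.
Qed.

Lemma rcM r s x : r *^ (s *^ x) = (r * s) *^ x.
Proof. by rewrite scalerA rmorphM. Qed.

Lemma rcD r s x : r *^ x + s *^ x = (r + s) *^ x.
Proof. by rewrite -scalerDl rmorphD. Qed.

Lemma rcN r x : - (r *^ x) = (- r) *^ x.
Proof. by rewrite -scaleNr rmorphN. Qed.

Lemma rcB r s x : r *^ x - s *^ x = (r - s) *^ x.
Proof. by rewrite rcN rcD. Qed.

Lemma rc1 x : 1 *^ x = x.
Proof. by rewrite scale1r. Qed.

Lemma rc0 x : 0 *^ x = 0.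
Proof. by rewrite scale0r. Qed.

Lemma rcnat n x : n%:R *^ x = x *+ n.
Proof. by rewrite rmorph_nat scaler_nat. Qed.

Definition cvA (u : nat -> A) l := forall e, 0 < e -> exists N, forall n, (N <= n)%N -> nrm (u n - l) <= e.

Lemma cvA_cauchy (u : nat -> A) (d : nat -> R) :
  (forall n m, (n <= m)%N -> nrm (u m - u n) <= d n) ->
  (forall e, 0 < e -> exists n, d n <= e) -> exists l, cvA u l.
Proof.
move=> hu hd.
have : cvg (u n @[n --> \oo]).
  apply/cauchy_cvgP/cauchy_exP => e e0.
  have er : e = (complex.Re e)%:C by rewrite RRe_real // gtr0_real.
  have he : 0 < complex.Re e by move: e0; rewrite {1}er ltcC.
  have he2 : 0 < complex.Re e / 2 by lra.
  have [n hn] := hd _ he2.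
  exists (u n); exists n => // k /= nk.
  rewrite -ball_normE /= er nrm_lt nrmB.
  have := hu _ _ nk; lra.
move=> /cvg_ex [l] /cvgrPdist_le hl; exists l => e e0.
have ec : (0 : R[i]) < e%:C by rewrite ltcC.
have [N _ hN] := hl _ ec; exists N => n Nn.
by rewrite nrmB -nrm_le; apply: hN.
Qed.

Lemma cvA_unique u l l' : cvA u l -> cvA u l' -> l = l'.
Proof.
move=> h1 h2; apply/eqP; rewrite -subr_eq0; apply/eqP; apply: nrm_small => e e0.
have e2 : 0 < e / 2 by lra.
have [n hn] := h1 _ e2; have [m hm] := h2 _ e2.
have := hn _ (leq_maxl n m); have := hm _ (leq_maxr n m).
rewrite [nrm (_ - l)]nrmB => a b; have := nrm_tri b a; lra.
Qed.

Lemma cvA_cst l : cvA (fun=> l) l.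
Proof. by move=> e e0; exists 0%N => n _; rewrite subrr nrm0 ltW. Qed.

Lemma cvA_ext u v l : (forall n, u n = v n) -> cvA u l -> cvA v l.
Proof. by move=> h hu e /hu [N hN]; exists N => n /hN; rewrite h. Qed.

Lemma cvA_shift u l : cvA u l -> cvA (fun n => u n.+1) l.
Proof. by move=> hu e /hu [N hN]; exists N => n Nn; apply: hN; apply: leqW. Qed.

Lemma cvAD u v l m : cvA u l -> cvA v m -> cvA (fun n => u n + v n) (l + m).
Proof.
move=> hu hv e e0; have e2 : 0 < e / 2 by lra.
have [N hN] := hu _ e2; have [M hM] := hv _ e2.
exists (maxn N M) => n; rewrite geq_max => /andP[/hN h1 /hM h2].
have -> : u n + v n - (l + m) = (u n - l) + (v n - m) by ncring.
have := nrmD (u n - l) (v n - m); lra.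
Qed.

Lemma cvA_lip u l (f : A -> A) K : 0 <= K -> (forall x y, nrm (f x - f y) <= K * nrm (x - y)) ->
  cvA u l -> cvA (fun n => f (u n)) (f l).
Proof.
move=> K0 hf hu e e0; have e2 : 0 < e / (K + 1) by apply: divr_gt0; lra.
have [N hN] := hu _ e2; exists N => n /hN h; apply: le_trans (hf _ _) _.
have : K * nrm (u n - l) <= K * (e / (K + 1)) by apply: ler_wpM2l.
move/le_trans; apply; rewrite mulrA ler_pdivrMr; nra.
Qed.

Lemma cvAN u l : cvA u l -> cvA (fun n => - u n) (- l).
Proof. by apply: (cvA_lip (K := 1)) => // x y; rewrite -opprD nrmN mul1r. Qed.

Lemma cvA_star u l : cvA u l -> cvA (fun n => star (u n)) (star l).
Proof. by apply: (cvA_lip (K := 1)) => // x y; rewrite -starB nrm_star mul1r. Qed.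

Lemma cvAZ (a : R[i]) u l : cvA u l -> cvA (fun n => a *: u n) (a *: l).
Proof.
apply: (cvA_lip (K := cnm a)); first by rewrite -ler0c -cnmE.
by move=> x y; rewrite -scalerBr nrmZ.
Qed.

Lemma cvA_mulr x u l : cvA u l -> cvA (fun n => u n * x) (l * x).
Proof.
apply: (cvA_lip (f := fun y => y * x) (K := nrm x)); first exact: nrm_ge0.
by move=> a b; rewrite -mulrBl mulrC; exact: nrmM.
Qed.

Lemma cvA_mull x u l : cvA u l -> cvA (fun n => x * u n) (x * l).
Proof.
apply: (cvA_lip (f := fun y => x * y) (K := nrm x)); first exact: nrm_ge0.
by move=> a b; rewrite -mulrBr; exact: nrmM.
Qed.

Lemma cvAM u v l m : cvA u l -> cvA v m -> cvA (fun n => u n * v n) (l * m).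
Proof.
move=> hu hv e e0.
have a0 := nrm_ge0 l; have b0 := nrm_ge0 m.
pose K := nrm l + nrm m + 2.
have d0 : 0 < Num.min 1 (e / K) by rewrite lt_min ltr01 divr_gt0 // /K; lra.
have [N hN] := hu _ d0; have [M hM] := hv _ d0.
exists (maxn N M) => n; rewrite geq_max => /andP[/hN h1 /hM h2].
move: h1 h2; rewrite !le_min => /andP[h1 h1'] /andP[h2 h2'].
have -> : u n * v n - l * m = (u n - l) * (v n - m) + (u n - l) * m + l * (v n - m) by ncring.
apply: le_trans (nrmD _ _) _; apply: le_trans (lerD (nrmD _ _) (lexx _)) _.
have k1 := nrmM_le h1 h2'; have k2 := nrmM_le h1' (lexx (nrm m)); have k3 := nrmM_le (lexx (nrm l)) h2'.
have K0 : 0 < K by rewrite /K; lra.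
have : e / K * K = e by rewrite divfK // lt0r_neq0.
have : 0 < e / K by rewrite divr_gt0.
by move: (e / K) k1 k2 k3 => q; rewrite /K; lra.
Qed.

Lemma cvA_nrm_le u l r : cvA u l -> (forall n, nrm (u n) <= r) -> nrm l <= r.
Proof.
move=> hu h; apply/ler_addgt0Pl => e /hu [N hN]; have := hN _ (leqnn N); have := h N.
rewrite nrmB => a b; have := nrmD (l - u N) (u N); rewrite subrK; lra.
Qed.

(** Unital C*-subalgebras, kept as predicates so that an element can be located in several of them
    without changing its type. *)
Definition csub (E : A -> Prop) := [/\ E 1, (forall x y, E x -> E y -> E (x + y)),
  (forall (a : R[i]) x, E x -> E (a *: x)), (forall x y, E x -> E y -> E (x * y)) &
  (forall x, E x -> E (star x)) /\ (forall u l, (forall n, E (u n)) -> cvA u l -> E l)].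

Section Csub.
Variables (E : A -> Prop) (hE : csub E).
Lemma csub1 : E 1. Proof. by case: hE. Qed.
Lemma csubD x y : E x -> E y -> E (x + y). Proof. by case: hE => _ h _ _ _; apply: h. Qed.
Lemma csubZ (a : R[i]) x : E x -> E (a *: x). Proof. by case: hE => _ _ h _ _; apply: h. Qed.
Lemma csubM x y : E x -> E y -> E (x * y). Proof. by case: hE => _ _ _ h _; apply: h. Qed.
Lemma csubS x : E x -> E (star x). Proof. by case: hE => _ _ _ _ [h _]; apply: h. Qed.
Lemma csubL u l : (forall n, E (u n)) -> cvA u l -> E l. Proof. by case: hE => _ _ _ _ [_ h]; apply: h. Qed.
Lemma csubN x : E x -> E (- x). Proof. by rewrite -scaleN1r; apply: csubZ. Qed.
Lemma csubB x y : E x -> E y -> E (x - y). Proof. by move=> hx hy; apply: csubD => //; apply: csubN. Qed.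
Lemma csub0 : E 0. Proof. by rewrite -[0](subrr 1); apply: csubB; apply: csub1. Qed.
Lemma csub_sum I (P : seq I) (Q : pred I) (F : I -> A) :
  (forall i, E (F i)) -> E (\sum_(i <- P | Q i) F i).
Proof. by move=> h; apply: big_ind => //; [exact: csub0|exact: csubD]. Qed.
End Csub.

Lemma csub_comm (S : A -> Prop) : (forall x, S x -> S (star x)) -> csub (fun d => forall x, S x -> d * x = x * d).
Proof.
move=> hS; split=> [x _|x y hx hy z hz|a x hx z hz|x y hx hy z hz|].
- by rewrite mul1r mulr1.
- by rewrite mulrDl mulrDr hx ?hy.
- by rewrite mulZl mulZr hx.
- by rewrite mulrA -hx // -!mulrA hy.
split=> [x hx z hz|u l hu hl z hz].
  by apply: (can_inj (@starK _ A)); rewrite !starMr starK hx //; apply: hS.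
apply: (cvA_unique (cvA_mulr z hl)); apply: cvA_ext (cvA_mull z hl) => n; by rewrite hu.
Qed.

End Norm.

(** * Square roots by iteration, and the cone of positive elements *)

Section Sqrt.
Variables (R : realType) (A : cstarType R).
Implicit Types (x y z w a b h k l : A) (r s t e : R).
Local Notation "t %:I" := (t%:C *: (1 : A)) (at level 1, left associativity, format "t %:I").

(** The limit y of this iteration satisfies 2 y = z + y^2, that is (1 - y)^2 = 1 - z, so 1 - y is a
    square root of 1 - z. The scalar sequence [sqr] is the case z = 1 and serves as a majorant. *)
Fixpoint sqit z n : A := if n is n'.+1 then 2^-1 *^ (z + sqit z n' * sqit z n') else 0.
Fixpoint sqr n : R := if n is n'.+1 then (1 + sqr n' ^+ 2) / 2 else 0.

Lemma sqr_bnd n : 0 <= sqr n <= 1.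
Proof. elim: n => [|n /andP[h1 h2]] /=; first by rewrite lexx ler01. apply/andP; split; nra. Qed.

Lemma sqr_ge n : 1 - sqr n <= 2 / n.+2%:R.
Proof.
elim: n => [|n IH] /=; first by rewrite subr0 divff // pnatr_eq0.
have /andP[h1 h2] := sqr_bnd n.
set a := 2 / n.+2%:R in IH.
have N0 : (0 : R) < n.+2%:R by rewrite ltr0n.
have a0 : 0 <= a <= 1.
  by rewrite /a divr_ge0 ?ler0n //= ler_pdivrMr // mul1r ler_nat.
(* With d = 1 - [sqr n] the recursion is d - d^2 / 2, which increases with d on [0, 1]. *)
apply: (@le_trans _ _ (a - a ^+ 2 / 2)); first by nra.
have aN : a * n.+2%:R = 2 by rewrite /a divfK // lt0r_neq0.
have e3 : n.+3%:R = n.+2%:R + 1 :> R by rewrite -natr1.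
rewrite e3 ler_pdivlMr; last by lra.
move: aN N0; set N := n.+2%:R => aN N0; nra.
Qed.

Lemma sqit_inter w z z' n : w * z = z' * w -> w * sqit z n = sqit z' n * w.
Proof.
move=> h; elim: n => [|n IH] /=; first by rewrite mulr0 mul0r.
rewrite mulZr mulZl; congr (_ *: _); rewrite mulrDr mulrDl h mulrA IH -!mulrA; congr (_ + _ * _); exact: IH.
Qed.

(** Iterates commute, so an increment is half the sum times half-step difference of the previous
    two: (a + b)(a - b) / 2. The same identity holds for [sqr], whence the domination. *)
Lemma sqit_bnd z n : nrm z <= 1 -> nrm (sqit z n) <= sqr n /\ nrm (sqit z n.+1 - sqit z n) <= sqr n.+1 - sqr n.
Proof.
move=> hz; elim: n => [|n [IH1 IH2]].
  rewrite /= mulr0 addr0 subr0 nrm0 nrmZ0 ?invr_ge0 //; split=> //; rewrite expr0n addr0 subr0; lra.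
have hb : nrm (sqit z n.+1) <= sqr n.+1.
  have -> : sqit z n.+1 = (sqit z n.+1 - sqit z n) + sqit z n by rewrite subrK.
  have := nrmD (sqit z n.+1 - sqit z n) (sqit z n); lra.
split => //.
set a := sqit z n.+1 in IH2 hb *; set b := sqit z n in IH1 IH2 *.
have ab : a * b = b * a by apply: sqit_inter; symmetry; apply: sqit_inter.
have -> : sqit z n.+2 - a = 2^-1 *^ ((a + b) * (a - b)).
  have -> : sqit z n.+2 = 2^-1 *^ (z + a * a) by [].
  have -> : a = 2^-1 *^ (z + b * b) by [].
  rewrite -/a -scalerBr; congr (_ *: _); have -> : 2^-1 *^ (z + b * b) = a by [].
  have -> : (a + b) * (a - b) = a * a - b * b + (b * a - a * b) by ncring.
  rewrite ab subrr; ncring.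
rewrite nrmZ0 ?invr_ge0 //.
have h1 : nrm (a + b) <= sqr n.+1 + sqr n by apply: le_trans (nrmD _ _) _; apply: lerD.
have := nrmM_le h1 IH2.
have -> : sqr n.+2 - sqr n.+1 = 2^-1 * ((sqr n.+1 + sqr n) * (sqr n.+1 - sqr n)) by rewrite /=; ring.
by rewrite ler_pM2l // invr_gt0.
Qed.

Lemma sqit_cauchy z : nrm z <= 1 -> exists l, cvA (sqit z) l.
Proof.
move=> hz; apply: (@cvA_cauchy _ _ _ (fun n => 2 / n.+2%:R)).
  move=> n m nm; apply: le_trans (sqr_ge n).
  apply: (@le_trans _ _ (sqr m - sqr n)); last by rewrite lerD2r; case/andP: (sqr_bnd m).
  elim: m nm => [|m IH]; first by rewrite leqn0 => /eqP ->; rewrite !subrr nrm0.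
  rewrite leq_eqVlt => /orP[/eqP <-|]; first by rewrite !subrr nrm0.
  rewrite ltnS => /IH h; have [_ h2] := sqit_bnd m hz; have := nrm_tri h2 h; lra.
move=> e e0; exists (archimedean.Num.truncn (2 / e)).
have := truncnS_gt (2 / e); move: (archimedean.Num.truncn _) => n h; have -> : n.+2%:R = n.+1%:R + 1 :> R by rewrite natr1.
have N0 := ltr0Sn R n; move: (n.+1%:R) N0 h => N N0 h.

rewrite ler_pdivrMr; last by lra.
have : 2 < e * N by rewrite mulrC -ltr_pdivrMr.
lra.
Qed.

Definition sqlim z : A := xget 0 [set l | cvA (sqit z) l].

Lemma sqlimP z : nrm z <= 1 -> cvA (sqit z) (sqlim z).
Proof. by move=> /sqit_cauchy [l hl]; rewrite /sqlim; exact: (xgetPex 0 (ex_intro _ l hl)). Qed.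

Lemma sqlim_eq z : nrm z <= 1 -> sqlim z + sqlim z = z + sqlim z * sqlim z.
Proof.
move=> /sqlimP h; have h1 := cvA_shift h.
have h2 := cvAZ 2^-1%:C (cvAD (cvA_cst z) (cvAM h h)).
have -> : sqlim z = 2^-1 *^ (z + sqlim z * sqlim z) by apply: cvA_unique h1 h2.
set u := z + _ * _; rewrite rcD; have -> : 2^-1 + 2^-1 = 1 :> R by lra.
rewrite rc1 /u; congr (_ + _ * _); exact: (cvA_unique h1 h2).
Qed.

Lemma sqlim_nrm z : nrm z <= 1 -> nrm (sqlim z) <= 1.
Proof.
move=> hz; apply: (cvA_nrm_le (sqlimP hz)) => n; have [h _] := sqit_bnd n hz.
by apply: le_trans h _; case/andP: (sqr_bnd n).
Qed.

Definition rsqrt a := 1 - sqlim (1 - a).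

Lemma rsqrtK a : nrm (1 - a) <= 1 -> rsqrt a * rsqrt a = a.
Proof.
move=> /sqlim_eq; rewrite /rsqrt; set y := sqlim _ => h.
have -> : (1 - y) * (1 - y) = 1 - (y + y) + y * y by ncring.
by rewrite h; ncring.
Qed.

Lemma rsqrt_nrm a : nrm (1 - a) <= 1 -> nrm (1 - rsqrt a) <= 1.
Proof. by move=> h; rewrite /rsqrt opprB addrC subrK; apply: sqlim_nrm. Qed.

(** Stated for intertwiners instead of commutants, because order zero maps later give relations w a
    = b w between different elements. *)
Lemma rsqrt_inter a b w : nrm (1 - a) <= 1 -> nrm (1 - b) <= 1 -> w * a = b * w ->
  w * rsqrt a = rsqrt b * w.
Proof.
move=> ha hb h; rewrite /rsqrt mulrBr mulrBl mulr1 mul1r; congr (_ - _).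
apply: (cvA_unique (cvA_mull w (sqlimP ha))).
apply: cvA_ext (cvA_mulr w (sqlimP hb)) => n; symmetry; apply: sqit_inter.
by rewrite mulrBr mulrBl mulr1 mul1r h.
Qed.

Lemma rsqrt_csub E a : csub E -> nrm (1 - a) <= 1 -> E a -> E (rsqrt a).
Proof.
move=> hE ha Ea; have E1 := csub1 hE; have Ez : E (1 - a) by apply: csubB.
apply: csubB => //; apply: (csubL hE) (sqlimP ha) => n.
elim: n => [|n IH] /=; first exact: csub0.
by apply: csubZ => //; apply: csubD => //; apply: csubM.
Qed.

Lemma rsqrt_sa a : nrm (1 - a) <= 1 -> star a = a -> star (rsqrt a) = rsqrt a.
Proof.
move=> ha h; rewrite /rsqrt starB star1; congr (_ - _).
apply: (cvA_unique (cvA_star (sqlimP ha))); apply: cvA_ext (sqlimP ha) => n.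
elim: n => [|n IH] /=; first by rewrite star0.
by rewrite starZr starD starMr -IH starB star1 h.
Qed.

(** The element u = a + i b satisfies u^* u = s^2, hence |u| <= s, and a is the real part of u. This
    estimate takes the place of spectral theory in what follows. *)
Lemma pair_nrm a b s : 0 <= s -> star a = a -> star b = b -> a * b = b * a ->
  a * a + b * b = (s ^+ 2)%:I -> nrm a <= s.
Proof.
move=> s0 sa sb ab h; pose u := a + 'i *: b.
have su : star u = a - 'i *: b.
  rewrite /u starD starZ sa sb; congr (_ + _); rewrite -scaleNr; congr (_ *: _).
  by apply/eqP; rewrite eq_complex /= !oppr0 !eqxx.
have ii : ('i : R[i]) * 'i = -1 by rewrite -expr2 sqr_i.
have uu : star u * u = (s ^+ 2)%:I.
  rewrite su /u -h.
  have -> : (a - 'i *: b) * (a + 'i *: b) = a * a + 'i *: (a * b - b * a) - ('i *: ('i *: (b * b))) by ncring.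
  by rewrite ab subrr scaler0 addr0 scalerA ii scaleN1r opprK.
have hu : nrm u <= s.
  by apply: nrm_sqr_le => //; rewrite uu; apply: nrm1Z; rewrite exprn_ge0.
have -> : a = 2^-1 *^ (u + star u).
  rewrite su /u; have -> : a + 'i *: b + (a - 'i *: b) = a + a by ncring.
  by rewrite -[a + a]mulr2n -rcnat rcM mulVf ?pnatr_eq0 // rc1.
rewrite nrmZ0 ?invr_ge0 //; have := nrmD u (star u); rewrite nrm_star; lra.
Qed.

(** Positivity by a norm inequality makes the cone visibly closed under sums; that it is the cone of
    the elements y^* y is [pos_eltP]. *)
Definition pos h := star h = h /\ exists2 t : R, 0 <= t & nrm (t%:I - h) <= t.

Lemma pos_sa h : pos h -> star h = h. Proof. by case. Qed.

Lemma pos_sqrt h : pos h -> exists k, [/\ pos k, k * k = h, (forall w, w * h = h * w -> w * k = k * w)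
  & forall E, csub E -> E h -> E k].
Proof.
move=> [sh [t t0 ht]]; case: (eqVneq t 0) => [t00|tn].
  have h0 : h = 0.
    by apply: nrm_eq0; apply/eqP; rewrite eq_le nrm_ge0 andbT -nrmN -[- h]add0r -[X in X - h](rc0 1) -{2}t00 -t00.
  exists 0; rewrite h0 mulr0; split=> //.
  by split; [exact: star0|exists 0; rewrite // subr0 rc0 nrm0].
have tp : 0 < t by rewrite lt_neqAle eq_sym tn.
have hn : nrm (1 - t^-1 *^ h) <= 1.
  have -> : 1 - t^-1 *^ h = t^-1 *^ (t%:I - h) by rewrite scalerBr rcM mulVf // rc1.
  rewrite nrmZ0 ?invr_ge0 // mulrC ler_pdivrMr // mul1r //.
have st0 := sqrtr_ge0 t.
exists (Num.sqrt t *^ rsqrt (t^-1 *^ h)); split.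
- split; first by rewrite starZr rsqrt_sa // starZr sh.
  exists (Num.sqrt t) => //; rewrite -scalerBr nrmZ0 // ler_piMr //; exact: rsqrt_nrm.
- by rewrite mulZl mulZr rcM -expr2 sqr_sqrtr // rsqrtK // rcM divff // rc1.
- move=> w hw; rewrite mulZl mulZr; congr (_ *: _); apply: rsqrt_inter => //.
  by rewrite mulZl mulZr hw.
by move=> E hE Eh; apply: csubZ => //; apply: rsqrt_csub => //; apply: csubZ.
Qed.

(** For a = k / t the root of 1 - a^2 commutes with a and the two squares add up to 1, so [pair_nrm]
    bounds that root, and hence 1 - a^2, by 1. *)
Lemma pos_sqr_nrm k t : star k = k -> 0 <= t -> nrm k <= t -> nrm ((t ^+ 2)%:I - k * k) <= t ^+ 2.
Proof.
move=> sk; rewrite le_eqVlt => /orP[/eqP <-|t0] hk.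
  have -> : k = 0 by apply: nrm_eq0; apply/eqP; rewrite eq_le hk nrm_ge0.
  by rewrite expr0n mulr0 subr0 rc0 nrm0.
pose a := t^-1 *^ k.
have na : nrm a <= 1 by rewrite nrmZ0 ?invr_ge0 ?(ltW t0) // ler_pdivrMl // mulr1.
have sa : star a = a by rewrite starZr sk.
have hb : nrm (1 - (1 - a * a)) <= 1.
  by rewrite opprB addrC subrK nrm_sa // expr_le1 ?nrm_ge0.
have cm : a * rsqrt (1 - a * a) = rsqrt (1 - a * a) * a.
  by apply: rsqrt_inter => //; ncring.
have sm : star (rsqrt (1 - a * a)) = rsqrt (1 - a * a).
  by apply: rsqrt_sa => //; rewrite starB star1 starMr sa.
have := @pair_nrm _ _ 1 ler01 sm sa (esym cm).
rewrite rsqrtK // subrK expr1n rc1 => /(_ erefl) hm.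
have -> : (t ^+ 2)%:I - k * k = (t ^+ 2) *^ (1 - a * a).
  have e1 : t ^+ 2 / t / t = 1 by field; rewrite lt0r_neq0.
  by rewrite scalerBr /a mulZl mulZr !rcM e1 rc1.
have t2 : 0 <= t ^+ 2 by rewrite exprn_ge0 // ltW.
by rewrite nrmZ0 // ler_piMr // -(rsqrtK hb) nrm_sa // expr_le1 // nrm_ge0.
Qed.

Lemma pos_sqr k : star k = k -> pos (k * k).
Proof.
move=> sk; split; first by rewrite starMr sk.
by exists (nrm k ^+ 2); rewrite ?exprn_ge0 ?nrm_ge0 //; apply: pos_sqr_nrm; rewrite ?nrm_ge0.
Qed.

Lemma pos_nrm h t : pos h -> nrm h <= t -> nrm (t%:I - h) <= t.
Proof.
move=> /pos_sqrt [k [[sk _] <- _ _]]; rewrite nrm_sa // => kt.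
have t0 : 0 <= t by apply: le_trans kt; rewrite exprn_ge0 ?nrm_ge0.
have := @pos_sqr_nrm k _ sk (sqrtr_ge0 t); rewrite sqr_sqrtr //; apply.
by rewrite -[nrm k]ger0_norm ?nrm_ge0 // -sqrtr_sqr ler_wsqrtr.
Qed.

Lemma pos0 : pos 0.
Proof. by split; [exact: star0|exists 0; rewrite // subr0 rc0 nrm0]. Qed.

Lemma pos1 : pos 1.
Proof. by rewrite -[1]mulr1; apply: pos_sqr; rewrite star1. Qed.

Lemma posD a b : pos a -> pos b -> pos (a + b).
Proof.
move=> [sa [t t0 ht]] [sb [r r0 hr]]; split; first by rewrite starD sa sb.
exists (t + r); first exact: addr_ge0.
rewrite -rcD; have -> : t%:I + r%:I - (a + b) = (t%:I - a) + (r%:I - b) by ncring.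
by apply: le_trans (nrmD _ _) _; apply: lerD.
Qed.

Lemma pos_sum I (P : seq I) (Q : pred I) (F : I -> A) :
  (forall i, Q i -> pos (F i)) -> pos (\sum_(i <- P | Q i) F i).
Proof. by move=> h; apply: big_ind => //; [exact: pos0|exact: posD]. Qed.

Lemma posZ r a : 0 <= r -> pos a -> pos (r *^ a).
Proof.
move=> r0 [sa [t t0 ht]]; split; first by rewrite starZr sa.
exists (r * t); first exact: mulr_ge0.
by rewrite -rcM -scalerBr nrmZ0 // ler_wpM2l.
Qed.

Lemma pos_rc r : 0 <= r -> pos (r%:I).
Proof. by move=> r0; apply: posZ => //; apply: pos1. Qed.

Lemma pos_lim u l : (forall n : nat, pos (u n)) -> cvA u l -> pos l.
Proof.
move=> hu hl; have sl : star l = l.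
  by apply: (cvA_unique (cvA_star hl)); apply: cvA_ext hl => n; case: (hu n).
have l0 := nrm_ge0 l; split => //; exists (nrm l + 1); first by lra.
have [N hN] := hl _ ltr01.
have hv : cvA (fun n => (nrm l + 1)%:I - u (n + N)%N) ((nrm l + 1)%:I - l).
  apply: cvAD; first exact: cvA_cst.
  by apply: cvAN => e /hl [M hM]; exists M => n Mn; apply: hM; lia.
apply: cvA_nrm_le hv _ => n; apply: pos_nrm => //.
have := hN (n + N)%N (leq_addl _ _); have := nrmD (u (n + N)%N - l) l; rewrite subrK; lra.
Qed.

Lemma pos_mulC a b : pos a -> pos b -> a * b = b * a -> pos (a * b).
Proof.
move=> /pos_sqrt [k [[sk _] <- ck _]] /pos_sqrt [l [[sl _] <- cl _]] h.
have h1 : k * (l * l) = (l * l) * k by symmetry; apply: ck.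
have h2 := cl _ h1.
have -> : k * k * (l * l) = (k * l) * (k * l) by rewrite -!mulrA; congr (_ * _); rewrite !mulrA h2.
by apply: pos_sqr; rewrite starMr sk sl h2.
Qed.

(** The roots of h and of - h commute and their squares add up to 0, so [pair_nrm] with s = 0 kills
    them. *)
Lemma pos_anti h : pos h -> pos (- h) -> h = 0.
Proof.
move=> /pos_sqrt [k [[sk _] <- ck _]] /pos_sqrt [l [[sl _] hl cl _]].
have kl : k * l = l * k by apply: cl; rewrite mulrN mulNr mulrA.
have : nrm k <= 0.
  by apply: (pair_nrm (lexx 0) sk sl kl); rewrite hl subrr expr0n rc0.
by move=> h0; have -> : k = 0; rewrite ?mulr0 //; apply: nrm_eq0; apply/eqP; rewrite eq_le h0 nrm_ge0.
Qed.

Lemma pos_le_nrm a s : 0 <= s -> pos a -> pos (s%:I - a) -> nrm a <= s.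
Proof.
move=> s0 /pos_sqrt [k [[sk _] <- ck _]] /pos_sqrt [l [[sl _] hl cl _]].
have kl : k * l = l * k by apply: cl; ncring.
rewrite nrm_sa // -[s]sqr_sqrtr // ler_pXn2r // ?nnegrE ?nrm_ge0 ?sqrtr_ge0 //.
apply: (pair_nrm (sqrtr_ge0 _) sk sl kl); rewrite hl sqr_sqrtr //; ncring.
Qed.

(** If k and l are the roots of s - z and s + z, then (k l)^2 = s^2 - z^2, and [pair_nrm] applies to
    z and k l. *)
Lemma sa_le_nrm z s : 0 <= s -> star z = z -> pos (s%:I - z) -> pos (s%:I + z) -> nrm z <= s.
Proof.
move=> s0 sz /pos_sqrt [k [[sk _] hk ck _]] /pos_sqrt [l [[sl _] hl cl _]].
have kz : z * k = k * z by apply: ck; ncring.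
have lz : z * l = l * z by apply: cl; ncring.
have kl : k * l = l * k by apply: cl; rewrite mulrDl mulrDr kz; congr (_ + _); ncring.
have skl : star (k * l) = k * l by rewrite starMr sk sl kl.
apply: (pair_nrm s0 sz skl); first by rewrite mulrA kz -mulrA lz mulrA.
have -> : k * l * (k * l) = (k * k) * (l * l) by rewrite -!mulrA; congr (_ * _); rewrite !mulrA kl.
rewrite hk hl; have -> : (s%:I - z) * (s%:I + z) = s *^ (s%:I) - z * z by ncring.
by rewrite rcM -expr2 addrC subrK.
Qed.

Lemma nrm_pos z s : star z = z -> nrm z <= s -> pos (s%:I - z).
Proof.
move=> sz h; have s0 := le_trans (nrm_ge0 _) h; split; first by rewrite starB starZr star1 sz.
by exists s => //; rewrite opprB addrC subrK.
Qed.

Lemma nrm_posD z s : star z = z -> nrm z <= s -> pos (s%:I + z).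
Proof. by move=> sz h; rewrite -[z]opprK; apply: nrm_pos; rewrite ?starN ?sz ?nrmN. Qed.
End Sqrt.

(** * Inverses, and the decomposition into positive and negative parts *)

Section Inverse.
Variables (R : realType) (A : cstarType R).
Implicit Types (x y z w a b h k l c d g u v : A) (r s t e q : R).
Local Notation "t %:I" := (t%:C *: (1 : A)) (at level 1, left associativity, format "t %:I").

Lemma expr_small q e : 0 <= q < 1 -> 0 < e -> exists n, q ^+ n <= e.
Proof.
move=> /andP[q0 q1] e0; have q1' : `|q| < 1 by rewrite ger0_norm.
have /cvgrPdist_le /(_ _ e0) [N _ hN] := cvg_expr q1'.
by exists N; have := hN N (leqnn N); rewrite /= sub0r normrN ger0_norm // exprn_ge0.
Qed.

Lemma cvA_geo (u : nat -> A) K q : 0 <= q < 1 -> 0 <= K -> (forall n, nrm (u n.+1 - u n) <= K * q ^+ n) ->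
  exists l, cvA u l.
Proof.
move=> /andP[q0 q1] K0 h; have q1' : 0 < 1 - q by lra.
apply: (@cvA_cauchy _ _ _ (fun n => K * (q ^+ n / (1 - q)))).
  move=> n m nm; suff : nrm (u m - u n) <= K * ((q ^+ n - q ^+ m) / (1 - q)).
    move/le_trans; apply; rewrite ler_wpM2l // ler_pM2r ?invr_gt0 //.
    by have : 0 <= q ^+ m by [rewrite exprn_ge0]; lra.
  elim: m nm => [|m IH]; first by rewrite leqn0 => /eqP ->; rewrite !subrr nrm0 mul0r mulr0.
  rewrite leq_eqVlt => /orP[/eqP <-|]; first by rewrite !subrr nrm0 mul0r mulr0.
  rewrite ltnS => /IH h1; have := nrm_tri (h m) h1.
  suff -> : K * q ^+ m + K * ((q ^+ n - q ^+ m) / (1 - q)) = K * ((q ^+ n - q ^+ m.+1) / (1 - q)) by [].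
  by rewrite exprS; field; rewrite lt0r_neq0.
move=> e e0; have e1 : 0 < e * (1 - q) / (K + 1) by apply: divr_gt0; [apply: mulr_gt0|lra].
have [n hn] := expr_small (introT andP (conj q0 q1)) e1; exists n.
rewrite mulrA ler_pdivrMr //; move: hn; rewrite ler_pdivlMr; last by lra.
have : 0 <= q ^+ n by rewrite exprn_ge0.
lra.
Qed.

Lemma neumann z q : q < 1 -> nrm z <= q -> exists x, [/\ (1 - z) * x = 1, x * (1 - z) = 1 &
  forall E, csub E -> E z -> E x].
Proof.
move=> q1 zq; have q0 : 0 <= q by apply: le_trans zq; exact: nrm_ge0.
pose u := fix u n : A := if n is n'.+1 then 1 + z * u n' else 1.
have uc n : z * u n = u n * z.
  by elim: n => [|n IH] /=; rewrite ?mulr1 ?mul1r // mulrDr mulrDl mulr1 mul1r {1}IH mulrA.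
have [l hl] : exists l, cvA u l.
  apply: (@cvA_geo _ q q); rewrite ?q0 //.
  elim=> [|n IH] /=.
    by rewrite mulr1 addrC addKr expr0 mulr1.
  have -> : 1 + z * (1 + z * u n) - (1 + z * u n) = z * (u n.+1 - u n) by rewrite /=; ncring.
  by rewrite exprS mulrCA; apply: nrmM_le.
have e1 : l = 1 + z * l.
  by apply: (cvA_unique (cvA_shift hl)); apply: cvAD; [exact: cvA_cst|exact: cvA_mull].
have e2 : z * l = l * z.
  by apply: (cvA_unique (cvA_mull z hl)); apply: cvA_ext (cvA_mulr z hl) => n; rewrite uc.
exists l; split.
- by rewrite mulrBl mul1r {1}e1 addrK.
- by rewrite mulrBr mulr1 -e2 {1}e1 addrK.
move=> E hE Ez; apply: (csubL hE) hl; elim=> [|n IH] /=; first exact: csub1.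
by apply: csubD => //; [exact: csub1|exact: csubM].
Qed.

Lemma inv_comm c g w : c * g = 1 -> g * c = 1 -> w * c = c * w -> w * g = g * w.
Proof. by move=> h1 h2 h; rewrite -[w * g]mul1r -h2 -mulrA (mulrA c) -h -!mulrA h1 mulr1. Qed.

Lemma inv_sa c g : c * g = 1 -> g * c = 1 -> star c = c -> star g = g.
Proof.
move=> h1 h2 h; have : star g * c = 1 by rewrite -h -starMr h1 star1.
by move=> h3; rewrite -[star g]mulr1 -h1 mulrA h3 mul1r.
Qed.

(** With t = |c - r| + r the element 1 - c / t has norm at most 1 - r / t < 1, and the Neumann
    series converges. *)
Lemma pos_inv c r : 0 < r -> pos (c - r%:I) -> exists g, [/\ c * g = 1, g * c = 1, pos g, nrm g <= r^-1 &
  forall E, csub E -> E c -> E g].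
Proof.
move=> r0 hc; pose t := nrm (c - r%:I) + r.
have t0 : 0 < t by have := nrm_ge0 (c - r%:I); rewrite /t; lra.
have pc : pos c by rewrite -[c](subrK r%:I); apply: posD => //; apply: pos_rc; rewrite ltW.
have hz : nrm (1 - t^-1 *^ c) <= 1 - r / t.
  have -> : 1 - t^-1 *^ c = t^-1 *^ (t%:I - c) by rewrite scalerBr rcM mulVf ?lt0r_neq0 // rc1.
  rewrite nrmZ0 ?invr_ge0 ?(ltW t0) // ler_pdivrMl // mulrBr mulr1 mulrCA divff ?lt0r_neq0 // mulr1.
  have -> : t%:I - c = (t - r)%:I - (c - r%:I) by rewrite -rcB; ncring.
  by rewrite {2}/t addrK; apply: pos_nrm => //; rewrite /t addrK.
have q1 : 1 - r / t < 1 by have : 0 < r / t by [apply: divr_gt0]; lra.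
have [x [x1 x2 xE]] := neumann q1 hz; rewrite opprB addrC subrK in x1 x2.
pose g := t^-1 *^ x.
have cg : c * g = 1 by rewrite /g mulZr -mulZl.
have gc : g * c = 1 by rewrite /g mulZl -mulZr.
have sg : star g = g by apply: (inv_sa cg gc); apply: pos_sa.
have g0 : pos g.
  have -> : g = c * (g * g) by rewrite mulrA cg mul1r.
  apply: pos_mulC => //; first exact: pos_sqr.
  by rewrite mulrA cg mul1r -mulrA gc mulr1.
exists g; split=> //.
  apply: pos_le_nrm => //; first by rewrite invr_ge0 ltW.
  have -> : (r^-1)%:I - g = r^-1 *^ ((c - r%:I) * g).
    by rewrite mulrBl cg mulZl mul1r scalerBr rcM mulVf ?lt0r_neq0 // rc1.
  apply: posZ; first by rewrite invr_ge0 ltW.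
  by apply: pos_mulC => //; rewrite mulrBl mulrBr cg gc; ncring.
move=> E hE Ec; apply: csubZ => //; apply: xE => //; apply: csubB => //; first exact: csub1.
exact: csubZ.
Qed.

(** Here b plays the role of |h|. The products vanish since b^2 = h^2; the point is that x = b + h
    and x = b - h are positive. In both cases b x = x^2 / 2 is positive, and so is (b + d)^-1 b x,
    which tends to x as d tends to 0. *)
Lemma abs_dec h b : star h = h -> pos b -> b * b = h * h -> h * b = b * h ->
  [/\ pos (2^-1 *^ (b + h)), pos (2^-1 *^ (b - h)), h = 2^-1 *^ (b + h) - 2^-1 *^ (b - h),
    2^-1 *^ (b + h) * (2^-1 *^ (b - h)) = 0 & 2^-1 *^ (b - h) * (2^-1 *^ (b + h)) = 0].
Proof.
move=> sh pb bb bh.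
have key x : star x = x -> b * x = x * b -> x * x = 2 *^ (b * x) -> pos x.
  move=> sx bx xx.
  have /choice [g hg] : forall n : nat, exists g : A, [/\ (b + (n.+1%:R^-1)%:I) * g = 1, g * (b + (n.+1%:R^-1)%:I) = 1,
      pos g & nrm g <= n.+1%:R].
    move=> n.
    have e0 : (0 : R) < n.+1%:R^-1 by rewrite invr_gt0 ltr0n.
    have [|g [g1 g2 g3 g4 _]] := @pos_inv (b + (n.+1%:R^-1)%:I) _ e0; first by rewrite addrK.
    by exists g; split => //; rewrite -[n.+1%:R]invrK.
  have gb n : g n * b = 1 - n.+1%:R^-1 *^ g n.
    by case: (hg n) => _ + _ _; rewrite mulrDr mulZr mulr1 => <-; rewrite addrK.
  have gx n : x * g n = g n * x.
    case: (hg n) => h1 h2 _ _; apply: (inv_comm h1 h2).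
    by rewrite mulrDl mulrDr bx mulZl mulZr mul1r mulr1.
  have bx0 : pos (b * x).
    have -> : b * x = 2^-1 *^ (x * x) by rewrite xx rcM mulVf ?pnatr_eq0 // rc1.
    by apply: posZ; rewrite ?invr_ge0 //; exact: pos_sqr.
  apply: (@pos_lim _ _ (fun n => g n * (b * x))) => [n|e e0].
    case: (hg n) => h1 h2 h3 _; apply: pos_mulC => //.
    have gbn : b * g n = g n * b by apply: (inv_comm h1 h2); rewrite mulrDl mulrDr mulZl mulZr mul1r mulr1.
    by rewrite mulrA -gbn -!mulrA gx.
  have x0 := nrm_ge0 x.
  (* The error (n+1)^-1 g x has square of norm at most 4 |x| / (n+1), because x^2 = 2 b x, |g| <=
     n+1 and |g b| <= 2. *)
  pose N := archimedean.Num.truncn (4 * nrm x / e ^+ 2); exists N => n Nn.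
  case: (hg n) => h1 h2 h3 h4; have e1 : 0 < e ^+ 2 by rewrite exprn_gt0.
  have n1 : (0 : R) < n.+1%:R by rewrite ltr0n.
  have hn : 4 * nrm x <= e ^+ 2 * n.+1%:R.
    by rewrite [leRHS]mulrC -ler_pdivrMr //; apply: ltW; rewrite -truncn_le_nat.
  set d := n.+1%:R^-1 in gb h1 h2; have dn : d * n.+1%:R = 1 by rewrite mulVf // lt0r_neq0.
  have d0 : 0 < d by rewrite invr_gt0.
  have -> : g n * (b * x) - x = - (d *^ (g n * x)).
    by rewrite mulrA gb mulrBl mul1r mulZl addrC addKr.
  have sgx : star (g n * x) = g n * x by rewrite starMr sx (pos_sa h3) gx.
  have n2 : nrm (g n * b) <= 2.
    rewrite gb -/d; apply: le_trans (nrmD _ _) _; rewrite nrmN nrmZ0 ?(ltW d0) //.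
    rewrite (_ : 2 = 1 + 1 :> R) //; apply: lerD; first exact: nrm1.
    by rewrite -dn ler_pM2l.
  rewrite nrmN nrmZ0 ?(ltW d0) // -(@ler_pXn2r _ 2) ?nnegrE ?(mulr_ge0 (ltW d0)) ?nrm_ge0 ?(ltW e0) // exprMn -nrm_sa //.
  have -> : g n * x * (g n * x) = g n * g n * (2 *^ (b * x)) by rewrite -xx -!mulrA; congr (_ * _); rewrite !mulrA gx.
  have -> : g n * g n * (2 *^ (b * x)) = 2 *^ (g n * (g n * b) * x) by ncring.
  rewrite nrmZ0 //; have := nrmM_le (nrmM_le h4 n2) (lexx (nrm x)) => h5.
  have : d ^+ 2 * (2 * nrm (g n * (g n * b) * x)) <= d ^+ 2 * (2 * (n.+1%:R * 2 * nrm x)).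
    by rewrite ler_pM2l ?exprn_gt0 // ler_pM2l.
  have -> : d ^+ 2 * (2 * (n.+1%:R * 2 * nrm x)) = (d * n.+1%:R) * d * (4 * nrm x) by ring.
  rewrite dn mul1r; move/le_trans; apply.
  by have := ler_wpM2l (ltW d0) hn; rewrite [leRHS]mulrCA dn mulr1.
have sb := pos_sa pb.
have pm : pos (b - h).
  apply: key; first by rewrite starB sb sh.
    by rewrite mulrBr mulrBl bh.
  have -> : (b - h) * (b - h) = b * b + h * h - b * h - h * b by ncring.
  rewrite bb bh; have -> : 2 *^ (b * (b - h)) = 2 *^ (b * b) - 2 *^ (b * h) by ncring.
  rewrite bb (_ : 2 = 1 + 1 :> R) // -!rcD !rc1; ncring.
have pp : pos (b + h).
  apply: key; first by rewrite starD sb sh.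
    by rewrite mulrDr mulrDl bh.
  have -> : (b + h) * (b + h) = b * b + h * h + b * h + h * b by ncring.
  rewrite bb bh; have -> : 2 *^ (b * (b + h)) = 2 *^ (b * b) + 2 *^ (b * h) by ncring.
  rewrite bb (_ : 2 = 1 + 1 :> R) // -!rcD !rc1; ncring.
split.
- by apply: posZ; rewrite ?invr_ge0.
- by apply: posZ; rewrite ?invr_ge0.
- rewrite -scalerBr; have -> : b + h - (b - h) = h + h by ncring.
  by rewrite (_ : h + h = 2 *^ h) ?rcM ?mulVf ?pnatr_eq0 ?rc1 // (_ : 2 = 1 + 1 :> R) // -rcD !rc1.
- rewrite mulZl mulZr; have -> : (b + h) * (b - h) = b * b - h * h + h * b - b * h by ncring.
  by rewrite bb bh subrr add0r subrr !scaler0.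
- rewrite mulZl mulZr; have -> : (b - h) * (b + h) = b * b - h * h - h * b + b * h by ncring.
  by rewrite bb bh subrr add0r addNr !scaler0.
Qed.

Lemma pos_abs h : star h = h -> exists p n, [/\ pos p, pos n, h = p - n, p * n = 0 & n * p = 0] /\
  [/\ (forall w, w * h = h * w -> w * p = p * w /\ w * n = n * w)
  & forall E, csub E -> E h -> E p /\ E n].
Proof.
move=> sh; have [b [pb bb bc bE]] := pos_sqrt (pos_sqr sh).
have bh : h * b = b * h by apply: bc; rewrite mulrA.
exists (2^-1 *^ (b + h)), (2^-1 *^ (b - h)); split; first exact: abs_dec.
split.
- move=> w hw; have wb : w * b = b * w by apply: bc; rewrite mulrA hw -!mulrA hw.
  by split; rewrite mulZl mulZr; congr (_ *: _); [rewrite mulrDl mulrDr|rewrite mulrBl mulrBr]; rewrite wb hw.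
move=> E hE Eh; have Eb : E b by apply: bE => //; apply: csubM.
by split; apply: csubZ => //; [apply: csubD|apply: csubB].
Qed.
End Inverse.

(** * Positivity of y^* y, and the order it defines *)

Section Positive.
Variables (R : realType) (A : cstarType R).
Implicit Types (x y z w a b h k l c d g u v : A) (r s t e q : R).
Local Notation "t %:I" := (t%:C *: (1 : A)) (at level 1, left associativity, format "t %:I").

Lemma nrm_le0 x : nrm x <= 0 -> x = 0.
Proof. by move=> h; apply: nrm_eq0; apply/eqP; rewrite eq_le h nrm_ge0. Qed.

Lemma cs_eq0 x : star x * x = 0 -> x = 0.
Proof.
move=> h; apply: nrm_eq0; have := nrm_cs x; rewrite h nrm0 => /esym/eqP.
by rewrite expf_eq0 /= => /eqP.
Qed.

(** Let c be the negative part of y^* y and z = y c, so that z^* z = - c^3, whereas z z^* turns out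
    positive. Classically the spectra of z^* z and z z^* agree off 0; here an explicit inverse of
    |z|^2 - z z^* bounds z z^* strictly below |z|^2 unless z = 0. *)
Lemma pos_cs y : pos (star y * y).
Proof.
set h := star y * y.
have sh : star h = h by rewrite starMr starK.
have [p [c [[pp pc hpc pc0 cp0] [hcomm _]]]] := pos_abs sh.
have [_ sc] := pc; have sc' := pos_sa pc.
pose z := y * c.
have zz : star z * z = - (c * (c * c)).
  have -> : star z * z = c * h * c by rewrite /z starMr sc' /h; ncring.
  rewrite hpc mulrBr cp0 sub0r mulNr; congr (- _); ncring.
have pv : pos (c * (c * c)) by apply: pos_mulC => //; [exact: pos_sqr|rewrite mulrA].
set v := c * (c * c) in zz pv.
have pu : pos (z * star z).
  have -> : z * star z = (star z * z + z * star z) + v by rewrite zz; ncring.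
  apply: posD => //.
  (* For the real and imaginary parts a and b of z, the sum z^* z + z z^* equals 2 (a^2 + b^2). *)
  pose a := 2^-1 *^ (z + star z); pose b := (2^-1%:C * - 'i) *: (z - star z).
  have ii : ('i : R[i]) * 'i = -1 by rewrite -expr2 sqr_i.
  have sa : star a = a by rewrite starZr starD starK addrC.
  have sb : star b = b.
    rewrite /b starZ starB starK -[star z - z]opprB scalerN -scaleNr; congr (_ *: _).
    by apply/eqP; rewrite eq_complex /=; apply/andP; split; apply/eqP; ring.
  have -> : star z * z + z * star z = 2 *^ (a * a + b * b).
    rewrite /a /b !mulZl !mulZr !scalerA.
    have -> : 2^-1%:C * - 'i * (2^-1%:C * - 'i) = - (2^-1 * 2^-1)%:C :> R[i].
      by rewrite rmorphM /= mulrACA mulrNN ii mulrN1.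
    rewrite -rmorphM scaleNr -scalerBr rcM.
    have -> : (z + star z) * (z + star z) - (z - star z) * (z - star z) =
      (star z * z + z * star z) + (star z * z + z * star z) by ncring.
    rewrite -[X in _ *^ X]mulr2n -rcnat rcM (_ : 2 * (2^-1 * 2^-1) * 2 = 1 :> R) ?rc1 //.
    by field.
  by apply: posZ => //; apply: posD; apply: pos_sqr.
suff z0 : z = 0.
  have c0 : c = 0.
    have : star (c * c) * (c * c) = 0.
      have -> : star (c * c) * (c * c) = c * v by rewrite starMr sc' /v; ncring.
      by rewrite -[v]opprK -zz z0 star0 mul0r oppr0 mulr0.
    by move=> /cs_eq0; rewrite -{1}sc' => /cs_eq0.
  by rewrite hpc c0 subr0.
have nz0 : nrm (z * star z) = nrm z ^+ 2 by rewrite -{1}[z]starK nrm_cs nrm_star.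
apply: nrm_le0; rewrite leNgt; apply/negP => nz.
pose N := nrm z ^+ 2; have N0 : 0 < N by rewrite exprn_gt0.
have [g [g1 g2 g3 _ _]] := @pos_inv _ _ (v + N%:I) N N0 (eq_ind_r (@pos _ _) pv (addrK _ _)).
(* The resolvent of z z^* at N, expressed through the inverse g of N - z^* z = v + N. *)
pose k := N^-1 *^ (1 + z * g * star z).
have sk : star k = k by rewrite starZr starD star1 (starMr (z * g)) (starMr z g) starK (pos_sa g3) mulrA.
have ek : (N%:I - z * star z) * k = 1.
  have E : (N%:I - z * star z) * (1 + z * g * star z) =
     N%:I + z * ((v + N%:I) * g - 1) * star z - z * (star z * z + v) * g * star z by ncring.
  rewrite /k mulZr E g1 zz subrr addNr !mulr0 !mul0r addr0 subr0 rcM mulVf ?lt0r_neq0 ?rc1 //.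
pose ee := N%:I - z * star z.
have see : star ee = ee by rewrite starB starZr star1 starMr starK.
have ke : k * ee = 1 by rewrite -see -sk -starMr ek star1.
pose K := nrm k + N^-1 + 1.
have K0 : 0 < K by have := nrm_ge0 k; have : 0 < N^-1 by [rewrite invr_gt0]; rewrite /K; lra.
have pK : pos (K%:I - k) by apply: nrm_pos => //; have : 0 < N^-1 by [rewrite invr_gt0]; rewrite /K; lra.
have pe : pos ee by apply: nrm_pos; [rewrite starMr starK|rewrite nz0].
have pKe : pos ((K%:I - k) * ee).
  have ek' : ee * k = 1 := ek.
  by apply: pos_mulC => //; rewrite (mulrBl ee) (mulrBr ee) ke ek'; ncring.
have := @pos_le_nrm _ _ (z * star z) (N - K^-1).
rewrite nz0 -/N.
have KN : K^-1 < N.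
  rewrite -[N]invrK ltf_pV2 ?posrE ?invr_gt0 // /K; have := nrm_ge0 k; lra.
have Ki : 0 < K^-1 by rewrite invr_gt0.
move=> H; have : N <= N - K^-1; last by lra.
apply: H => //; first by lra.
have -> : (N - K^-1)%:I - z * star z = K^-1 *^ ((K%:I - k) * ee).
  have -> : (K%:I - k) * ee = K *^ ee - 1 by rewrite (mulrBl ee) ke mulZl mul1r.
  rewrite scalerBr rcM mulVf ?lt0r_neq0 // rc1 -rcB /ee; ncring.
by apply: posZ => //; exact: ltW.
Qed.

Lemma pos_eltP x : positive_elt x <-> pos x.
Proof.
split; first by move=> [y ->]; apply: pos_cs.
by move=> /pos_sqrt [k [pk <- _ _]]; exists k; rewrite (pos_sa pk).
Qed.

Lemma pos_conj w h : pos h -> pos (star w * h * w).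
Proof.
move=> /pos_sqrt [k [pk <- _ _]].
have -> : star w * (k * k) * w = star (k * w) * (k * w) by rewrite starMr (pos_sa pk); ncring.
exact: pos_cs.
Qed.

Lemma pos_conj_sa w h : star w = w -> pos h -> pos (w * h * w).
Proof. by move=> {1}<-; apply: pos_conj. Qed.

Definition ple a b := pos (b - a).

Lemma ple_conj_sa w a b : star w = w -> ple a b -> ple (w * a * w) (w * b * w).
Proof. by rewrite /ple => sw h; rewrite -mulrBl -mulrBr; apply: pos_conj_sa. Qed.

Lemma ple_refl a : ple a a. Proof. by rewrite /ple subrr; exact: pos0. Qed.

Lemma ple_trans a b c : ple a b -> ple b c -> ple a c.
Proof. by rewrite /ple => h1 h2; have := posD h1 h2; rewrite (_ : _ + _ = c - a) //; ncring. Qed.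

Lemma pleD a b c d : ple a b -> ple c d -> ple (a + c) (b + d).
Proof. by rewrite /ple => h1 h2; have := posD h1 h2; rewrite (_ : _ + _ = b + d - (a + c)) //; ncring. Qed.

Lemma ple_sum I (P : seq I) (Q : pred I) (F G : I -> A) :
  (forall i, Q i -> ple (F i) (G i)) -> ple (\sum_(i <- P | Q i) F i) (\sum_(i <- P | Q i) G i).
Proof. by move=> h; rewrite /ple -sumrB; apply: pos_sum. Qed.

Lemma ple_term (I : finType) (F : I -> A) i : (forall j, pos (F j)) -> ple (F i) (\sum_j F j).
Proof. by move=> h; rewrite /ple (bigD1 i) //= addrAC subrr add0r; apply: pos_sum. Qed.

Lemma pleZ r a b : 0 <= r -> ple a b -> ple (r *^ a) (r *^ b).
Proof. by rewrite /ple => r0 h; rewrite -scalerBr; apply: posZ. Qed.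

Lemma pleZr r s a : r <= s -> pos a -> ple (r *^ a) (s *^ a).
Proof. by rewrite /ple => rs h; rewrite rcB; apply: posZ; rewrite ?subr_ge0. Qed.

Lemma ple0 a : pos a -> ple 0 a. Proof. by rewrite /ple subr0. Qed.

Lemma ple_pos a b : pos a -> ple a b -> pos b.
Proof. by rewrite /ple => h1 h2; rewrite -[b](subrK a); apply: posD. Qed.

Lemma ple_conj w a b : ple a b -> ple (star w * a * w) (star w * b * w).
Proof. by rewrite /ple => h; rewrite -mulrBl -mulrBr; apply: pos_conj. Qed.

Lemma ple_nrm a b : pos a -> ple a b -> nrm a <= nrm b.
Proof.
move=> pa ab; have pb := ple_pos pa ab; apply: pos_le_nrm => //; first exact: nrm_ge0.
have -> : (nrm b)%:I - a = ((nrm b)%:I - b) + (b - a) by ncring.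
by apply: posD => //; apply: nrm_pos => //; apply: pos_sa.
Qed.

Lemma ple_nrm_rc a r : 0 <= r -> pos a -> ple a r%:I -> nrm a <= r.
Proof. by move=> r0 pa h; apply: pos_le_nrm. Qed.

Lemma sa_ple a r : star a = a -> nrm a <= r -> ple a r%:I.
Proof. exact: nrm_pos. Qed.

Lemma sa_pleN a r : star a = a -> nrm a <= r -> ple (- a) r%:I.
Proof. by move=> sa h; rewrite /ple opprK; apply: nrm_posD. Qed.

Lemma invsqrt c r : 0 < r -> ple r%:I c -> exists k, [/\ k * c * k = 1, pos k,
  (forall w, w * c = c * w -> w * k = k * w) & forall E, csub E -> E c -> E k].
Proof.
move=> r0 /(pos_inv r0) [g [g1 g2 g3 _ gE]].
have [k [k1 k2 k3 kE]] := pos_sqrt g3; exists k; split=> //.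
- by rewrite -(k3 c) ?g1 ?g2 // -mulrA k2.
- by move=> w h; apply: k3; apply: inv_comm h.
by move=> E hE Ec; apply: kE => //; apply: gE.
Qed.
End Positive.

Section Linear.
Variables (R : realType) (A B : cstarType R) (f : A -> B).
Hypothesis lf : linear f.

Lemma linD x y : f (x + y) = f x + f y.
Proof. by have := lf 1 x y; rewrite !scale1r. Qed.

Lemma lin0 : f 0 = 0.
Proof. by apply: (addrI (f 0)); rewrite -linD !addr0. Qed.

Lemma linZ (a : R[i]) x : f (a *: x) = a *: f x.
Proof. by have := lf a x 0; rewrite lin0 !addr0. Qed.

Lemma linN x : f (- x) = - f x.
Proof. by rewrite -scaleN1r linZ scaleN1r. Qed.

Lemma linB x y : f (x - y) = f x - f y.
Proof. by rewrite linD linN. Qed.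

Lemma lin_sum I (P : seq I) (Q : pred I) (F : I -> A) :
  f (\sum_(i <- P | Q i) F i) = \sum_(i <- P | Q i) f (F i).
Proof. by apply: (big_morph f linD lin0). Qed.
End Linear.

(** * Completely positive and order zero maps *)

Section CP.
Variables (R : realType) (A B : cstarType R) (f : A -> B).
Hypothesis cf : completely_positive f.
Local Notation lf := (proj1 cf).

(** The matrix (x_i^* x_j) is positive, being the square of a matrix whose only nonzero row is x.
    Writing its image as a Gram matrix does the work of a dilation of f. *)
Lemma cp_gram n (x : 'I_n.+1 -> A) : exists Y : 'I_n.+1 -> 'I_n.+1 -> B,
  forall i j, f (star (x i) * x j) = \sum_k star (Y k i) * Y k j.
Proof.
have [_ h] := cf.
have [|Y hY] := h n.+1 (\matrix_(i, j) (star (x i) * x j)).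
  exists (\matrix_(k, j) if k == ord0 then x j else 0); apply/matrixP => i j.
  rewrite !mxE (bigD1 ord0) //= !mxE eqxx big1 ?addr0 // => k /negbTE k0.
  by rewrite !mxE k0 mulr0.
exists (fun k i => Y k i) => i j; move/matrixP: hY => /(_ i j); rewrite !mxE => ->.
by apply: eq_bigr => k _; rewrite !mxE.
Qed.

Lemma cp_star x : f (star x) = star (f x).
Proof.
have [Y hY] := @cp_gram 1 (fun i => if i == ord0 then 1 else x).
have := hY ord0 ord_max; have := hY ord_max ord0; rewrite /= star1 mul1r mulr1 => -> ->.
by rewrite star_sum; apply: eq_bigr => k _; rewrite starMr starK.
Qed.

Lemma cp_pos x : pos x -> pos (f x).
Proof.
move=> /pos_sqrt [k [pk <- _ _]]; have [Y hY] := @cp_gram 0 (fun=> k).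
have := hY ord0 ord0; rewrite (pos_sa pk) => ->; apply: pos_sum => i _; exact: pos_cs.
Qed.

Lemma cp_ple x y : ple x y -> ple (f x) (f y).
Proof. by rewrite /ple -(linB lf); apply: cp_pos. Qed.

(* A vector on which the positive matrix [f (x_i^* x_j)] nearly vanishes as a
   quadratic form is nearly in its kernel. *)
Lemma cp_kernel n (x : 'I_n.+1 -> A) (w : 'I_n.+1 -> B) :
  let S := \sum_i \sum_j star (w i) * f (star (x i) * x j) * w j in
  pos S /\ forall i (a b : R), 0 <= a -> 0 <= b -> nrm (f (star (x i) * x i)) <= a ^+ 2 ->
    nrm S <= b ^+ 2 -> nrm (\sum_j f (star (x i) * x j) * w j) <= n.+1%:R * (a * b).
Proof.
move=> S; have [Y hY] := cp_gram x.
pose v k := \sum_j Y k j * w j.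
have eS : S = \sum_k star (v k) * v k.
  transitivity (\sum_i \sum_j \sum_k (star (w i) * star (Y k i)) * (Y k j * w j)).
    apply: eq_bigr => i _; apply: eq_bigr => j _; rewrite hY mulr_sumr mulr_suml.
    by apply: eq_bigr => k _; rewrite !mulrA.
  under eq_bigr do rewrite exchange_big; rewrite exchange_big; apply: eq_bigr => k _ /=.
  rewrite /v star_sum mulr_suml; apply: eq_bigr => i _; rewrite mulr_sumr.
  by apply: eq_bigr => j _; rewrite starMr.
have pS : pos S by rewrite eS; apply: pos_sum => k _; apply: pos_cs.
split => // i a b a0 b0 ha hb.
have -> : \sum_j f (star (x i) * x j) * w j = \sum_k star (Y k i) * v k.
  transitivity (\sum_j \sum_k star (Y k i) * (Y k j * w j)).
    by apply: eq_bigr => j _; rewrite hY mulr_suml; apply: eq_bigr => k _; rewrite mulrA.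
  by rewrite exchange_big; apply: eq_bigr => k _; rewrite mulr_sumr.
apply: le_trans (nrm_sum_const (e := a * b) _) _; last by rewrite card_ord.
move=> k; apply: nrmM_le; rewrite ?nrm_star.
  apply: nrm_sqr_le => //; apply: le_trans ha; apply: ple_nrm; first exact: pos_cs.
  by rewrite hY; apply: (@ple_term _ _ _ (fun k => star (Y k i) * Y k i)) => j; exact: pos_cs.
apply: nrm_sqr_le => //; apply: le_trans hb; apply: ple_nrm; first exact: pos_cs.
by rewrite eS; apply: (@ple_term _ _ _ (fun k => star (v k) * v k)) => j; exact: pos_cs.
Qed.

Lemma cp_contr : nrm (f 1) <= 1 -> forall x, star x = x -> nrm (f x) <= nrm x.
Proof.
move=> h1 x sx.
have h1' : ple (f 1) 1.
  by have := @sa_ple _ _ (f 1) 1 _ h1; rewrite rc1; apply; rewrite -cp_star star1.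
have K y : star y = y -> ple (f y) ((nrm y)%:C *: (1 : B)).
  move=> sy; apply: (@ple_trans _ _ _ ((nrm y)%:C *: f 1)).
    by rewrite -(linZ lf); apply: cp_ple; apply: sa_ple.
  by apply: pleZ => //; apply: nrm_ge0.
apply: sa_le_nrm; rewrite ?nrm_ge0 //; first by rewrite -cp_star sx.
  exact: K.
by have := K (- x); rewrite starN sx nrmN (linN lf) /ple opprK; apply.
Qed.
End CP.

Section OrderZero.
Variables (R : realType) (F A : cstarType R) (f : F -> A).
Hypothesis cf : completely_positive f.
Hypothesis ozf : forall x y, positive_elt x -> positive_elt y -> x * y = 0 -> f x * f y = 0.
Local Notation h := (f 1).

Lemma oz_proj b p : projection p -> f b * f p = f (b * p) * h.
Proof.
move=> [pp sp].
have lf := proj1 cf.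
have pos_p : positive_elt p by exists p; rewrite sp pp.
have pos_q : positive_elt (1 - p).
  exists (1 - p); rewrite starB star1 sp.
  have -> : (1 - p) * (1 - p) = 1 - p + (p * p - p) by ncring.
  by rewrite pp subrr addr0.
have z : p * (1 - p) = 0 by rewrite mulrBr mulr1 pp subrr.
have gh : f p * h = f p * f p.
  have := ozf pos_p pos_q z; rewrite (linB lf) mulrBr => /eqP; rewrite subr_eq0 => /eqP //.
have hg : h * f p = f p * f p.
  by have := congr1 star gh; rewrite !starMr -!(cp_star cf) sp star1.
pose x (i : 'I_3) := if i == 0 :> nat then 1 else if i == 1%N :> nat then p else star b.
pose w (i : 'I_3) := if i == 0 :> nat then - f p else if i == 1%N :> nat then h else 0 : A.
have [_ H] := cp_kernel cf x w.
have S0 : \sum_i \sum_j star (w i) * f (star (x i) * x j) * w j = 0.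
  rewrite !big_ord_recr !big_ord0 /= /w /x /= star1 starN -!(cp_star cf) sp star1 star0.
  rewrite pp !mul1r !mulr1 !mul0r !mulr0 !addr0 !add0r.
  have -> : - f p * h * - f p + - f p * f p * h + (h * f p * - f p + h * f p * h) =
     f p * (h * f p) - f p * (f p * h) + (h * (f p * h) - h * (f p * f p)) by ncring.
  by rewrite hg gh !subrr addr0.
have := H ord_max (nrm (f (star (x ord_max) * x ord_max)) + 1) 0.
rewrite S0 nrm0 expr0n mulr0 mulr0 lexx => /(_ _ _ _ isT) H0.
have : f b * - f p + f (b * p) * h = 0.
  apply: nrm_le0; apply: le_trans (H0 _ _ _) => //.
  - by rewrite !big_ord_recr big_ord0 /= /w /x /= starK mulr0 addr0 add0r mulr1.
  - by rewrite addr_ge0 // nrm_ge0.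
  - have := nrm_ge0 (f (star (x ord_max) * x ord_max)); nra.
by rewrite mulrN addrC => /eqP; rewrite subr_eq0 => /eqP ->.
Qed.

End OrderZero.

Section CPApprox.
Variables (R : realType) (A : cstarType R) (I : finType) (th : I -> A -> A).
Hypothesis cth : forall i, completely_positive (th i).

(** For the pair (1, a) and the vector (- a, 1) the forms of the maps [th i] are positive and add up
    to nearly the form of the identity, which is 0. So each is small, and the kernel estimate says
    that [th i] nearly acts as multiplication by [th i 1]. *)
Lemma cp_summand (a : A) (e : R) : 0 <= e <= 1 -> nrm a <= 1 ->
  (forall x, x = 1 \/ x = a \/ x = star a \/ x = star a * a -> nrm (\sum_i th i x - x) <= e ^+ 2) ->
  forall i, nrm (th i a - th i 1 * a) <= 8 * e.
Proof.
move=> /andP[e0 e1] na H i.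
pose x (k : 'I_2) := if k == 0 :> nat then 1 else a.
pose w (k : 'I_2) := if k == 0 :> nat then - a else 1 : A.
pose S i := \sum_k \sum_l star (w k) * th i (star (x k) * x l) * w l.
have PS j : pos (S j) by have [] := cp_kernel (cth j) x w.
have [_ K] := cp_kernel (cth i) x w.
have p1 j : pos (th j 1) by apply: cp_pos; rewrite //; apply: pos1.
have n1 : nrm (th i 1) <= 2 ^+ 2.
  apply: (@le_trans _ _ (nrm (\sum_j th j 1))).
    by apply: ple_nrm => //; apply: (@ple_term _ _ _ (fun j => th j 1)).
  have h1 := H 1 (or_introl erefl); have := nrmD (\sum_j th j 1 - 1) 1; rewrite subrK.
  have := nrm1 A; have : e ^+ 2 <= 1 by rewrite expr_le1.
  lra.
have SE j : S j = star a * th j 1 * a - star a * th j a - th j (star a) * a + th j (star a * a).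
  by rewrite /S !big_ord_recr !big_ord0 /= /w /x /= star1 starN !add0r !mul1r !mulr1; ncring.
have nS : nrm (S i) <= (2 * e) ^+ 2.
  apply: (@le_trans _ _ (nrm (\sum_j S j))).
    by apply: ple_nrm => //; apply: ple_term.
  pose d y := \sum_j th j y - y.
  have -> : \sum_j S j = star a * d 1 * a - star a * d a - d (star a) * a + d (star a * a).
    under eq_bigr do rewrite SE.
    rewrite !big_split !sumrN /= -!mulr_suml -!mulr_sumr /d; ncring.
  have sa := na; rewrite -nrm_star in sa.
  have h1 := H 1 (or_introl erefl).
  have h2 := H a (or_intror (or_introl erefl)).
  have h3 := H (star a) (or_intror (or_intror (or_introl erefl))).
  have h4 := H (star a * a) (or_intror (or_intror (or_intror erefl))).
  have k1 := nrmM_le (nrmM_le sa h1) na; have k2 := nrmM_le sa h2; have k3 := nrmM_le h3 na.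
  have -> : (2 * e) ^+ 2 = 1 * e ^+ 2 * 1 + 1 * e ^+ 2 + e ^+ 2 * 1 + e ^+ 2 by ring.
  apply: le_trans (nrmD _ _) _; apply: lerD h4.
  apply: le_trans (nrmD _ _) _; apply: lerD; last by rewrite nrmN.
  by apply: le_trans (nrmD _ _) _; apply: lerD; last by rewrite nrmN.
(* The diagonal entry is at most 2^2 and the form at most (2 e)^2; with two rows this gives 2 * 2 *
   2 e. *)
have := K ord0 2 (2 * e); rewrite /x /= star1 mul1r => /(_ _ _ n1 nS).
rewrite !big_ord_recr big_ord0 /= /w /= !mulr1 mul1r add0r mulrN addrC => /(_ _ _) h.
have -> : 8 * e = 2 * (2 * (2 * e)) by ring.
by apply: h; rewrite ?mulr_ge0.
Qed.
End CPApprox.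

(** * Finite-dimensional algebras *)

Section FiniteDim.
Variables (R : realType) (F : cstarType R).
Implicit Types (x y z w : F).
Hypothesis fd : finite_dimensional [set: F].

Lemma fd_dep : exists n, forall k (v : 'I_k -> F), (n < k)%N ->
  exists c : 'I_k -> R[i], (exists i, c i != 0) /\ \sum_i c i *: v i = 0.
Proof.
have [n [e he]] := fd; exists n => k v nk.
have /choice [c hc] : forall i, exists c : 'I_n -> R[i], v i = \sum_j c j *: e j by move=> i; apply: he.
pose M := \matrix_(i, j) c i j : 'M[R[i]]_(k, n).
have [i hi] : exists i, row i (kermx M) != 0.
  apply/existsP; rewrite -negb_forall; apply/negP => /forallP h.
  have k0 : kermx M = 0 by apply/row_matrixP => i; rewrite row0; apply/eqP.
  have := mxrank_ker M; rewrite k0 mxrank0; have := rank_leq_col M; lia.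
pose u := row i (kermx M).
have uM : u *m M = 0 by rewrite -row_mul mulmx_ker row0.
exists (fun j => u 0 j); split.
  apply/existsP; rewrite -negb_forall; apply/negP => /forallP h.
  by move/eqP: hi; apply; apply/rowP => j; rewrite [RHS]mxE; apply/eqP; apply: h.
under eq_bigr do rewrite hc scaler_sumr; rewrite exchange_big big1 // => j _ /=.
under eq_bigr do rewrite scalerA; rewrite -scaler_suml.
have := congr1 (fun m : 'rV_n => m 0 j) uM; rewrite !mxE => h.
by rewrite (_ : \sum_ _ _ = 0) ?scale0r // -[RHS]h; apply: eq_bigr => l _; rewrite !mxE.
Qed.

Definition orth_proj k (p : 'I_k -> F) :=
  [/\ (forall i, projection (p i)), (forall i, p i <> 0) & forall i j, i <> j -> p i * p j = 0].

Lemma fd_proj_bound : exists n, forall k (p : 'I_k -> F), orth_proj p -> (k <= n)%N.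
Proof.
have [n hn] := fd_dep; exists n => k p [pp p0 po]; rewrite leqNgt; apply/negP => lt.
have [c [[i ci] s0]] := hn _ p lt.
have : p i * \sum_j c j *: p j = c i *: p i.
  rewrite mulr_sumr (bigD1 i) //= mulZr (proj1 (pp i)) big1 ?addr0 // => j /eqP ji.
  by rewrite mulZr po ?scaler0 // => e; apply: ji.
rewrite s0 mulr0 => /esym/eqP; rewrite scaler_eq0 (negbTE ci) /= => /eqP; exact: p0.
Qed.

Section Spectral.
Variables (f x : F).
Hypotheses (pf : projection f) (f0 : f <> 0) (sx : star x = x) (xf : x * f = x) (fx : f * x = x).

Let ev N (P : {poly R[i]}) := \sum_(i < N) P`_i *: (x ^+ i * f).
(** The product of the factors x - r over s, inside the corner of f. *)
Let acc (s : seq R[i]) := foldr (fun r a => x * a - r *: a) f s.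

Lemma ev_acc s : ev (size s).+1 (\prod_(r <- s) ('X - r%:P)) = acc s.
Proof.
elim: s => [|r s IH] /=.
  by rewrite /ev big_ord1 big_nil coefC /= expr0 mul1r scale1r.
rewrite big_cons mulrBl; set P := \prod_(_ <- s) _ in IH *.
have sP : size P = (size s).+1 by rewrite size_prod_XsubC.
rewrite -IH /ev.
transitivity (\sum_(i < (size s).+2) ('X * P)`_i *: (x ^+ i * f) -
   r *: \sum_(i < (size s).+2) P`_i *: (x ^+ i * f)).
  rewrite scaler_sumr -sumrB; apply: eq_bigr => i _.
  by rewrite coefB mul_polyC coefZ scalerBl scalerA.
congr (_ - _ *: _).
  rewrite big_ord_recl coefXM eqxx scale0r add0r mulr_sumr; apply: eq_bigr => i _.
  by rewrite coefXM /= mulZr mulrA -exprS.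
by rewrite big_ord_recr /= nth_default ?sP // scale0r addr0.
Qed.

Lemma acc_comm s w : w * x = x * w -> w * f = f * w -> w * acc s = acc s * w.
Proof.
move=> wx wf; elim: s => [|r s IH] //=.
by rewrite mulrBr mulrBl mulrA wx -mulrA IH mulrA mulZl mulZr IH.
Qed.

Lemma acc_f s : f * acc s = acc s /\ acc s * f = acc s.
Proof.
have ff := proj1 pf.
elim: s => [|r s [IH1 IH2]] //=; split.
  by rewrite mulrBr mulrA fx mulZr IH1.
by rewrite mulrBl -mulrA IH2 mulZl IH2.
Qed.

Lemma acc_eig s e r : x * e = r *: e -> f * e = e -> exists m, acc s * e = m *: e.
Proof.
move=> xe fe; elim: s => [|t s [m IH]] /=; first by exists 1; rewrite fe scale1r.
exists (m * r - t * m); rewrite mulrBl -mulrA mulZl IH mulZr xe !scalerA -scalerBl.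
by congr ((_ - _) *: _).
Qed.

(** A polynomial relation among the powers of x splits into linear factors over R[i]. The factor at
    which the partial product first vanishes gives an eigenvalue, and the product before it is an
    eigenvector. *)
Lemma spectral_eig : exists r s, acc s <> 0 /\ x * acc s = r *: acc s.
Proof.
have [n hn] := fd_dep; have [c [[i ci] s0]] := hn n.+1 (fun i => x ^+ i * f) (ltnSn n).
pose P := \poly_(j < n.+1) c (inord j).
have P0 : P != 0.
  apply/eqP => h; have := congr1 (fun p : {poly R[i]} => p`_i) h; rewrite coef0 coef_poly ltn_ord inord_val => e.
  by move: ci; rewrite e eqxx.
have [s hs] := closed_field_poly_normal P.
have a0 : acc s = 0.
  have evP : ev n.+1 P = 0.
    rewrite -[RHS]s0; apply: eq_bigr => j _; by rewrite coef_poly ltn_ord inord_val.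
  have ss : (size s < n.+1)%N.
    have : (size P <= n.+1)%N by apply: size_poly.
    by rewrite hs size_scale ?lead_coef_eq0 // size_prod_XsubC.
  have ext : ev n.+1 (\prod_(r <- s) ('X - r%:P)) = ev (size s).+1 (\prod_(r <- s) ('X - r%:P)).
    rewrite /ev (big_ord_widen _ (fun i => (\prod_(r <- s) ('X - r%:P))`_i *: (x ^+ i * f)) ss).
    rewrite [RHS]big_mkcond; apply: eq_bigr => j _; case: ifP => // /negbT; rewrite -leqNgt => hj.
    by rewrite nth_default ?scale0r // size_prod_XsubC.
  rewrite -ev_acc -ext; apply/eqP; move/eqP: evP; rewrite hs.
  have -> : ev n.+1 (lead_coef P *: \prod_(r <- s) ('X - r%:P)) =
    lead_coef P *: ev n.+1 (\prod_(r <- s) ('X - r%:P)).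
    by rewrite /ev scaler_sumr; apply: eq_bigr => j _; rewrite coefZ scalerA.
  by rewrite scaler_eq0 lead_coef_eq0 (negbTE P0).
elim: s a0 {hs} => [|r s IH] /= a0; first by case: (f0 a0).
have [/IH //|s1] := pselect (acc s = 0).
by exists r, s; split => //; apply/eqP; rewrite -subr_eq0; apply/eqP.
Qed.

(** The eigenvector N commutes with N^*, so e = N^* N satisfies e^2 = v e with v > 0, and e / v is
    an eigenprojection. It commutes with whatever commutes with x and f, since N is a polynomial in
    x. *)
Lemma spectral_proj : (exists r, x = r *: f) \/ exists q,
  [/\ projection q, q <> 0, q <> f, f * q = q & forall w, w * x = x * w -> w * f = f * w -> w * q = q * w].
Proof.
have [r [s [N0 xN]]] := spectral_eig; set N := acc s in N0 xN.
have sf := proj2 pf; have ff := proj1 pf.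
pose e := star N * N.
have se : star e = e by rewrite starMr starK.
have e0 : e <> 0 by move=> h; apply: N0; apply: cs_eq0.
have cN w : w * x = x * w -> w * f = f * w -> w * N = N * w by apply: acc_comm.
have cNs w : w * x = x * w -> w * f = f * w -> w * star N = star N * w.
  move=> wx wf; apply: (can_inj (@starK _ F)); rewrite !starMr starK; symmetry; apply: cN.
    by have := congr1 star wx; rewrite !starMr sx.
  by have := congr1 star wf; rewrite !starMr sf.
have [fN Nf] := acc_f s; rewrite -/N in fN Nf.
have sNx : star N * x = x * star N by symmetry; apply: cNs; rewrite // xf fx.
have sNf : star N * f = f * star N by symmetry; apply: cNs; rewrite // xf fx.
have NN : star N * N = N * star N by apply: cN.
have xe : x * e = r *: e by rewrite /e mulrA -sNx -mulrA xN mulZr.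
have fe : f * e = e by rewrite /e mulrA -sNf -mulrA fN.
have [m hm] := acc_eig s xe fe; rewrite -/N in hm.
have eN : e * N = m *: e by rewrite -hm /e mulrA -NN.
have ee : e * e = (Num.conj m * m) *: e.
  rewrite {2}/e mulrA.
  have -> : e * star N = Num.conj m *: e by have := congr1 star hm; rewrite starMr se starZ se.
  by rewrite mulZl eN scalerA.
pose v := Num.conj m * m.
have v0 : v != 0.
  apply/eqP => h; apply: e0; apply: cs_eq0; by rewrite se ee -/v h scale0r.
have sv : Num.conj v = v by apply/CrealP; rewrite /v mulrC -normCK rpredX // normr_real.
pose q := v^-1 *: e.
have svi : Num.conj v^-1 = v^-1 by apply/CrealP; rewrite rpredV; exact/CrealP.
have sq : star q = q by rewrite starZ se svi.
have qq : q * q = q by rewrite mulZl mulZr ee scalerA scalerA -/v -mulrA mulVf // mulr1.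
have q0 : q <> 0.
  by move=> /eqP; rewrite scaler_eq0 invr_eq0 (negbTE v0) /= => /eqP.
have xq : x * q = r *: q by rewrite mulZr xe scalerA mulrC -scalerA.
have [qf|qf] := pselect (q = f); first by left; exists r; rewrite -qf -xq qf xf.
right; exists q; split => //; first by rewrite mulZr fe.
move=> w wx wf; rewrite mulZl mulZr; congr (_ *: _).
by rewrite /e mulrA cNs // -mulrA cN // mulrA.
Qed.
End Spectral.

(** A maximal family of minimal projections. It replaces the isomorphism with a direct sum of matrix
    algebras: the matrix blocks are the classes of [eqv] below. *)
Definition msys k (p : 'I_k -> F) :=
  [/\ orth_proj p, \sum_i p i = 1 & forall i x, exists c : R[i], p i * x * p i = c *: p i].

Lemma re_im x : exists a b, [/\ star a = a, star b = b & x = a + 'i *: b].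
Proof.
have ii : (('i : R[i]) * 'i) = -1 by rewrite -expr2 sqr_i.
exists (2^-1 *^ (x + star x)), ((2^-1%:C * - 'i) *: (x - star x)); split.
- by rewrite starZr starD starK addrC.
- rewrite starZ starB starK -[star x - x]opprB scalerN -scaleNr; congr (_ *: _).
  by apply/eqP; rewrite eq_complex /=; apply/andP; split; apply/eqP; ring.
rewrite scalerA mulrCA mulrN ii opprK mulr1 -scalerDr.
have -> : x + star x + (x - star x) = x + x by ncring.
by rewrite -[x + x]mulr2n -rcnat rcM mulVf ?pnatr_eq0 // rc1.
Qed.

(* Found as a maximal orthogonal family of projections commuting with [y]. *)
Lemma fd_system y : star y = y -> exists k (p : 'I_k -> F), msys p /\ forall i, exists d : R, y * p i = d *^ p i.
Proof.
move=> sy.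
pose fam k := exists p : 'I_k -> F, orth_proj p /\ forall i, p i * y = y * p i.
have [n hn] := fd_proj_bound.
have ex0 : exists k, `[< fam k >].
  exists 0%N; apply/asboolP; by exists (fun=> 0); split; first split; case.
have bnd k : `[< fam k >] -> (k <= n)%N by move/asboolP => [p [/hn]].
case: (ex_maxnP ex0 bnd) => k /asboolP [p [[pp p0 po] py]] kmax.
have sum_p : \sum_i p i = 1.
  apply/eqP; rewrite eq_sym -subr_eq0; apply/eqP; apply: contrapT => q0.
  set q := 1 - \sum_i p i in q0.
  have pS i : p i * \sum_j p j = p i.
    rewrite mulr_sumr (bigD1 i) //= (proj1 (pp i)) big1 ?addr0 // => j /eqP ji.
    by apply: po => e; apply: ji.
  have Sp i : (\sum_j p j) * p i = p i.
    rewrite mulr_suml (bigD1 i) //= (proj1 (pp i)) big1 ?addr0 // => j /eqP ji.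
    by apply: po => e; apply: ji.
  have sS : star (\sum_i p i) = \sum_i p i.
    by rewrite star_sum; apply: eq_bigr => i _; case: (pp i).
  (* A nonzero rest q could be added to the family, against maximality. *)
  have : (k.+1 <= k)%N.
    apply: kmax; apply/asboolP; exists (fun i => if unlift ord0 i is Some j then p j else q); split; first split.
    - move=> i; case: unliftP => [j _|_] //; split; last by rewrite starB star1 sS.
      rewrite /q; have -> : (1 - \sum_i p i) * (1 - \sum_i p i) =
        1 - \sum_i p i - ((\sum_i p i) - (\sum_i p i) * (\sum_i p i)) by ncring.
      have SS : (\sum_i p i) * (\sum_i p i) = \sum_i p i by rewrite mulr_suml; apply: eq_bigr.
      by rewrite SS subrr subr0.
    - by move=> i; case: unliftP => [j _|_].
    - move=> i j; case: unliftP => [a ->|->]; case: unliftP => [b ->|->] ab //.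
      + by apply: po => e; apply: ab; rewrite e.
      + by rewrite /q mulrBr mulr1 pS subrr.
      + by rewrite /q mulrBl mul1r Sp subrr.
    move=> i; case: unliftP => [j _|_] //.
    rewrite /q mulrBl mulrBr mul1r mulr1 mulr_suml mulr_sumr; congr (_ - _); exact: eq_bigr.
  by rewrite ltnn.
(* A nonscalar self-adjoint element of the corner that commutes with y would split [p i] into q and
   [p i - q], again giving a longer family. *)
have scal i x : star x = x -> x * p i = x -> p i * x = x -> x * y = y * x -> exists c : R[i], x = c *: p i.
  move=> sx xp px xy; case: (spectral_proj (pp i) (p0 i) sx xp px) => // -[q [pq q0 qf fq cq]].
  have qf' : q * p i = q by have := congr1 star fq; rewrite starMr (proj2 pq) (proj2 (pp i)).
  have qy : q * y = y * q by symmetry; apply: cq.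
  have : (k.+1 <= k)%N; last by rewrite ltnn.
  pose p' j := if unlift ord0 j is Some l then (if l == i then p i - q else p l) else q.
  have qp j : j <> i -> q * p j = 0 by move=> ji; rewrite -qf' -mulrA po ?mulr0 // => e; apply: ji.
  have pq' j : j <> i -> p j * q = 0 by move=> ji; rewrite -fq mulrA po ?mul0r.
  have fi := proj1 (pp i).
  apply: kmax; apply/asboolP; exists p'; split; first split.
  - move=> j; rewrite /p'; case: unliftP => [l _|_] //; case: eqP => // _; split.
      have -> : (p i - q) * (p i - q) = p i * p i - p i * q - q * p i + q * q by ncring.
      by rewrite fi fq qf' (proj1 pq) subrK.
    by rewrite starB (proj2 (pp i)) (proj2 pq).
  - move=> j; rewrite /p'; case: unliftP => [l _|_] //; case: eqP => // _ /eqP.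
    by rewrite subr_eq0 => /eqP e; apply: qf.
  - move=> a b; rewrite /p'; case: unliftP => [l ->|->]; case: unliftP => [m ->|->] //.
    + case: (eqVneq l i) => [->|li]; case: (eqVneq m i) => [->|mi] // lm.
      * rewrite mulrBl qp ?subr0; last by apply/eqP.
        by apply: po => e; move/eqP: mi; rewrite e.
      * rewrite mulrBr pq' ?subr0; last by apply/eqP.
        by apply: po => e; move/eqP: li.
      by apply: po => e; apply: lm; rewrite e.
    + case: (eqVneq l i) => [->|/eqP li] _; first by rewrite mulrBl fq (proj1 pq) subrr.
      exact: pq'.
    case: (eqVneq m i) => [->|/eqP mi] _; first by rewrite mulrBr qf' (proj1 pq) subrr.
    exact: qp.
  move=> j; rewrite /p'; case: unliftP => [l _|_] //; case: eqP => // _.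
  by rewrite mulrBl mulrBr py qy.
have yd i : exists d : R, y * p i = d *^ p i.
  have fi := proj1 (pp i).
  have [c hc] : exists c : R[i], y * p i = c *: p i.
    apply: scal; rewrite ?starMr ?sy ?(proj2 (pp i)) ?py //.
    - by rewrite -mulrA fi.
    - by rewrite -py mulrA fi.
    by rewrite -mulrA py.
  have cc : Num.conj c = c.
    have := congr1 star hc; rewrite starMr starZ sy (proj2 (pp i)) py hc => /eqP.
    rewrite -subr_eq0 -scalerBl scaler_eq0 subr_eq0 => /orP[/eqP <- //|/eqP/p0 //].
  exists (complex.Re c); rewrite hc RRe_real //; exact/CrealP.
exists k, p; split => //; split => // i x.
have fi := proj1 (pp i); have [d hd] := yd i.
(* Since y acts on [p i] as the scalar d, every compression to [p i] commutes with y, so [scal]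
   applies to it. *)
have S z : star z = z -> exists c : R[i], p i * z * p i = c *: p i.
  move=> sz; apply: scal.
  - by rewrite !starMr sz (proj2 (pp i)) mulrA.
  - by rewrite -mulrA fi.
  - by rewrite !mulrA fi.
  by rewrite -mulrA py hd !mulrA hd !mulZl !mulZr.
have [a [b [sa sb ->]]] := re_im x.
have [c1 h1] := S a sa; have [c2 h2] := S b sb; exists (c1 + 'i * c2).
by rewrite mulrDr mulrDl h1 mulZr mulZl h2 scalerDl scalerA.
Qed.
End FiniteDim.

Section MinimalSystems.
Variables (R : realType) (F : cstarType R).
Implicit Types (x y z w : F).

Section Coef.
Variables (k : nat) (p : 'I_k -> F).
Hypothesis ms : msys p.

Let pp i : p i * p i = p i. Proof. by case: ms => [[h _ _] _ _]; case: (h i). Qed.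
Let sp i : star (p i) = p i. Proof. by case: ms => [[h _ _] _ _]; case: (h i). Qed.
Let p0 i : p i <> 0. Proof. by case: ms => [[_ h _] _ _]. Qed.
Let po i j : i <> j -> p i * p j = 0. Proof. by case: ms => [[_ _ h] _ _]; apply: h. Qed.
Let psum : \sum_i p i = 1. Proof. by case: ms. Qed.

Definition coef i x : R[i] := xget 0 [set c | p i * x * p i = c *: p i].

Lemma coefP i x : p i * x * p i = coef i x *: p i.
Proof. by case: ms => _ _ h; have [c hc] := h i x; exact: (@xgetPex R[i] 0 [set c | p i * x * p i = c *: p i] (ex_intro _ c hc)). Qed.

Lemma coef_uniq i x c : p i * x * p i = c *: p i -> coef i x = c.
Proof.
rewrite coefP => /eqP; rewrite -subr_eq0 -scalerBl scaler_eq0 subr_eq0 => /orP[/eqP //|/eqP].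
by move/p0.
Qed.

Lemma coefD i x y : coef i (x + y) = coef i x + coef i y.
Proof. by apply: coef_uniq; rewrite mulrDr mulrDl !coefP scalerDl. Qed.

Lemma coefZ i (a : R[i]) x : coef i (a *: x) = a * coef i x.
Proof. by apply: coef_uniq; rewrite mulZr mulZl coefP scalerA. Qed.

Lemma coef0 i : coef i 0 = 0.
Proof. by apply: coef_uniq; rewrite mulr0 mul0r scale0r. Qed.

Lemma coef_sum i I (P : seq I) (Q : pred I) (G : I -> F) :
  coef i (\sum_(j <- P | Q j) G j) = \sum_(j <- P | Q j) coef i (G j).
Proof. by apply: (big_morph _ (coefD i) (coef0 i)). Qed.

Lemma pos_projZ (c : R[i]) (q : F) : projection q -> q <> 0 -> pos (c *: q) -> 0 <= c.
Proof.
move=> [qq sq] q0 pc; have := pos_sa pc; rewrite starZ sq => /eqP.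
rewrite -subr_eq0 -scalerBl scaler_eq0 subr_eq0 => /orP[/eqP/CrealP cr|/eqP /q0 //].
have [//|c0] := real_leP (real0 _) cr.
have pq : pos q by rewrite -qq -{1}sq; apply: pos_cs.
case: q0; have : c *: q = 0.
  apply: pos_anti => //; rewrite -scaleNr -(RRe_real cr) -rmorphN; apply: posZ => //.
  by move: c0; rewrite -{1}(RRe_real cr) ltcC oppr_ge0 => /ltW.
by move/eqP; rewrite scaler_eq0 (lt_eqF c0) /= => /eqP.
Qed.

Lemma coef_ge0 i x : pos x -> 0 <= coef i x.
Proof.
move=> px; apply: (@pos_projZ _ (p i)) => //; rewrite -coefP; exact: pos_conj_sa.
Qed.

Lemma coef1 i : coef i 1 = 1.
Proof. by apply: coef_uniq; rewrite mulr1 pp scale1r. Qed.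

(** For minimal projections this means lying in the same matrix block. *)
Definition eqv q r := exists x, q * x * r <> 0.

(* The trace of the block of [q] *)
Definition btr q x : R[i] := \sum_(i < k | `[< eqv (p i) q >]) coef i x.

Lemma btrD q x y : btr q (x + y) = btr q x + btr q y.
Proof. by rewrite /btr -big_split; apply: eq_bigr => i _; rewrite coefD. Qed.

Lemma btrZ q (a : R[i]) x : btr q (a *: x) = a * btr q x.
Proof. by rewrite /btr mulr_sumr; apply: eq_bigr => i _; rewrite coefZ. Qed.

Lemma btr_ge0 q x : pos x -> 0 <= btr q x.
Proof. by move=> px; apply: sumr_ge0 => i _; apply: coef_ge0. Qed.

Definition minimal q := projection q /\ q <> 0 /\ forall x, exists c : R[i], q * x * q = c *: q.

Lemma msys_min i : minimal (p i).
Proof. by split=> //; split=> // x; exists (coef i x); apply: coefP. Qed.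

(** For u = q x r minimality gives u^* u = c r and u u^* = d q, and associativity of u u^* u forces
    c = d > 0; then v = u / sqrt c. *)
Lemma eqv_pi q r : minimal q -> minimal r -> eqv q r ->
  exists v, [/\ star v * v = r, v * star v = q, q * v = v & v * r = v].
Proof.
move=> [[qq sq] [q0 hq]] [[rr sr] [r0 hr]] [x hx].
pose u := q * x * r.
have qu : q * u = u by rewrite /u !mulrA qq.
have ur : u * r = u by rewrite /u -!mulrA rr.
have ru : r * star u = star u by have := congr1 star ur; rewrite starMr sr.
have uq : star u * q = star u by have := congr1 star qu; rewrite starMr sq.
have [c hc] := hr (star u * u).
have uc : star u * u = c *: r by rewrite -hc mulrA ru -mulrA ur.
have u0 : star u * u <> 0 by move/cs_eq0.
have c0 : 0 <= c by apply: (@pos_projZ _ r) => //; rewrite -uc; apply: pos_cs.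
have cn : c != 0 by apply/eqP => e; apply: u0; rewrite uc e scale0r.
have [d hd] := hq (u * star u).
have ud : u * star u = d *: q by rewrite -hd mulrA qu -mulrA uq.
have dc : d = c.
  have : u * (star u * u) = c *: u by rewrite uc mulZr ur.
  rewrite mulrA ud mulZl qu => /eqP; rewrite -subr_eq0 -scalerBl scaler_eq0 subr_eq0 => /orP[/eqP //|/eqP uu].
  by case: u0; rewrite uu mulr0.
rewrite dc in ud.
have cr : 0 < complex.Re c.
  by move: c0; rewrite lecE /= => /andP[/eqP ic]; rewrite le_eqVlt => /orP[/eqP e|//]; case/eqP: cn; apply/eqP; rewrite eq_complex -e ic /= !eqxx.
have cE : c = (complex.Re c)%:C by rewrite RRe_real // ger0_real.
pose s := (Num.sqrt (complex.Re c))^-1.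
have ss : s * s * complex.Re c = 1.
  rewrite /s -invfM -expr2 sqr_sqrtr ?mulVf ?lt0r_neq0 //; exact: ltW.
have key z : s *^ (s *^ (c *: z)) = z by rewrite {1}cE !rcM ?mulrA ss rc1.
exists (s *^ u); split.
- by rewrite starZr mulZl mulZr uc key.
- by rewrite starZr mulZl mulZr ud key.
- by rewrite mulZr qu.
by rewrite mulZl ur.
Qed.

Lemma eqv_refl q : minimal q -> eqv q q.
Proof. by move=> [[qq _] [q0 _]]; exists q; rewrite !qq. Qed.

Lemma eqv_sym q r : projection q -> projection r -> eqv q r -> eqv r q.
Proof.
move=> [_ sq] [_ sr] [x hx]; exists (star x) => h; apply: hx.
by apply: (can_inj (@starK _ F)); rewrite !starMr sq sr mulrA h star0.
Qed.

Lemma eqv_trans q r t : minimal q -> minimal r -> minimal t -> eqv q r -> eqv r t -> eqv q t.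
Proof.
move=> mq mr mt h1 h2.
have [v [v1 v2 v3 v4]] := eqv_pi mq mr h1; have [w [w1 w2 w3 w4]] := eqv_pi mr mt h2.
exists (v * w) => h; case: mt => _ [t0 _]; apply: t0.
have : star (v * w) * (v * w) = t by rewrite starMr mulrA -(mulrA (star w)) v1 -mulrA w3.
have -> : v * w = q * (v * w) * t by rewrite mulrA v3 -mulrA w4.
by rewrite h mulr0.
Qed.

(** It suffices to compare the coefficients of a p_j b at i and of b p_i a at j. They vanish across
    blocks, and for u = p_i a p_j, v = p_j b p_i they agree because u (v u) = (u v) u. *)
Lemma btr_comm q x y : minimal q -> btr q (x * y) = btr q (y * x).
Proof.
move=> mq; rewrite /btr.
have E (a b : F) i : coef i (a * b) = \sum_j coef i (a * p j * b).
  rewrite -coef_sum -mulr_suml -mulr_sumr psum mulr1 //.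
have Z i j (a b : F) : ~ eqv (p i) (p j) -> coef i (a * p j * b) = 0.
  move=> h; apply: coef_uniq; rewrite scale0r.
  have -> : p i * (a * p j * b) * p i = (p i * a * p j) * b * p i by rewrite !mulrA.
  by rewrite (_ : p i * a * p j = 0) ?mul0r //; apply: contrapT => h'; apply: h; exists a.
have S i j (a b : F) : coef i (a * p j * b) = coef j (b * p i * a).
  have [h|h] := pselect (eqv (p i) (p j)); last first.
    by rewrite Z // Z // => h'; apply: h; apply: eqv_sym h'; [case: (msys_min j)|case: (msys_min i)].
  pose u := p i * a * p j; pose v := p j * b * p i.
  have uv : u * v = coef i (a * p j * b) *: p i by rewrite -coefP /u /v !mulrA -(mulrA _ (p j) (p j)) pp.
  have vu : v * u = coef j (b * p i * a) *: p j by rewrite -coefP /u /v !mulrA -(mulrA _ (p i) (p i)) pp.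
  have piu : p i * u = u by rewrite /u !mulrA pp.
  have upj : u * p j = u by rewrite /u -!mulrA pp.
  have [u0|u0] := pselect (u = 0).
    move: uv vu; rewrite u0 mul0r mulr0 => /esym/eqP e1 /esym/eqP e2; move: e1 e2.
    by rewrite !scaler_eq0 => /orP[/eqP ->|/eqP/p0 //] /orP[/eqP ->|/eqP/p0 //].
  have : u * (v * u) = coef j (b * p i * a) *: u by rewrite vu mulZr upj.
  rewrite mulrA uv mulZl piu => /eqP; rewrite -subr_eq0 -scalerBl scaler_eq0 subr_eq0 => /orP[/eqP //|/eqP].
  by move/u0.
have key (a b : F) : \sum_(i < k | `[< eqv (p i) q >]) coef i (a * b) =
    \sum_(i < k | `[< eqv (p i) q >]) \sum_(j < k | `[< eqv (p j) q >]) coef i (a * p j * b).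
  apply: eq_bigr => i /asboolP iq; rewrite E [RHS]big_mkcond; apply: eq_bigr => j _.
  case: asboolP => // jq; apply: Z => ij; apply: jq.
  apply: eqv_trans (eqv_sym _ _ ij) iq => //; try exact: msys_min; by case: (msys_min i); case: (msys_min j).
rewrite !key exchange_big; apply: eq_bigr => j _; apply: eq_bigr => i _; exact: S.
Qed.

Lemma btr_min q r : minimal q -> minimal r -> btr q r = (`[< eqv q r >])%:R.
Proof.
move=> mq mr; case: asboolP => h.
  have [i hi] : exists i, eqv (p i) q.
    apply: contrapT => hn; case: mq => [[qq _] [q0 _]]; apply: q0.
    rewrite -qq -{1}[q]mul1r -psum mulr_suml mulr_suml big1 // => i _.
    by apply: contrapT => h'; apply: hn; exists i, 1; rewrite mulr1 => e; apply: h'; rewrite e mul0r.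
  have ir := eqv_trans (msys_min i) mq mr hi h.
  have [v [v1 v2 v3 v4]] := eqv_pi (msys_min i) mr ir.
  rewrite -v1 btr_comm // v2 /btr (bigD1 i) /=; last exact/asboolP.
  rewrite (_ : coef i (p i) = 1) ?big1 ?addr0 //; last by apply: coef_uniq; rewrite !pp scale1r.
  move=> j /andP[_ /eqP ji]; apply: coef_uniq; by rewrite po // mul0r scale0r.
rewrite /btr big1 // => i /asboolP iq; apply: coef_uniq; rewrite scale0r.
apply: contrapT => h'; apply: h.
have ir : eqv (p i) r by exists 1; rewrite mulr1 => e; apply: h'; rewrite e mul0r.
apply: eqv_trans ir => //; first exact: msys_min.
apply: eqv_sym iq; [by case: (msys_min i)|by case: mq].
Qed.
End Coef.

(** The block trace does not depend on the system, so one may be adapted to the image of 1 and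
    another to the image of x. *)
Lemma btr_system k l (p : 'I_k -> F) (r : 'I_l -> F) q x : msys p -> msys r -> minimal q ->
  btr p q x = btr r q x.
Proof.
move=> mp mr mq.
have rr i : r i * r i = r i by case: mr => [[h _ _] _ _]; case: (h i).
have rsum : \sum_i r i = 1 by case: mr.
transitivity (\sum_i btr p q (r i * x * r i)).
  rewrite -[in LHS](mulr1 x) -rsum mulr_sumr.
  have -> : btr p q (\sum_i x * r i) = \sum_i btr p q (x * r i).
    apply: (big_morph _ (btrD mp q)); by rewrite /btr big1 // => i _; rewrite coef0.
  by apply: eq_bigr => i _; rewrite -{1}(rr i) mulrA btr_comm // mulrA.
rewrite [RHS]big_mkcond; apply: eq_bigr => i _.
rewrite (coefP mr) btrZ // btr_min //; last exact: msys_min.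
case: asboolP => h; case: asboolP => h'; rewrite ?mulr1 ?mulr0 //.
  by case: h'; apply: eqv_sym h; [case: mq|case: (msys_min mr i)].
by case: h; apply: eqv_sym h'; [case: (msys_min mr i)|case: mq].
Qed.
End MinimalSystems.

(** * Moduli of scalars and positive functionals *)

Section Cnm.
Variable R : realType.
Implicit Types (a b z : R[i]) (r e : R).

Lemma cnm_ge0 a : 0 <= cnm a. Proof. by rewrite -ler0c -cnmE. Qed.
Lemma cnmD a b : cnm (a + b) <= cnm a + cnm b.
Proof. by rewrite -lecC rmorphD /= -!cnmE ler_normD. Qed.
Lemma cnmM a b : cnm (a * b) = cnm a * cnm b.
Proof. by apply: complexI; rewrite rmorphM /= -!cnmE normrM. Qed.
Lemma cnmN a : cnm (- a) = cnm a. Proof. by rewrite /cnm normrN. Qed.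
Lemma cnmB a b : cnm (a - b) = cnm (b - a). Proof. by rewrite /cnm distrC. Qed.
Lemma cnm0 : cnm (0 : R[i]) = 0. Proof. by rewrite /cnm normr0. Qed.
Lemma cnm_eq0 a : cnm a = 0 -> a = 0.
Proof. by move=> h; apply/eqP; rewrite -normr_eq0 cnmE h. Qed.
Lemma cnm_i : cnm ('i : R[i]) = 1.
Proof. by rewrite /cnm normc_def /= expr0n expr1n add0r sqrtr1. Qed.
Lemma cnm_Re z : `|complex.Re z| <= cnm z.
Proof. by rewrite -lecC -cnmE normc_ge_Re. Qed.
Lemma cnm_Im z : `|complex.Im z| <= cnm z.
Proof.
have := cnm_Re ('i * z); rewrite cnmM cnm_i mul1r mulrC ReiNIm normrN //.
Qed.
Lemma cnm_le z : cnm z <= `|complex.Re z| + `|complex.Im z|.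
Proof.
rewrite {1}[z]complexE; apply: le_trans (cnmD _ _) _.
by rewrite cnmM cnm_i mul1r !cnm_real.
Qed.
Lemma cnm_small z : (forall e, 0 < e -> cnm z <= e) -> z = 0.
Proof.
move=> h; apply: cnm_eq0; apply/eqP; rewrite eq_le cnm_ge0 andbT.
by apply/ler_addgt0Pl => e e0; rewrite addr0; apply: h.
Qed.
Lemma cnm_sum I (P : seq I) (Q : pred I) (F : I -> R[i]) :
  cnm (\sum_(i <- P | Q i) F i) <= \sum_(i <- P | Q i) cnm (F i).
Proof.
elim/big_rec2: _ => [|i y1 y2 _ h]; first by rewrite cnm0.
by apply: le_trans (cnmD _ _) _; rewrite lerD2l.
Qed.
Lemma ge0_Re z : 0 <= z -> z = (complex.Re z)%:C /\ 0 <= complex.Re z.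
Proof. by move=> h; rewrite RRe_real ?ger0_real //; split=> //; rewrite -ler0c RRe_real ?ger0_real. Qed.
End Cnm.

Section PosFunctional.
Variables (R : realType) (A : cstarType R) (f : A -> R[i]).
Hypotheses (lf : scalar f) (pf : forall x, pos x -> 0 <= f x).

Lemma sclD x y : f (x + y) = f x + f y.
Proof. by have := lf 1 x y; rewrite scale1r mul1r. Qed.
Lemma scl0 : f 0 = 0.
Proof. by apply: (addrI (f 0)); rewrite -sclD !addr0. Qed.
Lemma sclZ (a : R[i]) x : f (a *: x) = a * f x.
Proof. by have := lf a x 0; rewrite scl0 !addr0. Qed.
Lemma sclN x : f (- x) = - f x.
Proof. by rewrite -scaleN1r sclZ mulN1r. Qed.
Lemma sclB x y : f (x - y) = f x - f y.
Proof. by rewrite sclD sclN. Qed.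
Lemma scl_sum I (P : seq I) (Q : pred I) (F : I -> A) :
  f (\sum_(i <- P | Q i) F i) = \sum_(i <- P | Q i) f (F i).
Proof. by apply: (big_morph f sclD scl0). Qed.

Lemma pf_le x y : ple x y -> complex.Re (f x) <= complex.Re (f y).
Proof.
rewrite /ple => /pf; rewrite sclB => /ge0_Re [_]; by rewrite raddfB /= subr_ge0.
Qed.

Lemma pf_sa x : star x = x -> cnm (f x) <= nrm x * complex.Re (f 1).
Proof.
move=> sx; have h1 := pf (nrm_pos sx (lexx _)); have h2 := pf (nrm_posD sx (lexx _)).
have p1 := pf (pos1 A).
rewrite sclB sclZ in h1; rewrite sclD sclZ in h2.
have [e1 g1] := ge0_Re h1; have [e2 g2] := ge0_Re h2; have [e3 g3] := ge0_Re p1.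
have I0 : complex.Im (f x) = 0.
  move: h2; rewrite e3 -rmorphM /= lecE /= => /andP[/eqP]; case: (f x) => u v /=; lra.
apply: le_trans (cnm_le _) _; rewrite I0 normr0 addr0 ler_norml.
move: g1 g2; rewrite e3 -rmorphM /=; case: (f x) => u v /= a b; apply/andP; split; lra.
Qed.
End PosFunctional.

(** * Uniqueness of the trace *)

Section UltraLimit.
Variables (R : realType) (T : Type) (U : set_system T).
Hypothesis hU : UltraFilter U.
Let fU : ProperFilter U := @ultra_proper _ U hU.

Definition ulim (g : T -> R[i]) l := forall e : R, 0 < e -> U [set t | cnm (g t - l) <= e].

Lemma real_ulim (g : T -> R) M : (forall t, `|g t| <= M) ->
  exists l, forall e, 0 < e -> U [set t | `|g t - l| <= e].
Proof.
move=> hM.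
have pf : ProperFilter (g @ U) by apply: fmap_proper_filter.
have [|l [_ cl]] := @segment_compact R (- M) M _ pf.
  suff : U (g @^-1` `[- M, M]%classic) by [].
  by apply: filterE => t /=; rewrite in_itv /= -ler_norml; apply: hM.
exists l => e e0.
have [//|h] := in_ultra_setVsetC [set t | `|g t - l| <= e] hU.
have hA : (g @ U) [set y | e < `|y - l|].
  suff : U (g @^-1` [set y | e < `|y - l|]) by [].
  by apply: filterS h => t ht; rewrite /= ltNge; exact/negP.
have [y [/= h1 h2]] := cl _ _ hA (nbhsx_ballx l e e0).
by move: h2; rewrite -ball_normE /= distrC => h2; have := lt_trans h1 h2; rewrite ltxx.
Qed.

Lemma ulim_ex (g : T -> R[i]) M : (forall t, cnm (g t) <= M) -> exists l, ulim g l.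
Proof.
move=> hM.
have [a ha] := @real_ulim (fun t => complex.Re (g t)) M (fun t => le_trans (cnm_Re _) (hM t)).
have [b hb] := @real_ulim (fun t => complex.Im (g t)) M (fun t => le_trans (cnm_Im _) (hM t)).
exists (Complex a b) => e e0; have e2 : 0 < e / 2 by lra.
apply: filterS (filterI (ha _ e2) (hb _ e2)) => t /= [h1 h2].
apply: le_trans (cnm_le _) _; rewrite !raddfB /=; lra.
Qed.

Lemma ulim_ext g g' l : ulim g l -> (U [set t | g t = g' t]) -> ulim g' l.
Proof. by move=> h h' e /h h1; apply: filterS (filterI h1 h') => t /= [a <-]. Qed.

Lemma ulim_uniq g l l' : ulim g l -> ulim g l' -> l = l'.
Proof.
move=> h h'; apply/eqP; rewrite -subr_eq0; apply/eqP; apply: cnm_small => e e0.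
have e2 : 0 < e / 2 by lra.
have [t [/= h1 h2]] := filter_ex (filterI (h _ e2) (h' _ e2)).
have := cnmD (l - g t) (g t - l'); rewrite addrA subrK cnmB in h1 *; lra.
Qed.

Lemma ulim_lin (a : R[i]) g g' l l' : ulim g l -> ulim g' l' -> ulim (fun t => a * g t + g' t) (a * l + l').
Proof.
move=> h h' e e0; have K0 := cnm_ge0 a; have e2 : 0 < e / (cnm a + 1) / 2 by rewrite !divr_gt0 //; lra.
apply: filterS (filterI (h _ e2) (h' _ e2)) => t /= [h1 h2].
have -> : a * g t + g' t - (a * l + l') = a * (g t - l) + (g' t - l') by ring.
apply: le_trans (cnmD _ _) _; rewrite cnmM.
have h3 := ler_wpM2l K0 h1.
have : (cnm a + 1) * (e / (cnm a + 1) / 2) = e / 2 by rewrite mulrC mulrAC divfK // lt0r_neq0 //; lra.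
move: h2 h3; set q := e / _ / 2 => h2 h3 h4; lra.
Qed.

Lemma ulim_ge0 g l : ulim g l -> (forall t, 0 <= g t) -> 0 <= l.
Proof.
move=> h h0.
have I0 : complex.Im l = 0.
  apply/eqP; rewrite -normr_le0; apply/ler_addgt0Pl => e e0; rewrite addr0.
  have [t /= ht] := filter_ex (h _ e0).
  have [E _] := ge0_Re (h0 t); apply: le_trans ht; apply: le_trans (cnm_Im _).
  by rewrite raddfB /= E /= sub0r normrN.
have R0 : 0 <= complex.Re l.
  apply/ler_addgt0Pl => e e0.
  have [t /= ht] := filter_ex (h _ e0).
  have [_ E] := ge0_Re (h0 t); have := le_trans (cnm_Re _) ht; rewrite raddfB /= ler_norml => /andP[]; lra.
by rewrite lecE /= I0 eqxx R0.
Qed.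

Lemma ulim_le g l r : ulim g l -> (U [set t | cnm (g t) <= r]) -> cnm l <= r.
Proof.
move=> h h'; apply/ler_addgt0Pl => e e0.
have [t [/= h1 h2]] := filter_ex (filterI (h _ e0) h').
have := cnmD (l - g t) (g t); rewrite subrK cnmB; lra.
Qed.
End UltraLimit.

Section TraceUniqueness.
Variables (R : realType) (A : cstarType R) (tau : A -> R[i]).
Hypotheses (ht : tracial_state tau) (hu : forall t, tracial_state t -> t = tau).

(* By compactness of the state space, approximately tracial functionals are
   close to multiples of the unique trace. *)
Lemma approx_trace (x0 : A) (d : R) : 0 < d -> exists (S : seq A) (e : R), 0 < e /\
  forall f : A -> R[i], scalar f -> (forall x, pos x -> 0 <= f x) -> complex.Re (f 1) <= 1 ->
    (forall a b, a \in S -> b \in S -> cnm (f (a * b) - f (b * a)) <= e) ->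
    cnm (f x0 - tau x0 * f 1) <= d.
Proof.
move=> d0; apply: contrapT => hn.
pose bad (t : seq A * nat) (f : A -> R[i]) := [/\ scalar f, (forall x, pos x -> 0 <= f x), complex.Re (f 1) <= 1,
    (forall a b, a \in t.1 -> b \in t.1 -> cnm (f (a * b) - f (b * a)) <= t.2.+1%:R^-1) &
    d < cnm (f x0 - tau x0 * f 1)].
have /choice [f hf] : forall t, exists f, bad t f.
  move=> [S n]; apply: contrapT => hb; apply: hn; exists S, (n.+1%:R^-1); split; first by rewrite invr_gt0 ltr0n.
  move=> f h1 h2 h3 h4; rewrite leNgt; apply/negP => h5; apply: hb; exists f; by split.
(* A counterexample f t exists for each finite set and tolerance; an ultrafilter containing these
   upper sets makes the limit F tracial while keeping the gap d at x0. *)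
pose up (t : seq A * nat) := [set s : seq A * nat | {subset t.1 <= s.1} /\ (t.2 <= s.2)%N].
pose G := [set P : set (seq A * nat) | exists t, up t `<=` P].
have pG : ProperFilter G.
  split; first by move=> [t /(_ t)]; apply; split.
  split; first by exists ([::], 0%N).
    move=> P Q [t ht'] [s hs]; exists (t.1 ++ s.1, maxn t.2 s.2) => r [/= r1 r2]; split.
      apply: ht'; split; last by apply: leq_trans r2; apply: leq_maxl.
      by move=> x xt; apply: r1; rewrite mem_cat xt.
    apply: hs; split; last by apply: leq_trans r2; apply: leq_maxr.
    by move=> x xt; apply: r1; rewrite mem_cat xt orbT.
  by move=> P Q PQ [t ht']; exists t; apply: subset_trans PQ.
have [U [hU GU]] := ultraFilterLemma pG.
have fU : ProperFilter U := @ultra_proper _ U hU.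
have bnd a : exists M, forall t, cnm (f t a) <= M.
  have [b [c [sb sc ->]]] := re_im a; exists (nrm b + nrm c) => t.
  have [l1 l2 l3 _ _] := hf t; have [_ g1] := ge0_Re (l2 1 (pos1 A)).
  rewrite (sclD l1) (sclZ l1); apply: le_trans (cnmD _ _) _; rewrite cnmM cnm_i mul1r.
  have := pf_sa l1 l2 sb; have := pf_sa l1 l2 sc.
  have := nrm_ge0 b; have := nrm_ge0 c; nra.
have /choice [F hF] : forall a, exists l, ulim U (fun t => f t a) l.
  by move=> a; have [M hM] := bnd a; apply: (ulim_ex hU hM).
have lF : scalar F.
  move=> k a b; have h := ulim_lin hU k (hF a) (hF b).
  apply: (ulim_uniq hU (hF _)); apply: ulim_ext h _ => //; apply: filterE => t /=.
  by have [l1 _ _ _ _] := hf t; rewrite (sclD l1) (sclZ l1).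
have pF x : pos x -> 0 <= F x.
  by move=> px; apply: (ulim_ge0 hU (hF x)) => t; have [_ h _ _ _] := hf t; apply: h.
have tF a b : F (a * b) = F (b * a).
  apply/eqP; rewrite -subr_eq0; apply/eqP; apply: cnm_small => e e0.
  have h := ulim_lin hU (-1) (hF (b * a)) (hF (a * b)).
  rewrite addrC -mulN1r; apply: (ulim_le hU h); apply: GU.
  pose n := archimedean.Num.truncn e^-1.
  exists ([:: a; b], n) => t [/= t1 t2].
  have [_ _ _ h4 _] := hf t; rewrite mulN1r addrC; apply: le_trans (h4 _ _ _ _) _.
  - by apply: t1; rewrite !inE eqxx.
  - by apply: t1; rewrite !inE eqxx orbT.
  rewrite invf_ple ?posrE ?ltr0n //; apply: ltW; rewrite -truncn_le_nat //.
have dF : d <= cnm (F x0 - tau x0 * F 1).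
  rewrite leNgt; apply/negP => h.
  have h1 := ulim_lin hU (- tau x0) (hF 1) (hF x0).
  have e0 : 0 < (d - cnm (F x0 - tau x0 * F 1)) by lra.
  have [t /= ht'] := filter_ex (h1 _ e0); have [_ _ _ _ h5] := hf t.
  have := cnmD (- tau x0 * f t 1 + f t x0 - (- tau x0 * F 1 + F x0)) (- tau x0 * F 1 + F x0).
  rewrite subrK; have E u v : - tau x0 * u + v = v - tau x0 * u by ring.
  rewrite !E in ht' *; lra.
have [E1 c0] := ge0_Re (pF 1 (pos1 A)).
(* If F 1 = 0 then F vanishes; otherwise F / F 1 is a tracial state, hence tau. Both contradict the
   gap. *)
have [cz|cz] := eqVneq (complex.Re (F 1)) 0.
  have F0 : F x0 = 0.
    have [b [c [sb sc ->]]] := re_im x0; rewrite (sclD lF) (sclZ lF).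
    have := pf_sa lF pF sb; have := pf_sa lF pF sc; rewrite cz !mulr0 => h1 h2.
    have := cnm_ge0 (F b); have := cnm_ge0 (F c) => h3 h4.
    have -> : F b = 0 by apply: cnm_eq0; lra.
    have -> : F c = 0 by apply: cnm_eq0; lra.
    by rewrite mulr0 addr0.
  by move: dF; rewrite F0 E1 cz mulr0 subr0 cnm0; lra.
have F1 : F 1 != 0 by rewrite E1; apply/eqP => /(congr1 (fun z : R[i] => complex.Re z)) /= /eqP; rewrite (negbTE cz).
have hT : tracial_state (fun a => (F 1)^-1 * F a).
  split.
  - by move=> k a b; rewrite (sclD lF) (sclZ lF); ring.
  - move=> x /pos_eltP px; apply: mulr_ge0; last exact: pF.
    by rewrite invr_ge0; apply: pF; apply: pos1.
  - by rewrite mulVf.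
  by move=> a b; rewrite tF.
move: dF; rewrite -(hu hT) mulrAC mulVf // mul1r subrr cnm0; lra.
Qed.
End TraceUniqueness.

(** * Cuntz comparison *)

Section Cuntz.
Variables (R : realType) (D : cstarType R).
Implicit Types (a b c x y z w : D) (r s t e : R).
Local Notation "t %:I" := (t%:C *: (1 : D)) (at level 1, left associativity, format "t %:I").

(* A not necessarily closed unital *-subalgebra *)
Definition usub (E : D -> Prop) := [/\ E 1, (forall x y, E x -> E y -> E (x + y)),
  (forall (a : R[i]) x, E x -> E (a *: x)), (forall x y, E x -> E y -> E (x * y)) &
  (forall x, E x -> E (star x))].

Lemma csub_usub E : csub E -> usub E.
Proof. by case=> h1 h2 h3 h4 [h5 _]. Qed.

(* Cuntz comparison of the diagonal matrices with entries [a_i] and [b_j], by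
   rectangular matrices with entries in [E]. *)
Definition cle (E : D -> Prop) (I J : finType) (a : I -> D) (b : J -> D) :=
  forall e, 0 < e -> exists V : J -> I -> D, (forall j i, E (V j i)) /\
    forall i i', nrm (\sum_j star (V j i) * b j * V j i' - (if i == i' then a i else 0)) <= e.

Section Sub.
Variable E : D -> Prop.
Hypothesis hE : usub E.

Lemma usub1 : E 1. Proof. by case: hE. Qed.
Lemma usubD x y : E x -> E y -> E (x + y). Proof. by case: hE => _ h _ _ _; apply: h. Qed.
Lemma usubZ (a : R[i]) x : E x -> E (a *: x). Proof. by case: hE => _ _ h _ _; apply: h. Qed.
Lemma usubM x y : E x -> E y -> E (x * y). Proof. by case: hE => _ _ _ h _; apply: h. Qed.
Lemma usubS x : E x -> E (star x). Proof. by case: hE => _ _ _ _ h; apply: h. Qed.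
Lemma usub0 : E 0. Proof. by rewrite -(scale0r (1 : D)); apply: usubZ; apply: usub1. Qed.
Lemma usub_sum I (P : seq I) (Q : pred I) (F : I -> D) :
  (forall i, E (F i)) -> E (\sum_(i <- P | Q i) F i).
Proof. by move=> h; apply: big_ind => //; [exact: usub0|exact: usubD]. Qed.

Lemma cle_exact (I J : finType) (a : I -> D) (b : J -> D) (V : J -> I -> D) :
  (forall j i, E (V j i)) ->
  (forall i i', \sum_j star (V j i) * b j * V j i' = if i == i' then a i else 0) -> cle E a b.
Proof. by move=> hV h e e0; exists V; split => // i i'; rewrite h subrr nrm0 ltW. Qed.

Lemma cle_trans (I J K : finType) (a : I -> D) (b : J -> D) (c : K -> D) :
  cle E a b -> cle E b c -> cle E a c.
Proof.
move=> h1 h2 e e0; have e2 : 0 < e / 2 by lra.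
have [V [EV hV]] := h1 _ e2.
pose M := \sum_j \sum_i nrm (V j i).
have M0 : 0 <= M by apply: sumr_ge0 => j _; apply: sumr_ge0 => i _; apply: nrm_ge0.
have VM j i : nrm (V j i) <= M.
  rewrite /M (bigD1 j) //= (bigD1 i) //= -addrA lerDl addr_ge0 //; apply: sumr_ge0 => *;
    rewrite ?nrm_ge0 //; apply: sumr_ge0 => *; exact: nrm_ge0.
pose N := #|J|%:R * (#|J|%:R * (M * M)) + 1 : R.
have N0 : 0 < N by rewrite ltr_wpDl // !mulr_ge0.
have [W [EW hW]] := h2 (e / 2 / N) (divr_gt0 e2 N0).
exists (fun k i => \sum_j W k j * V j i); split.
  by move=> k i; apply: usub_sum => j; apply: usubM.
move=> i i'.
have -> : \sum_k star (\sum_j W k j * V j i) * c k * (\sum_j W k j * V j i') =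
  \sum_j \sum_j' star (V j i) * (\sum_k star (W k j) * c k * W k j') * V j' i'.
  transitivity (\sum_k \sum_j \sum_j' star (V j i) * (star (W k j) * c k * W k j') * V j' i').
    apply: eq_bigr => k _; rewrite star_sum !mulr_suml; apply: eq_bigr => j _.
    by rewrite mulr_sumr; apply: eq_bigr => j' _; rewrite starMr !mulrA.
  rewrite exchange_big; apply: eq_bigr => j _ /=; rewrite exchange_big; apply: eq_bigr => j' _ /=.
  by rewrite mulr_sumr mulr_suml.
pose d j j' := \sum_k star (W k j) * c k * W k j' - (if j == j' then b j else 0).
have -> : \sum_j \sum_j' star (V j i) * (\sum_k star (W k j) * c k * W k j') * V j' i' =
  \sum_j \sum_j' star (V j i) * d j j' * V j' i' + \sum_j star (V j i) * b j * V j i'.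
  rewrite -big_split; apply: eq_bigr => j _ /=.
  have -> : star (V j i) * b j * V j i' = \sum_j' star (V j i) * (if j == j' then b j else 0) * V j' i'.
    rewrite (bigD1 j) //= eqxx big1 ?addr0 // => j' /negbTE; rewrite eq_sym => ->.
    by rewrite mulr0 mul0r.
  by rewrite -big_split; apply: eq_bigr => j' _ /=; rewrite -mulrDl -mulrDr /d subrK.
rewrite -addrA; apply: le_trans (nrmD _ _) _.
have -> : e = e / 2 + e / 2 by lra.
apply: lerD; last exact: hV.
have d0 : 0 <= e / 2 / N by rewrite ltW // divr_gt0.
apply: (@le_trans _ _ (#|J|%:R * (#|J|%:R * (M * (e / 2 / N) * M)))).
  apply: nrm_sum_const => j; apply: nrm_sum_const => j'.
  by apply: nrmM_le => //; apply: nrmM_le; rewrite ?nrm_star //; apply: hW.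
have -> : #|J|%:R * (#|J|%:R * (M * (e / 2 / N) * M)) = (N - 1) * (e / 2 / N) by rewrite /N; ring.
have : N * (e / 2 / N) = e / 2 by rewrite mulrC divfK // lt0r_neq0.
lra.
Qed.

Lemma cle_inj (I J : finType) (a : I -> D) (b : J -> D) (f : I -> J) : injective f ->
  (forall i, exists V, E V /\ star V * b (f i) * V = a i) -> cle E a b.
Proof.
move=> fi /choice [V hV].
apply: (@cle_exact _ _ _ _ (fun j i => if j == f i then V i else 0)).
  by move=> j i; case: eqP => _; [case: (hV i)|exact: usub0].
move=> i i'; rewrite (bigD1 (f i)) //= eqxx (inj_eq fi) big1 ?addr0.
  by case: eqP => [<-|_]; [case: (hV i)|rewrite mulr0].
by move=> j /negbTE ->; rewrite star0 !mul0r.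
Qed.

Lemma cle_sub (I J : finType) (a : I -> D) (b : J -> D) (f : I -> J) : injective f ->
  (forall i, a i = b (f i)) -> cle E a b.
Proof.
move=> fi h; apply: (cle_inj fi) => i; exists 1; split; first exact: usub1.
by rewrite star1 mul1r mulr1 h.
Qed.

Lemma cle_inj_approx (I J : finType) (a : I -> D) (b : J -> D) (f : I -> J) : injective f ->
  (forall i, cle E (fun _ : unit => a i) (fun _ : unit => b (f i))) -> cle E a b.
Proof.
move=> fi h e e0.
have /choice [V hV] : forall i, exists V, E V /\ nrm (star V * b (f i) * V - a i) <= e.
  move=> i; have [V [EV hV]] := h i _ e0; exists (V tt tt); split => //.
  by have := hV tt tt; rewrite eqxx (big_pred1 tt) //; case.
exists (fun j i => if j == f i then V i else 0); split.
  by move=> j i; case: eqP => _; [case: (hV i)|exact: usub0].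
move=> i i'; rewrite (bigD1 (f i)) //= eqxx (inj_eq fi) big1 ?addr0; last first.
  by move=> j /negbTE ->; rewrite star0 !mul0r.
case: eqP => [<-|_]; first by case: (hV i).
by rewrite mulr0 subrr nrm0 ltW.
Qed.

Lemma cle_sum (K : finType) (I J : finType) (a : K -> I -> D) (b : K -> J -> D) :
  (forall k, cle E (a k) (b k)) ->
  cle E (fun u : K * I => a u.1 u.2) (fun u : K * J => b u.1 u.2).
Proof.
move=> h e e0.
have /choice [V hV] : forall k, exists V : J -> I -> D, (forall j i, E (V j i)) /\
    forall i i', nrm (\sum_j star (V j i) * b k j * V j i' - (if i == i' then a k i else 0)) <= e.
  by move=> k; apply: h.
exists (fun u v => if u.1 == v.1 then V u.1 u.2 v.2 else 0); split.
  by move=> u v; case: eqP => _; [case: (hV u.1)|exact: usub0].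
move=> [k i] [k' i'] /=.
rewrite -(pair_bigA _ (fun l j => star (if l == k then V l j i else 0) * b l j * (if l == k' then V l j i' else 0))) /=.
rewrite (bigD1 k) //= eqxx [\sum_(l | l != k) _]big1 ?addr0; last first.
  by move=> l /negbTE ->; apply: big1 => j _; rewrite star0 !mul0r.
have [<-|kk] := eqVneq k k'; rewrite xpair_eqE ?eqxx ?(negbTE kk) /=; first by case: (hV k) => _; apply.
by rewrite big1 ?subrr ?nrm0 ?ltW // => j _; rewrite mulr0.
Qed.

Lemma cle_sum2 (I J I' J' : finType) (a : I -> D) (b : J -> D) (a' : I' -> D) (b' : J' -> D) :
  cle E a b -> cle E a' b' ->
  cle E (fun u : I + I' => match u with inl i => a i | inr i => a' i end)
        (fun u : J + J' => match u with inl i => b i | inr i => b' i end).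
Proof.
move=> h h' e e0; have [V [EV hV]] := h _ e0; have [W [EW hW]] := h' _ e0.
exists (fun u v => match u, v with inl j, inl i => V j i | inr j, inr i => W j i | _, _ => 0 end).
split; first by move=> [j|j] [i|i] //; exact: usub0.
move=> [i|i] [i'|i'] /=; rewrite big_sumType /=.
- have -> : \sum_j star 0 * b' j * 0 = 0 by apply: big1 => j _; rewrite star0 !mul0r.
  by rewrite addr0; exact: hV.
- rewrite !big1 ?addr0 ?subr0 ?nrm0 ?ltW // => j _; by rewrite ?mulr0 ?star0 ?mul0r.
- rewrite !big1 ?addr0 ?subr0 ?nrm0 ?ltW // => j _; by rewrite ?mulr0 ?star0 ?mul0r.
rewrite big1 ?add0r; last by move=> j _; rewrite star0 !mul0r.
exact: hW.
Qed.

End Sub.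

Lemma cle_mono (E E' : D -> Prop) (I J : finType) (a : I -> D) (b : J -> D) :
  (forall x, E x -> E' x) -> cle E a b -> cle E' a b.
Proof. by move=> h hc e /hc [V [EV hV]]; exists V; split => // j i; apply: h. Qed.
End Cuntz.

Section Cut.
Variables (R : realType) (A : cstarType R).
Implicit Types (a b c g h u x y z w : A) (r s t e : R).
Local Notation "t %:I" := (t%:C *: (1 : A)) (at level 1, left associativity, format "t %:I").

(* The positive part of [g - e]. *)
Definition cut e g := 2^-1 *^ (rsqrt ((g - e%:I) * (g - e%:I)) + (g - e%:I)).

Lemma cut_nrm e g : 0 <= e <= 1 -> pos g -> nrm g <= 1 -> nrm (g - e%:I) <= 1.
Proof.
move=> /andP[e0 e1] pg ng; apply: sa_le_nrm => //.
- by rewrite starB starZr star1 (pos_sa pg).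
- have -> : 1%:I - (g - e%:I) = (1%:I - g) + e%:I by ncring.
  by apply: posD; [apply: nrm_pos => //; apply: pos_sa|apply: pos_rc].
have -> : 1%:I + (g - e%:I) = g + (1 - e)%:I by rewrite -rcB; ncring.
by apply: posD => //; apply: pos_rc; rewrite subr_ge0.
Qed.

(** All clauses come from [abs_dec] for g - e: its positive part u is orthogonal to the negative
    part n, so u (g - e) = u^2, and e + u - g = n. *)
Lemma cutP e g : 0 <= e <= 1 -> pos g -> nrm g <= 1 ->
  [/\ pos (cut e g), cut e g * g = g * cut e g, cut e g * (g - e%:I) = cut e g * cut e g,
     ple g (e%:I + cut e g) & nrm (cut e g) <= 1].
Proof.
move=> he pg ng; have nh := cut_nrm he pg ng.
have sh : star (g - e%:I) = g - e%:I by rewrite starB starZr star1 (pos_sa pg).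
set h := g - e%:I in nh sh.
have nr : nrm (1 - h * h) <= 1.
  by have := @pos_sqr_nrm _ _ h 1 sh ler01 nh; rewrite expr1n rc1.
have pb : pos (rsqrt (h * h)).
  split; first by apply: rsqrt_sa; rewrite // starMr sh.
  by exists 1; rewrite // rc1; apply: rsqrt_nrm.
have hb : h * rsqrt (h * h) = rsqrt (h * h) * h by apply: rsqrt_inter; rewrite // mulrA.
have [p1 p2 p3 p4 p5] := abs_dec sh pb (rsqrtK nr) hb.
rewrite -/(cut e g) in p1 p3 p4 p5; set u := cut e g in p1 p3 p4 p5 *; set n := 2^-1 *^ _ in p2 p3 p4 p5.
have uh : u * h = u * u by rewrite p3 mulrBr p4 subr0.
have hu : h * u = u * u by rewrite p3 mulrBl p5 subr0.
split => //.
- have -> : g = h + e%:I by rewrite /h subrK.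
  by rewrite (mulrDr u h) (mulrDl h _ u) uh hu; ncring.
- have -> : g = h + e%:I by rewrite /h subrK.
  rewrite /ple {1}p3; have -> : e%:I + u - (u - n + e%:I) = n by ncring.
  exact: p2.
have [//|u1] := leP (nrm u) 1.
have : nrm (u * u) <= nrm u * 1 by rewrite -uh; apply: nrmM_le.
rewrite nrm_sa ?(pos_sa p1) // mulr1 expr2.
have u0 : 0 < nrm u by apply: lt_trans u1.
by rewrite -{3}[nrm u]mulr1 ler_pM2l // leNgt u1.
Qed.

Lemma cut_inter e g g' z : 0 <= e <= 1 -> pos g -> nrm g <= 1 -> pos g' -> nrm g' <= 1 ->
  z * g = g' * z -> z * cut e g = cut e g' * z.
Proof.
move=> he pg ng pg' ng' zg.
have zh : z * (g - e%:I) = (g' - e%:I) * z by rewrite mulrBr mulrBl zg; ncring.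
have nr x : pos x -> nrm x <= 1 -> nrm (1 - (x - e%:I) * (x - e%:I)) <= 1.
  move=> px nx; have := @pos_sqr_nrm _ _ (x - e%:I) 1 _ ler01 (cut_nrm he px nx); rewrite expr1n rc1; apply.
  by rewrite starB starZr star1 (pos_sa px).
have := nr _ pg ng; have := nr _ pg' ng'; rewrite /cut; move: (g - e%:I) (g' - e%:I) zh => H H' zh n1 n2.
rewrite mulZr mulZl; congr (_ *: _); rewrite mulrDr mulrDl zh; congr (_ + _).
by apply: rsqrt_inter => //; rewrite mulrA zh -mulrA zh mulrA.
Qed.

Lemma cut_csub E e g : csub E -> 0 <= e <= 1 -> pos g -> nrm g <= 1 -> E g -> E (cut e g).
Proof.
move=> hE he pg ng Eg.
have Eh : E (g - e%:I) by apply: csubB => //; apply: csubZ => //; apply: csub1.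
apply: csubZ => //; apply: csubD => //; apply: rsqrt_csub => //; last exact: csubM.
have := @pos_sqr_nrm _ _ (g - e%:I) 1 _ ler01 (cut_nrm he pg ng); rewrite expr1n rc1; apply.
by rewrite starB starZr star1 (pos_sa pg).
Qed.

(** Multiplying u (g - e) = u^2 by z gives u^2 z = - e u z. Both u^2 z and u z are positive, so u z
    = 0. *)
Lemma cut_orth e g z : 0 < e <= 1 -> pos g -> nrm g <= 1 -> pos z -> z * g = 0 -> g * z = 0 ->
  z * cut e g = 0 /\ cut e g * z = 0.
Proof.
move=> /andP[e0 e1] pg ng pz zg gz.
have he : 0 <= e <= 1 by rewrite ltW.
have [pu ug uu _ _] := cutP he pg ng; set u := cut e g in pu ug uu *.
have zu : z * u = u * z by apply: cut_inter => //; rewrite zg gz.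
suff h : u * z = 0 by rewrite zu.
have p1 : pos (u * z) by apply: pos_mulC.
have p2 : pos (u * u * z).
  by apply: pos_mulC => //; [apply: pos_sqr; apply: pos_sa|rewrite -mulrA -zu mulrA -zu mulrA].
have E : u * u * z = - (e *^ (u * z)).
  by rewrite -uu mulrBr mulrBl -mulrA gz mulr0 sub0r mulZr mulr1 mulZl.
have e3 : e *^ (u * z) = 0 by apply: pos_anti; [apply: posZ => //; exact: ltW|rewrite -E].
by move/eqP: e3; rewrite scaler_eq0 => /orP[/eqP/complexI e00|/eqP //]; move: e0; rewrite e00 ltxx.
Qed.
End Cut.

Section CuntzTools.
Variables (R : realType) (A : cstarType R).
Implicit Types (a b c g h u x y z w : A) (r s t e K : R).
Local Notation "t %:I" := (t%:C *: (1 : A)) (at level 1, left associativity, format "t %:I").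

Definition allA (x : A) := True.
Lemma usub_all : usub allA. Proof. by []. Qed.

Definition cle1 a b := cle allA (fun _ : unit => a) (fun _ : unit => b).

Lemma cle1I a b : (forall e, 0 < e -> exists V, nrm (star V * b * V - a) <= e) -> cle1 a b.
Proof.
move=> h e /h [V hV]; exists (fun _ _ => V); split => // -[] [].
by rewrite eqxx (big_pred1 tt) //; case.
Qed.

Lemma cle1_conj a V : cle1 (star V * a * V) a.
Proof. by apply: cle1I => e e0; exists V; rewrite subrr nrm0 ltW. Qed.

Lemma cle1_conj_sa a V : star V = V -> cle1 (V * a * V) a.
Proof. by move=> sV; rewrite -{1}sV; apply: cle1_conj. Qed.

Lemma cle1_trans a b c : cle1 a b -> cle1 b c -> cle1 a c.
Proof. exact: (cle_trans usub_all). Qed.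

(* If b <= e + K c for every e > 0 and suitable K, then
   w = (K c + e)^(-1/2) b^(1/2) satisfies w^* (K c + e) w = b. *)
Lemma cle1_dom b c : pos b -> pos c -> (forall e, 0 < e -> exists K, 0 <= K /\ ple b (e%:I + K *^ c)) ->
  cle1 b c.
Proof.
move=> pb pc h; apply: cle1I => e e0; have [K [K0 hK]] := h _ e0.
have [b' [pb' bb' _ _]] := pos_sqrt pb.
have [|k [k1 k2 k3 _]] := @invsqrt _ _ (e%:I + K *^ c) _ e0.
  by rewrite /ple addrAC subrr add0r; apply: posZ.
set M := e%:I + K *^ c in hK k1 k3.
have kM : k * M = M * k by rewrite k3.
have Mkk : M * k * k = 1 by rewrite -kM k1.
have kkM : k * k * M = 1 by rewrite -mulrA kM mulrA k1.
pose w := k * b'.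
have sw : star w = b' * k by rewrite /w starMr (pos_sa k2) (pos_sa pb').
have wMw : star w * M * w = b.
  rewrite sw /w; have -> : b' * k * M * (k * b') = b' * (k * M * k) * b' by ncring.
  by rewrite k1 mulr1.
exists (Num.sqrt K *^ w).
have -> : star (Num.sqrt K *^ w) * c * (Num.sqrt K *^ w) - b = - (e *^ (star w * w)).
  rewrite starZr !mulZl mulZr rcM -expr2 sqr_sqrtr // -wMw /M mulrDr mulrDl.
  by rewrite !mulZr !mulZl mulr1 opprD addrCA subrr addr0.
rewrite nrmN nrmZ0 ?(ltW e0) // ler_piMr ?(ltW e0) // nrm_cs expr_le1 ?nrm_ge0 //.
rewrite -nrm_star -(@expr_le1 _ 2) ?nrm_ge0 // -nrm_cs starK.
have -> : w * star w = k * b * k by rewrite sw /w -bb' !mulrA.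
apply: ple_nrm_rc => //; first by apply: pos_conj_sa => //; apply: pos_sa.
rewrite rc1 -k1; apply: ple_conj_sa => //; exact: pos_sa.
Qed.

Lemma cle1_ple b c : pos b -> ple b c -> cle1 b c.
Proof.
move=> pb bc; apply: cle1_dom => //; first exact: ple_pos bc.
move=> e e0; exists 1; split=> //; rewrite rc1; apply: ple_trans bc _.
by rewrite /ple addrK; apply: pos_rc; rewrite ltW.
Qed.

Lemma cle1_pleZ b c K : 0 <= K -> pos b -> pos c -> ple b (K *^ c) -> cle1 b c.
Proof.
move=> K0 pb pc bc; apply: cle1_dom => // e e0; exists K; split => //.
by apply: ple_trans bc _; rewrite /ple addrK; apply: pos_rc; rewrite ltW.
Qed.

(** From (a - 2 e)^2 >= 0 one gets a <= e + a^2 / (4 e), and [cle1_dom] applies. *)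
Lemma cle1_sq a : pos a -> cle1 a (a * a).
Proof.
move=> pa; have sa := pos_sa pa; apply: cle1_dom => //; first exact: pos_sqr.
move=> e e0; exists (e^-1 / 4); split; first by rewrite divr_ge0 // invr_ge0 ltW.
have -> : ple a (e%:I + (e^-1 / 4) *^ (a * a)) = pos ((e^-1 / 4) *^ ((a - (2 * e)%:I) * (a - (2 * e)%:I))).
  rewrite /ple; congr (pos _).
  have -> : (a - (2 * e)%:I) * (a - (2 * e)%:I) = a * a - (2 * e) *^ a - (2 * e) *^ a + (2 * e) *^ ((2 * e)%:I) by ncring.
  rewrite !rcM !(scalerDr, scalerBr) !rcM.
  rewrite !scalerN !rcM.
  have -> : e^-1 / 4 * (2 * e) = 2^-1 by field; rewrite lt0r_neq0.
  have -> : e^-1 / 4 * (2 * e * (2 * e)) = e by field; rewrite lt0r_neq0.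
  have ha : 2^-1 *^ a + 2^-1 *^ a = a by rewrite rcD (_ : 2^-1 + 2^-1 = 1) ?rc1 //; lra.
  rewrite -[X in _ - X = _]ha; ncring.
apply: posZ; first by rewrite divr_ge0 // invr_ge0 ltW.
by apply: pos_sqr; rewrite starB starZr star1 sa.
Qed.

Lemma cle1_pow4 a : pos a -> cle1 a (a * a * (a * a)).
Proof.
move=> pa; apply: cle1_trans (cle1_sq pa) _; apply: cle1_sq; apply: pos_sqr; exact: pos_sa.
Qed.

(** Fourth powers suffice: a^4 = k a^3 k for the root k of a. In the same way a^6 = k a^5 k yields
    the fifth power. *)
Lemma cle1_cube a : pos a -> cle1 a (a * a * a).
Proof.
move=> pa; apply: cle1_trans (cle1_pow4 pa) _.
have [k [pk kk kc _]] := pos_sqrt pa.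
have ka : a * k = k * a by apply: kc.
have -> : a * a * (a * a) = k * (a * a * a) * k.
  by rewrite -{4}kk !mulrA -ka -(mulrA a k) -ka !mulrA -(mulrA _ k a) -ka !mulrA.
apply: cle1_conj_sa; exact: pos_sa.
Qed.

Lemma cle1_pow5 a : pos a -> cle1 a (a * a * a * a * a).
Proof.
move=> pa; have sa := pos_sa pa.
have p3 : pos (a * a * a) by apply: pos_conj_sa.
apply: cle1_trans (cle1_cube pa) _; apply: cle1_trans (cle1_sq p3) _.
have [k [pk kk kc _]] := pos_sqrt pa.
have ka : a * k = k * a by apply: kc.
have -> : a * a * a * (a * a * a) = k * (a * a * a * a * a) * k.
  have E w : a * w = w * a -> w * k = k * w by move=> h; symmetry; rewrite -kc.
  have -> : k * (a * a * a * a * a) = (a * a * a * a * a) * k.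
    by rewrite !mulrA -ka; do !rewrite -(mulrA _ k a) -ka !mulrA.
  by rewrite -[_ * k * k]mulrA kk !mulrA.
apply: cle1_conj_sa; exact: pos_sa.
Qed.
End CuntzTools.

Section OrthFamilies.
Variables (R : realType) (A : cstarType R).
Implicit Types (a b c g h u x y z w : A) (r s t e K : R).
Local Notation "t %:I" := (t%:C *: (1 : A)) (at level 1, left associativity, format "t %:I").
Variables (I : finType) (g : I -> A).
Hypotheses (pg : forall i, pos (g i)) (og : forall i j, i != j -> g i * g j = 0).

Lemma orth_mul i (f : I -> A) : (forall j, j != i -> g i * f j = 0) -> g i * (\sum_j f j) = g i * f i.
Proof.
by move=> h; rewrite mulr_sumr (bigD1 i) //= big1 ?addr0.
Qed.

(** With the row V_i = g_i the entries g_i b g_i' are g_i^3 on the diagonal and 0 elsewhere, where b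
    is the sum. *)
Lemma orth_cle : cle (@allA _ A) g (fun _ : unit => \sum_i g i).
Proof.
apply: (cle_trans (@usub_all _ _)) (cle_exact (V := fun _ i => g i) _ _) => //; first last.
  move=> i i'; rewrite (big_pred1 tt); last by case.
  rewrite (pos_sa (pg i)) -mulrA mulr_suml.
  have -> : \sum_j g j * g i' = g i' * g i'.
    by rewrite (bigD1 i') //= big1 ?addr0 // => j ji; apply: og.
  have [<-|ii] := eqVneq i i'; last by rewrite mulrA og // mul0r.
  reflexivity.
apply: (@cle_inj_approx _ _ _ (@usub_all _ _) _ _ _ _ id) => // i.
rewrite mulrA; exact: cle1_cube.
Qed.

Lemma orth_nrm e : 0 <= e -> (forall i, nrm (g i) <= e) -> ple (\sum_i g i) e%:I.
Proof.
move=> e0 he; set b := \sum_i g i.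
have pb : pos b by apply: pos_sum.
have bb : ple (b * b) (e *^ b).
  have -> : b * b = \sum_i g i * g i.
    rewrite {1}/b mulr_suml; apply: eq_bigr => i _; rewrite /b (orth_mul (f := g)) // => j ji.
    by apply: og; rewrite eq_sym.
  rewrite /b scaler_sumr; apply: ple_sum => i _.
  have [k [pk kk kc _]] := pos_sqrt (pg i).
  have gk : g i * k = k * g i by apply: kc.
  have sk := pos_sa pk.
  have -> : g i * g i = star k * g i * k by rewrite sk -gk -mulrA kk.
  have -> : e *^ g i = star k * e%:I * k by rewrite sk mulZr mulZl mulr1 kk.
  by apply: ple_conj; apply: sa_ple => //; apply: pos_sa.
have : nrm b <= e.
  have := ple_nrm (pos_sqr (pos_sa pb)) bb; rewrite nrm_sa ?(pos_sa pb) // nrmZ0 // expr2.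
  have := nrm_ge0 b; rewrite le_eqVlt => /orP[/eqP <- //|b0]; by rewrite ler_pM2r.
by move=> h; apply: sa_ple => //; apply: pos_sa.
Qed.

Hypothesis ng : forall i, nrm (g i) <= 1.

Lemma cut_cut_orth e i j : 0 < e <= 1 -> i != j ->
  [/\ cut e (g i) * g j = 0, g j * cut e (g i) = 0 & cut e (g i) * cut e (g j) = 0].
Proof.
move=> he ij.
have he' : 0 <= e <= 1 by case/andP: he => /ltW -> ->.
have ji : j != i by rewrite eq_sym.
have [h1 h2] := @cut_orth _ _ e (g i) (g j) he (pg i) (ng i) (pg j) (og ji) (og ij).
have [pu _ _ _ _] := cutP he' (pg i) (ng i).
have [h3 _] := @cut_orth _ _ e (g j) _ he (pg j) (ng j) pu h2 h1; by split.

Qed.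

(** Let u_i be the cuts and b their sum. Then b (sum g_i - e) b = b^3, so b^3 <= K b x b, which is
    below x; and the row u_i turns b^3 into the diagonal matrix of the u_i^5. *)
Lemma cut_cle e K x : 0 < e <= 1 -> 0 <= K -> pos x -> ple (\sum_i g i) (e%:I + K *^ x) ->
  cle (@allA _ A) (fun i => cut e (g i)) (fun _ : unit => x).
Proof.
move=> he K0 px hx.
have he' : 0 <= e <= 1 by case/andP: he => /ltW -> ->.
pose u i := cut e (g i).
have U i := cutP he' (pg i) (ng i).
have pu i : pos (u i) by case: (U i).
have uu i : u i * (g i - e%:I) = u i * u i by case: (U i).
have ug i j : i != j -> u i * g j = 0 by move=> /(cut_cut_orth he) [].
have ou i j : i != j -> u i * u j = 0 by move=> /(cut_cut_orth he) [].
pose b := \sum_i u i.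
have pb : pos b by apply: pos_sum.
have bu i : b * u i = u i * u i.
  by rewrite /b mulr_suml (bigD1 i) //= big1 ?addr0 // => j ji; apply: ou.
have bgb : b * (\sum_i g i - e%:I) * b = b * b * b.
  have -> : b * (\sum_i g i - e%:I) = b * b.
    rewrite mulrBr mulr_sumr.
    have -> : \sum_i b * g i = \sum_i u i * g i.
      apply: eq_bigr => i _; rewrite /b mulr_suml (bigD1 i) //= big1 ?addr0 // => j ji; exact: ug.
    have -> : b * e%:I = \sum_i u i * e%:I by rewrite /b mulr_suml.
    rewrite -sumrB {2}/b mulr_sumr; apply: eq_bigr => i _.
    by rewrite -mulrBr uu bu.
  by [].
have h1 : cle1 (b * b * b) x.
  apply: (@cle1_trans _ _ _ (b * x * b)); last by apply: cle1_conj_sa; apply: pos_sa.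
  apply: (@cle1_pleZ _ _ _ _ K) => //.
  - by apply: pos_conj_sa => //; apply: pos_sa.
  - by apply: pos_conj_sa => //; apply: pos_sa.
  rewrite -bgb; have -> : K *^ (b * x * b) = b * (K *^ x) * b by rewrite mulZr mulZl.
  apply: ple_conj_sa; first exact: pos_sa.
  rewrite /ple.
  by move: hx; rewrite /ple; have -> : e%:I + K *^ x - \sum_i g i = K *^ x - (\sum_i g i - e%:I) by ncring.
apply: (cle_trans (@usub_all _ _)) h1.
have ub i : u i * b = u i * u i.
  by rewrite /b mulr_sumr (bigD1 i) //= big1 ?addr0 // => j ji; apply: ou; rewrite eq_sym.
apply: (@cle_trans _ _ _ (@usub_all _ _) _ _ _ _ (fun i => u i * u i * u i * u i * u i)); last first.
  apply: (cle_exact (V := fun _ i => u i)) => // i i'; rewrite (big_pred1 tt); last by case.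
  rewrite (pos_sa (pu i)).
  have -> : u i * (b * b * b) * u i' = u i * b * b * (b * u i') by rewrite !mulrA.
  rewrite ub -(mulrA (u i)) ub bu; have [<-|ii] := eqVneq i i'; first by rewrite !mulrA.
  by rewrite -!mulrA (mulrA (u i) (u i') (u i')) ou // mul0r !mulr0.
apply: (@cle_inj_approx _ _ _ (@usub_all _ _) _ _ _ _ id) => // i.
exact: cle1_pow5.
Qed.
End OrthFamilies.

(** * Finite nuclear dimension, one colour at a time *)

Section NuclearSystem.
Variables (R : realType) (A : cstarType R).

Lemma star_hom_lin (B C : cstarType R) (f : B -> C) : star_hom f -> linear f.
Proof. by case. Qed.

(** By uniqueness of the decomposition the coordinates [pr] of the direct sum are unital
    *-homomorphisms, so every colour gets its own completely positive map. *)
Lemma nuc_system m (S : set A) (e : R) : nuclear_dimension_le A m -> finite_set S -> 0 < e ->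
  exists (G : 'I_m.+1 -> cstarType R) (psi : forall l, A -> G l) (phi : forall l, G l -> A),
  [/\ forall l, finite_dimensional [set: G l],
      forall l, completely_positive (psi l) /\ ple (psi l 1) 1,
      forall l, cpc_order_zero (phi l)
    & forall a, S a -> nrm (\sum_l phi l (psi l a) - a) <= e].
Proof.
move=> hm fS e0; have [F [G [i [psi [phi [fdF [hi io iu] [cpsi npsi] [cphi ozphi] happ]]]]]] := hm S e fS e0.
have /choice [pr hpr] : forall z : F, exists x : (forall l, G l), z = \sum_l i l (x l).
  by move=> z; have [x [hx _]] := iu z; exists x.
have uniq (x y : forall l, G l) : \sum_l i l (x l) = \sum_l i l (y l) -> forall l, x l = y l.
  by move=> h l; have [t [_ ht]] := iu (\sum_l i l (x l)); rewrite -(ht x) // -(ht y).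
have li l := star_hom_lin (hi l).
have prE z (x : forall l, G l) : z = \sum_l i l (x l) -> forall l, pr z l = x l.
  by move=> h; apply: uniq; rewrite -hpr.
have prD x y l : pr (x + y) l = pr x l + pr y l.
  apply: (prE _ (fun l => pr x l + pr y l)).
  by rewrite {1}(hpr x) {1}(hpr y) -big_split; apply: eq_bigr => k _; rewrite (linD (li k)).
have prZ a x l : pr (a *: x) l = a *: pr x l.
  apply: (prE _ (fun l => a *: pr x l)).
  by rewrite {1}(hpr x) scaler_sumr; apply: eq_bigr => k _; rewrite (linZ (li k)).
have prM x y l : pr (x * y) l = pr x l * pr y l.
  apply: (prE _ (fun l => pr x l * pr y l)).
  rewrite {1}(hpr x) {1}(hpr y) mulr_suml; apply: eq_bigr => k _.
  rewrite mulr_sumr (bigD1 k) //= big1 ?addr0; first by case: (hi k) => _ ->.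
  by move=> j /eqP jk; apply: io => e1; apply: jk.
have prS x l : pr (star x) l = star (pr x l).
  apply: (prE _ (fun l => star (pr x l))).
  by rewrite {1}(hpr x) star_sum; apply: eq_bigr => k _; case: (hi k) => _ _ ->.
have pri l (x : G l) : pr (i l x) l = x.
  pose fx : forall k, G k := @eqtype.dfwith _ _ (fun k => 0) l x.
  rewrite (prE _ fx); first by rewrite /fx eqtype.dfwith_in.
  rewrite (bigD1 l) //= /fx eqtype.dfwith_in big1 ?addr0 // => k kl.
  by rewrite eqtype.dfwith_out 1?eq_sym // (lin0 (li k)).
have lpr l : linear (fun z => pr z l) by move=> a x y; rewrite prD prZ.
have pr1 l : pr 1 l = 1.
  have h (x : G l) : pr 1 l * x = x by rewrite -[in LHS](pri l x) -prM mul1r pri.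
  by rewrite -[LHS]mulr1 h.
exists G, (fun l a => pr (psi a) l), (fun l => phi \o i l); split.
- move=> l; have [n [b hb]] := fdF; exists n, (fun j => pr (b j) l) => x _.
  have [c hc] := hb (i l x) I; exists c.
  rewrite -{1}(pri l x) hc (lin_sum (lpr l)); apply: eq_bigr => j _; exact: prZ.
- move=> l; split.
    split; first by move=> a x y; rewrite (proj1 cpsi) prD prZ.
    move=> n X /(proj2 cpsi n) [Y hY]; exists (map_mx (fun z => pr z l) Y).
    apply/matrixP => s t; move/matrixP: hY => /(_ s t); rewrite !mxE => ->.
    rewrite (lin_sum (lpr l)); apply: eq_bigr => j _; by rewrite !mxE prM prS.
  have h1 : pos (1 - psi 1).
    have := @nrm_pos _ _ (psi 1) 1; rewrite rc1; apply.
      by rewrite -(cp_star cpsi) star1.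
    by rewrite -lecC -nrmE; apply: le_trans (npsi 1) _; rewrite nrmE lecC; apply: nrm1.
  have [y hy] := (proj2 (pos_eltP _)) h1.
  rewrite /ple -(pr1 l) -(linB (lpr l)) hy prM prS; exact: pos_cs.
- exact: ozphi.
move=> a Sa; have := happ a Sa; rewrite nrm_lt => /ltW.
by rewrite {1}(hpr (psi a)) (lin_sum (proj1 cphi)).
Qed.
End NuclearSystem.

Section OrderZeroFD.
Variables (R : realType) (G A : cstarType R) (phi : G -> A).
Hypotheses (fdG : finite_dimensional [set: G]) (hphi : cpc_order_zero phi).
Implicit Types (x y q r v : G).
Local Notation h := (phi 1).
Local Notation "t %:I" := (t%:C *: (1 : A)) (at level 1, left associativity, format "t %:I").
Let cphi : completely_positive phi := proj1 (proj1 hphi).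
Let lphi : linear phi := proj1 cphi.

(** An induction principle: diagonalising real and imaginary parts shows that projections span a
    finite-dimensional algebra. *)
Lemma fd_proj_span (P : G -> Prop) : (forall q, projection q -> P q) ->
  (forall x y, P x -> P y -> P (x + y)) -> (forall (a : R[i]) x, P x -> P (a *: x)) -> forall x, P x.
Proof.
move=> hp hD hZ.
have h0 : P 0 by rewrite -(scale0r (0 : G)); apply: hZ; apply: hp; split; rewrite ?mulr0 ?star0.
have hs x : star x = x -> P x.
  move=> /(fd_system fdG) [k [p [[[pp _ _] p1 _] hd]]].
  rewrite -[x]mulr1 -p1 mulr_sumr; apply: big_ind => // i _.
  by have [d ->] := hd i; apply: hZ; apply: hp.
by move=> x; have [a [b [sa sb ->]]] := re_im x; apply: hD; [|apply: hZ]; apply: hs.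
Qed.

(** The basic identity of order zero maps; [oz_proj] is the case of a projection y, and projections
    span. *)
Lemma ozM x y : phi x * phi y = phi (x * y) * h.
Proof.
apply: (@fd_proj_span (fun y => phi x * phi y = phi (x * y) * h)).
- by move=> q hq; apply: oz_proj => //; case: hphi.
- by move=> u v h1 h2; rewrite mulrDr !(linD lphi) mulrDl mulrDr h1 h2.
by move=> a u h1; rewrite mulZr !(linZ lphi) mulZl mulZr h1.
Qed.

Lemma oz_star x : phi (star x) = star (phi x). Proof. exact: cp_star. Qed.

Lemma oz_h : star h = h. Proof. by rewrite -oz_star star1. Qed.

Lemma oz_comm x : h * phi x = phi x * h.
Proof. by rewrite ozM mul1r. Qed.

Lemma ozM' x y : phi x * phi y = h * phi (x * y).
Proof. by rewrite ozM oz_comm. Qed.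

Lemma oz_pos x : pos x -> pos (phi x). Proof. exact: cp_pos. Qed.

Lemma oz_nrm x : nrm (phi x) <= nrm x.
Proof. by have := proj2 (proj1 hphi) x; rewrite !nrmE lecC. Qed.

Lemma proj_pos (B : cstarType R) (q : B) : projection q -> pos q.
Proof. by move=> [qq sq]; rewrite -qq -{1}sq; apply: pos_cs. Qed.

Lemma proj_nrm (B : cstarType R) (q : B) : projection q -> nrm q <= 1.
Proof.
move=> [qq sq]; have := nrm_sa sq; rewrite qq => e.
have [//|n1] := leP (nrm q) 1; have : nrm q < nrm q ^+ 2 by rewrite expr2 ltr_pMr // (lt_trans ltr01).
by rewrite -e ltxx.
Qed.

Lemma oz_nproj q : projection q -> nrm (phi q) <= 1.
Proof. by move=> hq; apply: le_trans (oz_nrm q) (proj_nrm hq). Qed.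

(** The intertwining relation gives phi(v) phi(r) phi(v)^* = phi(q)^3, and phi(q) is below its
    cube. *)
Lemma oz_equiv v q r : star v * v = r -> v * star v = q -> projection q -> q * v = v -> v * r = v ->
  cle1 (phi q) (phi r) /\ phi v * phi r = phi q * phi v.
Proof.
move=> v1 v2 pq qv vr.
have inter : phi v * phi r = phi q * phi v by rewrite (ozM v) vr (ozM q) qv.
split => //.
have E : phi v * phi r * phi (star v) = phi q * phi q * phi q.
  rewrite inter -mulrA (ozM v (star v)) v2; rewrite -!mulrA; congr (_ * _).
  by rewrite (ozM q q) (proj1 pq).
apply: (@cle1_trans _ _ _ (phi q * phi q * phi q)); first by apply: cle1_cube; apply: oz_pos; apply: proj_pos.
by rewrite -E oz_star -{1}[phi v]starK; apply: cle1_conj.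
Qed.

(** Let u be the cut of g = phi(q). Conjugating the cut of phi(r) by phi(v) gives u g^2, and u <=
    e^-2 u g^2 because u (g^2 - e^2) = u^2 (g + e) is positive. *)
Lemma oz_equiv_cut e v q r : 0 < e <= 1 -> star v * v = r -> v * star v = q -> projection q -> projection r ->
  q * v = v -> v * r = v -> cle1 (cut e (phi q)) (cut e (phi r)).
Proof.
move=> he v1 v2 pq pr qv vr.
have he' : 0 <= e <= 1 by case/andP: he => /ltW -> ->.
have [_ inter] := oz_equiv v1 v2 pq qv vr.
have pp := oz_pos (proj_pos pq); have np := oz_nproj pq.
have pp' := oz_pos (proj_pos pr); have np' := oz_nproj pr.
have hc := cut_inter he' pp' np' pp np inter.
have [pu ug uu _ _] := cutP he' pp np; set u := cut e (phi q) in hc pu ug uu *.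
set u' := cut e (phi r) in hc *.
have E : phi v * u' * phi (star v) = u * (phi q * phi q).
  by rewrite hc -mulrA (ozM v (star v)) v2 (ozM q q) (proj1 pq).
apply: (@cle1_trans _ _ _ (u * (phi q * phi q))); last first.
  by rewrite -E oz_star -{1}[phi v]starK; apply: cle1_conj.
have e0 : 0 < e by case/andP: he.
have ugg : u * (phi q * phi q) = phi q * phi q * u by rewrite mulrA ug -!mulrA ug.
apply: (@cle1_pleZ _ _ _ _ (e^-1 * e^-1)) => //; first by rewrite mulr_ge0 // invr_ge0 ltW.
  by apply: pos_mulC => //; apply: pos_sqr; apply: pos_sa.
have -> : ple u ((e^-1 * e^-1) *^ (u * (phi q * phi q))) =
   pos ((e^-1 * e^-1) *^ (u * u * (phi q + e%:I))).
  rewrite /ple; congr (pos _).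
  have -> : u * u * (phi q + e%:I) = u * (phi q * phi q) - (e * e) *^ u.
    rewrite -uu -rcM.
    have -> : u * (phi q - e%:I) * (phi q + e%:I) = u * (phi q * phi q) - e *^ (e *^ u) by ncring.
    by [].
  rewrite scalerBr; congr (_ - _); rewrite rcM (_ : _ * (e * e) = 1) ?rc1 //.
  by field; rewrite lt0r_neq0.
apply: posZ; first by rewrite mulr_ge0 // invr_ge0 ltW.
apply: pos_mulC; first by apply: pos_sqr; apply: pos_sa.
  by apply: posD => //; apply: pos_rc; apply: ltW.
rewrite mulrDr mulrDl -[u * u * phi q]mulrA ug !mulrA ug; congr (_ + _).
ncring.
Qed.
End OrderZeroFD.

Section Labels.
(** Within each label, the elements of I and J are enumerated and matched by position. *)
Lemma label_inj (I J : finType) (K : eqType) (f : I -> K) (g : J -> K) :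
  (forall i, (#|[pred i' | f i' == f i]| <= #|[pred j | g j == f i]|)%N) ->
  exists h : I -> J, injective h /\ forall i, g (h i) = f i.
Proof.
move=> hc; case: (pickP (predT : pred J)) => [j0 _|noJ]; last first.
  have noI (i : I) : False.
    have := hc i; rewrite (eq_card0 (A := [pred j | g j == f i])) => [|j]; last by have := noJ j.
    by rewrite leqn0 => /eqP /card0_eq /(_ i); rewrite inE eqxx.
  by exists (fun i => match noI i with end); split => [i|i]; case: (noI i).
pose h i := nth j0 (enum [pred j | g j == f i]) (index i (enum [pred i' | f i' == f i])).
have idx i : (index i (enum [pred i' | f i' == f i]) < size (enum [pred j | g j == f i]))%N.
  by rewrite -cardE; apply: leq_trans (hc i); rewrite [X in (_ < X)%N]cardE index_mem mem_enum inE.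
have gh i : g (h i) = f i.
  by have := mem_nth j0 (idx i); rewrite mem_enum inE => /eqP.
exists h; split => // i i' e.
have fe : f i = f i' by rewrite -!gh e.
have idx' := idx i'; move: e; rewrite /h -fe => /eqP; rewrite nth_uniq ?enum_uniq //; last first.
  by move: idx'; rewrite -fe.
move=> /eqP e; have := congr1 (nth i (enum [pred i' | f i' == f i])) e.
by rewrite !nth_index // mem_enum inE ?fe.
Qed.

Lemma sum_sig (V : nmodType) (I : finType) (P : pred I) (F : I -> V) :
  \sum_(i | P i) F i = \sum_(x : {x | P x}) F (val x).
Proof. exact: (big_sub P F). Qed.

Lemma card_sig_pred (T : finType) (P S : pred T) :
  #|[pred x : {x | P x} | S (val x)]| = #|[pred x | P x && S x]|.
Proof.
rewrite -(card_in_image (in2W (@val_inj _ _ {x | P x}))); apply: eq_card => x; apply/idP/idP => [/fintype.imageP [y hy ->]|/andP [Px Sx]].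
  by apply/andP; split; [exact: (valP y)|exact: hy].
by apply/fintype.imageP; exists (exist _ x Px).
Qed.

Variables (R : realType) (F : cstarType R) (k : nat) (p : 'I_k -> F).
Hypothesis ms : msys p.
(** The index of a first equivalent member of the system names the block of q, so that [label_inj]
    can match projections block by block. *)
Definition lab q := [pick i | `[< eqv (p i) q >]].

Lemma lab_ex q : minimal q -> exists i, lab q = Some i /\ eqv (p i) q.
Proof.
move=> mq; rewrite /lab; case: pickP => [i /asboolP h|h]; first by exists i.
have [_ [q0 _]] := mq; case: q0; have [_ ps _] := ms.
rewrite -[q]mul1r -ps mulr_suml big1 // => i _; apply: contrapT => hn.
by have /negP := negbT (h i); apply; apply/asboolP; exists 1; rewrite mulr1.
Qed.

Lemma lab_eqv q q' : minimal q -> minimal q' -> (lab q == lab q') = `[< eqv q q' >].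
Proof.
move=> mq mq'; apply/eqP/asboolP => [e|e].
  have [i [e1 h1]] := lab_ex mq; have [j [e2 h2]] := lab_ex mq'.
  move: e; rewrite e1 e2 => -[ij]; subst j.
  apply: (eqv_trans mq (msys_min ms i)) => //; apply: eqv_sym => //; first exact: (proj1 (msys_min ms i)).
  exact: (proj1 mq).
rewrite /lab; apply: eq_pick => i; apply/asboolP/asboolP => h.
  exact: (eqv_trans (msys_min ms i) mq).
apply: (eqv_trans (msys_min ms i) mq') => //; apply: eqv_sym => //; first exact: (proj1 mq).
exact: (proj1 mq').
Qed.

(** Comparison of projections reduced to counting minimal projections in each block, with
    multiplicity N on the right. *)
Lemma sys_match l (r : 'I_l -> F) N (P : pred 'I_k) (Q : pred 'I_l) : msys r ->
  (forall i, P i -> (#|[pred i' | P i' && `[< eqv (p i') (p i) >]]| <=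
     N * #|[pred j | Q j && `[< eqv (r j) (p i) >]]|)%N) ->
  exists h : {i | P i} -> 'I_N * {j | Q j}, injective h /\ forall i, eqv (p (val i)) (r (val (h i).2)).
Proof.
move=> mr hN.
suff [h [ih hh]] : exists h : {i | P i} -> 'I_N * {j | Q j}, injective h /\
    forall i, lab (r (val (h i).2)) = lab (p (val i)).
  exists h; split => // i; apply/asboolP; rewrite -lab_eqv ?hh //; exact: msys_min.
apply: (@label_inj {i | P i} ('I_N * {j | Q j})%type _ (fun i => lab (p (val i))) (fun j => lab (r (val j.2)))).
case=> i Pi /=.
have -> : #|[pred i' : {i | P i} | lab (p (sval i')) == lab (p i)]| = #|[pred i' | P i' && `[< eqv (p i') (p i) >]]|.
  rewrite -(card_sig_pred P (fun i' => `[< eqv (p i') (p i) >])); apply: eq_card => i'.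
  rewrite !inE lab_eqv //; exact: msys_min.
apply: leq_trans (hN i Pi) _.
rewrite -(card_sig_pred Q (fun i' => `[< eqv (r i') (p i) >])) -[N in (N * _ <= _)%N]card_ord -cardX.
apply: eq_leq; apply: eq_card => -[a j]; rewrite !inE /= lab_eqv //; exact: msys_min.
Qed.
End Labels.

Section ConstFamilies.
Variables (R : realType) (D : cstarType R) (E : D -> Prop).
Hypothesis hE : usub E.
Lemma cle_card (I J : finType) (a : D) : (#|I| <= #|J|)%N -> cle E (fun _ : I => a) (fun _ : J => a).
Proof.
move=> h; have [f [fi _]] : exists f : I -> J, injective f /\ forall i : I, tt = tt.
  by apply: (@label_inj _ _ _ (fun=> tt) (fun=> tt)) => i; rewrite (eq_card (B := I)) // (eq_card (B := J)).
exact: (@cle_sub _ _ _ hE _ _ _ _ f).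
Qed.
End ConstFamilies.

Section CutOrth.
Variables (R : realType) (A : cstarType R).
Implicit Types (a b c g h u x y z w : A) (r s t e K : R).
Local Notation "t %:I" := (t%:C *: (1 : A)) (at level 1, left associativity, format "t %:I").

(** The negative part n = e + u - g is orthogonal to u and satisfies n^2 = e n - g n <= e n, so |n|
    <= e and g - u = e - n lies between 0 and e. *)
Lemma cut_rest e g : 0 <= e <= 1 -> pos g -> nrm g <= 1 -> pos (g - cut e g) /\ nrm (g - cut e g) <= e.
Proof.
move=> he pg ng; have [pu ug uu gu _] := cutP he pg ng; set u := cut e g in pu ug uu gu *.
have e0 : 0 <= e by case/andP: he.
pose n := e%:I + u - g; have pn : pos n by rewrite /n.
have un : u * n = 0.
  have -> : u * n = u * u - u * (g - e%:I) by rewrite /n; ncring.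
  by rewrite uu subrr.
have ng' : n * g = g * n.
  have -> : n * g = e *^ g + u * g - g * g by rewrite /n; ncring.
  by rewrite ug /n; ncring.
have nn : n * n = e *^ n - g * n.
  have -> : n * n = e *^ n - g * n + u * n by rewrite {1}/n; ncring.
  by rewrite un addr0.
have le1 : ple (n * n) (e *^ n).
  rewrite /ple nn; have -> : e *^ n - (e *^ n - g * n) = g * n by ncring.
  exact: pos_mulC.
have nn' : nrm n <= e.
  have := ple_nrm (pos_sqr (pos_sa pn)) le1; rewrite (nrm_sa (pos_sa pn)) (nrmZ0 _ e0) expr2.
  have [n0|n0] := eqVneq (nrm n) 0; first by rewrite n0.
  by rewrite ler_pM2r // lt_def n0 nrm_ge0.
have p1 : pos (g - u).
  have -> : g - u = e%:I - n by rewrite /n; ncring.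
  by apply: nrm_pos => //; apply: pos_sa.
split => //; apply: pos_le_nrm => //.
by have -> : e%:I - (g - u) = e%:I + u - g by ncring.
Qed.

Lemma cut_orth_sum (I : finType) (g : I -> A) e : 0 < e <= 1 -> (forall i, pos (g i)) ->
  (forall i j, i != j -> g i * g j = 0) -> (forall i, nrm (g i) <= 1) ->
  ple (\sum_i g i) (e%:I + \sum_i cut e (g i)).
Proof.
move=> he pg og ng; have he' : 0 <= e <= 1 by case/andP: he => /ltW -> ->.
have : ple (\sum_i (g i - cut e (g i))) e%:I.
  apply: orth_nrm.
  - by move=> i; have [] := cut_rest he' (pg i) (ng i).
  - move=> i j ij; have [h1 h2 h3] := cut_cut_orth pg og ng he ij.
    have ji : j != i by rewrite eq_sym.
    have [_ h4 _] := cut_cut_orth pg og ng he ji.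
    by rewrite mulrBl !mulrBr og // h1 h4 h3 !subr0.
  - by case/andP: he'.
  - by move=> i; have [] := cut_rest he' (pg i) (ng i).
rewrite /ple sumrB; set a := \sum_i g i; set b := \sum_i _.
by have -> : e%:I - (a - b) = e%:I + b - a by ncring.
Qed.
End CutOrth.

(** * Nearly tracial functionals on the blocks of one colour *)

Section Color.
Variables (R : realType) (G A : cstarType R) (psi : A -> G) (phi : G -> A).
Hypotheses (fdG : finite_dimensional [set: G]) (hphi : cpc_order_zero phi).
Hypotheses (cpsi : completely_positive psi) (psi1 : ple (psi 1) 1).
Implicit Types (x y : A) (q r v Y : G).
Local Notation h := (phi 1).
Local Notation "t %:I" := (t%:C *: (1 : A)) (at level 1, left associativity, format "t %:I").
Let cphi : completely_positive phi := proj1 (proj1 hphi).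
Let lphi : linear phi := proj1 cphi.
Let lpsi : linear psi := proj1 cpsi.
Local Notation lam q := (nrm (phi q)).

Lemma oz_pow4 q : projection q -> phi q * phi q * (phi q * phi q) = phi q * h * h * h.
Proof.
move=> [qq _]; have e : phi q * phi q = phi q * h by rewrite (ozM fdG hphi q q) qq.
rewrite e -mulrA [h * (phi q * h)]mulrA (oz_comm fdG hphi) -!mulrA [phi q * (phi q * _)]mulrA e.
by rewrite !mulrA.
Qed.

(** An estimate in A returns to the finite-dimensional algebra only on the part seen by phi: phi(q)
    (phi(Y) h) phi(q) = c phi(q)^4, so lam^4 |c| <= lam^2 e. This is the origin of the weight
    lam^2. *)
Lemma coef_bound q Y (c : R[i]) e : projection q -> q * Y * q = c *: q -> nrm (phi Y * h) <= e ->
  lam q ^+ 2 * cnm c <= e.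
Proof.
move=> pq hc he.
have sq : star (phi q) = phi q by rewrite -(oz_star hphi) (proj2 pq).
have e0 : 0 <= e by apply: le_trans he; apply: nrm_ge0.
have E : phi q * (phi Y * h) * phi q = c *: (phi q * phi q * (phi q * phi q)).
  rewrite oz_pow4 // -!mulZl -(linZ lphi) -hc.
  rewrite -(ozM fdG hphi (q * Y) q) -[phi (q * Y) * _ * _]mulrA -[phi q * h](oz_comm fdG hphi) mulrA.
  rewrite [phi (q * Y) * (h * _)]mulrA -(ozM fdG hphi q Y) -[RHS]mulrA -(oz_comm fdG hphi q).
  by rewrite !mulrA.
have := nrmM_le (nrmM_le (lexx (lam q)) he) (lexx (lam q)).
rewrite E nrmZ nrm_sa; last by rewrite starMr sq.
rewrite (nrm_sa sq); have [->|l0] := eqVneq (lam q) 0; first by move=> _; rewrite expr0n mul0r.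
have l1 : 0 < lam q ^+ 2 by rewrite exprn_gt0 // lt_def l0 nrm_ge0.
move=> H; rewrite -(ler_pM2l l1); move: H; nra.
Qed.

(** The squares of both norms are the norms of phi(v)^* phi(v) and phi(v) phi(v)^*; thus the weight
    is constant on a block. *)
Lemma lam_eqv q r : minimal q -> minimal r -> eqv q r -> lam q = lam r.
Proof.
move=> mq mr e; have [v [v1 v2 qv vr]] := eqv_pi mq mr e.
have sq s : minimal s -> star (phi s) = phi s by move=> [[_ ss] _]; rewrite -(oz_star hphi) ss.
have n2 s : minimal s -> nrm (phi s * h) = lam s ^+ 2.
  by move=> ms; rewrite -(nrm_sa (sq s ms)) (ozM fdG hphi s s) (proj1 (proj1 ms)).
apply/eqP; rewrite -(@eqrXn2 _ 2) ?nrm_ge0 //; apply/eqP.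
rewrite -(n2 q mq) -(n2 r mr) -v1 -v2 -!(ozM fdG hphi) (oz_star hphi) nrm_cs.
by rewrite -{1}[phi v]starK nrm_cs nrm_star.
Qed.

Section Functional.
Variables (k : nat) (p : 'I_k -> G) (q : G).
Hypotheses (ms : msys p) (mq : minimal q).
Local Notation n := (#|[pred i | `[< eqv (p i) q >]]|).
(** Division by the block size n and |phi(q)| <= 1 keep the value at 1 at most 1, as [approx_trace]
    requires. *)
Definition cfun x := (lam q ^+ 2 / n%:R)%:C * btr p q (psi 1 * psi x).

Lemma btr_one : btr p q 1 = (n%:R : R)%:C.
Proof.
rewrite /btr (eq_bigr (fun=> 1)) => [|i _]; last by rewrite coef1.
by rewrite sumr_const rmorph_nat.
Qed.

Lemma btrB (x y : G) : btr p q (x - y) = btr p q x - btr p q y.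
Proof. by rewrite -[- y]scaleN1r (btrD ms) (btrZ ms) mulN1r. Qed.

Lemma n_gt0 : (0 < n)%N.
Proof.
have [i [_ e]] := lab_ex ms mq; apply/card_gt0P; exists i; exact: asboolT.
Qed.

Let w0 : 0 <= lam q ^+ 2 / n%:R. Proof. by rewrite divr_ge0 // exprn_ge0 // nrm_ge0. Qed.

Lemma cfun_scalar : scalar cfun.
Proof.
move=> a x y; rewrite /cfun (linD lpsi) (linZ lpsi) mulrDr mulZr (btrD ms) (btrZ ms) mulrDr.
by rewrite mulrCA.
Qed.

Lemma cfun_pos x : pos x -> 0 <= cfun x.
Proof.
move=> px; have [s [ps e _ _]] := pos_sqrt (cp_pos cpsi px).
apply: mulr_ge0; first by rewrite (_ : 0 = 0%:C) // lecC.
rewrite -e mulrA (btr_comm ms _ _ mq) mulrA; apply: (btr_ge0 ms).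
by apply: pos_conj_sa; [exact: pos_sa|apply: (cp_pos cpsi); exact: pos1].
Qed.

(** The block trace of psi(x) psi(y) equals that of psi(y) psi(x), and these products are near
    psi(xy) psi(1) and psi(yx) psi(1) by hypothesis, after phi and with weight lam^2. *)
Lemma cfun_trace e x y : nrm (phi (psi x * psi y - psi (x * y) * psi 1) * h) <= e ->
  nrm (phi (psi y * psi x - psi (y * x) * psi 1) * h) <= e -> cnm (cfun (x * y) - cfun (y * x)) <= 2 * e.
Proof.
move=> h1 h2.
have bnd Y : nrm (phi Y * h) <= e -> cnm ((lam q ^+ 2 / n%:R)%:C * btr p q Y) <= e.
  move=> hY; rewrite cnmM cnm_real ger0_norm //.
  apply: (@le_trans _ _ (lam q ^+ 2 / n%:R * \sum_(i < k | `[< eqv (p i) q >]) cnm (coef p i Y))).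
    by apply: ler_wpM2l => //; apply: cnm_sum.
  rewrite mulrAC mulr_sumr ler_pdivrMr ?ltr0n ?n_gt0 //.
  apply: (@le_trans _ _ (\sum_(i < k | `[< eqv (p i) q >]) e)).
    apply: ler_sum => i /asboolP ei; rewrite -(lam_eqv (msys_min ms i) mq ei).
    apply: coef_bound hY; [exact: (proj1 (msys_min ms i))|exact: (coefP ms)].
  by rewrite sumr_const mulr_natr.
have -> : cfun (x * y) - cfun (y * x) =
   (lam q ^+ 2 / n%:R)%:C * btr p q (psi y * psi x - psi (y * x) * psi 1)
   - (lam q ^+ 2 / n%:R)%:C * btr p q (psi x * psi y - psi (x * y) * psi 1).
  rewrite /cfun -!mulrBr; congr (_ * _).
  rewrite !btrB (btr_comm ms (psi x) (psi y) mq).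
  by rewrite (btr_comm ms (psi 1) _ mq) (btr_comm ms (psi 1) (psi (y * x)) mq); ring.
apply: le_trans (cnmD _ _) _; rewrite cnmN; have := bnd _ h1; have := bnd _ h2; lra.
Qed.

Lemma cfun_adapted1 (d : 'I_k -> R) : (forall i, psi 1 * p i = d i *^ p i) ->
  complex.Re (cfun 1) = lam q ^+ 2 / n%:R * \sum_(i < k | `[< eqv (p i) q >]) d i ^+ 2.
Proof.
move=> hd; rewrite /cfun /btr.
rewrite (eq_bigr (fun i => (d i ^+ 2)%:C)) => [|i _]; first by rewrite -rmorph_sum -rmorphM.
apply: (coef_uniq ms); rewrite -!mulrA hd mulZr.
have hd' : p i * psi 1 = d i *^ p i.
  have := congr1 star (hd i); rewrite starMr starZr -(cp_star cpsi) star1.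
  by have [[hp _ _] _ _] := ms; rewrite (proj2 (hp i)).
rewrite mulZr mulrA hd' mulZl; have [[hp _ _] _ _] := ms.
by rewrite (proj1 (hp i)) rcM expr2.
Qed.

Lemma cfun_adapted x (d : 'I_k -> R) : (forall i, psi x * p i = d i *^ p i) -> (forall i, 0 <= d i <= 1) ->
  complex.Re (cfun x) <= lam q ^+ 2 / n%:R * \sum_(i < k | `[< eqv (p i) q >]) d i.
Proof.
move=> hd d01.
have cb i : coef p i (psi 1) <= 1.
  rewrite -subr_ge0 -(coef1 ms i) -[- coef p i _]mulN1r -(coefZ ms) -(coefD ms) scaleN1r.
  exact: (coef_ge0 ms).
have c0 i : 0 <= coef p i (psi 1) by apply: (coef_ge0 ms); apply: (cp_pos cpsi); apply: pos1.
have E : btr p q (psi 1 * psi x) = \sum_(i < k | `[< eqv (p i) q >]) (d i)%:C * coef p i (psi 1).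
  apply: eq_bigr => i _; apply: (coef_uniq ms).
  by rewrite -!mulrA hd !mulZr mulrA (coefP ms) scalerA.
have H : cfun x <= (lam q ^+ 2 / n%:R * \sum_(i < k | `[< eqv (p i) q >]) d i)%:C.
  rewrite /cfun [leRHS]rmorphM; apply: ler_wpM2l; first by rewrite (_ : 0 = 0%:C) // lecC.
  rewrite E rmorph_sum; apply: ler_sum => i _; rewrite -[leRHS]mulr1; apply: ler_wpM2l => //.
  by rewrite (_ : 0 = 0%:C) // lecC; case/andP: (d01 i).
by move: H; rewrite lecE => /andP [_].
Qed.

Lemma cfun1_le : complex.Re (cfun 1) <= 1.
Proof.
have H : cfun 1 <= 1.
  rewrite /cfun; apply: (@le_trans _ _ ((lam q ^+ 2 / n%:R)%:C * btr p q 1)).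
    apply: ler_wpM2l; first by rewrite (_ : 0 = 0%:C) // lecC.
    rewrite -subr_ge0 -btrB; apply: (btr_ge0 ms); have p1 : pos (psi 1) by apply: (cp_pos cpsi); apply: pos1.
    have -> : 1 - psi 1 * psi 1 = (1 - psi 1) + psi 1 * (1 - psi 1) by ncring.
    by apply: posD => //; apply: pos_mulC => //; ncring.
  rewrite btr_one -rmorphM divfK; last by rewrite pnatr_eq0 -lt0n n_gt0.
  rewrite (_ : 1 = 1%:C) // lecC; have := oz_nproj hphi (proj1 mq).
  have := nrm_ge0 (phi q); nra.
by move: H; rewrite lecE => /andP [_].
Qed.
End Functional.
End Color.

Section ColorStep.
Variables (R : realType) (G A : cstarType R) (psi : A -> G) (phi : G -> A).
Hypotheses (fdG : finite_dimensional [set: G]) (hphi : cpc_order_zero phi).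
Hypotheses (cpsi : completely_positive psi) (psi1 : ple (psi 1) 1).
Local Notation "t %:I" := (t%:C *: (1 : A)) (at level 1, left associativity, format "t %:I").
Let cphi : completely_positive phi := proj1 (proj1 hphi).
Let lphi : linear phi := proj1 cphi.
Let lpsi : linear psi := proj1 cpsi.
Local Notation lam q := (nrm (phi q)).

Lemma adapted_unit (y : G) k (p : 'I_k -> G) (d : 'I_k -> R) : pos y -> ple y 1 -> msys p ->
  (forall i, y * p i = d i *^ p i) -> forall i, 0 <= d i <= 1.
Proof.
move=> py y1 ms hd i; have [[hp p0 _] _ _] := ms.
have c : coef p i y = (d i)%:C.
  by apply: (coef_uniq ms); rewrite -mulrA hd mulZr (proj1 (hp i)).
have := coef_ge0 ms i py; rewrite c (_ : 0 = 0%:C) // lecC => -> /=.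
have := coef_ge0 ms i y1; have -> : coef p i (1 - y) = (1 - d i)%:C.
  by rewrite -[- y]scaleN1r (coefD ms) (coefZ ms) (coef1 ms) c rmorphB rmorph1 mulN1r.
by rewrite (_ : 0 = 0%:C) // lecC subr_ge0.
Qed.

(** The minimal projections diagonalising psi(1) fall into three classes. On good blocks the
    functional has mass at least kap, and the trace count puts their cuts below N copies of x.
    Elsewhere, those with lam d >= del are so rare in their block that 2P copies of them fit below
    1. The others contribute at most del. *)
Lemma color_step (S : seq A) (x : A) (P N : nat) (t e e1 del : R) :
  let kap := del ^+ 2 / (2 * P%:R) in
  (0 < P)%N -> 0 < del -> 0 < t <= 1 -> kap <= 1 -> 0 < e1 <= 1 -> 2 <= N%:R * (t * kap) -> pos x -> ple x 1 ->
  (forall f : A -> R[i], scalar f -> (forall x, pos x -> 0 <= f x) -> complex.Re (f 1) <= 1 ->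
    (forall a b, a \in S -> b \in S -> cnm (f (a * b) - f (b * a)) <= 2 * e) ->
    cnm (f x - t%:C * f 1) <= t * kap / 4) ->
  (forall a b, a \in S -> b \in S -> nrm (phi (psi a * psi b - psi (a * b) * psi 1) * phi 1) <= e) ->
  ple (phi (psi x)) ((e1 * (t * kap / 4))%:I + x) ->
  exists (I J : finType) (u : I -> A) (b : J -> A),
  [/\ (forall i, pos (u i)) /\ (forall j, pos (b j)),
      ple (phi (psi 1)) (\sum_i u i + \sum_j b j + (del + e1)%:I),
      cle (@allA _ A) u (fun _ : 'I_N => x)
    & cle (@allA _ A) (fun w : 'I_(2 * P) * J => b w.2) (fun _ : unit => 1)].
Proof.
move=> kap P0 d0 /andP [t0 t1] k1 he1 hN px x1 hS hY hx.
have P0' : 0 < P%:R :> R by rewrite ltr0n.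
have kap0 : 0 < kap by rewrite divr_gt0 ?mulr_gt0 ?exprn_gt0.
have he1' : 0 <= e1 <= 1 by case/andP: he1 => /ltW -> ->.
have e10 : 0 < e1 by case/andP: he1.
have pp1 : pos (psi 1) by apply: (cp_pos cpsi); apply: pos1.
have [k [p [ms /choice [d hd]]]] := fd_system fdG (pos_sa pp1).
have ppx : pos (psi x) by apply: (cp_pos cpsi).
have [l [r [mr /choice [d' hd']]]] := fd_system fdG (pos_sa ppx).
have d01 := adapted_unit pp1 psi1 ms hd.
have d01' := adapted_unit ppx (ple_trans (cp_ple cpsi x1) psi1) mr hd'.
have mp i := msys_min ms i; have mr' j := msys_min mr j.
have [[hp p0 po] psum _] := ms; have [[hr r0 ro] rsum _] := mr.
have ppos i : pos (phi (p i)) by apply: (oz_pos hphi); apply: proj_pos.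
have rpos i : pos (phi (r i)) by apply: (oz_pos hphi); apply: proj_pos.
have pn i : nrm (phi (p i)) <= 1 by apply: (oz_nproj hphi).
have rn i : nrm (phi (r i)) <= 1 by apply: (oz_nproj hphi).
have porth i j : i != j -> phi (p i) * phi (p j) = 0.
  by move=> /eqP ij; rewrite (ozM fdG hphi) po // (lin0 lphi) mul0r.
have rorth i j : i != j -> phi (r i) * phi (r j) = 0.
  by move=> /eqP ij; rewrite (ozM fdG hphi) ro // (lin0 lphi) mul0r.
pose n i := #|[pred i' | `[< eqv (p i') (p i) >]]|.
have n0 i : (0 < n i)%N by apply/card_gt0P; exists i; apply: asboolT; apply: eqv_refl.
have nR i : 0 < (n i)%:R :> R by rewrite ltr0n.
(* This is the inequality kap <= f(1) for the functional of the block, cleared of the denominator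
   n. *)
pose good i := kap * (n i)%:R <= lam (p i) ^+ 2 * \sum_(i' < k | `[< eqv (p i') (p i) >]) d i' ^+ 2.
(* The threshold above which an eigenvalue of psi(x) is counted; ignoring the smaller ones loses at
   most s on average. *)
pose s := t * kap / 4; have s0 : 0 < s by rewrite divr_gt0 // mulr_gt0.
pose Q j := s <= d' j.
pose I := {i | good i}.
pose J := {i | ~~ good i && (del <= lam (p i) * d i)}.
exists I, J, (fun i => cut e1 (phi (p (val i)))), (fun j => phi (p (val j))); split.
- split => i; last exact: ppos.
  by have [] := cutP he1' (ppos (val i)) (pn (val i)).
- rewrite -[psi 1]mulr1 -psum mulr_sumr (lin_sum lphi).
  pose bad2 i := ~~ good i && (del <= lam (p i) * d i).
  pose c i := if ~~ good i && ~~ (del <= lam (p i) * d i) then d i *^ phi (p i) else 0.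
  have pc i : pos (c i).
    by rewrite /c; case: ifP => _; [apply: posZ => //; case/andP: (d01 i)|apply: pos0].
  have h1 : ple (\sum_i phi (psi 1 * p i)) (\sum_i (if good i then phi (p i) else 0) +
      \sum_i (if bad2 i then phi (p i) else 0) + \sum_i c i).
    rewrite -!big_split /=; apply: ple_sum => i _; rewrite hd (linZ lphi) /bad2 /c.
    have h2 : ple (d i *^ phi (p i)) (phi (p i)).
      by rewrite -[X in ple _ X]rc1; apply: pleZr => //; case/andP: (d01 i).
    case: (good i) => /=; first by rewrite !addr0.
    by case: ifP => _ /=; rewrite ?addr0 ?add0r //; apply: ple_refl.
  have h2 : ple (\sum_i c i) del%:I.
    apply: orth_nrm => //.
    - move=> i j ij; rewrite /c; do 2! case: ifP => _; rewrite ?mul0r ?mulr0 //.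
      by rewrite mulZl mulZr porth // !scaler0.
    - exact: ltW.
    - move=> i; rewrite /c; case: ifP => [/andP [_ hlt]|_]; last by rewrite nrm0 ltW.
      rewrite nrmZ0; last by case/andP: (d01 i).
      by move: hlt; rewrite -ltNge => /ltW; rewrite mulrC.
  have h3 : ple (\sum_i (if good i then phi (p i) else 0)) (e1%:I + \sum_(i : I) cut e1 (phi (p (val i)))).
    rewrite -big_mkcond (sum_sig good (fun i => phi (p i))); apply: cut_orth_sum => // i j ij.
    exact: porth.
  apply: (ple_trans h1); move: (pleD (pleD h3 (ple_refl (\sum_i (if bad2 i then phi (p i) else 0)))) h2).
  have -> : \sum_i (if bad2 i then phi (p i) else 0) = \sum_(j : J) phi (p (val j)).
    by rewrite -big_mkcond (sum_sig bad2 (fun i => phi (p i))).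
  move=> h4; apply: (ple_trans h4).
  rewrite -rcD; set a := \sum_i _; set b := \sum_i _.
  have -> : e1%:I + a + b + del%:I = a + b + (del%:I + e1%:I) by ncring.
  exact: ple_refl.
- have hm i : good i -> (#|[pred i' | good i' && `[< eqv (p i') (p i) >]]| <=
     N * #|[pred j | Q j && `[< eqv (r j) (p i) >]]|)%N.
    move=> gi; pose f := cfun psi phi p (p i).
    (* A block has the same size in both systems, since its size is the block trace of 1. *)
    have nE : n i = #|[pred j | `[< eqv (r j) (p i) >]]|.
      apply/eqP; rewrite -(eqr_nat R) -(inj_eq (@complexI R)); apply/eqP.
      by rewrite -(btr_one (p i) ms) -(btr_one (p i) mr) (btr_system _ ms mr (mp i)).
    have fr : f x = cfun psi phi r (p i) x by rewrite /f /cfun -/(n i) nE (btr_system _ ms mr (mp i)).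
    have f1 : kap <= complex.Re (f 1).
      rewrite /f (cfun_adapted1 phi cpsi (p i) ms hd) -/(n i) mulrAC ler_pdivlMr //; exact: gi.
    have fx : t * complex.Re (f 1) - s <= complex.Re (f x).
      have H := hS f (cfun_scalar phi cpsi (p i) ms) (@cfun_pos _ _ _ _ _ cpsi _ _ _ ms (mp i))
         (cfun1_le hphi cpsi psi1 ms (mp i)) _.
      have := le_trans (cnm_Re _) (H _).
      rewrite (_ : complex.Re (f x - t%:C * f 1) = complex.Re (f x) - t * complex.Re (f 1)).
        by rewrite ler_distl => hh; case/andP: (hh (fun a b ha hb => cfun_trace fdG hphi ms (mp i) (hY a b ha hb) (hY b a hb ha))); rewrite -/s.
      by case: (f x) (f 1) => [a1 a2] [b1 b2] /=; rewrite mul0r subr0.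
    have f2 := cfun_adapted phi cpsi psi1 (p i) mr hd' d01'.
    rewrite -fr -nE in f2.
    pose q := #|[pred j | Q j && `[< eqv (r j) (p i) >]]|.
    have f3 : \sum_(j < l | `[< eqv (r j) (p i) >]) d' j <= q%:R + (n i)%:R * s.
      apply: (@le_trans _ _ (\sum_(j < l | `[< eqv (r j) (p i) >]) ((Q j)%:R + s))).
        apply: ler_sum => j _; case/andP: (d01' j) => _ h1; rewrite /Q.
        by case: (leP s (d' j)) => [_|/ltW h2] /=; rewrite ?add0r //; apply: le_trans h1 _; rewrite lerDl ltW.
      rewrite big_split /= sumr_const -nE mulr_natl; apply: lerD => //.
      rewrite -natr_sum ler_nat /q -sum1_card [leqLHS]big_mkcond [leqRHS]big_mkcond.
      apply: leq_sum => j _; rewrite !inE /=; by case: (Q j); case: (`[< _ >]).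
    have f4 : lam (p i) ^+ 2 <= 1 by have := pn i; have := nrm_ge0 (phi (p i)); nra.
    have f5 : complex.Re (f x) * (n i)%:R <= q%:R + (n i)%:R * s.
      apply: le_trans f3; move: f2; rewrite mulrAC ler_pdivlMr // => f2; apply: (le_trans f2).
      rewrite -[leRHS]mul1r; apply: ler_wpM2r => //.
      by apply: sumr_ge0 => j _; case/andP: (d01' j).
    (* Indeed t kap = 4 s and the approximation costs s. With f5 this leaves at least 2 s n
       projections above the threshold, and N * 2 s >= 1. *)
    have f6 : 3 * s <= complex.Re (f x).
      apply: le_trans fx; have := ler_wpM2l (ltW t0) f1; rewrite {1 2}/s; lra.
    have f7 : (n i)%:R * (t * kap / 2) <= q%:R.
      have := ler_wpM2r (ltW (nR i)) f6; rewrite -/s; move: f5; rewrite /s; nra.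
    apply: (@leq_trans (n i)).
      by apply: subset_leq_card; apply/fintype.subsetP => j /andP [].
    rewrite -(ler_nat R) natrM -/q.
    have N0 : 0 <= N%:R :> R by rewrite ler0n.
    apply: le_trans (ler_wpM2l N0 f7); have := ler_wpM2r (ltW (nR i)) hN; nra.
  have [h [ih hh]] := sys_match ms mr hm.
  apply: (@cle_trans _ _ _ (@usub_all _ _) _ _ _ _ (fun w : 'I_N * {j | Q j} => cut e1 (phi (r (val w.2))))).
    apply: (@cle_inj_approx _ _ _ (@usub_all _ _) _ _ _ _ h) => // i.
    have [v [v1 v2 qv vr]] := eqv_pi (mp (val i)) (mr' _) (hh i).
    exact: (oz_equiv_cut fdG hphi he1 v1 v2 (hp _) (hr _) qv vr).
  apply: (@cle_trans _ _ _ (@usub_all _ _) _ _ _ _ (fun w : 'I_N * unit => x)); last first.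
    by apply: (@cle_card _ _ _ (@usub_all _ _)); rewrite card_prod card_unit muln1.
  apply: (@cle_sum _ _ _ (@usub_all _ _) _ _ _ (fun _ j => cut e1 (phi (r (val j)))) (fun _ _ => x)) => _.
  apply: (@cut_cle _ _ _ (fun j : {j | Q j} => phi (r (val j))) _ _ _ _ s^-1) => //.
  + by move=> i j ij; apply: rorth.
  + by rewrite invr_ge0 ltW.
  (* Eigenvalues in Q are at least s, so s times the sum of the phi(r_j) is below phi(psi(x)) <= e1
     s + x; division by s gives the hypothesis of [cut_cle]. *)
  have h1 : ple (s *^ \sum_(j : {j | Q j}) phi (r (val j))) ((e1 * s)%:I + x).
    apply: ple_trans hx; rewrite -(sum_sig Q (fun j => phi (r j))) -[psi x]mulr1 -rsum mulr_sumr (lin_sum lphi).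
    rewrite scaler_sumr big_mkcond; apply: ple_sum => j _; rewrite hd' (linZ lphi).
    case: ifP => [Qj|_]; first exact: pleZr.
    by apply: ple0; apply: posZ => //; case/andP: (d01' j).
  have := pleZ (ltW (_ : 0 < s^-1)) h1; rewrite invr_gt0 => /(_ s0).
  rewrite rcM mulVf ?lt0r_neq0 // rc1 scalerDr rcM mulrCA mulVf ?lt0r_neq0 // mulr1; exact.
pose badp i := ~~ good i && (del <= lam (p i) * d i).
(* Every such projection adds at least del^2 to a sum smaller than kap n = del^2 n / (2P), so there
   are fewer than n / (2P) of them. *)
have hm (j : J) : (2 * P * #|[pred i | badp i && `[< eqv (p i) (p (val j)) >]]| <= n (val j))%N.
  case: j => j /= /andP [gj _].
  rewrite -(ler_nat R) natrM; set q := #|_|.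
  have h1 : del ^+ 2 * q%:R <= lam (p j) ^+ 2 * \sum_(i' < k | `[< eqv (p i') (p j) >]) d i' ^+ 2.
    rewrite /q -sum1_card natr_sum mulr_sumr [leLHS]big_mkcond mulr_sumr [leRHS]big_mkcond.
    apply: ler_sum => i _; rewrite unfold_in /=; case: (asboolP (eqv _ _)) => ee; last by rewrite andbF.
    rewrite andbT; case: ifP => [/andP [_ h1]|_]; last by rewrite mulr_ge0 // sqr_ge0.
    rewrite mulr1 -(lam_eqv fdG hphi (mp i) (mp j) ee) -exprMn; apply: lerXn2r => //.
      by rewrite nnegrE ltW.
    by rewrite nnegrE mulr_ge0 ?nrm_ge0 //; case/andP: (d01 i).
  move: gj; rewrite /good -ltNge => h2; have := le_lt_trans h1 h2; rewrite /kap => h3.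
  have dd : 0 < del ^+ 2 by rewrite exprn_gt0.
  move: h3; rewrite -mulrA ltr_pM2l // mulrC ltr_pdivlMr ?mulr_gt0 // natrM; nra.
have [h [ih hh]] : exists h : 'I_(2 * P) * J -> 'I_k, injective h /\
    forall w, lab p (p (h w)) = lab p (p (val w.2)).
  apply: (@label_inj ('I_(2 * P) * J)%type 'I_k _ (fun w => lab p (p (val w.2))) (fun i => lab p (p i))) => -[w j] /=.
  have -> : #|[pred i | lab p (p i) == lab p (p (val j))]| = n (val j).
    by apply: eq_card => i; rewrite !unfold_in /= lab_eqv.
  apply: leq_trans (hm j).
  rewrite -(card_sig_pred badp (fun i' => `[< eqv (p i') (p (val j)) >])) -[(2 * P)%N in leqRHS]card_ord -cardX.
  by apply: eq_leq; apply: eq_card => -[a i]; rewrite !unfold_in /= lab_eqv.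
apply: (@cle_trans _ _ _ (@usub_all _ _) _ _ _ _ (fun i => phi (p i))).
  apply: (@cle_inj_approx _ _ _ (@usub_all _ _) _ _ _ _ h) => // w.
  have ee : eqv (p (val w.2)) (p (h w)) by apply/asboolP; rewrite -(lab_eqv ms) ?hh.
  have [v [v1 v2 qv vr]] := eqv_pi (mp _) (mp _) ee.
  by have [] := oz_equiv fdG hphi v1 v2 (hp _) qv vr.
apply: (@cle_trans _ _ _ (@usub_all _ _) _ _ _ _ _ _ (orth_cle ppos porth)).
rewrite -(lin_sum lphi) psum; apply: cle1_ple; first by apply: (oz_pos hphi); apply: pos1.
rewrite -[X in ple _ X]rc1; apply: sa_ple; first exact: (oz_h hphi).
exact: le_trans (oz_nrm hphi 1) (nrm1 _).
Qed.
End ColorStep.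

(** * Cuntz comparison of sequences, where addition is concatenation *)

Section SeqCuntz.
Variables (R : realType) (D : cstarType R).
Implicit Types (s t : seq D).
(** With sequences, sums and multiples of classes are [++], [nseq] and [smul], and regrouping is
    [perm_eq]. *)
Definition sle (E : D -> Prop) s t :=
  cle E (fun i : 'I_(size s) => nth 0 s i) (fun j : 'I_(size t) => nth 0 t j).
Definition smul K s := flatten (nseq K s).

Lemma smul_nseq K L (a : D) : smul K (nseq L a) = nseq (K * L) a.
Proof. by elim: K => // K IH; rewrite /smul /= -/(smul K _) IH -nseqD. Qed.

Lemma count_smul (p : pred D) K s : count p (smul K s) = (K * count p s)%N.
Proof. by elim: K => // K IH; rewrite /smul /= count_cat -/(smul K _) IH mulSn. Qed.

Lemma perm_smul_cat K s t : perm_eq (smul K (s ++ t)) (smul K s ++ smul K t).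
Proof. by apply/permP => p; rewrite count_cat !count_smul count_cat mulnDr. Qed.

Lemma perm_smul_fam K (J : finType) (b : J -> D) :
  perm_eq (smul K (codom b)) (codom (fun w : 'I_K * J => b w.2)).
Proof.
apply/permP => p; rewrite count_smul.
have ce (T : finType) (f : T -> D) : count p (codom f) = (\sum_x p (f x))%N.
  rewrite -sum1_count big_map big_mkcond /= big_enum /=; apply: eq_bigr => x _; by case: (p _).
rewrite !ce -(pair_bigA _ (fun _ j => p (b j) : nat)) /= sum_nat_const card_ord; by [].
Qed.

Variable E : D -> Prop.
Hypothesis hE : usub E.

Lemma sle_trans s t u : sle E s t -> sle E t u -> sle E s u.
Proof. exact: (cle_trans hE). Qed.

Lemma sle_perm s t : perm_eq s t -> sle E s t.
Proof.
move=> h; have st := perm_size h; move/(perm_iotaP 0): h => [Is hI e].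
have sI : size Is = size t by rewrite (perm_size hI) size_iota.
have lt (i : 'I_(size s)) : (nth 0%N Is i < size t)%N.
  have : nth 0%N Is i \in Is by rewrite mem_nth // sI -st.
  by rewrite (perm_mem hI) mem_iota.
apply: (@cle_sub _ _ _ hE _ _ _ _ (fun i => Ordinal (lt i))) => [i j|i] /=.
  move=> /(congr1 val) /= /eqP; rewrite nth_uniq ?sI -?st //; last by rewrite (perm_uniq hI) iota_uniq.
  by move=> /eqP /val_inj.
by rewrite {1}e (nth_map 0%N) // sI -st.
Qed.

Lemma sle_refl s : sle E s s. Proof. exact: sle_perm. Qed.

Lemma sle_catl s t : sle E s (s ++ t).
Proof.
have lt (i : 'I_(size s)) : (i < size (s ++ t))%N by rewrite size_cat ltn_addr.
apply: (@cle_sub _ _ _ hE _ _ _ _ (fun i => Ordinal (lt i))) => [i j|i] /=.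
  by move=> /(congr1 val) /= /val_inj.
by rewrite nth_cat ltn_ord.
Qed.

Lemma sle_catr s t : sle E t (s ++ t).
Proof. by apply: (sle_trans (sle_catl t s)); apply: sle_perm; rewrite perm_catC. Qed.

Lemma sle_nseq K L (a : D) : (K <= L)%N -> sle E (nseq K a) (nseq L a).
Proof. by move=> h; rewrite -(subnKC h) nseqD; apply: sle_catl. Qed.

Lemma sle_fam (I J : finType) (u : I -> D) (v : J -> D) : cle E u v -> sle E (codom u) (codom v).
Proof.
move=> h; apply: (cle_trans hE (_ : cle E _ u)); last apply: (cle_trans hE h).
  have lt (i : 'I_(size (codom u))) : (i < #|I|)%N by rewrite -(size_codom u).
  apply: (@cle_sub _ _ _ hE _ _ _ _ (fun i => enum_val (Ordinal (lt i)))) => [i j|i] /=.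
    by move=> /enum_val_inj /(congr1 val) /= /val_inj.
  rewrite /codom /image_mem (nth_map (enum_val (Ordinal (lt i)))) -?cardE ?lt //.
  by congr (u _); symmetry; apply: enum_val_nth.
have lt (j : J) : (enum_rank j < size (codom v))%N by rewrite size_codom ltn_ord.
apply: (@cle_sub _ _ _ hE _ _ _ _ (fun j => Ordinal (lt j))) => [i j|j] /=.
  by move=> /(congr1 val) /= /val_inj /enum_rank_inj.
rewrite /codom /image_mem (nth_map j) -?cardE ?ltn_ord //; by rewrite nth_enum_rank.
Qed.

Lemma sle_cat s t s' t' : sle E s t -> sle E s' t' -> sle E (s ++ s') (t ++ t').
Proof.
move=> h h'; pose F (u : 'I_(size s) + 'I_(size s')) :=
  match u with inl i => nth 0 s i | inr i => nth 0 s' i end.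
apply: (cle_trans hE (_ : cle E _ F)).
  have e := size_cat s s'; apply: (@cle_sub _ _ _ hE _ _ _ F (fun i => fintype.split (cast_ord e i))) => [i j|i].
    by move=> /(can_inj splitK) /cast_ord_inj.
  by rewrite nth_cat /F; case: split_ordP => j /(congr1 val) /= ->; rewrite ?ltn_ord // -ltn_subRL subnn ltn0 addKn.
apply: (cle_trans hE (cle_sum2 hE h h')).
have e := esym (size_cat t t'); apply: (@cle_sub _ _ _ hE ('I_(size t) + 'I_(size t'))%type 'I_(size (t ++ t')) _ _ (fun u => cast_ord e (unsplit u))) => [i j|].
  by move=> /cast_ord_inj /(can_inj unsplitK).
by case=> i /=; rewrite nth_cat ?ltn_ord // ltnNge leq_addr /= addKn.
Qed.

Lemma sle_smul K s t : sle E s t -> sle E (smul K s) (smul K t).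
Proof.
move=> h; elim: K => [|K IH]; first exact: sle_refl.
by rewrite /smul /=; apply: sle_cat.
Qed.

(** The column with all entries k = (sum s)^(-1/2) gives k (sum s) k = 1. *)
Lemma sle_column r (s : seq D) : csub E -> (forall a, a \in s -> pos a) -> (forall a, a \in s -> E a) -> 0 < r ->
  ple (r%:C *: (1 : D)) (\sum_(a <- s) a) -> sle E [:: 1] s.
Proof.
move=> cE ps Es r0 hr; have Et : E (\sum_(a <- s) a) by rewrite big_seq; elim/big_ind: _ => //; [exact: csub0|exact: csubD].
have [k [k1 pk _ kE]] := invsqrt r0 hr.
apply: (cle_exact (V := fun _ _ => k)) => [j i|i i']; first exact: kE.
have -> : i = i' by case: i i' => [[|i] //= hi] [[|i'] //= hi']; apply: val_inj.
rewrite eqxx; case: i' => [[|n] //= _]; rewrite (pos_sa pk) -mulr_suml -mulr_sumr.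
by rewrite -[RHS]k1 (big_nth 0) big_mkord.
Qed.
End SeqCuntz.

(** * Fullness of positive elements and faithfulness of the trace in simple algebras *)

Section SimpleFull.
Variables (R : realType) (A : cstarType R).
Implicit Types (x y z w b c k : A).
Local Notation "t %:I" := (t%:C *: (1 : A)) (at level 1, left associativity, format "t %:I").

Lemma closureP (S : set A) y : closure S y <-> forall e, 0 < e -> exists2 w, S w & nrm (w - y) <= e.
Proof.
split=> [h e e0|h B /nbhs_ballP [e /= e0 hB]].
  have e0' : 0 < e%:C by rewrite (_ : 0 = 0%:C) // ltcC.
  have [w [Sw]] := h _ (nbhsx_ballx y e%:C e0').
  by rewrite -ball_normE /= nrm_lt -nrmN opprB => /ltW hw; exists w.
have [re er] : e = (complex.Re e)%:C /\ 0 <= complex.Re e by apply: ge0_Re; exact: ltW.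
have e1 : 0 < complex.Re e by move: e0; rewrite re (_ : 0 = 0%:C) // ltcC.
have [w Sw hw] := h (complex.Re e / 2) (divr_gt0 e1 (ltr0n _ 2)).
exists w; split => //; apply: hB; rewrite -ball_normE /= re nrm_lt -nrmN opprB.
by apply: le_lt_trans hw _; lra.
Qed.

Lemma dense_approx (S : set A) x e : dense S -> 0 < e -> exists2 w, S w & nrm (w - x) <= e.
Proof.
move=> dS e0; have e0' : 0 < e%:C by rewrite (_ : 0 = 0%:C) // ltcC.
have [w [hw Sw]] := dS _ (ex_intro _ x (nbhsx_ballx x e%:C e0' : (ball x e%:C)^° x)) (open_interior _).
by have := interior_subset hw; rewrite -ball_normE /= nrm_lt -nrmN opprB => /ltW hwx; exists w.
Qed.

(** The operator Cauchy-Schwarz inequality, from positivity of the sum of all (y_i - y_j)^* (y_i -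
    y_j). *)
Lemma sum_sq (I : finType) (y : I -> A) :
  ple (star (\sum_i y i) * \sum_i y i) (#|I|%:R *^ \sum_i star (y i) * y i).
Proof.
set S := \sum_i y i; set T := \sum_i star (y i) * y i.
have E : \sum_i \sum_j star (y i - y j) * (y i - y j) = 2 *^ (#|I|%:R *^ T - star S * S).
  have -> : \sum_i \sum_j star (y i - y j) * (y i - y j) =
     \sum_i \sum_j (star (y i) * y i + star (y j) * y j) - \sum_i \sum_j (star (y i) * y j + star (y j) * y i).
    rewrite -sumrB; apply: eq_bigr => i _; rewrite -sumrB; apply: eq_bigr => j _; rewrite starB; ncring.
  have e1 : \sum_i \sum_(j : I) star (y i) * y i = #|I|%:R *^ T.
    by rewrite scaler_sumr; apply: eq_bigr => i _; rewrite sumr_const rcnat.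
  have e2 : \sum_i \sum_j star (y i) * y j = star S * S.
    by rewrite /S star_sum mulr_suml; apply: eq_bigr => i _; rewrite mulr_sumr.
  rewrite (eq_bigr (fun i => \sum_(j : I) star (y i) * y i + \sum_j star (y j) * y j)) => [|i _]; last by rewrite big_split.
  rewrite [X in _ - X](eq_bigr (fun i => \sum_j star (y i) * y j + \sum_j star (y j) * y i)) => [|i _]; last by rewrite big_split.
  rewrite !big_split /= e1 e2 [\sum_i \sum_j star (y j) * y j]exchange_big e1 [\sum_i \sum_j star (y j) * y i]exchange_big e2.
  have -> : 2 = 1 + 1 :> R by [].
  by rewrite -rcD !rc1; ncring.
have : pos (2^-1 *^ (2 *^ (#|I|%:R *^ T - star S * S))).
  rewrite -E; apply: posZ; first by rewrite invr_ge0.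
  by apply: pos_sum => i _; apply: pos_sum => j _; apply: pos_cs.
by rewrite rcM mulVf // rc1.
Qed.

Lemma ple_mid x b c : pos x -> ple (star c * (x * star b * b * x) * c) ((nrm b ^+ 2 * nrm x) *^ (star c * x * c)).
Proof.
move=> px; have [s [ps ss _ _]] := pos_sqrt px; have sS := pos_sa ps.
have h1 : ple (star (b * s) * (b * s)) (nrm b ^+ 2 * nrm x)%:I.
  apply: sa_ple; first by rewrite starMr starK.
  rewrite nrm_cs; have := nrmM b s; have e : nrm x = nrm s ^+ 2 by rewrite -ss nrm_sa.
  rewrite e -exprMn => h; apply: lerXn2r => //; rewrite nnegrE ?nrm_ge0 //.
  by rewrite mulr_ge0 ?nrm_ge0.
have := ple_conj (s * c) h1; rewrite !starMr sS -ss.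
have -> : star c * s * (s * star b * (b * s)) * (s * c) = star c * (s * s * star b * b * (s * s)) * c by ncring.
have -> : star c * s * (nrm b ^+ 2 * nrm (s * s))%:I * (s * c) = (nrm b ^+ 2 * nrm (s * s)) *^ (star c * (s * s) * c) by ncring.
by [].
Qed.

(** The ideal algebraically generated by x is dense, so it contains an invertible w = sum b_i x c_i,
    say w w' = 1. By [sum_sq] and [ple_mid], 1 = (w w')^* (w w') is below a multiple of T = sum (c_i
    w')^* x (c_i w'), and T^(-1/2) normalises. *)
Lemma simple_full x : simple A -> pos x -> x <> 0 ->
  exists n (z : 'I_n -> A), \sum_i star (z i) * x * z i = 1.
Proof.
move=> [A1 hS] px x0.
pose I0 : set A := [set y | exists n (b c : 'I_n -> A), y = \sum_i b i * x * c i].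
have I0D y y' : I0 y -> I0 y' -> I0 (y + y').
  move=> [n [b [c ->]]] [n' [b' [c' ->]]]; exists (n + n')%N.
  exists (fun i => match fintype.split i with inl j => b j | inr j => b' j end).
  exists (fun i => match fintype.split i with inl j => c j | inr j => c' j end).
  rewrite big_split_ord /=; congr (_ + _); apply: eq_bigr => i _.
    by rewrite (unsplitK (inl i)).
  by rewrite (unsplitK (inr i)).
have I0l y w : I0 y -> I0 (w * y).
  move=> [n [b [c ->]]]; exists n, (fun i => w * b i), c; rewrite mulr_sumr.
  by apply: eq_bigr => i _; rewrite !mulrA.
have I0r y w : I0 y -> I0 (y * w).
  move=> [n [b [c ->]]]; exists n, b, (fun i => c i * w); rewrite mulr_suml.
  by apply: eq_bigr => i _; rewrite !mulrA.
have Ix : I0 x by exists 1%N, (fun=> 1), (fun=> 1); rewrite big_ord1 mulr1 mul1r.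
have cI : closed_ideal (closure I0).
  have M y w : closure I0 y -> closure I0 (y * w) /\ closure I0 (w * y).
    move=> hy; split; apply/closureP => e e0; have h1 : 0 < nrm w + 1 by have := nrm_ge0 w; lra.
      have [v Iv hv] := (proj1 (closureP _ _)) hy (e / (nrm w + 1)) (divr_gt0 e0 h1).
      exists (v * w); first exact: I0r.
      rewrite -mulrBl; apply: le_trans (nrmM _ _) _; move: hv; rewrite ler_pdivlMr // => hv.
      by apply: le_trans hv; apply: ler_wpM2l; rewrite ?nrm_ge0 // lerDl.
    have [v Iv hv] := (proj1 (closureP _ _)) hy (e / (nrm w + 1)) (divr_gt0 e0 h1).
    exists (w * v); first exact: I0l.
    rewrite -mulrBr; apply: le_trans (nrmM _ _) _; move: hv; rewrite ler_pdivlMr // => hv.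
    by apply: le_trans hv; rewrite mulrC; apply: ler_wpM2l; rewrite ?nrm_ge0 // lerDl.
  split; first exact: closed_closure.
  - by apply: subset_closure; exists 0%N, (fun=> 0), (fun=> 0); rewrite big_ord0.
  - move=> y y' hy hy'; apply/closureP => e e0; have e2 : 0 < e / 2 by rewrite divr_gt0.
    have [v Iv hv] := (proj1 (closureP _ _)) hy _ e2; have [v' Iv' hv'] := (proj1 (closureP _ _)) hy' _ e2.
    exists (v + v'); first exact: I0D.
    rewrite opprD addrACA; apply: le_trans (nrmD _ _) _; lra.
  - by move=> a y hy; rewrite -[y]mul1r -mulZl; case: (M y (a *: (1 : A)) hy).
  - by move=> y w hy; exact: M.
have [h|h] := hS _ cI; first by have := subset_closure Ix; rewrite h => /x0.
have /closureP h1 : closure I0 1 by rewrite h.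
have h12 : 0 < 2^-1 :> R by rewrite invr_gt0.
have [w [n [b [c ew]]] hw] := h1 _ h12.
have [w' [ww' _ _]] : exists w', [/\ w * w' = 1, w' * w = 1 & forall E, csub E -> E (1 - w) -> E w'].
  have ee : 1 - (1 - w) = w by ncring.
  have q1 : 2^-1 < 1 :> R by rewrite invf_lt1 // ltr1n.
  have nw : nrm (1 - w) <= 2^-1 by rewrite -nrmN opprB.
  by have [w' hw'] := neumann q1 nw; exists w'; rewrite ee in hw'.
pose K := n%:R * \sum_i (nrm (b i) ^+ 2 * nrm x) + 1.
have s0 : 0 <= \sum_i (nrm (b i) ^+ 2 * nrm x).
  by apply: sumr_ge0 => i _; rewrite mulr_ge0 ?nrm_ge0 // exprn_ge0 // nrm_ge0.
have K0 : 0 < K by rewrite ltr_wpDl // mulr_ge0.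
pose T := \sum_i star (c i * w') * x * (c i * w').
have hT : ple 1 (K *^ T).
  have -> : 1 = star (w * w') * (w * w') by rewrite ww' star1 mul1r.
  have -> : w * w' = \sum_i b i * x * c i * w' by rewrite ew mulr_suml.
  apply: ple_trans (sum_sq _) _; rewrite card_ord scaler_sumr /T scaler_sumr.
  apply: ple_sum => i _.
  have := ple_mid (b i) (c i * w') px.
  have -> : star (c i * w') * (x * star (b i) * b i * x) * (c i * w') = star (b i * x * c i * w') * (b i * x * c i * w').
    by rewrite !starMr (pos_sa px) !mulrA.
  move=> /(pleZ (ler0n R n)) h2; apply: ple_trans h2 _; rewrite rcM; apply: pleZr; last exact: pos_conj.
  rewrite /K (bigD1 i) //= mulrDr -addrA lerDl addr_ge0 // mulr_ge0 //.
  by apply: sumr_ge0 => j _; rewrite mulr_ge0 ?nrm_ge0 // exprn_ge0 // nrm_ge0.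
have hT' : ple (K^-1)%:I T.
  have := pleZ (ltW (_ : 0 < K^-1)) hT; rewrite invr_gt0 => /(_ K0).
  by rewrite rcM mulVf ?lt0r_neq0 // rc1.
have K1 : 0 < K^-1 by rewrite invr_gt0.
have [k [k1 pk _ _]] := invsqrt K1 hT'.
exists n, (fun i => c i * w' * k); rewrite -k1 /T mulr_sumr mulr_suml; apply: eq_bigr => i _.
by rewrite starMr (pos_sa pk) !mulrA.
Qed.

(** Applying the trace to 1 = sum z_i^* x z_i bounds 1 by tau(x) times the sum of the |z_i|^2. *)
Lemma trace_faithful (tau : A -> R[i]) x : simple A -> tracial_state tau -> pos x -> x <> 0 ->
  0 < complex.Re (tau x).
Proof.
move=> sA [ls pt t1 tt] px x0; have [n [z hz]] := simple_full sA px x0.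
have pt' y : pos y -> 0 <= tau y by move=> /pos_eltP; apply: pt.
have [s [ps ss _ _]] := pos_sqrt px.
have h1 i : complex.Re (tau (star (z i) * x * z i)) <= nrm (z i) ^+ 2 * complex.Re (tau x).
  have -> : tau (star (z i) * x * z i) = tau (s * (z i * star (z i)) * s).
    by rewrite -ss -mulrA tt -mulrA -mulrA tt !mulrA.
  have h2 : ple (s * (z i * star (z i)) * s) ((nrm (z i) ^+ 2) *^ x).
    have -> : (nrm (z i) ^+ 2) *^ x = s * ((nrm (z i) ^+ 2)%:I) * s by rewrite -ss; ncring.
    apply: ple_conj_sa; first exact: pos_sa.
    apply: sa_ple; first by rewrite starMr starK.
    by rewrite -{1}[z i]starK nrm_cs nrm_star.
  apply: le_trans (pf_le ls pt' h2) _; rewrite (sclZ ls).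
  by case: (tau x) => a c /=; rewrite mul0r subr0.
have : 1 <= \sum_i nrm (z i) ^+ 2 * complex.Re (tau x).
  have : complex.Re (tau 1) = 1 by rewrite t1.
  rewrite -hz (scl_sum ls) (raddf_sum (@complex.Re R)) => <-; by apply: ler_sum => i _; exact: h1.
rewrite -mulr_suml => h2; rewrite lt_def; apply/andP; split.
  by apply/eqP => e; move: h2; rewrite e mulr0 ler10.
by have [] := ge0_Re (pt' x px).
Qed.
End SimpleFull.

(** * Comparison with the unit *)

Section Key.
Variables (R : realType) (A : cstarType R).
Implicit Types (x y z w b c k : A).
Local Notation "t %:I" := (t%:C *: (1 : A)) (at level 1, left associativity, format "t %:I").

Lemma cp_summand_gen (I : finType) (th : I -> A -> A) (a : A) (e M : R) :
  (forall i, completely_positive (th i)) -> 0 <= e <= 1 -> 1 <= M -> nrm a <= M ->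
  (forall x, x = 1 \/ x = a \/ x = star a \/ x = star a * a -> nrm (\sum_i th i x - x) <= e ^+ 2) ->
  forall i, nrm (th i a - th i 1 * a) <= 8 * e * M.
Proof.
move=> cth he hM na h i; have M0 : 0 < M by lra.
have M1 : 0 <= M^-1 <= 1 by rewrite invr_ge0 ltW //= invf_le1.
case/andP: M1 => M1 M2.
have sc x (r : R) : 0 <= r <= 1 -> nrm (\sum_i th i x - x) <= e ^+ 2 -> nrm (\sum_i th i (r *^ x) - r *^ x) <= e ^+ 2.
  move=> /andP [r0 r1] hx.
  have -> : \sum_i th i (r *^ x) - r *^ x = r *^ (\sum_i th i x - x).
    rewrite scalerBr scaler_sumr; congr (_ - _); apply: eq_bigr => j _; exact: (linZ (proj1 (cth j))).
  rewrite nrmZ0 //; have := nrm_ge0 (\sum_i th i x - x); nra.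
have h' := @cp_summand _ _ _ th cth (M^-1 *^ a) e he _ _ i.
have -> : th i a - th i 1 * a = M *^ (th i (M^-1 *^ a) - th i 1 * (M^-1 *^ a)).
  rewrite (linZ (proj1 (cth i))) mulZr -scalerBr rcM mulfV ?lt0r_neq0 // rc1; by [].
rewrite nrmZ0 ?(ltW M0) // mulrC; apply: ler_wpM2r; first exact: ltW.
apply: h'; first by rewrite nrmZ0 // mulrC ler_pdivrMr // mul1r.
move=> x [->|[->|[->|->]]]; first by apply: h; left.
- by apply: sc; [apply/andP|apply: h; right; left].
- by rewrite starZr; apply: sc; [apply/andP|apply: h; right; right; left].
rewrite starZr mulZl mulZr rcM; apply: sc; last by apply: h; right; right; right.
by rewrite mulr_ge0 //= -[leRHS]mulr1 ler_pM.
Qed.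

(** Moving [th 1] through the product: th(a) is near th(1) a, th(b) near b th(1), and th(1) a b near
    th(ab). This is the hypothesis of [cfun_trace] read in A. *)
Lemma th_mult (th : A -> A) (a b : A) (eta M : R) : completely_positive th -> nrm (th 1) <= 1 -> 0 <= eta -> 1 <= M ->
  nrm a <= M -> nrm b <= M -> eta <= 1 ->
  nrm (th a - th 1 * a) <= eta -> nrm (th (star b) - th 1 * star b) <= eta -> nrm (th (a * b) - th 1 * (a * b)) <= eta ->
  nrm (th a * th b - th (a * b) * th 1) <= 4 * M * eta.
Proof.
move=> cth n1 e0 M1 na nb e1 h1 h2 h3.
have sth1 : star (th 1) = th 1 by rewrite -(cp_star cth) star1.
have h2' : nrm (th b - b * th 1) <= eta.
  by rewrite -nrm_star starB starMr sth1 -(cp_star cth).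
have -> : th a * th b - th (a * b) * th 1 = (th a - th 1 * a) * th b + th 1 * a * (th b - b * th 1)
    - (th (a * b) - th 1 * (a * b)) * th 1 by ncring.
have nb' : nrm (th b) <= M + eta.
  have -> : th b = b * th 1 + (th b - b * th 1) by ncring.
  apply: le_trans (nrmD _ _) _; apply: lerD => //.
  by rewrite -[leRHS]mulr1; apply: nrmM_le.
apply: le_trans (nrmD _ _) _; rewrite nrmN.
apply: (@le_trans _ _ (eta * (M + eta) + 1 * M * eta + eta * 1)); last by nra.
apply: lerD; last exact: nrmM_le.
by apply: le_trans (nrmD _ _) _; apply: lerD; apply: nrmM_le => //; apply: nrmM_le.
Qed.

(* The constant depends on [m] only; this bounds the number of columns of the
   intertwiner independently of the approximation. *)
Definition keyc (m : nat) : R := let P := m.+1%:R in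
  2 * P * (2 / ((8 * P)^-1 ^+ 2 / (2 * P)) + 1) + 1.

Lemma big_codom (I : finType) (u : I -> A) : \sum_(a <- codom u) a = \sum_i u i.
Proof. by rewrite /codom /image_mem big_map big_enum. Qed.

Lemma codom_cst (I : finType) x : codom (fun _ : I => x) = nseq #|I| x.
Proof.
have h : all (pred1 x) (codom (fun _ : I => x)) by apply/allP => y /codomP [i ->] /=.
by move/all_pred1P: h; rewrite size_codom.
Qed.

Lemma csub_all : csub (@allA _ A). Proof. by split. Qed.

(** Adding the colours: the pieces bounded by copies of x go to su, the pieces of which 2P copies
    fit below the unit go to sb. *)
Lemma colors_sum n (th1 : 'I_n -> A) (N P : nat) (c : R) (x : A) :
  (forall l, exists (I J : finType) (u : I -> A) (b : J -> A),
    [/\ (forall i, pos (u i)) /\ (forall j, pos (b j)),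
      ple (th1 l) (\sum_i u i + \sum_j b j + c%:I),
      cle (@allA _ A) u (fun _ : 'I_N => x)
    & cle (@allA _ A) (fun w : 'I_(2 * P) * J => b w.2) (fun _ : unit => 1)]) ->
  exists su sb : seq A, [/\ (forall a, a \in su ++ sb -> pos a),
    ple (\sum_l th1 l) (\sum_(a <- su ++ sb) a + (n%:R * c)%:I),
    sle (@allA _ A) su (nseq (n * N) x) & sle (@allA _ A) (smul (2 * P) sb) (nseq n 1)].
Proof.
have hU := @usub_all _ A.
elim: n th1 => [|n IH] th1 hl.
  exists [::], [::]; split => //=; try exact: sle_refl.
    by rewrite big_ord0 big_nil mul0r rc0 addr0; apply: ple_refl.
  have -> : smul (2 * P) [::] = [::] :> seq A by rewrite /smul; elim: (2 * P)%N.
  exact: sle_refl.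
have [su [sb [h1 h2 h3 h4]]] := IH (fun l => th1 (widen_ord (leqnSn n) l)) (fun l => hl _).
have [I [J [u [b [[pu pb] k2 k3 k4]]]]] := hl ord_max.
exists (su ++ codom u), (sb ++ codom b); split.
- move=> a; rewrite !mem_cat -!orbA => /or4P [ha|/codomP [i ->]|ha|/codomP [i ->]] //.
    by apply: h1; rewrite mem_cat ha.
  by apply: h1; rewrite mem_cat ha orbT.
- rewrite big_ord_recr /=; have := pleD h2 k2.
  rewrite !big_cat /= !big_codom -natr1 mulrDl mul1r -rcD.
  set a1 := \sum_(i <- su) i; set a2 := \sum_(i <- sb) i; set a3 := \sum_i u i; set a4 := \sum_j b j.
  set T := (X in ple _ X -> _); set T' := (X in _ -> ple _ X).
  by have -> : T = T' by rewrite /T /T'; ncring.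
- rewrite mulSn addnC nseqD; apply: (sle_cat hU) => //.
  by have := sle_fam hU k3; rewrite codom_cst card_ord.
apply: (sle_trans hU (sle_perm hU (perm_smul_cat _ _ _))).
rewrite -[n.+1]addn1 nseqD; apply: (sle_cat hU) => //.
apply: (sle_trans hU (sle_perm hU (perm_smul_fam _ _))).
by have := sle_fam hU k4; rewrite (codom_cst unit) card_unit.
Qed.

(** The colours give 2P [1] <= K0 [x] + P [1], and P [1] cannot be cancelled. Iteration turns this
    into 2^j P [1] <= 2^j K0 [x] + P [1]. For j large the crude bound from simplicity absorbs the
    last term into 2^j P [x]; so the ratio is (K0 + P) / P whatever that crude bound was. *)
Lemma key m (tau : A -> R[i]) x : nuclear_dimension_le A m -> simple A -> tracial_state tau ->
  (forall t, tracial_state t -> t = tau) -> pos x -> ple x 1 -> x <> 0 ->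
  exists M1 M2, [/\ (0 < M1)%N, M2%:R * complex.Re (tau x) <= keyc m * M1%:R
    & sle (@allA _ A) (nseq M1 1) (nseq M2 x)].
Proof.
move=> hm sA ht hu px x1 x0; have hU := @usub_all _ A.
have [ls pt t1 tt] := ht.
have pt' y : pos y -> 0 <= tau y by move=> /pos_eltP; apply: pt.
set t := complex.Re (tau x); have t0 : 0 < t by apply: trace_faithful.
have tle : t <= 1 by have := pf_le ls pt' x1; rewrite t1.
have tC : tau x = t%:C by case: (ge0_Re (pt' x px)).
(* The colours together lose P (del + del) = 1/4. *)
pose P := m.+1; pose del : R := (8 * P%:R)^-1; pose kap : R := del ^+ 2 / (2 * P%:R).
have P0 : 1 <= P%:R :> R by rewrite ler1n.
have P0' : 0 < P%:R :> R by lra.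
have d0 : 0 < del by rewrite invr_gt0 mulr_gt0.
have d1 : del <= 1 by rewrite invf_le1 ?mulr_gt0 //; lra.
have dP : P%:R * del = 8^-1 by rewrite /del invfM mulrCA mulfV ?mulr1 // lt0r_neq0.
have kap0 : 0 < kap by rewrite divr_gt0 ?exprn_gt0 ?mulr_gt0.
have kap1 : kap <= 1 by rewrite ler_pdivrMr ?mulr_gt0 //; nra.
pose N := (Num.truncn (2 / (t * kap))).+1.
have tk : 0 < t * kap by rewrite mulr_gt0.
have hN : 2 <= N%:R * (t * kap).
  by rewrite -ler_pdivrMr // ltW // truncnS_gt.
have hN' : N%:R <= 2 / (t * kap) + 1.
  by rewrite /N -natr1 lerD2r truncn_le // divr_ge0 // ltW.
have s0 : 0 < t * kap / 4 by rewrite divr_gt0.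
have [S [e [e0 hS]]] := approx_trace hu x s0.
(* T0 contains all elements to which [th] is applied in the trace estimate; T adds 1, adjoints and
   squares, as needed for [cp_summand_gen]. *)
pose T0 := x :: S ++ map star S ++ [seq a * b | a <- S, b <- S].
pose T := 1 :: T0 ++ map star T0 ++ [seq star a * a | a <- T0].
pose M : R := 1 + \sum_(a <- T0) nrm a.
have M1 : 1 <= M by rewrite lerDl sumr_ge0 // => a _; apply: nrm_ge0.
have nM a : a \in T0 -> nrm a <= M.
  move=> /(big_rem a) h; rewrite /M h /= addrCA lerDl addr_ge0 // sumr_ge0 // => b _; exact: nrm_ge0.
pose e' : R := Num.min 2^-1 (Num.min (e / (64 * M ^+ 2)) (Num.min (8 * M)^-1 (del * (t * kap / 4)))).
have M0 : 0 < M by lra.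
have e'0 : 0 < e'.
  have i1 : 0 < e / (64 * M ^+ 2) by rewrite divr_gt0 // mulr_gt0 // exprn_gt0.
  have i2 : 0 < (8 * M)^-1 by rewrite invr_gt0 mulr_gt0.
  have i3 : 0 < del * (t * kap / 4) by exact: mulr_gt0.
  by rewrite /e' !lt_min i1 i2 i3 invr_gt0 ltr0n.
have e'1 : e' <= 2^-1 by rewrite /e' ge_min lexx.
have e'2 : e' <= e / (64 * M ^+ 2) by rewrite /e' !ge_min lexx orbT.
have e'3 : e' <= (8 * M)^-1 by rewrite /e' !ge_min lexx !orbT.
have e'4 : e' <= del * (t * kap / 4) by rewrite /e' !ge_min lexx !orbT.
have e'5 : 8 * e' * M <= 1 by rewrite mulrAC -ler_pdivlMl ?mulr1 // mulr_gt0.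
have e'6 : 4 * M * (8 * e' * M) <= e / 2.
  move: e'2; rewrite ler_pdivlMr; last by rewrite mulr_gt0 // exprn_gt0.
  by rewrite expr2; nra.
have e'7 : e' ^+ 2 <= e' by rewrite expr2; nra.
have [G [psi [phi [fdG cpsi ozphi happ]]]] := nuc_system hm (finite_seq T) (exprn_gt0 2 e'0).
pose th l := phi l \o psi l.
have cphi l : completely_positive (phi l) := proj1 (proj1 (ozphi l)).
have cth l : completely_positive (th l).
  case: (cphi l) (proj1 (cpsi l)) => lf hf [lg hg]; split; first by move=> a y z; rewrite /th /= lg lf.
  move=> k X /hg /hf [Y hY]; exists Y; rewrite -hY; by apply/matrixP => i j; rewrite !mxE.
have th1 l : ple (th l 1) 1.
  apply: ple_trans (cp_ple (cphi l) (proj2 (cpsi l))) _; rewrite -[X in ple _ X]rc1; apply: sa_ple.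
    by rewrite (oz_h (ozphi l)).
  exact: le_trans (oz_nrm (ozphi l) 1) (nrm1 _).
have nth1 l : nrm (th l 1) <= 1.
  apply: ple_nrm_rc => //; first by apply: (cp_pos (cth l)); apply: pos1.
  by rewrite rc1.
have appr a : a \in T -> nrm (\sum_l th l a - a) <= e' ^+ 2 by exact: happ.
have sumd a : a \in T0 -> forall l, nrm (th l a - th l 1 * a) <= 8 * e' * M.
  move=> ha; apply: cp_summand_gen => //; [by apply/andP; split; lra|exact: nM|].
  move=> y [->|[->|[->|->]]]; apply: appr; rewrite inE ?eqxx // !mem_cat ?ha ?orbT //.
    by rewrite (map_f star) ?orbT.
  by rewrite (map_f (fun a => star a * a)) ?orbT.
have col l := @color_step _ _ _ (psi l) (phi l) (fdG l) (ozphi l) (proj1 (cpsi l)) (proj2 (cpsi l))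
  S x P N t (e / 2) del del.
have [su [sb [psb hsum hsu hsb]]] : exists su sb : seq A, [/\ (forall a, a \in su ++ sb -> pos a),
    ple (\sum_l th l 1) (\sum_(a <- su ++ sb) a + (P%:R * (del + del))%:I),
    sle (@allA _ A) su (nseq (P * N) x) & sle (@allA _ A) (smul (2 * P) sb) (nseq P 1)].
  apply: colors_sum => l; apply: col => //; try by apply/andP; split.
  - move=> f lf pf f1 hf; rewrite -tC; apply: hS => // a b ha hb.
    by have := hf a b ha hb; rewrite mulrC divfK.
  - move=> a b ha hb.
    have -> : phi l (psi l a * psi l b - psi l (a * b) * psi l 1) * phi l 1 = th l a * th l b - th l (a * b) * th l 1.
      rewrite /th /= (ozM (fdG l) (ozphi l) (psi l a)) (ozM (fdG l) (ozphi l) (psi l (a * b))).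
      by rewrite (linB (proj1 (cphi l))) mulrBl.
    have aT : a \in T0 by rewrite inE mem_cat ha orbT.
    have bT : star b \in T0 by rewrite inE !mem_cat (map_f star hb) !orbT.
    have bT' : b \in T0 by rewrite inE mem_cat hb orbT.
    have abT : a * b \in T0 by rewrite inE !mem_cat (allpairs_f (fun a b => a * b) ha hb) !orbT.
    apply: le_trans e'6; apply: th_mult => //; try exact: nM; try exact: sumd.
    by rewrite !mulr_ge0 // ltW.
  have hx : x \in T by rewrite !inE eqxx orbT.
  have sx : star (\sum_l th l x - x) = \sum_l th l x - x.
    by rewrite starB (pos_sa px) star_sum; congr (_ - _); apply: eq_bigr => i _; rewrite -(cp_star (cth i)) (pos_sa px).
  have h1 := sa_ple sx (le_trans (appr x hx) (le_trans e'7 e'4)).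
  apply: (@ple_trans _ _ _ (\sum_l th l x)); first by apply: ple_term => i; apply: (cp_pos (cth i)).
  move: h1; rewrite /ple; set y := \sum_l _.
  by have -> : (del * (t * kap / 4))%:I + x - y = (del * (t * kap / 4))%:I - (y - x) by ncring.
(* What remains of 1 after the error 1/2 of the approximation and the loss 1/4 of the colours. *)
have hq : ple (4^-1)%:I (\sum_(a <- su ++ sb) a).
  have one : 1 \in T by rewrite inE eqxx.
  have s1 : star (\sum_l th l 1 - 1) = \sum_l th l 1 - 1.
    by rewrite starB star1 star_sum; congr (_ - _); apply: eq_bigr => i _; rewrite -(cp_star (cth i)) star1.
  have h1 := sa_pleN s1 (le_trans (appr 1 one) (le_trans e'7 e'1)).
  have := pleD h1 hsum; have -> : P%:R * (del + del) = 4^-1 :> R by move: dP; lra.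
  rewrite /ple; set y := \sum_l _; set w := \sum_(a <- _) _ => h.
  have -> : w - (4^-1)%:I = 2^-1%:I + (w + 4^-1%:I) - (- (y - 1) + y).
    have -> : w - (4^-1)%:I = w + (2^-1 + 4^-1 - 1)%:I.
      rewrite (_ : 2^-1 + 4^-1 - 1 = - 4^-1); last by lra.
      by rewrite rmorphN scaleNr.
    by rewrite -rcB -rcD rc1; ncring.
  exact: h.
have hcol : sle (@allA _ A) [:: 1] (su ++ sb).
  by apply: (sle_column csub_all psb _ _ hq) => //; rewrite invr_gt0.
pose K0 := (2 * P * (P * N))%N.
have step : sle (@allA _ A) (nseq (2 * P) 1) (nseq K0 x ++ nseq P 1).
  have hc := sle_smul hU (2 * P) hcol; rewrite -[[:: 1]]/(nseq 1 1) smul_nseq muln1 in hc.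
  apply: (sle_trans hU hc).
  apply: (sle_trans hU (sle_perm hU (perm_smul_cat _ _ _))); apply: (sle_cat hU) => //.
  by rewrite /K0 -smul_nseq; apply: (sle_smul hU).
(* Each round applies [step] 2^j times and feeds the surplus into the previous round. *)
have iter j : sle (@allA _ A) (nseq (2 ^ j * P) 1) (nseq (2 ^ j * K0) x ++ nseq P 1).
  elim: j => [|j IH]; first by rewrite !mul1n; apply: (sle_catr hU).
  have h1 := sle_smul hU (2 ^ j) step.
  rewrite smul_nseq mulnA -expnSr in h1.
  apply: (sle_trans hU h1); apply: (sle_trans hU (sle_perm hU (perm_smul_cat _ _ _))).
  rewrite !smul_nseq; apply: (sle_trans hU (sle_cat hU (sle_refl hU (nseq (2 ^ j * K0) x)) IH)).
  rewrite catA -nseqD; apply: (sle_cat hU); last exact: (sle_refl hU).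
  by rewrite -mulnDl addnn -muln2 -expnSr; apply: (sle_refl hU).
have [C0 [z hz]] := simple_full sA px x0.
have hC : sle (@allA _ A) [:: 1] (nseq C0 x).
  have h : cle (@allA _ A) (fun _ : unit => 1) (fun _ : 'I_C0 => x).
    by apply: (cle_exact (V := fun j _ => z j)) => // -[] [].
  by have := sle_fam hU h; rewrite !codom_cst card_unit card_ord.
(* Taking j = C0 makes 2^j P copies of x enough for P units of C0 copies each. *)
have jC : (C0 <= 2 ^ C0)%N by apply: ltnW; apply: ltn_expl.
exists (2 ^ C0 * P)%N, (2 ^ C0 * (K0 + P))%N; split.
- by rewrite muln_gt0 expn_gt0.
- rewrite -/t !natrM mulrAC -!mulrA [leRHS]mulrCA; apply: ler_wpM2l; first exact: ler0n.
  rewrite mulrC natrD /K0 !natrM /keyc -/P -/del -/kap.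
  have h1 : t * N%:R <= 2 / kap + 1.
    apply: le_trans (ler_wpM2l (ltW t0) hN') _; rewrite mulrDr mulr1; apply: lerD => //.
    have fe (a b : R) : 0 < a -> 0 < b -> a * (2 / (a * b)) = 2 / b.
      by move=> a0 b0; field; rewrite !lt0r_neq0.
    by rewrite fe.
  have : 2 * P%:R * P%:R * (t * N%:R) <= 2 * P%:R * P%:R * (2 / kap + 1).
    by apply: ler_wpM2l => //; rewrite !mulr_ge0.
  nra.
apply: (sle_trans hU (iter C0)); rewrite mulnDr nseqD; apply: (sle_cat hU); first exact: (sle_refl hU).
have hc := sle_smul hU P hC; rewrite -[[:: 1]]/(nseq 1 1) !smul_nseq muln1 in hc.
by apply: (sle_trans hU hc); apply: (sle_nseq hU); rewrite mulnC leq_mul2r jC orbT.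
Qed.
End Key.

(** * Matrix subalgebras of Q *)

Section MatrixRep.
Variable R : realType.
Local Notation C := R[i].
Local Notation "X ^*t" := (map_mx Num.conj X)^T (at level 8).

Lemma tcM m n l (X : 'M[C]_(m, n)) (Y : 'M[C]_(n, l)) : (X *m Y)^*t = Y^*t *m X^*t.
Proof. by rewrite map_mxM trmx_mul. Qed.

Lemma tcK m n (X : 'M[C]_(m, n)) : (X^*t)^*t = X.
Proof. by apply/matrixP => i j; rewrite !mxE /=; exact: conjCK. Qed.

Lemma tc_delta m n (i : 'I_m) (j : 'I_n) : (delta_mx i j : 'M[C]_(m, n))^*t = delta_mx j i.
Proof. by apply/matrixP => a b; rewrite !mxE rmorph_nat andbC. Qed.

Lemma sum_delta n : \sum_(i < n) delta_mx i i = 1%:M :> 'M[C]_n.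
Proof. by rewrite [RHS]scalar_mx_sum_delta; apply: eq_bigr => i _; rewrite scale1r. Qed.

Lemma mid_scalar u n (S : 'M[C]_(u, n)) (Y : 'M[C]_n) : u = 1%N ->
  exists c : C, S^*t *m (S *m Y *m S^*t) *m S = c *: (S^*t *m S).
Proof.
move=> u1; subst u; exists ((S *m Y *m S^*t) 0 0).
by rewrite {1}(mx11_scalar (S *m Y *m S^*t)) mul_mx_scalar -scalemxAl.
Qed.

(** Gram-Schmidt on a basis of the row space of P gives S with orthonormal rows, hence the
    factorisation through a space of dimension the trace. *)
Lemma proj_factor n (P : 'M[C]_n) : P *m P = P -> P^*t = P ->
  exists u (S : 'M[C]_(u, n)), [/\ P = S^*t *m S, S *m S^*t = 1%:M & \tr P = u%:R].
Proof.
move=> PP sP; suff [S [h1 h2]] : exists S : 'M[C]_(\rank P, n), P = S^*t *m S /\ S *m S^*t = 1%:M.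
  by exists (\rank P), S; split => //; rewrite {1}h1 mxtrace_mulC h2 mxtrace1.
pose S := schmidt (row_base P); exists S.
have e1 : S *m S^*t = 1%:M.
  by have /unitarymxP := schmidt_unitarymx (row_base P) (rank_leq_col P); rewrite map_trmx.
have eS : (S :=: P)%MS.
  apply: eqmx_trans (eq_row_base P); apply: eqmx_schmidt_free; exact: row_base_free.
have /submxP [Y hY] : (P <= S)%MS by rewrite eS.
have /submxP [Z hZ] : (S <= P)%MS by rewrite eS.
split => //.
have h1 : P *m (S^*t *m S) = P by rewrite {1}hY mulmxA -(mulmxA Y) e1 mulmx1 -hY.
have h2 : S *m P = S by rewrite {1}hZ -mulmxA PP -hZ.
have SS : (S^*t *m S)^*t = S^*t *m S by rewrite tcM tcK.
have h3 : (S^*t *m S) *m P = P.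
  by have := congr1 (fun X : 'M[C]_n => X^*t) h1; rewrite tcM sP SS.
by rewrite -{1}h3 -mulmxA h2.
Qed.

Lemma trace_idem n (P : 'M[C]_n) : P *m P = P -> \tr P = (\rank P)%:R.
Proof.
move=> PP; have e := mulmx_base P.
have rf := row_base_free P; have cf := col_base_full P.
move: (col_base P) (row_base P) e rf cf => c r e rf cf.
have h : r *m c = 1%:M.
  apply: (row_full_inj cf); apply: (row_free_inj rf).
  have : c *m r *m (c *m r) = c *m r by rewrite e.
  by rewrite mulmx1 !mulmxA.
have -> : \tr P = \tr (c *m r) by rewrite e.
by rewrite mxtrace_mulC h mxtrace1.
Qed.

Variable Q : cstarType R.
Definition mxrep k (e : 'M[C]_k -> Q) := [/\ linear e, {morph e : X Y / X *m Y >-> X * Y},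
  forall X, e X^*t = star (e X), e 1%:M = 1 & injective e].

Definition munits u (mu : 'I_u -> 'I_u -> Q) :=
  [/\ forall a b c d, mu a b * mu c d = if b == c then mu a d else 0,
      forall a b, star (mu a b) = mu b a & \sum_a mu a a = 1].

Section Rep.
Variables (k : nat) (e : 'M[C]_k -> Q).
Hypothesis he : mxrep e.
Let le : linear e. Proof. by case: he. Qed.
Let eM X Y : e (X *m Y) = e X * e Y. Proof. by case: he. Qed.
Let eS X : e X^*t = star (e X). Proof. by case: he. Qed.
Let e1 : e 1%:M = 1. Proof. by case: he. Qed.
Let ei : injective e. Proof. by case: he. Qed.

Lemma rep0 : e 0 = 0.
Proof. by have := le (-1) 0 0; rewrite scaler0 addr0 scaleN1r addNr. Qed.
Lemma repD X Y : e (X + Y) = e X + e Y.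
Proof. by have := le 1 X Y; rewrite !scale1r. Qed.
Lemma repZ (a : C) X : e (a *: X) = a *: e X.
Proof. by have := le a X 0; rewrite !addr0 rep0 addr0. Qed.
Lemma rep_sum I (r : seq I) (P : pred I) (F : I -> 'M[C]_k) :
  e (\sum_(i <- r | P i) F i) = \sum_(i <- r | P i) e (F i).
Proof. by apply: (big_morph e repD rep0). Qed.

Lemma rep_units : munits (fun i j => e (delta_mx i j)).
Proof.
split => [a b c d|a b|].
- by rewrite -eM mul_delta_mx_cond; case: eqP => _ /=; rewrite ?mulr0n ?rep0.
- by rewrite -eS tc_delta.
by rewrite -rep_sum sum_delta.
Qed.

Lemma rep_expand X : e X = \sum_i \sum_j X i j *: e (delta_mx i j).
Proof.
rewrite {1}(matrix_sum_delta X) rep_sum; apply: eq_bigr => i _; rewrite rep_sum.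
by apply: eq_bigr => j _; rewrite repZ.
Qed.
End Rep.

(** The preimage P of e_00 in the larger matrix algebra is S^* S with u rows. Matrix units v_ab of
    the corner, copied along the diagonal of the smaller algebra as sum_i E_i0 v_ab E_0i, commute
    with it. The last clause, for multiplicity one, is used to show that a tower of bounded size is
    stationary. *)
Lemma relative_units k k' (e : 'M[C]_k.+1 -> Q) (e' : 'M[C]_k'.+1 -> Q) : mxrep e -> mxrep e' ->
  range e `<=` range e' -> exists u (mu : 'I_u -> 'I_u -> Q),
  [/\ (u * k.+1 = k'.+1)%N, munits mu, (forall a b, range e' (mu a b)),
  (forall a b x, range e x -> mu a b * x = x * mu a b)
  & u = 1%N -> forall i j x, range e' x -> exists c : C,
      e (delta_mx 0 i) * x * e (delta_mx j 0) = c *: e (delta_mx 0 0)].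
Proof.
move=> he he' sub; pose E i j := e (delta_mx i j).
have [EM ES E1] := rep_units he.
have [le' e'M e'S e'1 e'i] := he'.
have /choice [F hF] : forall ij, exists X, e' X = E ij.1 ij.2.
  by move=> ij; have [X _ hX] := sub (E ij.1 ij.2) (ex_intro2 _ _ (delta_mx ij.1 ij.2) I erefl); exists X.
have hF' i j : e' (F (i, j)) = E i j by rewrite hF.
pose P := F (0, 0).
have PP : P *m P = P by apply: e'i; rewrite e'M !hF' EM eqxx.
have sP : P^*t = P by apply: e'i; rewrite e'S !hF' ES.
have [u [S [PS SS tP]]] := proj_factor PP sP.
pose v a b := e' (S^*t *m delta_mx a b *m S).
have vM a b c d : v a b * v c d = if b == c then v a d else 0.
  rewrite -e'M.
  have -> : S^*t *m delta_mx a b *m S *m (S^*t *m delta_mx c d *m S) = S^*t *m (delta_mx a b *m delta_mx c d) *m S.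
    by rewrite !mulmxA -(mulmxA _ S) SS mulmx1.
  by rewrite mul_delta_mx_cond; case: eqP => _ /=; rewrite ?mulr1n // mulr0n mulmx0 mul0mx (rep0 he').
have vS a b : star (v a b) = v b a by rewrite -e'S !tcM tcK tc_delta mulmxA.
have v1 : \sum_a v a a = E 0 0.
  rewrite -hF' -/P PS -(rep_sum he') -mulmx_suml -mulmx_sumr sum_delta mulmx1.
  by [].
have vE a b : E 0 0 * v a b = v a b.
  rewrite -v1 mulr_suml (bigD1 a) //= big1 ?addr0 ?vM ?eqxx // => c ca.
  by rewrite vM (negbTE ca).
have vE' a b : v a b * E 0 0 = v a b by rewrite -[LHS]starK starMr ES vS vE vS.
pose mu a b := \sum_i E i 0 * v a b * E 0 i.
have muE a b i j : mu a b * E i j = E i 0 * v a b * E 0 j.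
  rewrite /mu mulr_suml (bigD1 i) //= big1 ?addr0 => [|l li]; first by rewrite -!mulrA EM eqxx.
  by rewrite -!mulrA EM (negbTE li) !mulr0.
have Emu a b i j : E i j * mu a b = E i 0 * v a b * E 0 j.
  rewrite /mu mulr_sumr (bigD1 j) //= big1 ?addr0 => [|l li]; first by rewrite !mulrA EM eqxx.
  by rewrite !mulrA EM eq_sym (negbTE li) !mul0r.
exists u, mu; split.
- have tF i : \tr (F (i, i)) = \tr P.
    have -> : F (i, i) = F (i, 0) *m F (0, i) by apply: e'i; rewrite e'M !hF' EM eqxx.
    rewrite mxtrace_mulC; congr (\tr _); apply: e'i; by rewrite e'M !hF' EM eqxx.
  have : \tr (1%:M : 'M[C]_k'.+1) = \sum_i \tr (F (i, i)).
    rewrite -raddf_sum; congr (\tr _); apply: e'i; rewrite e'1 (rep_sum he') -E1.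
    by apply: eq_bigr => i _; rewrite hF'.
  rewrite mxtrace1 (eq_bigr (fun=> u%:R)) => [|i _]; last by rewrite tF tP.
  rewrite sumr_const card_ord => e0.
  have /eqP : k'.+1%:R = (u * k.+1)%:R :> C by rewrite e0 natrM mulr_natr.
  by rewrite eqr_nat => /eqP ->.
- split => [a b c d|a b|].
  + rewrite {2}/mu mulr_sumr.
    have -> : \sum_i mu a b * (E i 0 * v c d * E 0 i) = \sum_i E i 0 * (v a b * v c d) * E 0 i.
      apply: eq_bigr => i _; rewrite !mulrA muE; congr (_ * _).
      by rewrite -(mulrA _ (E 0 0)) vE.
    by rewrite vM; case: eqP => // _; apply: big1 => i _; rewrite mulr0 mul0r.
  + by rewrite /mu star_sum; apply: eq_bigr => i _; rewrite !starMr !ES vS mulrA.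
  rewrite /mu exchange_big /= -E1; apply: eq_bigr => i _.
  by rewrite -mulr_suml -mulr_sumr v1 !EM eqxx.
- move=> a b; exists (\sum_i F (i, 0) *m (S^*t *m delta_mx a b *m S) *m F (0, i)) => //.
  by rewrite /mu (rep_sum he'); apply: eq_bigr => i _; rewrite 2!e'M !hF'.
- move=> a b x [X _ <-]; rewrite (rep_expand he) mulr_sumr mulr_suml; apply: eq_bigr => i _.
  rewrite mulr_sumr mulr_suml; apply: eq_bigr => j _.
  by rewrite mulZr mulZl muE Emu.
move=> u1 i j x [X _ <-]; rewrite -/(E 0 i) -/(E j 0) -/(E 0 0).
pose Y := F (0, i) *m X *m F (j, 0).
have hY : E 0 i * e' X * E j 0 = e' (P *m Y *m P).
  by rewrite /Y !e'M !hF' !mulrA EM eqxx -!mulrA EM eqxx.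
have [c hc] := mid_scalar S Y u1; exists c.
rewrite hY -hF' -(repZ he') -/P; congr e'.
by rewrite PS -hc !mulmxA.
Qed.

(** The scalars c_ij are the matrix entries of x, recovered by expanding x between the diagonal
    units. *)
Lemma rep_range k (e : 'M[C]_k.+1 -> Q) x : mxrep e ->
  (forall i j, exists c : C, e (delta_mx 0 i) * x * e (delta_mx j 0) = c *: e (delta_mx 0 0)) -> range e x.
Proof.
move=> he h; have [EM _ E1] := rep_units he.
have /choice [c hc] : forall ij : 'I_k.+1 * 'I_k.+1, exists c : C,
  e (delta_mx 0 ij.1) * x * e (delta_mx ij.2 0) = c *: e (delta_mx 0 0) by move=> ij; apply: h.
exists (\sum_i \sum_j c (i, j) *: delta_mx i j) => //.
rewrite (rep_sum he) -[RHS]mul1r -[RHS]mulr1 -{1}E1 mulr_suml mulr_suml; apply: eq_bigr => i _.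
rewrite (rep_sum he) -E1 mulr_sumr; apply: eq_bigr => j _.
rewrite (repZ he); have := congr1 (fun y => e (delta_mx i 0) * y * e (delta_mx 0 j)) (hc (i, j)).
rewrite /= !mulrA EM eqxx -!mulrA EM eqxx mulZl mulZr !mulrA EM eqxx EM eqxx => <-.
by [].
Qed.

(** A one-dimensional subspace is closed: the approximating coefficients are bounded, and an
    ultrafilter supplies their limit. *)
Lemma line_closed (E y : Q) : E <> 0 -> (forall d : R, 0 < d -> exists c : C, nrm (y - c *: E) <= d) ->
  exists c : C, y = c *: E.
Proof.
move=> /nrm_gt0 E0 h.
have h' n : exists c : C, nrm (y - c *: E) <= n.+1%:R^-1 by apply: h; rewrite invr_gt0.
have [c hc] := choice h'.
have inv1 n : n.+1%:R^-1 <= 1 :> R by rewrite invf_le1 // ler1n.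
have bnd n : cnm (c n) <= (nrm y + 1) / nrm E.
  rewrite ler_pdivlMr // -nrmZ.
  have -> : c n *: E = y - (y - c n *: E) by rewrite subKr.
  apply: le_trans (nrmD _ _) _; rewrite nrmN; apply: lerD => //; exact: le_trans (hc n) (inv1 n).
have [U [hU UF]] := ultraFilterLemma eventually_filter.
have [l hl] := ulim_ex hU bnd.
exists l; apply/eqP; rewrite -subr_eq0; apply/eqP; apply: nrm_small => d d0.
have d2 : 0 < d / 2 by rewrite divr_gt0.
have d3 : 0 < d / 2 / nrm E by rewrite divr_gt0.
pose N := Num.truncn (d / 2)^-1.
have hN n : (N <= n)%N -> n.+1%:R^-1 <= d / 2.
  move=> hn; rewrite invf_ple ?posrE //; apply: ltW; apply: lt_le_trans (truncnS_gt _) _.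
  by rewrite ler_nat.
have UN : U [set n | (N <= n)%N] by apply: UF; exists N.
have fU : ProperFilter U := @ultra_proper _ U hU.
have hI : U ([set n | (N <= n)%N] `&` [set t | cnm (c t - l) <= d / 2 / nrm E]) by apply: filterI => //; exact: hl.
have [n [hn1 hn2]] := @filter_ex _ U fU _ hI.
have -> : y - l *: E = (y - c n *: E) + (c n - l) *: E.
  by rewrite scalerBl addrA addrNK.
apply: le_trans (nrmD _ _) _; rewrite [d]splitr; apply: lerD; first exact: le_trans (hc n) (hN n hn1).
by rewrite nrmZ -ler_pdivlMr.
Qed.
End MatrixRep.

(** * Divisibility of K_0 and large relative commutants *)

Section Rational.
Variables (R : realType) (Q : cstarType R).
Local Notation C := R[i].
Local Notation "X ^*t" := (map_mx Num.conj X)^T (at level 8).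

Section Trace.
Variables (k : nat) (f : Q -> 'M[C]_k).
Hypotheses (lf : linear f) (fM : forall x y, f (x * y) = f x *m f y).

Let fD x y : f (x + y) = f x + f y. Proof. by have := lf 1 x y; rewrite !scale1r. Qed.
Let f0 : f 0 = 0. Proof. by have := lf (-1) 0 0; rewrite scaler0 addr0 scaleN1r addNr. Qed.
Let fsum I (r : seq I) (P : pred I) (F : I -> Q) : f (\sum_(i <- r | P i) F i) = \sum_(i <- r | P i) f (F i).
Proof. by apply: (big_morph f fD f0). Qed.

Definition mtr m (p : 'M[Q]_m) : C := \sum_i \tr (f (p i i)).

Lemma mtr_dsum m n (p : 'M[Q]_m) (q : 'M[Q]_n) : mtr (dsum_mx p q) = mtr p + mtr q.
Proof.
rewrite /mtr big_split_ord /=; congr (_ + _); apply: eq_bigr => i _.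
  by rewrite /dsum_mx block_mxEul.
by rewrite /dsum_mx block_mxEdr.
Qed.

Lemma mtr_mulC m n (v : 'M[Q]_(n, m)) (w : 'M[Q]_(m, n)) : mtr (w *m v) = mtr (v *m w).
Proof.
have E a b (x : 'M[Q]_(a, b)) (y : 'M[Q]_(b, a)) : mtr (x *m y) = \sum_i \sum_j \tr (f (x i j) *m f (y j i)).
  apply: eq_bigr => i _; rewrite !mxE fsum raddf_sum; by apply: eq_bigr => j _; rewrite fM.
rewrite !E exchange_big; apply: eq_bigr => i _; apply: eq_bigr => j _; exact: mxtrace_mulC.
Qed.

Lemma mtr_stable m n (p : 'M[Q]_m) (q : 'M[Q]_n) : stably_equivalent p q -> mtr p = mtr q.
Proof.
move=> [l [r [_ [v [h1 h2]]]]]; apply: (addIr (mtr r)); rewrite -!mtr_dsum -h1 -h2; exact: mtr_mulC.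
Qed.

(** Flattening turns a projection over Q, when Q is a matrix algebra, into a scalar idempotent,
    whose trace is its rank. *)
Lemma mtr_int m (p : 'M[Q]_m) : projection_mx p -> exists a : nat, mtr p = a%:R.
Proof.
move=> [pp _]; pose T := ('I_m * 'I_k)%type.
pose P : 'M[C]_#|{: T}| := \matrix_(s, t) f (p (enum_val s).1 (enum_val t).1) (enum_val s).2 (enum_val t).2.
have re (F : T -> C) : \sum_(s < #|{: T}|) F (enum_val s) = \sum_i \sum_j F (i, j).
  rewrite -(big_enum_val (fun x => F x)) pair_bigA /=; by apply: eq_big => [x|[i j] _] //; rewrite inE.
have PP : P *m P = P.
  apply/matrixP => s t; rewrite !mxE.
  transitivity (\sum_i \sum_j f (p (enum_val s).1 i) (enum_val s).2 j * f (p i (enum_val t).1) j (enum_val t).2).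
    rewrite -[RHS](re (fun x : T => f (p (enum_val s).1 x.1) (enum_val s).2 x.2 *
      f (p x.1 (enum_val t).1) x.2 (enum_val t).2)).
    by apply: eq_bigr => u _; rewrite !mxE.
  rewrite -[p in RHS]pp mxE fsum summxE; apply: eq_bigr => i _; by rewrite fM mxE.
exists (\rank P); rewrite -(trace_idem PP) /mtr /mxtrace.
rewrite -[LHS](re (fun x : T => f (p x.1 x.1) x.2 x.2)).
by apply: eq_bigr => u _; rewrite mxE.
Qed.
End Trace.

Lemma dsum_proj m n (p : 'M[Q]_m) (q : 'M[Q]_n) : projection_mx p -> projection_mx q -> projection_mx (dsum_mx p q).
Proof.
move=> [pp sp] [qq sq]; split; rewrite /dsum_mx.
  by rewrite mulmx_block !mul0mx !mulmx0 !addr0 !add0r pp qq.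
rewrite /adjmx map_block_mx tr_block_mx -/(adjmx p) -/(adjmx q) sp sq; congr block_mx;
  by apply/matrixP => i j; rewrite !mxE star0.
Qed.

(** The trace of the unit is k+1 and traces of projections are integers, so the class of 1 is not
    divisible by k+2; in the rationals it would be. *)
Lemma not_rational k (e : 'M[C]_k.+1 -> Q) : mxrep e -> range e = setT -> ~ K0_isomorphic Q rat.
Proof.
move=> he re [kap [kD kE kS]].
have [le eM eS e1 ei] := he.
have /choice [f hf] : forall x, exists X, e X = x.
  move=> x; have [X _ hX] : range e x by rewrite re.
  by exists X.
have lf : linear f by move=> a x y; apply: ei; rewrite (repD he) (repZ he) !hf.
have fM x y : f (x * y) = f x *m f y by apply: ei; rewrite eM !hf.
have f1 : f 1 = 1%:M by apply: ei; rewrite hf e1.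
pose L := k.+2.
pose one : 'M[Q]_1 := const_mx 1.
have pone : projection_mx one.
  split; first by apply/matrixP => i j; rewrite !mxE big_ord1 !mxE mulr1.
  by apply/matrixP => i j; rewrite !mxE star1.
have [m [n [p [q [pp pq hpq]]]]] := kS (kap _ one / L%:R).
have pow (a : nat) : forall l (r : 'M[Q]_l), projection_mx r -> exists l' (r' : 'M[Q]_l'),
   [/\ projection_mx r', kap _ r' = kap _ r *+ a.+1 & mtr f r' = mtr f r *+ a.+1].
  move=> l r pr; elim: a => [|a [l' [r' [h1 h2 h3]]]]; first by exists l, r.
  exists (l + l')%N, (dsum_mx r r'); split; first exact: dsum_proj.
    by rewrite kD // h2 [RHS]mulrS.
  by rewrite mtr_dsum // h3 [RHS]mulrS.
have [mp [p' [hp1 hp2 hp3]]] := pow k.+1 _ _ pp.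
have [mq [q' [hq1 hq2 hq3]]] := pow k.+1 _ _ pq.
have : kap _ p' = kap _ (dsum_mx q' one).
  have hc : kap _ one = (kap _ p - kap _ q) *+ k.+2.
    by rewrite -hpq -[RHS]mulr_natr divfK // pnatr_eq0.
  by rewrite kD // hp2 hq2 hc mulrnBl addrC subrK.
move=> /(kE _ _ _ _ hp1 (dsum_proj hq1 pone)) /(mtr_stable lf fM).
rewrite mtr_dsum // hp3 hq3.
have [a ->] := mtr_int lf fM pp; have [b ->] := mtr_int lf fM pq.
have -> : mtr f one = k.+1%:R by rewrite /mtr big_ord1 mxE f1 mxtrace1.
move=> h0; have /eqP : (a * k.+2)%:R = (b * k.+2 + k.+1)%:R :> C by rewrite natrD !natrM !mulr_natr.
rewrite eqr_nat => /eqP h.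
have : (k.+2 %| k.+1)%N by rewrite -(dvdn_addr _ (dvdn_mull b (dvdnn k.+2))) -h dvdn_mull.
by move=> /dvdn_leq; rewrite ltnn => /(_ isT).
Qed.

(** The only consequences of the hypothesis on Q used later: an increasing dense tower of matrix
    algebras whose relative commutants contain arbitrarily large systems of matrix units. *)
Lemma universal_units : universal_UHF Q -> exists B : nat -> Q -> Prop,
  [/\ forall n x, B n x -> B n.+1 x, forall n x, B n x -> B n (star x),
    (forall x (d : R), 0 < d -> exists n y, B n y /\ nrm (y - x) <= d),
    forall n, exists k (mu : 'I_k.+1 -> 'I_k.+1 -> Q), munits mu /\
       forall x, B n x <-> exists c : 'I_k.+1 -> 'I_k.+1 -> C, x = \sum_i \sum_j c i j *: mu i j
  & forall n U, exists n' u (mu : 'I_u.+1 -> 'I_u.+1 -> Q),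
      [/\ (n <= n')%N, (U <= u)%N, munits mu, (forall a b, B n' (mu a b))
        & forall a b x, B n x -> mu a b * x = x * mu a b]].
Proof.
move=> [[B [fB incB dB]] hK].
have /choice [s hs] : forall n, exists s : {k & 'M[C]_k.+1 -> Q}, mxrep (projT2 s) /\ range (projT2 s) = B n.
  by move=> n; have [k [e [h1 h2 h3 h4 [h5 h6]]]] := fB n; exists (existT _ k e); split.
pose k n := projT1 (s n); pose e n : 'M[C]_((k n).+1) -> Q := projT2 (s n).
have he n : mxrep (e n) by case: (hs n).
have re n : range (e n) = B n by case: (hs n).
have inc n n' : (n <= n')%N -> B n `<=` B n'.
  by move=> /subnKC <-; elim: (n' - n)%N => [|d IH]; rewrite ?addn0 // addnS; apply: subset_trans IH _.
have inc' n n' : (n <= n')%N -> range (e n) `<=` range (e n') by rewrite !re; apply: inc.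
have dens x (d : R) : 0 < d -> exists n y, B n y /\ nrm (y - x) <= d.
  by move=> d0; have [y [n _ hy] hyx] := dense_approx x dB d0; exists n, y.
(* If the sizes were bounded, take a stage N of largest size. All later stages contain it with
   multiplicity one, so by density and [line_closed] it is all of Q, contradicting
   [not_rational]. *)
have unb U : exists n, (U <= k n)%N.
  apply: contrapT => hn; have hb n : (k n <= U)%N.
    by rewrite leqNgt; apply/negP => h; apply: hn; exists n; apply: ltnW.
  pose P j := `[< exists n, k n = j >].
  have exP : exists j, P j by exists (k 0%N); apply/asboolP; exists 0%N.
  have ubP j : P j -> (j <= U)%N by move=> /asboolP [n <-].
  have [K /asboolP [N hN] maxK] := ex_maxnP exP ubP.
  have kN n : (k n <= k N)%N by rewrite hN; apply: maxK; apply/asboolP; exists n.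
  apply: (not_rational (he N)); last exact: hK.
  apply/seteqP; split => // x _; apply: (rep_range (he N)) => i j.
  have E0 : e N (delta_mx 0 0) <> 0.
    move=> h; have [_ _ _ _ inj] := he N; have := inj (delta_mx 0 0) 0.
    rewrite h (rep0 (he N)) => /(_ erefl) /matrixP /(_ 0 0) /eqP; by rewrite !mxE eqxx /= oner_eq0.
  apply: line_closed => // d d0.
  pose M := nrm (e N (delta_mx 0 i)) * nrm (e N (delta_mx j 0)) + 1.
  have M0 : 0 < M by rewrite ltr_wpDl // mulr_ge0 ?nrm_ge0.
  have [n [y [hy hyx]]] := dens x _ (divr_gt0 d0 M0).
  have hy' : range (e (maxn n N)) y by rewrite re; apply: inc hy; exact: leq_maxl.
  have [u [mu [hu _ _ _ hc]]] := relative_units (he N) (he (maxn n N)) (inc' _ _ (leq_maxr n N)).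
  have u1 : u = 1%N.
    have := kN (maxn n N); case: u {mu hc} hu => [|[|u]] // hu.
    by rewrite -ltnS -hu !mulSn => h; exfalso; move: h; lia.
  have [c hc'] := hc u1 i j y hy'; exists c; rewrite -hc' -mulrBl -mulrBr.
  apply: le_trans (nrmM _ _) _; apply: (@le_trans _ _ (nrm (e N (delta_mx 0 i)) * (d / M) * nrm (e N (delta_mx j 0)))).
    apply: ler_wpM2r; first exact: nrm_ge0.
    by apply: nrmM_le => //; rewrite -nrmN opprB.
  rewrite (_ : nrm _ * (d / M) * nrm _ = d * (nrm (e N (delta_mx 0 i)) * nrm (e N (delta_mx j 0))) / M); last by ring.
  by rewrite ler_pdivrMr //; apply: ler_wpM2l; [exact: ltW|rewrite /M lerDl].
exists B; split => //.
- by move=> n x; rewrite -!re => -[X _ <-]; have [_ _ hS _ _] := he n; exists (X^*t).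
- move=> n; exists (k n), (fun i j => e n (delta_mx i j)); split; first exact: rep_units.
  move=> x; rewrite -re; split => [[X _ <-]|[c ->]]; first by exists X; exact: rep_expand.
  exists (\sum_i \sum_j c i j *: delta_mx i j) => //; rewrite (rep_sum (he n)); apply: eq_bigr => i _.
  by rewrite (rep_sum (he n)); apply: eq_bigr => j _; rewrite (repZ (he n)).
(* Size above (U+1) (k n + 1) forces the multiplicity over stage n to exceed U. *)
move=> n U; have [N hN] := unb (U.+1 * (k n).+1)%N.
have [u [mu [hu hmu hB hc _]]] := relative_units (he n) (he (maxn n N)) (inc' _ _ (leq_maxl n N)).
have hN' : (k N <= k (maxn n N))%N.
  have [u' [_ [hu' _ _ _ _]]] := relative_units (he N) (he (maxn n N)) (inc' _ _ (leq_maxr n N)).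
  rewrite -ltnS -hu'; case: u' hu' => [|u'] // _; by rewrite mulSn leq_addr.
have Uu : (U < u)%N by rewrite -(@ltn_pmul2r (k n).+1) // hu; apply: leq_ltn_trans (leq_trans _ (leq_trans hN hN')) _; rewrite ?leq_mul2r ?leqnSn ?orbT.
case: u mu hu hmu hB hc Uu => [|u] mu // hu hmu hB hc Uu.
exists (maxn n N), u, mu; split => //; first exact: leq_maxl.
  by move=> a b; rewrite -re; exact: hB.
by move=> a b x; rewrite -re; exact: hc.
Qed.
End Rational.

(** * Quasidiagonal models *)

Section Model.
Variables (R : realType) (A : cstarType R) (tau : A -> R[i]).
Hypotheses (ht : tracial_state tau) (hu : forall t, tracial_state t -> t = tau).
Local Notation C := R[i].

Lemma approx_traces (T : seq A) (d : R) : 0 < d -> exists (S : seq A) (e : R), 0 < e /\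
  forall f : A -> R[i], scalar f -> (forall x, pos x -> 0 <= f x) -> complex.Re (f 1) <= 1 ->
    (forall a b, a \in S -> b \in S -> cnm (f (a * b) - f (b * a)) <= e) ->
    forall x, x \in T -> cnm (f x - tau x * f 1) <= d.
Proof.
move=> d0; elim: T => [|x T [S [e [e0 hS]]]]; first by exists [::], 1.
have [S' [e' [e'0 hS']]] := approx_trace hu x d0.
exists (S ++ S'), (Num.min e e'); split; first by rewrite lt_min e0.
move=> f lf pf f1 hf y; rewrite inE => /orP [/eqP ->|hy].
  apply: hS' => // a b ha hb; apply: le_trans (hf a b _ _) _; rewrite ?mem_cat ?ha ?hb ?orbT //.
  by rewrite ge_min lexx orbT.
apply: hS => // a b ha hb; apply: le_trans (hf a b _ _) _; rewrite ?mem_cat ?ha ?hb ?orbT //.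
by rewrite ge_min lexx.
Qed.

(** Full matrix algebras, described by having a single block, so that the results on minimal systems
    apply directly. *)
Definition factor (M : cstarType R) := finite_dimensional [set: M] /\
  forall q r : M, minimal q -> minimal r -> eqv q r.

Lemma full_factor (M : cstarType R) : full_matrix_subalgebra [set: M] -> factor M.
Proof.
move=> [k [e [h1 h2 h3 h4 [h5 h6]]]]; have he : mxrep e by split.
have ex x : exists X, e X = x.
  have [X _ hX] : range e x by rewrite h6.
  by exists X.
split.
  pose T := ('I_k.+1 * 'I_k.+1)%type.
  exists #|{: T}|, (fun s => e (delta_mx (enum_val s).1 (enum_val s).2)) => x _.
  have [X <-] := ex x; exists (fun s => X (enum_val s).1 (enum_val s).2).
  rewrite (rep_expand he) pair_bigA /=.
  rewrite -(big_enum_val (fun s : T => X s.1 s.2 *: e (delta_mx s.1 s.2))).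
  by apply: eq_bigl => s; rewrite inE.
move=> q r [pq [q0 _]] [pr [r0 _]]; have [X hX] := ex q; have [Y hY] := ex r.
have nz (Z : 'M[C]_k.+1) : e Z <> 0 -> exists i j, Z i j != 0.
  move=> hZ; apply: contrapT => hn; apply: hZ; rewrite (_ : Z = 0) ?(rep0 he) //.
  apply/matrixP => i j; rewrite mxE; apply/eqP; apply: contrapT => /negP h; apply: hn; by exists i, j.
have [a [b hab]] : exists i j, X i j != 0 by apply: nz; rewrite hX.
have [c [d hcd]] : exists i j, Y i j != 0 by apply: nz; rewrite hY.
exists (e (delta_mx b c)); rewrite -hX -hY -!h2 => h.
have /matrixP /(_ a d) : X *m delta_mx b c *m Y = 0 by apply: h5; rewrite h (rep0 he).
rewrite !mxE (bigD1 c) //= big1 ?addr0 => [|i ic]; last first.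
  by rewrite mxE big1 ?mul0r // => j _; rewrite mxE (negbTE ic) andbF mulr0.
rewrite mxE (bigD1 b) //= big1 ?addr0 => [|i ib]; last by rewrite mxE (negbTE ib) mulr0.
by rewrite mxE !eqxx mulr1 => /eqP; rewrite mulf_eq0 (negbTE hab) (negbTE hcd).
Qed.

Section Coefs.
Variables (M : cstarType R) (k : nat) (p : 'I_k -> M).
Hypothesis ms : msys p.

Lemma proj_nrm1 (q : M) : projection q -> q <> 0 -> nrm q = 1.
Proof.
move=> [qq sq] /nrm_gt0 q0; have := nrm_sa sq; rewrite qq expr2 => e.
by apply: (mulfI (lt0r_neq0 q0)); rewrite mulr1.
Qed.

Lemma coef_nrm i x : cnm (coef p i x) <= nrm x.
Proof.
have [[hp p0 _] _ _] := ms.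
have <- : nrm (coef p i x *: p i) = cnm (coef p i x) by rewrite nrmZ proj_nrm1 ?mulr1.
rewrite -(coefP ms); apply: le_trans (nrmM_le (nrmM_le (lexx _) (lexx (nrm x))) (lexx _)) _.
by rewrite proj_nrm1 // mul1r mulr1.
Qed.

Lemma diag_nrm (c : 'I_k -> R) r : 0 <= r -> (forall i, `|c i| <= r) -> nrm (\sum_i c i *^ p i) <= r.
Proof.
move=> r0 hc; have [[hp _ _] p1 _] := ms.
have E : r%:C *: (1 : M) = \sum_i r *^ p i by rewrite -p1 scaler_sumr.
apply: sa_le_nrm => //.
- by rewrite star_sum; apply: eq_bigr => i _; rewrite starZr (proj2 (hp i)).
- rewrite E -sumrB; apply: pos_sum => i _; rewrite rcB; apply: posZ; last exact: proj_pos.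
  by rewrite subr_ge0; apply: le_trans (hc i); apply: ler_norm.
rewrite E -big_split /=; apply: pos_sum => i _; rewrite rcD; apply: posZ; last exact: proj_pos.
by have := hc i; rewrite ler_norml => /andP [h _]; lra.
Qed.

Definition ftr x := \sum_i coef p i x.

Lemma ftrD x y : ftr (x + y) = ftr x + ftr y.
Proof. by rewrite /ftr -big_split; apply: eq_bigr => i _; rewrite (coefD ms). Qed.
Lemma ftrZ a x : ftr (a *: x) = a * ftr x.
Proof. by rewrite /ftr mulr_sumr; apply: eq_bigr => i _; rewrite (coefZ ms). Qed.
Lemma ftrB x y : ftr (x - y) = ftr x - ftr y.
Proof. by rewrite -[- y]scaleN1r ftrD ftrZ mulN1r. Qed.
Lemma ftr_ge0 x : pos x -> 0 <= ftr x.
Proof. by move=> px; apply: sumr_ge0 => i _; apply: (coef_ge0 ms). Qed.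

Hypothesis fM : factor M.
Lemma ftr_btr q x : minimal q -> ftr x = btr p q x.
Proof.
move=> mq; rewrite /ftr /btr [RHS]big_mkcond; apply: eq_bigr => i _.
by rewrite asboolT //; apply: (proj2 fM) => //; exact: msys_min.
Qed.

Lemma ftr_comm (q : M) x y : minimal q -> ftr (x * y) = ftr (y * x).
Proof. by move=> mq; rewrite !(ftr_btr _ mq); apply: btr_comm. Qed.
End Coefs.

Lemma ftr_system (M : cstarType R) k l (p : 'I_k -> M) (r : 'I_l -> M) (q x : M) : factor M ->
  msys p -> msys r -> minimal q -> ftr p x = ftr r x.
Proof. by move=> fM mp mr mq; rewrite (ftr_btr _ fM _ mq) // (ftr_btr _ fM _ mq) //; apply: btr_system. Qed.

(* A quasidiagonal model: [sg] maps into the corner of the factor [M] at the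
   projection [sum v_i v_i^*] of rank k. *)
Definition qmodel (S : seq A) (e : R) (M : cstarType R) (sg : A -> M) k (v : 'I_k -> M) (e0 : M) :=
  let g0 := \sum_i v i * star (v i) in
  [/\ (0 < k)%N /\ factor M, minimal e0 /\ (forall i j, star (v i) * v j = if i == j then e0 else 0),
    [/\ linear sg, forall x, pos x -> pos (sg x), forall x, sg (star x) = star (sg x) & forall x, nrm (sg x) <= nrm x],
    (forall a, g0 * sg a = sg a /\ sg a * g0 = sg a) /\ nrm (sg 1 - g0) <= e
  & (forall a b, a \in S -> b \in S -> nrm (sg (a * b) - sg a * sg b) <= e) /\
    forall a l (r : 'I_l -> M), a \in S -> star a = a -> msys r -> cnm (ftr r (sg a) - k%:R * tau a) <= k%:R * e].

(** The image y of 1 is nearly idempotent; its spectral projection g0 for eigenvalues at least 1/2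
    is close to y, and compressing by g0 keeps the map nearly multiplicative. The normalised trace
    of the corner is then a nearly tracial functional, hence near tau by uniqueness. *)
Lemma qd_model (S : seq A) (e : R) : (1 : A) <> 0 -> quasidiagonal A -> 0 < e ->
  exists (M : cstarType R) (sg : A -> M) k (v : 'I_k -> M) (e0 : M), qmodel S e sg v e0.
Proof.
have aux1 (a b : R) : a <= 2 * b -> b <= 8^-1 -> `|a - 1| < b -> False.
  by move=> h1 h2; rewrite ltr_norml => /andP [h3 _]; lra.
have aux2 (a b : R) : 0 <= a -> a <= 1 -> a - a ^+ 2 <= b -> `|a - (if 2^-1 <= a then 1 else 0)| <= 2 * b.
  move=> h1 h2 h3; rewrite expr2 in h3; case: (leP 2^-1 a) => h4; rewrite ler_norml; apply/andP; split; nra.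
move=> A1 qd e0; have e2 : 0 < e / 2 by rewrite divr_gt0.
have [S1 [e1 [e10 hS1]]] := approx_traces S e2.
pose T := 1 :: (S ++ S1) ++ [seq a * b | a <- S ++ S1, b <- S ++ S1].
pose L : R := 1 + \sum_(a <- T) nrm a.
have L1 : 1 <= L by rewrite lerDl sumr_ge0 // => a _; apply: nrm_ge0.
have L0 : 0 < L by lra.
have nL a : a \in T -> nrm a <= L.
  move=> /(big_rem a) h; rewrite /L h /= addrCA lerDl addr_ge0 // sumr_ge0 // => b _; exact: nrm_ge0.
(* With norms at most L, compression costs 20 L^2 d in multiplicativity and a commutator twice that;
   64 L^2 d covers both. *)
pose d : R := Num.min 8^-1 (Num.min (e / (64 * L ^+ 2)) (e1 / (64 * L ^+ 2))).
have L2 : 0 < 64 * L ^+ 2 by rewrite mulr_gt0 // exprn_gt0.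
have d0 : 0 < d by rewrite /d !lt_min !divr_gt0 // invr_gt0 ltr0n.
have d8 : d <= 8^-1 by rewrite /d ge_min lexx.
have de : d * (64 * L ^+ 2) <= e by rewrite -ler_pdivlMr // /d !ge_min lexx orbT.
have de1 : d * (64 * L ^+ 2) <= e1 by rewrite -ler_pdivlMr // /d !ge_min lexx !orbT.
have [M [s0 [hM [cs ns] hmul hnrm]]] := qd [set` T] d (finite_seq T) d0.
have fM := full_factor hM; have ls := proj1 cs.
have ns' x : nrm (s0 x) <= nrm x by have := ns x; rewrite !nrmE lecC.
have n1 : nrm (1 : A) = 1.
  apply: (mulfI (lt0r_neq0 (nrm_gt0 A1))); rewrite mulr1 -{3}[1]mulr1 -{3}star1.
  by rewrite nrm_cs expr2.
have mul a b : a \in T -> b \in T -> nrm (s0 (a * b) - s0 a * s0 b) <= d.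
  by move=> ha hb; have := hmul a b ha hb; rewrite nrm_lt => /ltW.
have oneT : 1 \in T by rewrite inE eqxx.
pose y := s0 1; have py : pos y by apply: (cp_pos cs); apply: pos1.
have y1 : ple y 1.
  rewrite -[X in ple _ X]rc1; apply: sa_ple; first exact: pos_sa.
  by apply: le_trans (ns' 1) _; rewrite n1.
have [N [p [ms /choice [c hc]]]] := fd_system (proj1 fM) (pos_sa py).
have c01 := adapted_unit py y1 ms hc.
have [[hp p0 po] p1 _] := ms.
have np i : nrm (p i) = 1 by apply: proj_nrm1.
have cc i : c i - c i ^+ 2 <= d.
  have <- : nrm ((y - y * y) * p i) = c i - c i ^+ 2.
    rewrite mulrBl -mulrA !hc mulZr hc rcM rcB nrmZ0 ?np ?mulr1 ?expr2 //.
    by have := c01 i; nra.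
  have h1 : nrm (y - y * y) <= d by have := mul 1 1 oneT oneT; rewrite mulr1.
  by have := nrmM_le h1 (lexx (nrm (p i))); rewrite np mulr1.
pose K i := 2^-1 <= c i.
have ySum : y = \sum_i c i *^ p i by rewrite -[y]mulr1 -p1 mulr_sumr; apply: eq_bigr => i _; rewrite hc.
pose g0 := \sum_(i | K i) p i.
have g0E : g0 = \sum_i (if K i then 1 : R else 0) *^ p i.
  by rewrite /g0 big_mkcond; apply: eq_bigr => i _; case: ifP; rewrite ?rc1 ?rc0.
have yg : nrm (y - g0) <= 2 * d.
  have -> : y - g0 = \sum_i (c i - (if K i then 1 : R else 0)) *^ p i.
    by rewrite ySum g0E -sumrB; apply: eq_bigr => i _; rewrite rcB.
  apply: diag_nrm => //; first by lra.
  move=> i; rewrite /K; have h3 := cc i; have /andP [h0 h1] := c01 i.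
  exact: aux2.
(* Quasidiagonality keeps the norm of y near 1, so y is not close to 0 and the corner is nonzero. *)
have [i0 Ki0] : exists i, K i.
  apply: contrapT => hn; have z : g0 = 0.
    by rewrite /g0 big_pred0 // => i; apply/negbTE/negP => h; apply: hn; exists i.
  have := hnrm 1 oneT; rewrite !nrmE -rmorphB /= n1 => h.
  have : `|nrm y - 1| < d.
    move: h; rewrite normc_def /= expr0n addr0 sqrtr_sqr ltcE /= => /andP [_]; exact.
  by rewrite z subr0 in yg; exact: aux1.
pose k := #|K|; have k0 : (0 < k)%N by apply/card_gt0P; exists i0.
have /choice [w hw] : forall i : 'I_N, exists w, [/\ star w * w = p i0, w * star w = p i, p i * w = w & w * p i0 = w].
  by move=> i; apply: eqv_pi; try exact: msys_min; apply: (proj2 fM); exact: msys_min.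
pose v (s : 'I_k) := w (enum_val s).
have vv s t : star (v s) * v t = if s == t then p i0 else 0.
  rewrite /v; have [<-|st] := eqVneq s t; first by have [] := hw (enum_val s).
  have [_ _ h1 _] := hw (enum_val s); have [_ _ h2 _] := hw (enum_val t).
  rewrite -h1 -h2 starMr (proj2 (hp _)) -mulrA (mulrA (p _)) po ?mul0r ?mulr0 //.
  by move=> /enum_val_inj e'; rewrite e' eqxx in st.
have gv : \sum_s v s * star (v s) = g0.
  rewrite (eq_bigr (fun s : 'I_k => p (enum_val s))) => [|s _]; last by have [_ -> _ _] := hw (enum_val s).
  rewrite /g0; symmetry; apply: (etrans _ (big_enum_val p)); exact: eq_bigl.
have gg : g0 * g0 = g0.
  rewrite -gv mulr_suml; apply: eq_bigr => s _; rewrite mulr_sumr (bigD1 s) //= big1 ?addr0.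
    by rewrite -!mulrA (mulrA (star _)) vv eqxx; have [_ _ _ h] := hw (enum_val s); rewrite /v mulrA h.
  by move=> t ts; rewrite -!mulrA (mulrA (star _)) vv eq_sym (negbTE ts) mul0r mulr0.
have sg0 : star g0 = g0 by rewrite /g0 star_sum; apply: eq_bigr => i _; rewrite (proj2 (hp i)).
have ng : nrm g0 <= 1 by apply: proj_nrm.
pose sg a := g0 * s0 a * g0.
have lsg : linear sg by move=> a x z; rewrite /sg ls mulrDr mulrDl mulZr mulZl.
have near a : a \in T -> nrm (s0 a - sg a) <= 2 * (d + L * (2 * d)).
  move=> ha.
  have r1 : nrm (s0 a - s0 a * g0) <= d + L * (2 * d).
    have -> : s0 a - s0 a * g0 = (s0 (a * 1) - s0 a * y) + s0 a * (y - g0) by rewrite mulr1; ncring.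
    apply: le_trans (nrmD _ _) _; apply: lerD; first exact: mul.
    by apply: nrmM_le => //; apply: le_trans (ns' a) (nL a ha).
  have r2 : nrm (s0 a - g0 * s0 a) <= d + L * (2 * d).
    have -> : s0 a - g0 * s0 a = (s0 (1 * a) - y * s0 a) + (y - g0) * s0 a by rewrite mul1r; ncring.
    apply: le_trans (nrmD _ _) _; apply: lerD; first exact: mul.
    by rewrite mulrC; apply: nrmM_le => //; apply: le_trans (ns' a) (nL a ha).
  have -> : s0 a - sg a = (s0 a - g0 * s0 a) + g0 * (s0 a - s0 a * g0) by rewrite /sg; ncring.
  apply: le_trans (nrmD _ _) _; rewrite mulrDl mul1r; apply: lerD => //.
  by rewrite -[leRHS]mul1r; apply: nrmM_le.
have nsg x : nrm (sg x) <= nrm x.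
  rewrite -[leRHS]mul1r -[leRHS]mulr1; apply: nrmM_le => //; apply: nrmM_le => //.
have mulsg a b : a \in S ++ S1 -> b \in S ++ S1 -> nrm (sg (a * b) - sg a * sg b) <= 20 * L ^+ 2 * d.
  move=> ha hb; have aT : a \in T by rewrite inE mem_cat ha orbT.
  have bT : b \in T by rewrite inE mem_cat hb orbT.
  have abT : a * b \in T by rewrite inE mem_cat (allpairs_f (fun a b => a * b) ha hb) !orbT.
  have -> : sg (a * b) - sg a * sg b = - (s0 (a * b) - sg (a * b)) + (s0 (a * b) - s0 a * s0 b)
    + (s0 a - sg a) * s0 b + sg a * (s0 b - sg b) by ncring.
  have h1 := near _ abT; have h2 := mul _ _ aT bT; have h3 := near _ aT; have h4 := near _ bT.
  have h5 := nrmM_le h3 (le_trans (ns' b) (nL b bT)).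
  have h6 := nrmM_le (le_trans (nsg a) (nL a aT)) h4.
  apply: le_trans (nrmD _ _) _; apply: (le_trans (lerD (le_trans (nrmD _ _) (lerD (le_trans (nrmD _ _) (lerD _ h2)) h5)) h6)).
    by rewrite nrmN; exact: h1.
  have u1 : d <= L * d by rewrite ler_peMl // ltW.
  have u2 : L * d <= L * (L * d) by rewrite ler_peMl ?mulr_ge0 // ltW.
  by rewrite expr2; nra.
have kR : 0 < k%:R :> R by rewrite ltr0n.
have cK i x : ~~ K i -> coef p i (g0 * x * g0) = 0.
  move=> nK; apply: (coef_uniq ms).
  have z : p i * g0 = 0.
    by rewrite /g0 mulr_sumr big1 // => j Kj; apply: po => e'; move: nK; rewrite e' Kj.
  by rewrite !mulrA z !mul0r scale0r.
have trb x : cnm (ftr p (g0 * x * g0)) <= k%:R * nrm (g0 * x * g0).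
  rewrite /ftr (bigID K) /= [X in _ + X]big1 ?addr0 => [|i nK]; last exact: cK.
  apply: le_trans (cnm_sum _ _ _) _; apply: (@le_trans _ _ (\sum_(i | K i) nrm (g0 * x * g0))).
    by apply: ler_sum => i _; apply: coef_nrm.
  by rewrite sumr_const mulr_natl.
have mi := msys_min ms i0.
pose f a : C := (k%:R^-1)%:C * ftr p (sg a).
have lf : scalar f.
  by move=> a x z; rewrite /f lsg (ftrD ms) (ftrZ ms) mulrDr mulrCA.
have psg x : pos x -> pos (sg x) by move=> px; apply: pos_conj_sa => //; apply: (cp_pos cs).
have pf x : pos x -> 0 <= f x.
  move=> px; apply: mulr_ge0; last by apply: (ftr_ge0 ms); apply: psg.
  by rewrite (_ : 0 = 0%:C) // lecC invr_ge0 ltW.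
have f1E : f 1 = (k%:R^-1 * \sum_(i | K i) c i)%:C.
  rewrite /f rmorphM rmorph_sum /ftr (bigID K) /= [X in _ * (_ + X)]big1 ?addr0 => [|i nK]; last exact: cK.
  congr (_ * _); apply: eq_bigr => i Ki; apply: (coef_uniq ms).
  have pg : p i * g0 = p i.
    rewrite /g0 mulr_sumr (bigD1 i) //= big1 ?addr0 ?(proj1 (hp i)) // => j /andP [_ ji].
    by apply: po => e'; rewrite e' eqxx in ji.
  have gp : g0 * p i = p i by have := congr1 star pg; rewrite starMr sg0 (proj2 (hp i)).
  by rewrite /sg !mulrA pg -!mulrA gp -/y hc mulZr (proj1 (hp i)).
have cK2 i : K i -> 1 - 2 * d <= c i <= 1.
  by rewrite /K => Ki; have := cc i; have /andP [h0 h1] := c01 i; nra.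
have f1 : 1 - 2 * d <= complex.Re (f 1) <= 1.
  rewrite f1E /= [k%:R^-1 * _]mulrC ler_pdivrMr // ler_pdivlMr // mul1r.
  have E (r : R) : r * k%:R = \sum_(i | K i) r by rewrite sumr_const mulr_natr.
  rewrite E -[X in _ && (_ <= X)]mul1r E; apply/andP; split; apply: ler_sum => i Ki; by case/andP: (cK2 i Ki).
(* The trace of the corner is exactly tracial, so only the two multiplicativity defects remain. *)
have tc a b : cnm (f (a * b) - f (b * a)) <= nrm (sg (a * b) - sg a * sg b) + nrm (sg (b * a) - sg b * sg a).
  have gsg x : g0 * sg x * g0 = sg x by rewrite /sg !mulrA gg -!mulrA gg.
  have gsg2 x z : g0 * (sg (x * z) - sg x * sg z) * g0 = sg (x * z) - sg x * sg z.
    rewrite mulrBr mulrBl gsg; congr (_ - _).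
    by rewrite /sg !mulrA gg -!mulrA gg.
  have hb x z : cnm ((k%:R^-1)%:C * ftr p (sg (x * z) - sg x * sg z)) <= nrm (sg (x * z) - sg x * sg z).
    rewrite cnmM cnm_real ger0_norm ?invr_ge0 // mulrC ler_pdivrMr // mulrC -gsg2; exact: trb.
  have -> : f (a * b) - f (b * a) = (k%:R^-1)%:C * ftr p (sg (a * b) - sg a * sg b)
     - (k%:R^-1)%:C * ftr p (sg (b * a) - sg b * sg a).
    by rewrite /f !(ftrB ms) (ftr_comm ms fM (sg a) _ mi); ring.
  apply: le_trans (cnmD _ _) _; rewrite cnmN; exact: lerD.
have trf x : x \in S -> cnm (f x - tau x * f 1) <= e / 2.
  apply: hS1 => //; first by case/andP: f1.
  move=> a b ha hb; apply: le_trans (tc a b) _.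
  have aS : a \in S ++ S1 by rewrite mem_cat ha orbT.
  have bS : b \in S ++ S1 by rewrite mem_cat hb orbT.
  have := mulsg a b aS bS; have := mulsg b a bS aS; rewrite -/d; move: de1; nra.
exists M, sg, k, v, (p i0); rewrite /qmodel gv; split => //.
- split => // x; by rewrite /sg !starMr sg0 -(cp_star cs) mulrA.
- split; first by move=> a; rewrite /sg !mulrA gg -!mulrA gg.
  have -> : sg 1 - g0 = g0 * (y - g0) * g0 by rewrite mulrBr mulrBl gg gg.
  have := nrmM_le (nrmM_le ng yg) ng; rewrite mul1r mulr1 => h; apply: le_trans h _.
  have u1 : d <= d * L ^+ 2 by rewrite ler_peMr ?exprn_ege1 // ltW.
  by move: de u1; rewrite expr2; nra.
split.
  move=> a b ha hb; apply: le_trans (mulsg a b _ _) _; rewrite ?mem_cat ?ha ?hb //.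
  by move: de; nra.
move=> a l r ha sa mr; rewrite (ftr_system _ fM mr ms mi).
have -> : ftr p (sg a) - k%:R * tau a = k%:R%:C * (f a - tau a * f 1) + k%:R%:C * (tau a * (f 1 - 1)).
  have fa : k%:R%:C * f a = ftr p (sg a) by rewrite /f mulrA -rmorphM mulfV ?lt0r_neq0 // mul1r.
  have -> : (k%:R : C) = k%:R%:C by rewrite rmorph_nat.
  by rewrite -fa; ring.
apply: le_trans (cnmD _ _) _; rewrite !cnmM !cnm_real ger0_norm ?(ltW kR) //.
rewrite -mulrDr; apply: ler_wpM2l; first exact: ltW.
have aT : a \in T by rewrite inE !mem_cat ha orbT.
have [lt pt t1 _] := ht.
have t2 : cnm (tau a) <= L.
  have := pf_sa lt (fun x px => pt x ((proj2 (pos_eltP x)) px)) sa; rewrite t1 mulr1 => h.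
  exact: le_trans h (nL a aT).
have t3 : cnm (f 1 - 1) <= 2 * d.
  have -> : f 1 - 1 = (k%:R^-1 * (\sum_(i | K i) c i) - 1)%:C by rewrite f1E rmorphB rmorph1.
  rewrite cnm_real ler_norml; move: f1; rewrite f1E /= => /andP [h1 h2]; apply/andP; split; lra.
apply: (@le_trans _ _ (e / 2 + L * (2 * d))).
  by apply: lerD; [exact: trf|apply: ler_pM; rewrite ?cnm_ge0].
by move: de; rewrite expr2; nra.
Qed.
End Model.

(** * Transporting a corner of the model into the target algebra *)

Section RhoMap.
Variables (R : realType) (M D : cstarType R) (k : nat) (v : 'I_k -> M) (e0 : M) (nu : 'I_k -> 'I_k -> D).
Hypotheses (me : minimal e0) (vv : forall i j, star (v i) * v j = if i == j then e0 else 0).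
Hypotheses (nuM : forall a b c d, nu a b * nu c d = if b == c then nu a d else 0).
Hypothesis nuS : forall a b, star (nu a b) = nu b a.
Local Notation C := R[i].
Variable g0 : M.
Hypothesis g0E : \sum_i v i * star (v i) = g0.
Implicit Types x y : M.

Definition mc x : C := xget 0 [set c | x = c *: e0].

Lemma mc_uniq x c : x = c *: e0 -> mc x = c.
Proof.
move=> h; have : x = mc x *: e0 by apply: (@xgetPex _ 0 [set c | x = c *: e0]); exists c.
rewrite {1}h => /eqP; rewrite -subr_eq0 -scalerBl => /eqP h'; apply/esym/eqP; rewrite -subr_eq0; apply/eqP.
apply: cnm_eq0; have [_ [/nrm_gt0 e00 _]] := me; apply: (mulIf (lt0r_neq0 e00)).
by rewrite -nrmZ h' nrm0 mul0r.
Qed.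

Lemma v_e0 i : v i * e0 = v i.
Proof.
have [[ee se] _] := me; apply/eqP; rewrite -subr_eq0; apply/eqP; apply: cs_eq0.
rewrite starB starMr se mulrBl !mulrBr -!mulrA !(mulrA (star (v i))) vv eqxx !mulrA ee ee.
by rewrite !subrr.
Qed.

Lemma vxv x i j : star (v i) * x * v j = mc (star (v i) * x * v j) *: e0.
Proof.
have [[_ se] [_ h]] := me; have [c hc] := h (star (v i) * x * v j).
have E : star (v i) * x * v j = c *: e0.
  rewrite -hc !mulrA -[in LHS](v_e0 j) -[in LHS](v_e0 i) starMr se.
  by rewrite !mulrA.
by rewrite (mc_uniq E) E.
Qed.

(** On the corner at g0 this is the *-homomorphism sending v_i v_j^* to nu_ij; elsewhere x is first
    compressed to the corner, whence the g0 in [rho_mul]. *)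
Definition rho x : D := \sum_i \sum_j mc (star (v i) * x * v j) *: nu i j.

Lemma mc_lin (a : C) x y i j : mc (star (v i) * (a *: x + y) * v j) =
  a * mc (star (v i) * x * v j) + mc (star (v i) * y * v j).
Proof.
apply: mc_uniq; rewrite mulrDr mulrDl mulZr mulZl {1}(vxv x) {1}(vxv y).
by rewrite scalerA -scalerDl.
Qed.

Lemma rho_lin : linear rho.
Proof.
move=> a x y; rewrite /rho scaler_sumr -big_split; apply: eq_bigr => i _ /=.
by rewrite scaler_sumr -big_split; apply: eq_bigr => j _ /=; rewrite mc_lin scalerDl scalerA.
Qed.

Lemma rho_star x : rho (star x) = star (rho x).
Proof.
rewrite /rho star_sum exchange_big; apply: eq_bigr => i _; rewrite star_sum; apply: eq_bigr => j _ /=.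
rewrite starZ nuS; congr (_ *: _); apply: mc_uniq.
have := congr1 star (vxv x i j); rewrite !starMr starK starZ (proj2 (proj1 me)) mulrA; exact.
Qed.

Lemma rho_mul x y : rho x * rho y = rho (x * g0 * y).
Proof.
rewrite /rho mulr_suml; apply: eq_bigr => i _; rewrite mulr_suml.
have E j : mc (star (v i) * x * v j) *: nu i j * (\sum_i0 \sum_l mc (star (v i0) * y * v l) *: nu i0 l) =
   \sum_l (mc (star (v i) * x * v j) * mc (star (v j) * y * v l)) *: nu i l.
  rewrite mulr_sumr (bigD1 j) //= [X in _ + X]big1 ?addr0 => [|t tj].
    by rewrite mulr_sumr; apply: eq_bigr => s _; rewrite mulZl mulZr nuM eqxx scalerA.
  by rewrite mulr_sumr big1 // => s _; rewrite mulZl mulZr nuM eq_sym (negbTE tj) !scaler0.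
rewrite (eq_bigr _ (fun j _ => E j)) exchange_big; apply: eq_bigr => l _ /=.
rewrite -scaler_suml; congr (_ *: _); apply/esym; apply: mc_uniq.
rewrite -g0E mulr_sumr !mulr_suml mulr_sumr mulr_suml scaler_suml; apply: eq_bigr => j _.
have -> : star (v i) * (x * (v j * star (v j)) * y) * v l = (star (v i) * x * v j) * (star (v j) * y * v l).
  by rewrite !mulrA.
by rewrite {1}(vxv x) {1}(vxv y) mulZl mulZr (proj1 (proj1 me)) scalerA.
Qed.

Lemma gv i : g0 * v i = v i.
Proof.
rewrite -g0E mulr_suml (bigD1 i) //= big1 ?addr0 => [|j ji]; first by rewrite -mulrA vv eqxx v_e0.
by rewrite -mulrA vv (negbTE ji) mulr0.
Qed.

Lemma g0_proj : projection g0.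
Proof.
split; first by rewrite -{2 3}g0E mulr_sumr; apply: eq_bigr => i _; rewrite mulrA gv.
by rewrite -g0E star_sum; apply: eq_bigr => i _; rewrite starMr starK.
Qed.

Lemma vg i : star (v i) * g0 = star (v i).
Proof. by have := congr1 star (gv i); rewrite starMr (proj2 g0_proj). Qed.

Lemma rho_corner x : rho (g0 * x * g0) = rho x.
Proof.
apply: eq_bigr => i _; apply: eq_bigr => j _; congr (mc _ *: _).
by rewrite !mulrA vg -!mulrA gv.
Qed.

Lemma rho_g0 : rho g0 = \sum_i nu i i.
Proof.
apply: eq_bigr => i _; rewrite (bigD1 i) //= [X in _ + X]big1 ?addr0 => [|j ji].
  by rewrite vg vv eqxx (mc_uniq (c := 1)) ?scale1r.
by rewrite vg vv eq_sym (negbTE ji) (mc_uniq (c := 0)) ?scale0r.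
Qed.

Lemma rho_pos x : pos x -> pos (rho x).
Proof.
move=> px; have [gg sg] := g0_proj.
have [y [py yy yc _]] := pos_sqrt (pos_conj_sa sg px).
have gy : g0 * y = y * g0 by apply: yc; rewrite !mulrA gg -!mulrA gg.
rewrite -rho_corner -yy.
have -> : rho (y * y) = rho y * rho y.
  by rewrite rho_mul -gy -mulrA yy !mulrA gg.
by apply: pos_sqr; rewrite -rho_star (pos_sa py).
Qed.

Lemma nu_proj : projection (\sum_i nu i i).
Proof.
split; last by rewrite star_sum; apply: eq_bigr => i _; rewrite nuS.
rewrite mulr_suml; apply: eq_bigr => i _; rewrite mulr_sumr (bigD1 i) //= big1 ?addr0 ?nuM ?eqxx // => j ji.
by rewrite nuM eq_sym (negbTE ji).
Qed.

Lemma rho_nrm x : nrm (rho x) <= nrm x.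
Proof.
have [gg sg] := g0_proj.
have h y : pos y -> nrm (rho y) <= nrm y.
  move=> py; apply: (ple_nrm_rc (nrm_ge0 _) (rho_pos py)).
  have := rho_pos (nrm_pos (pos_sa py) (lexx (nrm y))).
  have r1 : rho 1 = rho g0 by rewrite -rho_corner mulr1 gg.
  rewrite (linB rho_lin) (linZ rho_lin) r1 rho_g0 => h; apply: ple_trans h _; apply: pleZ; first exact: nrm_ge0.
  rewrite -[X in ple _ X]rc1; apply: sa_ple; [exact: (proj2 nu_proj)|exact: proj_nrm nu_proj].
have ng := proj_nrm g0_proj.
apply: nrm_sqr_le; first exact: nrm_ge0.
rewrite -rho_star rho_mul; apply: le_trans (h _ _) _.
  have -> : star x * g0 * x = star (g0 * x) * (g0 * x) by rewrite starMr sg -!mulrA (mulrA g0) gg.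
  exact: pos_cs.
rewrite expr2 -{1}[nrm x]mulr1; apply: nrmM_le => //; apply: nrmM_le => //.
by rewrite nrm_star.
Qed.

Variables (E : D -> Prop).
Hypotheses (uE : usub E) (nuE : forall i j, E (nu i j)).

Lemma rho_E x : E (rho x).
Proof. by apply: usub_sum => // i; apply: usub_sum => // j; apply: usubZ. Qed.

Hypothesis fM : factor M.
(** A minimal projection of the corner is equivalent to each v_i v_i^*, and these k projections are
    orthogonal, so k copies of it fit below the unit. *)
Lemma rho_min_sle r : minimal r -> g0 * r = r -> sle E (nseq k (rho r)) [:: 1].
Proof.
move=> mr gr; have [[rr sr] _] := mr.
have /choice [w hw] : forall i : 'I_k, exists w, [/\ star w * w = r, w * star w = v i * star (v i) & g0 * w = w].
  move=> i; have mi : minimal (v i * star (v i)).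
    have pi : projection (v i * star (v i)).
      by split; rewrite ?starMr ?starK // -mulrA (mulrA (star _)) vv eqxx mulrA v_e0.
    split => //; split.
      move=> z; have [_ [e00 _]] := me; apply: e00; have := congr1 (fun y => star (v i) * y * v i) z.
      by rewrite mulr0 mul0r -mulrA -!mulrA vv eqxx mulrA vv eqxx (proj1 (proj1 me)).
    move=> x; exists (mc (star (v i) * x * v i)).
    have -> : v i * star (v i) * x * (v i * star (v i)) = v i * (star (v i) * x * v i) * star (v i) by rewrite !mulrA.
    by rewrite {1}vxv mulZr mulZl v_e0.
  have [w [h1 h2 h3 _]] := eqv_pi mi mr (proj2 fM _ _ mi mr); exists w; split => //.
  by rewrite -h3 !mulrA gv.
have h : cle E (fun _ : 'I_k => rho r) (fun _ : unit => 1).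
  apply: (cle_exact (V := fun _ i => rho (w i))) => [_ i|i j]; first exact: rho_E.
  rewrite (big_pred1 tt); last by case.
  have [h1 h2 h3] := hw i; have [h1' h2' h3'] := hw j.
  rewrite mulr1 -rho_star rho_mul -mulrA h3'.
  have [<-|ij] := eqVneq i j; first by rewrite h1.
  have ww l : w l = v l * star (v l) * w l.
    have [q1 q2 _] := hw l; have wr : w l * r = w l.
      apply/eqP; rewrite -subr_eq0 -oppr_eq0 opprB; apply/eqP; apply: cs_eq0.
      rewrite starB starMr sr.
      have -> : (star (w l) - r * star (w l)) * (w l - w l * r) = (1 - r) * (star (w l) * w l) * (1 - r) by ncring.
      by rewrite q1 mulrBl mul1r rr subrr mul0r.
    by rewrite -{1}wr -q1 mulrA q2.
  rewrite (ww i) (ww j) !starMr starK -!mulrA (mulrA (star (v i)) (v j)) vv (negbTE ij).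
  by rewrite !mul0r !mulr0 (lin0 rho_lin).
by have := sle_fam uE h; rewrite !codom_cst card_unit card_ord.
Qed.

(** Adds up the previous bound: a projection of rank #|J| in a corner of rank k has size at most
    #|J| / k, expressed without traces. *)
Lemma rho_sum_sle (J : finType) (r : J -> M) : (forall j, minimal (r j)) -> (forall j, g0 * r j = r j) ->
  (forall i j, i != j -> r i * r j = 0) -> sle E (nseq k (rho (\sum_j r j))) (nseq #|J| 1).
Proof.
move=> mr gr ro.
have rr j : rho (r j) * rho (r j) = rho (r j).
  by rewrite rho_mul -mulrA gr (proj1 (proj1 (mr j))).
have rij i j : i != j -> rho (r i) * rho (r j) = 0.
  by move=> ij; rewrite rho_mul -mulrA gr ro // (lin0 rho_lin).
have h : cle E (fun _ : unit => rho (\sum_j r j)) (fun j => rho (r j)).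
  apply: (cle_exact (V := fun j _ => rho (r j))) => [j _|[] []]; first exact: rho_E.
  rewrite (lin_sum rho_lin); apply: eq_bigr => j _.
  by rewrite -rho_star (proj2 (proj1 (mr j))) !rr.
have h1 := sle_smul uE k (sle_fam uE h); rewrite codom_cst card_unit -[nseq 1 _]/([:: _]) in h1.
have h2 : sle E (smul k [:: rho (\sum_j r j)]) (smul k (codom (fun j => rho (r j)))) by exact: h1.
rewrite -[[:: _]]/(nseq 1 _) smul_nseq muln1 in h2; apply: (sle_trans uE h2).
rewrite /codom /image_mem cardE; elim: (enum J) => [|j s IH].
  have -> : smul k [::] = [::] :> seq D by rewrite /smul; elim: (k).
  exact: sle_refl.
rewrite -[[seq _ | _ <- j :: s]]/([:: rho (r j)] ++ [seq rho (r j) | j <- s]) /=.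
apply: (sle_trans uE (sle_perm uE (perm_smul_cat k [:: rho (r j)] _))).
apply: (sle_cat uE (s := smul k [:: rho (r j)]) (t := [:: 1])) IH.
by rewrite -[[:: rho _]]/(nseq 1 _) smul_nseq muln1; apply: rho_min_sle.
Qed.
End RhoMap.

(** * Dividing multiplicities by means of commuting matrix units *)

Section Units.
Variables (R : realType) (D : cstarType R) (u : nat) (mu : 'I_u.+1 -> 'I_u.+1 -> D) (L E : D -> Prop).
Hypotheses (hmu : munits mu) (uL : usub L) (uE : usub E) (LE : forall x, L x -> E x) (muE : forall a b, E (mu a b)).
Hypothesis muL : forall a b x, L x -> mu a b * x = x * mu a b.
Let muM a b c d : mu a b * mu c d = if b == c then mu a d else 0. Proof. by case: hmu. Qed.
Let muS a b : star (mu a b) = mu b a. Proof. by case: hmu. Qed.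
Let mu1 : \sum_a mu a a = 1. Proof. by case: hmu. Qed.
Local Notation m0 := (mu ord0 ord0).

Lemma units_up a : L a -> sle E [:: a] (nseq u.+1 (a * m0)).
Proof.
move=> La; have h : cle E (fun _ : unit => a) (fun _ : 'I_u.+1 => a * m0).
  apply: (cle_exact (V := fun i _ => mu ord0 i)) => // [[] []].
  rewrite -[RHS]mulr1 -mu1 mulr_sumr; apply: eq_bigr => i _.
  by rewrite muS mulrA (muL _ _ La) -!mulrA muM eqxx /= muM eqxx.
by have := sle_fam uE h; rewrite !codom_cst card_unit card_ord.
Qed.

Lemma units_down b : L b -> sle E (nseq u.+1 (b * m0)) [:: b].
Proof.
move=> Lb; have h : cle E (fun _ : 'I_u.+1 => b * m0) (fun _ : unit => b).
  apply: (cle_exact (V := fun _ i => mu i ord0)) => // i j.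
  rewrite (big_pred1 tt); last by case.
  rewrite muS (muL _ _ Lb) -mulrA muM eq_sym; case: eqP => // _; by rewrite mulr0.
by have := sle_fam uE h; rewrite !codom_cst card_unit card_ord.
Qed.

(** Entries of the comparison commute with the diagonal unit, so multiplying them by it compares the
    cut-down families. This is why the entries must lie in L. *)
Lemma units_cut s t : (forall x, x \in t -> L x) -> sle L s t -> sle E [seq x * m0 | x <- s] [seq x * m0 | x <- t].
Proof.
move=> Lt h e e0; have n0 : nrm m0 <= 1 by apply: proj_nrm; split; rewrite ?muM ?muS ?eqxx.
have [V [VL hV]] := h e e0.
have cs (w : seq D) : size [seq x * m0 | x <- w] = size w by rewrite size_map.
exists (fun j i => V (cast_ord (cs t) j) (cast_ord (cs s) i) * m0); split.
  by move=> j i; apply: usubM => //; apply: LE.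
move=> i i'; have := nrmM_le (hV (cast_ord (cs s) i) (cast_ord (cs s) i')) n0; rewrite mulr1.
apply: le_trans; rewrite le_eqVlt; apply/orP; left; apply/eqP; congr nrm; rewrite mulrBl mulr_suml; congr (_ - _).
  rewrite (reindex (cast_ord (esym (cs t)))) /=; last first.
    by exists (cast_ord (cs t)) => j _; rewrite ?cast_ordK ?cast_ordKV.
  apply: eq_bigr => j _; rewrite cast_ordKV (nth_map 0) // starMr muS.
  set W := V j _; set W' := V j _; have LW : L (star W) by apply: usubS => //; apply: VL.
  have LW' : L W' by apply: VL.
  have Lb : L (t`_j) by apply: Lt; apply: mem_nth.
  have -> : m0 * star W * (t`_j * m0) * (W' * m0) = star W * t`_j * W' * (m0 * m0 * m0).
    rewrite (muL _ _ LW) -!mulrA; congr (_ * _); rewrite !mulrA (muL _ _ Lb) -!mulrA; congr (_ * _).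
    have mw : m0 * W' = W' * m0 by apply: muL.
    by rewrite (mulrA m0 W') mw -!mulrA (mulrA m0 W') mw -!mulrA.
  by rewrite muM eqxx /= muM eqxx.
rewrite (inj_eq (@cast_ord_inj _ _ _)); case: eqP => _; last by rewrite mul0r.
by rewrite (nth_map 0) //= -(cs s).
Qed.

(* Almost unperforation, with the loss of a factor two *)
Lemma unperf a b K K' C : L a -> L b -> (0 < K)%N -> (K <= u.+1)%N -> (2 * K' <= C * K)%N ->
  sle L (nseq K a) (nseq K' b) -> sle E [:: a] (nseq C b).
Proof.
move=> La Lb K0 Ku hC h.
have h1 := units_cut (_ : forall x, x \in nseq K' b -> L x) h.
have {h1} h1 : sle E (nseq K (a * m0)) (nseq K' (b * m0)).
  by rewrite !map_nseq in h1; apply: h1 => x; rewrite mem_nseq => /andP [_ /eqP ->].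
(* The least convenient multiple: u+1 <= s K <= 2 (u+1), using K <= u+1. The second inequality is
   the factor two that is lost. *)
pose s := (u.+1 %/ K).+1.
have hs : (u.+1 <= s * K)%N by rewrite ltnW // ltn_ceil.
have hs' : (s * K' <= C * u.+1)%N.
  have : (s * K <= 2 * u.+1)%N by rewrite [leqLHS]mulSn mul2n -addnn leq_add // leq_trunc_div.
  move=> h2; rewrite -(leq_pmul2l (_ : 0 < 2 * K)%N) ?muln_gt0 //.
  have -> : (2 * K * (s * K') = (s * K) * (2 * K'))%N by lia.
  have -> : (2 * K * (C * u.+1) = 2 * u.+1 * (C * K))%N by lia.
  exact: leq_mul.
apply: (sle_trans uE (units_up La)); apply: (sle_trans uE (sle_nseq uE _ hs)).
rewrite -smul_nseq; apply: (sle_trans uE (sle_smul uE s h1)); rewrite smul_nseq.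
apply: (sle_trans uE (sle_nseq uE _ hs')); rewrite -smul_nseq.
have := sle_smul uE C (units_down Lb); by rewrite -[[:: b]]/(nseq 1 b) [smul C (nseq 1 b)]smul_nseq muln1.
Qed.

(** Pack w = floor((u+1) / k) blocks of size k along the diagonal; the rest is smaller than k, hence
    the unit of the blocks has at least half the full size. *)
Lemma corner_units k : (0 < k)%N -> (k <= u.+1)%N -> exists nu : 'I_k -> 'I_k -> D,
  [/\ forall a b c d, nu a b * nu c d = if b == c then nu a d else 0,
      forall a b, star (nu a b) = nu b a, forall a b, E (nu a b),
      forall a b x, L x -> nu a b * x = x * nu a b
    & sle E [:: 1] (nseq 2 (\sum_i nu i i))].
Proof.
move=> k0 ku; pose w := (u.+1 %/ k)%N.
have wk : (w * k <= u.+1)%N by exact: leq_trunc_div.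
(* Position i of block b has index b k + i, so that quotient and remainder recover the pair. *)
have lt (i : 'I_k) (b : 'I_w) : (b * k + i < u.+1)%N.
  by apply: leq_trans wk; apply: leq_trans (_ : b.+1 * k <= _)%N; rewrite ?leq_mul2r ?ltn_ord ?orbT // mulSn addnC ltn_add2r.
pose io i b := Ordinal (lt i b).
have ioE i b j c : (io i b == io j c) = (i == j) && (b == c).
  apply/eqP/andP => [/(congr1 val) /= h|[/eqP -> /eqP ->]] //.
  have h1 : (i == j :> nat) by have := congr1 (modn^~ k) h; rewrite /= !modnMDl !modn_small // => ->.
  have h2 : (b == c :> nat) by have := congr1 (divn^~ k) h; rewrite /= !divnMDl // !divn_small // !addn0 => ->.
  by split; apply/eqP; apply: val_inj; apply/eqP.
pose nu i j := \sum_b mu (io i b) (io j b).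
exists nu; split.
- move=> a b c d; rewrite /nu mulr_suml.
  have [<-|bc] := eqVneq b c.
    apply: eq_bigr => s _; rewrite mulr_sumr (bigD1 s) //= big1 ?addr0 ?muM ?eqxx // => t ts.
    by rewrite muM ioE eq_sym (negbTE ts) andbF.
  by apply: big1 => s _; rewrite mulr_sumr big1 // => t _; rewrite muM ioE (negbTE bc).
- by move=> a b; rewrite /nu star_sum; apply: eq_bigr => s _; rewrite muS.
- by move=> a b; apply: usub_sum.
- by move=> a b x Lx; rewrite /nu mulr_suml mulr_sumr; apply: eq_bigr => s _; apply: muL.
have h : cle E (fun _ : 'I_k * 'I_w => m0) (fun _ : unit => \sum_i nu i i).
  apply: (cle_exact (V := fun _ ib => mu (io ib.1 ib.2) ord0)) => // -[i b] [j c].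
  rewrite (big_pred1 tt) /=; last by case.
  rewrite muS xpair_eqE -ioE -mulrA; have -> : (\sum_i nu i i) * mu (io j c) ord0 = mu (io j c) ord0.
    rewrite mulr_suml (bigD1 j) //= big1 ?addr0 => [|i' ij]; last first.
      by rewrite /nu mulr_suml big1 // => s _; rewrite muM ioE (negbTE ij).
    rewrite /nu mulr_suml (bigD1 c) //= big1 ?addr0 ?muM ?eqxx // => s sc.
    by rewrite muM ioE (negbTE sc) andbF.
  by rewrite muM.
have {}h : sle E (nseq (k * w) m0) [:: \sum_i nu i i].
  by have := sle_fam uE h; rewrite !codom_cst card_unit card_prod !card_ord.
have h1 := units_up (usub1 uL); rewrite mul1r in h1; apply: (sle_trans uE h1).
have hw : (u.+1 <= 2 * (k * w))%N.
  have w0 : (0 < w)%N by rewrite divn_gt0.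
  have : (u.+1 < w.+1 * k)%N by apply: ltn_ceil.
  by nia.
apply: (sle_trans uE (sle_nseq uE _ hw)); rewrite -smul_nseq.
have := sle_smul uE 2 h; by rewrite -[[:: _]]/(nseq 1 _) [smul 2 (nseq 1 _)]smul_nseq muln1.
Qed.
End Units.

(** * Commutators with inverse square roots *)

Section CommInvsqrt.
Variables (R : realType) (D : cstarType R).
Implicit Types (x y c k w : D) (r s e : R).
Local Notation "t %:I" := (t%:C *: (1 : D)) (at level 1, left associativity, format "t %:I").

Lemma ple_approx x y e : star x = x -> star y = y -> nrm (x - y) <= e -> ple x (y + e%:I).
Proof.
move=> sx sy h; have := @sa_ple _ _ (x - y) e _ h; rewrite starB sx sy => /(_ erefl).
by rewrite /ple; have -> : e%:I - (x - y) = y + e%:I - x by ncring.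
Qed.

(* Writing k = R - k' with |k'| <= R - s turns [x, k^2] = [x, k] k + k [x, k]
   into 2 R [x, k] up to 2 (R - s) |[x, k]|. *)
Lemma comm_sqrt k x s : 0 < s -> pos k -> ple s%:I k ->
  2 * s * nrm (x * k - k * x) <= nrm (x * (k * k) - k * k * x).
Proof.
move=> s0 pk hk; set w := x * k - k * x; set b := x * (k * k) - k * k * x.
pose N := nrm k; have N0 : 0 <= N := nrm_ge0 k.
pose k' := (N + s)%:I - k.
have nk : nrm k' <= N.
  apply: pos_le_nrm => //; first by apply: nrm_pos; [exact: pos_sa|rewrite /N lerDl ltW].
  by have -> : N%:I - k' = k - s%:I by rewrite /k' -rcD; ncring.
have E : (2 * (N + s)) *^ w = b + (k' * w + w * k').
  have -> : (2 * (N + s)) *^ w = (N + s) *^ w + (N + s) *^ w by rewrite rcD; congr (_%:C *: _); ring.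
  by rewrite /b /k' /w; ncring.
have := nrmZ0 w (_ : 0 <= 2 * (N + s)); rewrite E => H.
have : 2 * (N + s) * nrm w <= nrm b + (N * nrm w + nrm w * N).
  rewrite -H; last by rewrite mulr_ge0 // addr_ge0 // ltW.
  apply: le_trans (nrmD _ _) _; apply: lerD => //; apply: le_trans (nrmD _ _) _.
  by apply: lerD; apply: nrmM_le.
by nra.
Qed.

Lemma invsqrt_nrm c k r : 0 < r -> ple r%:I c -> k * c * k = 1 -> pos k -> nrm k <= r^-1 + 1.
Proof.
move=> r0 h1 kck pk; have sk := pos_sa pk; have ri : 0 < r^-1 by rewrite invr_gt0.
have nkk : nrm (k * k) <= r^-1.
  apply: ple_nrm_rc; [exact: ltW|exact: pos_sqr|].
  by have := pleZ (ltW ri) (ple_conj_sa sk h1); rewrite kck mulZr mulZl mulr1 rcM mulVf ?lt0r_neq0 // rc1.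
by move: nkk; rewrite (nrm_sa sk) expr2; have := nrm_ge0 k; nra.
Qed.

(** As k^2 is the inverse of c, the commutator of x with k^2 is that with c, conjugated by k^2. To
    descend to k, [comm_sqrt] needs a lower bound on k: 1 = k c k <= r' k^2 <= r' N k with N
    bounding |k|. *)
Lemma comm_invsqrt c k x r r' : 0 < r -> 0 < r' -> ple r%:I c -> ple c r'%:I -> k * c * k = 1 -> pos k ->
  c * k = k * c -> nrm (x * k - k * x) <= r' * (r^-1 + 1) / 2 * (r^-1 * nrm (x * c - c * x) * r^-1).
Proof.
move=> r0 r0' h1 h2 kck pk ck; have sk := pos_sa pk.
have kk : k * k * c = 1 by rewrite -mulrA -ck mulrA kck.
have kk' : c * (k * k) = 1 by rewrite mulrA ck kck.
have pkk := pos_sqr sk.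
have nkk : nrm (k * k) <= r^-1.
  apply: ple_nrm_rc => //; first by rewrite invr_ge0 ltW.
  have := pleZ (ltW (_ : 0 < r^-1)) (ple_conj_sa sk h1); rewrite invr_gt0 kck mulZr mulZl mulr1 rcM mulVf ?lt0r_neq0 // rc1; exact.
pose N := r^-1 + 1.
have ri : 0 < r^-1 by rewrite invr_gt0.
have nk : nrm k <= N := invsqrt_nrm r0 h1 kck pk.
have N0 : 0 < N by rewrite /N; lra.
pose s := (r' * N)^-1; have s0 : 0 < s by rewrite invr_gt0 mulr_gt0.
have hk : ple s%:I k.
  have a1 : ple 1 (r' *^ (k * k)).
    by have := ple_conj_sa sk h2; rewrite kck mulZr mulZl mulr1.
  have a2 : ple (k * k) (N *^ k).
    rewrite /ple; have -> : N *^ k - k * k = k * (N%:I - k) by ncring.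
    by apply: pos_mulC => //; [exact: nrm_pos|ncring].
  have a3 := ple_trans a1 (pleZ (ltW r0') a2).
  move: a3; rewrite rcM => a3; have := pleZ (ltW s0) a3.
  by rewrite [X in ple _ X]rcM /s mulVf ?rc1 // lt0r_neq0 // mulr_gt0.
have h3 := comm_sqrt x s0 pk hk.
have E : x * (k * k) - k * k * x = k * k * (c * x - x * c) * (k * k).
  have -> : k * k * (c * x - x * c) * (k * k) = (k * k * c) * x * (k * k) - k * k * x * (c * (k * k)) by ncring.
  by rewrite kk kk' mul1r mulr1.
have h4 : nrm (x * (k * k) - k * k * x) <= r^-1 * nrm (x * c - c * x) * r^-1.
  rewrite E; apply: nrmM_le => //; apply: nrmM_le => //.
  by rewrite -nrmN opprB.
have h5 := le_trans h3 h4; rewrite -(ler_pM2l (_ : 0 < 2 * s)) ?mulr_gt0 //.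
apply: le_trans h5 _; rewrite mulrA (_ : 2 * s * _ = 1) ?mul1r //.
rewrite -/N; have -> : 2 * s * (r' * N / 2) = s * (r' * N) by field.
by rewrite /s mulVf // lt0r_neq0 // mulr_gt0.
Qed.
End CommInvsqrt.

Section StarHom.
Variables (R : realType) (A D : cstarType R) (j : A -> D).
Hypothesis hj : unital_star_hom j.
Let lj : linear j. Proof. by case: hj => [[]]. Qed.
Lemma homM x y : j (x * y) = j x * j y. Proof. by case: hj => [[_ h _] _]; exact: h. Qed.
Lemma homS x : j (star x) = star (j x). Proof. by case: hj => [[_ _ h] _]; exact: h. Qed.
Lemma hom1 : j 1 = 1. Proof. by case: hj. Qed.
Lemma hom_pos x : pos x -> pos (j x).
Proof. by move=> px; have [k [pk <- _ _]] := pos_sqrt px; rewrite homM; apply: pos_sqr; rewrite -homS (pos_sa pk). Qed.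
Lemma hom_ple x y : ple x y -> ple (j x) (j y).
Proof. by move=> h; rewrite /ple -(linB lj); apply: hom_pos. Qed.
Lemma hom_nrm x : nrm (j x) <= nrm x.
Proof.
apply: nrm_sqr_le; first exact: nrm_ge0.
rewrite -homS -homM -nrm_cs; apply: ple_nrm_rc; first exact: nrm_ge0.
  by apply: hom_pos; apply: pos_cs.
have := hom_pos (nrm_pos (pos_sa (pos_cs x)) (lexx (nrm (star x * x)))).
by rewrite (linB lj) (linZ lj) hom1.
Qed.
End StarHom.

(** * The intertwiner *)

Section Intertwiner.
Variables (R : realType) (A D G : cstarType R) (j : A -> D) (phi : G -> A) (al : A -> D) (P : D).
Hypotheses (hj : unital_star_hom j) (fdG : finite_dimensional [set: G]) (hphi : cpc_order_zero phi).
Hypotheses (lal : linear al) (sal : forall x, al (star x) = star (al x)) (nal : forall x, nrm (al x) <= nrm x).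
Hypotheses (pal : forall x, pos x -> pos (al x)) (pP : projection P) (alP : forall a, P * al a = al a).
Variables (K : nat) (f : 'I_K -> G) (rep : 'I_K -> 'I_K) (v : 'I_K -> G).
Hypotheses (ms : msys f) (hrep : forall a b, eqv (f a) (f b) -> rep a = rep b).
Hypotheses (vsv : forall a, star (v a) * v a = f (rep a)) (vvs : forall a, v a * star (v a) = f a).
Hypotheses (fv : forall a, f a * v a = v a) (vf : forall a, v a * f (rep a) = v a).
Implicit Types (x : G) (y : 'I_K -> D) (w : 'I_K -> D).
Local Notation h := (phi 1).
Local Notation C := R[i].
Local Notation "t %:I" := (t%:C *: (1 : D)) (at level 1, left associativity, format "t %:I").
Let lphi : linear phi := proj1 (proj1 (proj1 hphi)).
Let lj : linear j. Proof. by case: hj => [[]]. Qed.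
Let hf a : projection (f a). Proof. by case: ms => [[hp _ _] _ _]. Qed.

Lemma f_v a : f (rep a) * star (v a) = star (v a).
Proof. by have := congr1 star (vf a); rewrite starMr (proj2 (hf _)). Qed.

Lemma vsv_off a b : a != b -> star (v a) * v b = 0.
Proof.
move=> ab; have [[_ _ po] _ _] := ms.
have -> : star (v a) * v b = star (v a) * (f a * f b) * v b.
  rewrite -mulrA -mulrA fv mulrA; congr (_ * _).
  by have := congr1 star (fv a); rewrite starMr (proj2 (hf _)).
by rewrite po ?mulr0 ?mul0r //; apply/eqP.
Qed.

(** The coefficients of x in the matrix units v_a v_b^*. The same numbers describe multiplication of
    the v_b from the left and of the v_a^* from the right, and they vanish across blocks. *)
Lemma kap x : exists ka : 'I_K -> 'I_K -> C, (forall a b, rep a <> rep b -> ka a b = 0) /\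
  [/\ (forall b, x * v b = \sum_a ka a b *: v a) & forall a, star (v a) * x = \sum_b ka a b *: star (v b)].
Proof.
have h1 a b : exists c : C, star (v a) * x * v b = c *: f (rep b) /\ (rep a <> rep b -> c = 0).
  have [e|ne] := eqVneq (rep a) (rep b).
    have [_ _ mn] := ms; have [c hc] := mn (rep b) (star (v a) * x * v b).
    exists c; split => //; rewrite -hc -{1}(f_v a) e -{1}(vf b) !mulrA; by [].
  exists 0; split => //; rewrite scale0r; apply: contrapT => hn; move/eqP: ne; apply; apply: hrep.
  exists x => h0; apply: hn.
  have -> : star (v a) * x * v b = star (v a) * (f a * x * f b) * v b.
    rewrite -(vvs a) -(vvs b); have -> : star (v a) * (v a * star (v a) * x * (v b * star (v b))) * v b =
      (star (v a) * v a) * star (v a) * x * (v b * (star (v b) * v b)) by rewrite !mulrA.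
    by rewrite !vsv f_v vf.
  by rewrite h0 mulr0 mul0r.
have /choice [k hk] : forall ab : 'I_K * 'I_K, exists c : C,
   star (v ab.1) * x * v ab.2 = c *: f (rep ab.2) /\ (rep ab.1 <> rep ab.2 -> c = 0).
  by move=> [a b]; apply: h1.
have [_ f1 _] := ms.
exists (fun a b => k (a, b)); split; first by move=> a b; exact: (proj2 (hk (a, b))).
have vz a b : k (a, b) *: (v a * f (rep b)) = k (a, b) *: v a.
  have [e|ne] := eqVneq (rep a) (rep b); first by rewrite -e vf.
  by rewrite (proj2 (hk (a, b))) ?scale0r //; apply/eqP.
split => [b|a].
  rewrite -[x * v b]mul1r -f1 mulr_suml; apply: eq_bigr => a _.
  by rewrite -vvs -vz -mulZr -(proj1 (hk (a, b))) /= !mulrA.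
rewrite -[star (v a) * x]mulr1 -f1 mulr_sumr; apply: eq_bigr => b _.
by rewrite -vvs mulrA (proj1 (hk (a, b))) /= mulZl f_v.
Qed.

(* The intertwiner, with the coefficients y indexed by the blocks *)
Definition itw y w := \sum_a j (phi (v a)) * y (rep a) * w a.

(** Both sides expand with the same coefficients of [kap]: x crosses from the left factor to the
    right one, because y depends on a only through [rep a]. The factors h are those of the order
    zero identity. *)
Lemma itw_l x y : j (phi x) * itw y (fun a => al (phi (star (v a)) * h)) =
  j h * itw y (fun a => al (phi (star (v a)) * phi x)).
Proof.
have [ka [k0 [k1 k2]]] := kap x.
rewrite /itw !mulr_sumr.
have E1 b : j (phi x) * (j (phi (v b)) * y (rep b) * al (phi (star (v b)) * h)) =
   \sum_a ka a b *: (j h * j (phi (v a)) * y (rep a) * al (phi (star (v b)) * h)).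
  rewrite !mulrA -(homM hj) (ozM' fdG hphi) k1 (lin_sum lphi) mulr_sumr (lin_sum lj) !mulr_suml.
  apply: eq_bigr => a _; rewrite (linZ lphi) mulZr (linZ lj) !mulZl (homM hj).
  have [->|ne] := eqVneq (rep a) (rep b); first by [].
  by rewrite k0 ?scale0r //; apply/eqP.
rewrite (eq_bigr _ (fun b _ => E1 b)) exchange_big; apply: eq_bigr => a _ /=.
rewrite (ozM fdG hphi (star (v a)) x) k2 (lin_sum lphi) mulr_suml (lin_sum lal) !mulr_sumr.
by apply: eq_bigr => b _; rewrite (linZ lphi) mulZl (linZ lal) !mulZr !mulrA.
Qed.

Lemma itw_sq y w : star (itw y w) * itw y w = \sum_a star (w a) * (star (y (rep a)) * j (phi (f (rep a)) * h) * y (rep a)) * w a.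
Proof.
rewrite /itw star_sum mulr_suml; apply: eq_bigr => a _; rewrite mulr_sumr (bigD1 a) //= big1 ?addr0 => [|b ba].
  by rewrite !starMr -(homS hj) -(oz_star hphi) -(vsv a) -(ozM fdG hphi) (homM hj) !mulrA.
rewrite !starMr -(homS hj) -(oz_star hphi).
have -> : star (w a) * (star (y (rep a)) * j (phi (star (v a)))) * (j (phi (v b)) * y (rep b) * w b) =
  star (w a) * star (y (rep a)) * (j (phi (star (v a))) * j (phi (v b))) * y (rep b) * w b by rewrite !mulrA.
by rewrite -(homM hj) (ozM fdG hphi) vsv_off 1?eq_sym // (lin0 lphi) mul0r (lin0 lj) mulr0 !mul0r.
Qed.

(** The mixed terms vanish by orthogonality of the ranges of the v_a; two further factors h turn
    phi(f) h into phi(f)^4, the power for which the columns y are prepared. *)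
Lemma itw_hsq y w : star (j h * itw y w) * (j h * itw y w) =
  \sum_a star (w a) * (star (y (rep a)) * j (phi (f (rep a)) * phi (f (rep a)) * (phi (f (rep a)) * phi (f (rep a)))) * y (rep a)) * w a.
Proof.
rewrite /itw mulr_sumr star_sum mulr_suml; apply: eq_bigr => a _; rewrite mulr_sumr (bigD1 a) //= big1 ?addr0 => [|b ba].
  rewrite !starMr -!(homS hj) (oz_h hphi) -(oz_star hphi).
  rewrite (oz_pow4 fdG hphi (hf (rep a))) -(vsv a) -(ozM fdG hphi (star (v a)) (v a)).
  have -> : phi (star (v a)) * phi (v a) * h * h = phi (star (v a)) * h * h * phi (v a).
    have hc := oz_comm fdG hphi (v a).
    by rewrite -(mulrA _ (phi (v a)) h) -hc !mulrA -(mulrA _ (phi (v a)) h) -hc !mulrA.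
  by rewrite !(homM hj) !mulrA.
rewrite !starMr -!(homS hj) (oz_h hphi) -(oz_star hphi).
have -> : star (w a) * (star (y (rep a)) * j (phi (star (v a)))) * j h * (j h * (j (phi (v b)) * y (rep b) * w b)) =
  star (w a) * star (y (rep a)) * j (phi (star (v a)) * h * h * phi (v b)) * y (rep b) * w b.
  by rewrite !(homM hj) !mulrA.
have -> : phi (star (v a)) * h * h * phi (v b) = phi (star (v a)) * phi (v b) * h * h.
  by rewrite -!mulrA !(oz_comm fdG hphi) !mulrA -(mulrA _ h) (oz_comm fdG hphi) !mulrA.
by rewrite (ozM fdG hphi (star (v a))) vsv_off 1?eq_sym // (lin0 lphi) !mul0r (lin0 lj) mulr0 !mul0r.
Qed.

Lemma itw_nrm y w Y Z : 0 <= Y -> 0 <= Z -> (forall a, nrm (y a) <= Y) -> ple (\sum_a star (w a) * w a) (Z ^+ 2)%:I ->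
  nrm (itw y w) <= Y * Z.
Proof.
move=> Y0 Z0 hy hw; apply: nrm_sqr_le; first exact: mulr_ge0.
rewrite itw_sq; apply: (@le_trans _ _ (nrm (\sum_a star (w a) * (Y ^+ 2)%:I * w a))).
  have pp a : pos (phi (f (rep a)) * h).
    have -> : phi (f (rep a)) * h = phi (f (rep a)) * phi (f (rep a)) by rewrite (ozM fdG hphi (f (rep a)) (f (rep a))) (proj1 (hf _)).
    by apply: pos_sqr; rewrite -(oz_star hphi) (proj2 (hf _)).
  have p1 a : pos (star (y (rep a)) * j (phi (f (rep a)) * h) * y (rep a)).
    by apply: pos_conj; apply: (hom_pos hj).
  apply: ple_nrm; first by apply: pos_sum => a _; apply: pos_conj.
  apply: ple_sum => a _; apply: ple_conj; apply: sa_ple; first exact: pos_sa.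
  rewrite expr2 -[Y * Y]mulr1 mulrAC; apply: nrmM_le => //; apply: nrmM_le; first by rewrite nrm_star.
  apply: le_trans (hom_nrm hj _) _.
  apply: (le_trans (nrmM_le (oz_nproj hphi (hf (rep a))) (le_trans (oz_nrm hphi 1) (nrm1 _)))).
  by rewrite mulr1.
have -> : \sum_a star (w a) * (Y ^+ 2)%:I * w a = (Y ^+ 2) *^ (\sum_a star (w a) * w a).
  by rewrite scaler_sumr; apply: eq_bigr => a _; rewrite mulZr mulr1 mulZl.
rewrite nrmZ0 ?exprn_ge0 // exprMn; apply: ler_wpM2l; first by rewrite exprn_ge0.
by apply: ple_nrm_rc => //; [rewrite exprn_ge0|apply: pos_sum => a _; apply: pos_cs].
Qed.

Lemma itw_sub y w w' Y d : (forall a, nrm (y a) <= Y) -> 0 <= d -> (forall a, nrm (w a - w' a) <= d) ->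
  nrm (itw y w - itw y w') <= K%:R * (Y * d).
Proof.
move=> hy d0 hw; rewrite /itw -sumrB -[in leRHS](card_ord K); apply: nrm_sum_const => a.
rewrite -mulrBr; apply: nrmM_le => //; rewrite -[Y]mul1r; apply: nrmM_le => //.
apply: le_trans (hom_nrm hj _) _; apply: le_trans (oz_nrm hphi _) _.
apply: nrm_sqr_le => //; rewrite expr1n vsv; exact: proj_nrm.
Qed.

Lemma itw_mulr y w z : itw y w * z = itw y (fun a => w a * z).
Proof. by rewrite mulr_suml; apply: eq_bigr => a _; rewrite !mulrA. Qed.

Variables (T : seq A) (eta : R).
Hypotheses (am : forall a b, a \in T -> b \in T -> nrm (al (a * b) - al a * al b) <= eta).
Hypotheses (eta0 : 0 <= eta) (Keta : K%:R * eta <= 1).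
Hypotheses (vT : forall a, phi (v a) \in T) (svT : forall a, phi (star (v a)) \in T) (hT : h \in T).

(** In the domain sum_a phi(v_a) phi(v_a)^* = h^2 exactly, as sum_a v_a v_a^* = 1; each term costs
    eta under the almost multiplicative map. *)
Lemma vsum : nrm (\sum_a al (phi (v a)) * al (phi (star (v a))) - al (h * h)) <= K%:R * eta.
Proof.
have [_ f1 _] := ms.
have -> : h * h = \sum_a phi (v a) * phi (star (v a)).
  rewrite -{1}f1 (lin_sum lphi) mulr_suml; apply: eq_bigr => a _.
  by rewrite (ozM fdG hphi (v a)) vvs.
rewrite (lin_sum lal) -sumrB -[in leRHS](card_ord K); apply: nrm_sum_const => a.
by rewrite nrmB; apply: am.
Qed.

Lemma nh : nrm h <= 1. Proof. exact: le_trans (oz_nrm hphi 1) (nrm1 _). Qed.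

Lemma nalh : nrm (al (h * h)) <= 1.
Proof. by apply: le_trans (nal _) _; have := nrmM_le nh nh; rewrite mulr1. Qed.

Lemma vsum_le : ple (\sum_a al (phi (v a)) * al (phi (star (v a)))) ((1 + K%:R * eta)%:I).
Proof.
have sv a : star (al (phi (v a))) = al (phi (star (v a))) by rewrite -sal -(oz_star hphi).
have sa : star (\sum_a al (phi (v a)) * al (phi (star (v a)))) = \sum_a al (phi (v a)) * al (phi (star (v a))).
  by rewrite star_sum; apply: eq_bigr => a _; rewrite starMr -sv starK.
have sh : star (al (h * h)) = al (h * h) by rewrite -sal starMr (oz_h hphi).
apply: ple_trans (ple_approx sa sh vsum) _; rewrite -rcD; apply: pleD; last exact: ple_refl.
by apply: sa_ple => //; exact: nalh.
Qed.

Local Notation X0 y := (itw y (fun a => al (phi (star (v a))))).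

Lemma X0_nrm y Y : 0 <= Y -> (forall a, nrm (y a) <= Y) -> nrm (X0 y) <= 2 * Y.
Proof.
move=> Y0 hy; rewrite mulrC; apply: itw_nrm => //.
have -> : \sum_a star (al (phi (star (v a)))) * al (phi (star (v a))) = \sum_a al (phi (v a)) * al (phi (star (v a))).
  by apply: eq_bigr => a _; rewrite -sal -(oz_star hphi) starK.
apply: ple_trans vsum_le _; rewrite /ple rcB; apply: pos_rc; move: Keta; lra.
Qed.

(** An approximate form of [itw_l]: h and phi(x) leave the argument of [al] at the price of almost
    multiplicativity. *)
Lemma X0_l y Y x : 0 <= Y -> (forall a, nrm (y a) <= Y) -> phi x \in T -> nrm x <= 2 ->
  nrm (j (phi x) * X0 y * al h - j h * X0 y * al (phi x)) <= 3 * (K%:R * (Y * eta)).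
Proof.
move=> Y0 hy xT nx; rewrite -!mulrA !itw_mulr.
have njx : nrm (j (phi x)) <= 2 by apply: le_trans (hom_nrm hj _) _; apply: le_trans (oz_nrm hphi _) nx.
have njh : nrm (j h) <= 1 by apply: le_trans (hom_nrm hj _) nh.
have -> : 3 * (K%:R * (Y * eta)) = 2 * (K%:R * (Y * eta)) + 1 * (K%:R * (Y * eta)) by ring.
apply: (@nrm_tri _ _ _ (j (phi x) * itw y (fun a => al (phi (star (v a)) * h)))).
  rewrite -mulrBr; apply: nrmM_le => //; apply: itw_sub => // a; rewrite nrmB; exact: am.
rewrite itw_l -mulrBr; apply: nrmM_le => //; apply: itw_sub => // a; exact: am.
Qed.

Variable e : G.
Hypotheses (eT : phi e \in T) (pe : pos e) (e1 : ple e 1).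

Lemma ne : nrm e <= 1. Proof. by apply: ple_nrm_rc => //; rewrite rc1. Qed.

(** With X for the intertwiner, a travels along a h X al(phi e), a phi(e) X al(h), phi(x) X al(h), h
    X al(phi x), h X al(phi(e) a), h X al(phi e) al(a). Here x and e stand for the images of a and 1
    under the downward map, so that a phi(e), phi(x) and phi(e) a are close. *)
Lemma inter_color y Y a x d : 0 <= Y -> (forall a, nrm (y a) <= Y) -> a \in T -> phi x \in T -> nrm a <= 1 ->
  nrm x <= 2 -> nrm (a * phi e - phi x) <= d -> nrm (phi x - phi e * a) <= d ->
  nrm (j a * (j h * X0 y * al (phi e)) - j h * X0 y * al (phi e) * al a) <= Y * (6 * K%:R * eta + 4 * d + 2 * eta).
Proof.
move=> Y0 hy aT xT na nx d1 d2.
have nX := X0_nrm Y0 hy.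
have njh : nrm (j h) <= 1 by apply: le_trans (hom_nrm hj _) nh.
have nja : nrm (j a) <= 1 by apply: le_trans (hom_nrm hj _) na.
have nalh1 : nrm (al h) <= 1 by apply: le_trans (nal _) nh.
have nhX : nrm (j h * X0 y) <= 1 * (2 * Y) by apply: nrmM_le.
pose E := 3 * (K%:R * (Y * eta)).
have -> : Y * (6 * K%:R * eta + 4 * d + 2 * eta) =
  1 * E + (d * (2 * Y) * 1 + (E + (1 * (2 * Y) * d + 1 * (2 * Y) * eta))) by rewrite /E; ring.
apply: (@nrm_tri _ _ _ (j a * (j (phi e) * X0 y * al h))).
  rewrite -mulrBr; apply: nrmM_le => //; rewrite nrmB; apply: X0_l => //; apply: le_trans ne _; lra.
apply: (@nrm_tri _ _ _ (j (phi x) * X0 y * al h)).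
  have -> : j a * (j (phi e) * X0 y * al h) = j (a * phi e) * X0 y * al h by rewrite (homM hj) !mulrA.
  rewrite -!mulrBl -(linB lj); apply: nrmM_le => //; apply: nrmM_le => //; exact: le_trans (hom_nrm hj _) d1.
apply: (@nrm_tri _ _ _ (j h * X0 y * al (phi x))); first exact: X0_l.
apply: (@nrm_tri _ _ _ (j h * X0 y * al (phi e * a))).
  by rewrite -mulrBr -(linB lal); apply: nrmM_le => //; apply: le_trans (nal _) d2.
rewrite -[X in _ - X]mulrA -mulrBr; apply: nrmM_le => //; exact: am.
Qed.

Variables (d : 'I_K -> R) (pq : 'I_K -> D) (t : R).
Hypotheses (ed : forall a, e * f a = d a *^ f a) (d01 : forall a, 0 <= d a <= 1).
Hypotheses (fT : forall a, phi (f a) \in T) (hhT : h * h \in T) (hhe : h * h * phi e \in T).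
Hypotheses (pX : forall c, pos (P - pq c)) (nX : forall c, nrm (P - pq c) <= 1) (t01 : 0 <= t <= 1).
Hypothesis hq : forall c, ple (al (phi (f c)) * (P - pq c) * al (phi (f c))) (t ^+ 2 *^ P).

Local Notation w a := (al (phi (star (v a))) * al (phi e)).

Lemma alphi_s x : star (al (phi x)) = al (phi (star x)).
Proof. by rewrite -sal -(oz_star hphi). Qed.

Lemma sae : star (al (phi e)) = al (phi e).
Proof. by rewrite alphi_s (pos_sa pe). Qed.

Lemma alv_n x : nrm x <= 1 -> nrm (al (phi x)) <= 1.
Proof. by move=> nx; apply: le_trans (nal _) _; apply: le_trans (oz_nrm hphi _) nx. Qed.

Lemma nv a : nrm (v a) <= 1.
Proof. apply: nrm_sqr_le => //; rewrite expr1n vsv; exact: proj_nrm. Qed.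

(** By [vsum] the sum is near al(phi e) al(h^2) al(phi e), and h^2 - phi(e)^2 is positive since
    phi(e) <= h commute. *)
Lemma wsum : ple (al (phi e * phi e * (phi e * phi e))) (\sum_a star (w a) * w a + ((K%:R + 2) * eta)%:I) /\
  ple (\sum_a star (w a) * w a) 2%:I.
Proof.
have E : \sum_a star (w a) * w a = al (phi e) * (\sum_a al (phi (v a)) * al (phi (star (v a)))) * al (phi e).
  by rewrite mulr_sumr mulr_suml; apply: eq_bigr => a _; rewrite starMr sae alphi_s starK !mulrA.
have nale := alv_n ne.
split; last first.
  rewrite E; apply: ple_trans (ple_conj_sa sae vsum_le) _; rewrite mulZr mulZl mulr1.
  apply: sa_ple; first by rewrite starZr starMr sae.
  rewrite nrmZ0 ?addr_ge0 ?mulr_ge0 //; have := nrmM_le nale nale; move: Keta.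
  have := nrm_ge0 (al (phi e) * al (phi e)); have : 0 <= K%:R * eta by rewrite mulr_ge0.
  by nra.
have sS : star (\sum_a star (w a) * w a) = \sum_a star (w a) * w a.
  by rewrite star_sum; apply: eq_bigr => a _; rewrite starMr starK.
have sh := oz_h hphi; have se : star (phi e) = phi e by rewrite -(oz_star hphi) (pos_sa pe).
have sM : star (al (phi e * (h * h * phi e))) = al (phi e * (h * h * phi e)).
  by rewrite -sal !starMr se sh !mulrA.
apply: (@ple_trans _ _ _ (al (phi e * (h * h * phi e)))).
  have ple_h : ple (phi e) h by rewrite /ple -(linB lphi); apply: (oz_pos hphi).
  have ce := oz_comm fdG hphi e.
  have p1 : pos (h * h - phi e * phi e).
    have -> : h * h - phi e * phi e = h * (h - phi e) + (h - phi e) * phi e.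
      by rewrite mulrBr mulrBl ce; ncring.
    apply: posD; apply: pos_mulC => //.
    - exact: (oz_pos hphi (pos1 G)).
    - by rewrite mulrBr mulrBl ce.
    - exact: (oz_pos hphi).
    - by rewrite mulrBr mulrBl ce.
  rewrite /ple -(linB lal); apply: pal.
  have -> : phi e * (h * h * phi e) - phi e * phi e * (phi e * phi e) = phi e * (h * h - phi e * phi e) * phi e.
    by ncring.
  exact: pos_conj_sa.
apply: ple_approx => //; rewrite E.
have -> : (K%:R + 2) * eta = eta + (1 * eta + 1 * (K%:R * eta) * 1) by ring.
apply: (@nrm_tri _ _ _ (al (phi e) * al (h * h * phi e))); first exact: am.
apply: (@nrm_tri _ _ _ (al (phi e) * (al (h * h) * al (phi e)))).
  by rewrite -mulrBr; apply: nrmM_le => //; apply: am.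
rewrite mulrA -mulrBl -mulrBr; apply: nrmM_le => //; apply: nrmM_le => //; rewrite nrmB; exact: vsum.
Qed.

Lemma w_cut a : ple (star (w a) * (P - pq (rep a)) * w a)
  (t ^+ 2 *^ (al (phi (v a)) * al (phi (star (v a)))) + (4 * eta)%:I).
Proof.
pose g := al (phi (f (rep a))); pose u := d a *^ (g * al (phi (star (v a)))).
have nsv : nrm (al (phi (star (v a)))) <= 1 by apply: alv_n; rewrite nrm_star nv.
have ng : nrm g <= 1 by apply: alv_n; apply: proj_nrm.
have [d0 d1] := andP (d01 a).
have nw : nrm (w a) <= 1 by have := nrmM_le nsv (alv_n ne); rewrite mulr1.
have nu : nrm u <= 1.
  by rewrite /u nrmZ0 //; have := nrmM_le ng nsv; have := nrm_ge0 (g * al (phi (star (v a)))); nra.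
have wu : nrm (w a - u) <= 2 * eta.
  have fe : f a * e = d a *^ f a by rewrite -[LHS]starK starMr (pos_sa pe) (proj2 (hf a)) ed starZr (proj2 (hf a)).
  have E1 : phi (star (v a)) * phi e = d a *^ (phi (f (rep a)) * phi (star (v a))).
    rewrite (ozM fdG hphi (star (v a))) (ozM fdG hphi (f (rep a))) f_v.
    have -> : star (v a) * e = d a *^ star (v a).
      have -> : star (v a) = star (v a) * f a by have := congr1 star (fv a); rewrite starMr (proj2 (hf a)) => ->.
      by rewrite -mulrA fe mulZr.
    by rewrite (linZ lphi) mulZl.
  have -> : 2 * eta = eta + d a * eta + (1 - d a) * eta by ring.
  rewrite -[X in X <= _]addr0; apply: lerD; last by rewrite mulr_ge0 // subr_ge0.
  apply: (@nrm_tri _ _ _ (al (phi (star (v a)) * phi e))); first by rewrite nrmB; apply: am.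
  rewrite E1 (linZ lal) /u -scalerBr nrmZ0 //; apply: ler_wpM2l => //; exact: am.
set X := P - pq (rep a).
apply: (@ple_trans _ _ _ (star u * X * u + (4 * eta)%:I)).
  have sX : star X = X := pos_sa (pX _).
  have scj (z : D) : star (star z * X * z) = star z * X * z by rewrite !starMr starK sX mulrA.
  apply: ple_approx; [exact: scj|exact: scj|].
  have -> : star (w a) * X * w a - star u * X * u = star (w a - u) * X * w a + star u * X * (w a - u).
    by rewrite starB; ncring.
  apply: le_trans (nrmD _ _) _; have -> : 4 * eta = 2 * eta * 1 * 1 + 1 * 1 * (2 * eta) by ring.
  by apply: lerD; (apply: nrmM_le; first (apply: nrmM_le; rewrite ?nrm_star //; exact: nX)).
apply: pleD; last exact: ple_refl.
have -> : star u * X * u = d a ^+ 2 *^ (al (phi (v a)) * (g * X * g) * al (phi (star (v a)))).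
  rewrite /u starZr starMr !alphi_s starK (proj2 (hf _)) !(mulZl, mulZr) rcM expr2; congr (_ *: _).
  by rewrite !mulrA.
have sv : star (al (phi (star (v a)))) = al (phi (v a)) by rewrite alphi_s starK.
have pg : pos (g * X * g) by apply: pos_conj_sa; [rewrite /g alphi_s (proj2 (hf _))|exact: pX].
apply: (@ple_trans _ _ _ (al (phi (v a)) * (g * X * g) * al (phi (star (v a))))).
  rewrite -[X in ple _ X]rc1; apply: pleZr; first by rewrite expr_le1.
  by rewrite -sv; apply: pos_conj.
have := ple_conj (al (phi (star (v a)))) (hq (rep a)); rewrite -/g -/X sv => h1.
by apply: (ple_trans h1); rewrite mulZr mulZl -mulrA alP; exact: ple_refl.
Qed.

(** Each block contributes s w_a^* pq w_a up to eps; replacing pq by P costs t^2 by [w_cut], and the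
    sum of the w_a^* w_a is bounded below by [wsum]. The error terms do not grow with n. *)
Lemma lower_color n (y : 'I_n -> 'I_K -> D) s eps : 0 <= s -> 0 <= eps ->
  (forall c, ple (s *^ pq c) (\sum_i star (y i c) *
     j (phi (f c) * phi (f c) * (phi (f c) * phi (f c))) * y i c + eps%:I)) ->
  ple (s *^ al (phi e * phi e * (phi e * phi e)))
    (\sum_i star (j h * X0 (y i) * al (phi e)) * (j h * X0 (y i) * al (phi e)) +
     (s * (t ^+ 2 + 8 * (K%:R + 1) * eta) + 2 * eps)%:I).
Proof.
move=> s0 eps0 hy; have [w1 w2] := wsum; have [t0 t1] := andP t01.
set S1 := \sum_a star (w a) * w a in w1 w2.
pose Z c := \sum_i star (y i c) * j (phi (f c) * phi (f c) * (phi (f c) * phi (f c))) * y i c.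
have -> : \sum_i star (j h * X0 (y i) * al (phi e)) * (j h * X0 (y i) * al (phi e)) =
    \sum_a star (w a) * Z (rep a) * w a.
  have E i : star (j h * X0 (y i) * al (phi e)) * (j h * X0 (y i) * al (phi e)) =
     \sum_a star (w a) * (star (y i (rep a)) * j (phi (f (rep a)) * phi (f (rep a)) * (phi (f (rep a)) * phi (f (rep a)))) * y i (rep a)) * w a.
    by rewrite -(mulrA (j h)) itw_mulr itw_hsq.
  rewrite (eq_bigr _ (fun i _ => E i)) exchange_big; apply: eq_bigr => a _ /=.
  by rewrite /Z mulr_sumr mulr_suml.
have h1 : ple (s *^ (\sum_a star (w a) * pq (rep a) * w a)) (\sum_a star (w a) * Z (rep a) * w a + eps *^ S1).
  rewrite !scaler_sumr -big_split /=; apply: ple_sum => a _.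
  have := ple_conj (w a) (hy (rep a)); rewrite mulrDr mulrDl mulZr mulZl mulZr mulZl mulr1; exact.
have h2 : ple (\sum_a star (w a) * (P - pq (rep a)) * w a) ((t ^+ 2 + 5 * K%:R * eta)%:I).
  apply: ple_trans; first by apply: ple_sum => a _; exact: w_cut.
  rewrite big_split /= -scaler_sumr sumr_const card_ord.
  have -> : (4 * eta)%:I *+ K = (K%:R * (4 * eta))%:I by rewrite -(rcM K%:R) rcnat.
  have a1 := pleZ (sqr_ge0 t) vsum_le.
  apply: (@ple_trans _ _ _ (t ^+ 2 *^ (1 + K%:R * eta)%:I + (K%:R * (4 * eta))%:I)).
    by apply: pleD => //; exact: ple_refl.
  rewrite rcM rcD /ple rcB; apply: pos_rc.
  have K0 : 0 <= K%:R * eta by rewrite mulr_ge0.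
  have : t ^+ 2 * (K%:R * eta) <= 1 * (K%:R * eta) by apply: ler_wpM2r => //; rewrite expr_le1.
  lra.
have E : \sum_a star (w a) * (P - pq (rep a)) * w a = S1 - \sum_a star (w a) * pq (rep a) * w a.
  rewrite -sumrB; apply: eq_bigr => a _; rewrite mulrBr mulrBl -mulrA.
  by congr (_ * _ - _); rewrite mulrA alP.
rewrite E in h2.
have h3 := pleZ s0 (pleD w1 h2).
have h4 := pleZ eps0 w2.
have h5 := pleD h3 (pleD h1 h4).
have : pos ((\sum_a star (w a) * Z (rep a) * w a + (s * (t ^+ 2 + (6 * K%:R + 2) * eta) + 2 * eps)%:I) -
   s *^ al (phi e * phi e * (phi e * phi e))).
  move: h5; rewrite /ple; set q := al _; set B := \sum_a star (w a) * Z (rep a) * w a; set B' := \sum_a _.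
  set l := (X in pos X -> _); set l' := (X in _ -> pos X).
  have -> // : l = l'.
  rewrite /l /l' !rcM !scalerDr !rcM.
  have -> : s * (t ^+ 2 + (6 * K%:R + 2) * eta) + 2 * eps = s * ((K%:R + 2) * eta) + s * (t ^+ 2 + 5 * K%:R * eta) + eps * 2 by ring.
  rewrite -!rcD; ncring.
move=> h6; apply: (@ple_trans _ _ _ _ _ h6); apply: pleD; first exact: ple_refl.
rewrite /ple rcB; apply: pos_rc.
have K0 : 0 <= K%:R * eta by rewrite mulr_ge0.
have : 0 <= s * ((8 * (K%:R + 1) - (6 * K%:R + 2)) * eta).
  by rewrite !mulr_ge0 //; have : 0 <= K%:R :> R by []; lra.
lra.
Qed.

End Intertwiner.

(** * Polar parts of columns *)

Section Normalize.
Variables (R : realType) (D : cstarType R).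
Implicit Types (x y k : D) (r d : R).
Local Notation "t %:I" := (t%:C *: (1 : D)) (at level 1, left associativity, format "t %:I").

Lemma projC (P : D) : projection P -> projection (1 - P).
Proof.
move=> [pp sp]; split; last by rewrite starB star1 sp.
by rewrite mulrBr !mulrBl !mul1r !mulr1 pp subrr subr0.
Qed.

(** The bound on |k| plus Y times the constant of [comm_invsqrt]. Only the number of entries, the
    lower bound and the norm bound enter, so it is known before any tolerance is chosen. *)
Definition ncst n r Y : R := (r^-1 + 1) +
  Y * ((n%:R * Y ^+ 2 + 1) * (r^-1 + 1) / 2 * (r^-1 * (n%:R * (2 * Y)) * r^-1)).

Variables (I : finType) (W : I -> D) (P : D) (r Y : R).
Hypotheses (pP : projection P) (WP : forall i, W i * P = W i) (r01 : 0 < r <= 1).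
Hypothesis lW : ple (r *^ P) (\sum_i star (W i) * W i).
Hypothesis nW : forall i, nrm (W i) <= Y.

(* The polar part of a column W with W^*W bounded below on the range of P *)
Lemma normalize : exists k, [/\ pos k, P * k = k * P,
  \sum_i star (W i * k) * (W i * k) = P,
  (forall E, csub E -> E P -> (forall i, E (W i)) -> E k)
  & forall x y d, 0 <= d -> P * y = y * P -> (forall i, nrm (x * W i - W i * y) <= d) ->
    (forall i, nrm (star x * W i - W i * star y) <= d) ->
    forall i, nrm (x * (W i * k) - W i * k * y) <= ncst #|I| r Y * d].
Proof.
have [r0 r1] := andP r01; pose T := \sum_i star (W i) * W i; have [PP sP] := pP.
have PW i : P * star (W i) = star (W i) by have := congr1 star (WP i); rewrite starMr sP.
have TP : T * P = T by rewrite mulr_suml; apply: eq_bigr => i _; rewrite -mulrA WP.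
have PT : P * T = T by rewrite mulr_sumr; apply: eq_bigr => i _; rewrite mulrA PW.
have pT : pos T by apply: pos_sum => i _; apply: pos_cs.
(* Adding 1 - P makes the column square invertible without changing it on the range of P. *)
pose c := T + (1 - P); pose r' := #|I|%:R * Y ^+ 2 + 1.
have r'0 : 0 < r' by rewrite ltr_pwDr // mulr_ge0 // sqr_ge0.
have h1 : ple r%:I c.
  have -> : r%:I = r *^ P + r *^ (1 - P) by rewrite -scalerDr addrC subrK.
  apply: pleD => //; rewrite -[X in ple _ X]rc1; apply: pleZr => //; exact: proj_pos (projC pP).
have nT : nrm T <= #|I|%:R * Y ^+ 2.
  by apply: nrm_sum_const => i; rewrite expr2; apply: nrmM_le; rewrite ?nrm_star.
have h2 : ple c r'%:I.
  rewrite /r' -rcD rc1; apply: pleD; first exact: sa_ple (pos_sa pT) nT.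
  by rewrite /ple opprB addrC subrK; exact: proj_pos pP.
have [k [kck pk kc kE]] := invsqrt r0 h1.
have ck : c * k = k * c by apply: kc.
have cP : P * c = c * P by rewrite /c mulrDl mulrDr PT TP mulrBl mulrBr PP mul1r mulr1.
have Pk : P * k = k * P by apply: kc.
have sk := pos_sa pk; have nk := invsqrt_nrm r0 h1 kck pk.
exists k; split => //.
- have -> : \sum_i star (W i * k) * (W i * k) = k * T * k.
    by rewrite mulr_sumr mulr_suml; apply: eq_bigr => i _; rewrite starMr sk !mulrA.
  have e1 : k * T * k = k * c * k * P.
    rewrite -[RHS]mulrA -Pk mulrA -(mulrA k c P) -cP (_ : P * c = T) //.
    by rewrite /c mulrDr PT mulrBr PP mulr1 subrr addr0.
  by rewrite e1 kck mul1r.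
- move=> E hE EP EW; apply: kE => //; apply: csubD => //; last by apply: csubB => //; exact: csub1.
  by apply: (csub_sum hE) => i; apply: csubM => //; apply: csubS.
move=> x y d d0 Py h3 h4 i.
have -> : x * (W i * k) - W i * k * y = (x * W i - W i * y) * k + W i * (y * k - k * y) by ncring.
apply: le_trans (nrmD _ _) _; rewrite /ncst [leRHS]mulrDl; apply: lerD; first by rewrite [leRHS]mulrC; apply: nrmM_le.
rewrite -[leRHS]mulrA; apply: nrmM_le => //; apply: le_trans (comm_invsqrt y r0 r'0 h1 h2 kck pk ck) _.
have hc : nrm (y * c - c * y) <= #|I|%:R * (2 * Y) * d.
  (* The commutator of y with W_i^* W_i is expressed by the defects for x and for its adjoint, which
     is why both are assumed small. *)
  have -> : y * c - c * y = \sum_i (star (W i) * (x * W i - W i * y) - star (star x * W i - W i * star y) * W i).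
    have -> : y * c - c * y = y * T - T * y.
      by rewrite /c !(mulrDl, mulrDr) !(mulrN, mulNr) Py mulr1 mul1r; ncring.
    rewrite mulr_sumr mulr_suml -sumrB; apply: eq_bigr => l _.
    by rewrite starB !starMr !starK; ncring.
  rewrite -mulrA; apply: nrm_sum_const => l; apply: le_trans (nrmD _ _) _; rewrite nrmN.
  have -> : 2 * Y * d = Y * d + d * Y by ring.
  by apply: lerD; apply: nrmM_le => //; rewrite nrm_star.
have ri : 0 <= r^-1 by rewrite invr_ge0 ltW.
have -> : #|I|%:R * Y ^+ 2 + 1 = r' by [].
have q0 : 0 <= r' * (r^-1 + 1) / 2 by have := mulr_ge0 (ltW r'0) ri; lra.
rewrite -[leRHS]mulrA; apply: ler_wpM2l => //.
rewrite [leRHS]mulrAC; apply: ler_wpM2r => //; rewrite -[leRHS]mulrA; exact: ler_wpM2l.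
Qed.
End Normalize.

Section SleTools.
Variables (R : realType) (A D : cstarType R) (j : A -> D).
Hypothesis hj : unital_star_hom j.
Variable L : D -> Prop.
Hypothesis Lj : forall a, L (j a).
Let lj : linear j. Proof. by case: hj => [[]]. Qed.

Lemma sle_cst (B : cstarType R) (E : B -> Prop) K N x y : usub E -> sle E (nseq K x) (nseq N y) ->
  cle E (fun _ : 'I_K => x) (fun _ : 'I_N => y).
Proof.
move=> uE h; have sK n (z : B) : n = size (nseq n z) by rewrite size_nseq.
have ni n (z : B) (i : 'I_(size (nseq n z))) : nth 0 (nseq n z) i = z.
  by have h1 := ltn_ord i; rewrite nth_nseq; rewrite [X in (_ < X)%N]size_nseq in h1; rewrite h1.
apply: (cle_trans uE (b := fun i : 'I_(size (nseq K x)) => nth 0 (nseq K x) i)).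
  by apply: (cle_sub uE (f := cast_ord (sK K x))) => [|i]; [exact: cast_ord_inj|rewrite ni].
apply: (cle_trans uE h).
by apply: (cle_sub uE (f := cast_ord (esym (sK N y)))) => [|i]; [exact: cast_ord_inj|rewrite ni].
Qed.

Lemma sle_hom K x N y : usub L -> sle (@allA _ A) (nseq K x) (nseq N y) -> sle L (nseq K (j x)) (nseq N (j y)).
Proof.
move=> uL h; have := sle_cst (usub_all A) h => h1.
have h2 : cle L (fun _ : 'I_K => j x) (fun _ : 'I_N => j y).
  move=> e e0; have [V [_ hV]] := h1 e e0; exists (fun b a => j (V b a)); split => // a a'.
  apply: le_trans (hV a a'); apply: le_trans (hom_nrm hj _).
  rewrite (linB lj) (lin_sum lj).
  set s1 := (X in nrm (X - _) <= _); set s2 := (X in _ <= nrm (X - _)); have -> : s1 = s2.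
    by apply: eq_bigr => b _; rewrite !(homM hj) (homS hj).
  by case: eqP; rewrite ?(lin0 lj).
by have := sle_fam uL h2; rewrite !codom_cst !card_ord.
Qed.

Lemma sle_one (E : D -> Prop) a b C e : usub E -> sle E [:: a] (nseq C b) -> 0 < e -> exists z : 'I_C -> D,
  (forall i, E (z i)) /\ nrm (\sum_i star (z i) * b * z i - a) <= e.
Proof.
move=> uE h e0; have h1 := sle_cst (K := 1) uE h; have [V [hE hV]] := h1 e e0.
by exists (fun i => V i ord0); split => //; have := hV ord0 ord0; rewrite eqxx.
Qed.
End SleTools.

(** * Spectral projections of the model below copies of a cut *)

Section Columns.
Variables (R : realType) (A M D : cstarType R) (j : A -> D) (tau : A -> R[i]) (S : seq A) (eps : R).
Variables (sg : A -> M) (k : nat) (v : 'I_k -> M) (e0 : M) (nu : 'I_k -> 'I_k -> D).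
Hypotheses (hj : unital_star_hom j) (hm : qmodel tau S eps sg v e0) (tau_pos : forall x, pos x -> 0 <= tau x).
Hypotheses (nuM : forall a b c d, nu a b * nu c d = if b == c then nu a d else 0).
Hypothesis nuS : forall a b, star (nu a b) = nu b a.
Variables (u : nat) (mu : 'I_u.+1 -> 'I_u.+1 -> D) (L E : D -> Prop).
Hypotheses (hmu : munits mu) (uL : usub L) (uE : usub E) (LE : forall x, L x -> E x) (muE : forall a b, E (mu a b)).
Hypotheses (muL : forall a b x, L x -> mu a b * x = x * mu a b) (nuL : forall a b, L (nu a b)) (jL : forall a, L (j a)).
Local Notation "t %:I" := (t%:C *: (1 : D)) (at level 1, left associativity, format "t %:I").
Local Notation P := (\sum_i nu i i).
Local Notation al := (fun a => rho v e0 nu (sg a)).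

(** On the cut c one has c (g - s) = c^2, so c (g^4 - s^4) = c^2 q with q = g^3 + s g^2 + s^2 g +
    s^3, a product of commuting positive elements. *)
Lemma pow4_low (B : cstarType R) (s : R) (g c : B) : 0 <= s -> pos g -> pos c -> c * g = g * c ->
  c * (g - s%:C *: (1 : B)) = c * c -> ple ((s * (s * (s * s))) *^ c) (c * (g * g * (g * g))).
Proof.
move=> s0 pg pc cg cc; pose q := g * g * g + s *^ (g * g + s *^ (g + s *^ (1 : B))).
have cq : c * q = q * c by rewrite /q; do 20?[rewrite ?mulrDl ?mulrDr ?mulZl ?mulZr ?mulr1 ?mul1r ?mulrA ?cg -?(mulrA _ c g) ?cg ?mulrA].
have pgg : pos (g * g) by apply: pos_sqr; exact: pos_sa.
have pq : pos q.
  apply: posD; first by apply: pos_mulC => //; rewrite mulrA.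
  by apply: posZ => //; apply: posD => //; apply: posZ => //; apply: posD => //; apply: posZ => //; exact: pos1.
rewrite /ple; have -> : c * (g * g * (g * g)) - (s * (s * (s * s))) *^ c = c * c * q.
  by rewrite -cc /q -!rcM; ncring.
by apply: pos_mulC => //; [apply: pos_sqr; exact: pos_sa|rewrite -mulrA cq mulrA cq mulrA].
Qed.

(** The projection [pq] is the image of the spectral projection of the model of g above t, and g' is
    the cut of g at t/2. Eigenvalue counting gives k [pq] <= #|J| [1] with #|J| t/2 at most about k
    tau(g'), while M1 [1] <= M2 [g']. The ratio depends on kc and t only, so [unperf] yields C
    copies of g', uniformly in the model. *)
Lemma spectral_column (g : A) (t kc eta : R) (C : nat) : pos g -> ple g 1 -> 0 < t <= 1 -> 0 < eta <= 1 -> (8 * kc <= C%:R * t) ->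
  cut (t / 2) g \in S ->
  (cut (t / 2) g <> 0 -> exists M1 M2, [/\ (0 < M1)%N, M2%:R * complex.Re (tau (cut (t / 2) g)) <= kc * M1%:R,
     sle (@allA _ A) (nseq M1 1) (nseq M2 (cut (t / 2) g)), (M1 * k <= u.+1)%N & eps <= complex.Re (tau (cut (t / 2) g))]) ->
  exists (pq : D) (y : 'I_C -> D),
  [/\ pos (P - pq) /\ nrm (P - pq) <= 1, ple (al g * (P - pq) * al g) (t ^+ 2 *^ P),
    (forall i, nrm (y i) <= 2), (forall i, E (y i))
  & ple ((t / 2 * (t / 2 * (t / 2 * (t / 2)))) *^ pq) (\sum_i star (y i) * j (g * g * (g * g)) * y i + eta%:I)].
Proof.
move=> pg g1 /andP[t0 t1] /andP[eta0 eta1] hC gS hkey.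
have [] := hm; set g0 := \sum_i v i * star (v i).
move=> [k0 fM] [me vv] [lsg psg ssg nsg] [gsg sg1] [sgm sgt].
have g0E : \sum_i v i * star (v i) = g0 by [].
have lr : linear (rho v e0 nu) by apply: rho_lin.
have rM x y : rho v e0 nu x * rho v e0 nu y = rho v e0 nu (x * g0 * y) by apply: rho_mul.
have rP : rho v e0 nu g0 = P by apply: rho_g0.
have rpos x : pos x -> pos (rho v e0 nu x) by apply: rho_pos.
have rn x : nrm (rho v e0 nu x) <= nrm x by apply: rho_nrm.
have rcor x : rho v e0 nu (g0 * x * g0) = rho v e0 nu x by apply: rho_corner.
have [gg sg0] : projection g0 by apply: (g0_proj me vv).
have psgg := psg _ pg; have sgg := pos_sa psgg.
have ng : nrm g <= 1 by apply: ple_nrm_rc => //; rewrite rc1.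
have sgg1 : ple (sg g) 1 by rewrite -[1]rc1; apply: sa_ple => //; exact: le_trans (nsg _) ng.
have [l [r [ms /choice [d hd]]]] := fd_system (proj1 fM) sgg.
have d01 := adapted_unit psgg sgg1 ms hd.
have [[hr r0 ro] r1 _] := ms.
have rmin i := msys_min ms i.
(* A nonzero eigenvalue forces the eigenprojection into the corner, so q lies below g0. *)
pose J := [pred i | t < d i]; pose q := \sum_(i | J i) r i.
have gr i : J i -> g0 * r i = r i.
  move=> Ji; have di : d i <> 0 by apply/eqP; rewrite lt0r_neq0 // (lt_trans t0).
  have E1 : r i = (d i)^-1 *^ (sg g * r i) by rewrite hd rcM mulVf ?rc1 //; apply/eqP.
  by rewrite E1 mulZr mulrA (gsg g).1.
have gq : g0 * q = q by rewrite /q mulr_sumr; apply: eq_bigr.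
have sq : star q = q by rewrite /q star_sum; apply: eq_bigr => i _; exact: (proj2 (hr i)).
have rq i : r i * q = if J i then r i else 0.
  rewrite /q mulr_sumr; case: ifP => Ji.
    rewrite (bigD1 i) //= (proj1 (hr i)) big1 ?addr0 // => b /andP[_ bi]; apply: ro; apply/eqP; by rewrite eq_sym.
  by rewrite big1 // => b Jb; apply: ro => ib; rewrite ib Jb in Ji.
have qq : q * q = q by rewrite {1}/q mulr_suml; apply: eq_bigr => i Ji; rewrite rq Ji.
have qg : q * g0 = q by have := congr1 star gq; rewrite starMr sq sg0.
have pgq : projection (g0 - q).
  split; last by rewrite starB sg0 sq.
  by rewrite mulrBr !mulrBl gg qg gq qq subrr subr0.
pose pq := rho v e0 nu q.
have PE : P - pq = rho v e0 nu (g0 - q) by rewrite (linB lr) rP.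
have b1 : ple (al g * (P - pq) * al g) (t ^+ 2 *^ P).
  rewrite PE !rM.
  have -> : sg g * g0 * (g0 - q) * g0 * sg g = sg g * (1 - q) * sg g.
    by rewrite (proj2 (gsg g)) -(mulrA _ g0) (proj1 (gsg g)) !mulrBr (proj2 (gsg g)) mulr1.
  have -> : t ^+ 2 *^ P = rho v e0 nu (t ^+ 2 *^ g0) by rewrite (linZ lr) rP.
  rewrite /ple -(linB lr) -rcor; apply: rpos.
  have -> : g0 * (t ^+ 2 *^ g0 - sg g * (1 - q) * sg g) * g0 = g0 * (t ^+ 2 *^ (1 : M) - sg g * (1 - q) * sg g) * g0.
    by rewrite !mulrBr !mulrBl !mulZr mulr1 !mulZl gg gg.
  apply: pos_conj_sa => //.
  have E1 : sg g * (1 - q) * sg g = \sum_i (if J i then 0 else d i ^+ 2) *^ r i.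
    have dr i : r i * sg g = d i *^ r i.
      by rewrite -[LHS]starK starMr sgg (proj2 (hr i)) hd starZr (proj2 (hr i)).
    have sgE : sg g = \sum_i d i *^ r i by rewrite -[LHS]mulr1 -r1 mulr_sumr; apply: eq_bigr => i _; exact: hd.
    rewrite {1}sgE !mulr_suml; apply: eq_bigr => i _; rewrite -mulrA mulZl mulrA mulrBr mulr1 rq.
    by case: ifP => _; rewrite ?subrr ?mul0r ?scaler0 ?rc0 // subr0 dr rcM.
  apply: nrm_pos.
    by rewrite E1 star_sum; apply: eq_bigr => i _; rewrite starZr (proj2 (hr i)).
  rewrite E1; apply: (diag_nrm ms) => [|i]; first exact: sqr_ge0.
  have /andP[di0 di1] := d01 i; case: ifP => Ji; first by rewrite normr0 sqr_ge0.
  rewrite ger0_norm ?sqr_ge0 // lerXn2r ?nnegrE //; first exact: ltW.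
  by rewrite leNgt; apply: negbT Ji.
have b0 : pos (P - pq) /\ nrm (P - pq) <= 1.
  rewrite PE; split; first by apply: rpos; exact: proj_pos.
  by apply: le_trans (rn _) _; exact: proj_nrm.
have t2 : 0 <= t / 2 <= 1 by lra.
have [c1 c2 c3 c4 c5] := cutP t2 pg ng; set g' := cut _ g in c1 c2 c3 c4 c5 gS hkey *.
pose s := t / 2 * (t / 2 * (t / 2 * (t / 2))).
have s1 : 0 <= s <= 1.
  have h1 (x : R) : 0 <= x <= 1 -> 0 <= t / 2 * x <= 1 by nra.
  by rewrite /s; apply: (h1 _ (h1 _ (h1 _ t2))).
(* From g <= t/2 + g' an eigenvalue of the model of g above t leaves at least t/2 for g'. *)
have dJ i : J i -> t / 2 <= complex.Re (coef r i (sg g')).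
  move=> Ji; have h1 : pos ((t / 2)%:C *: (1 : M) + sg g' - sg g).
    have := psg _ c4; rewrite (linB lsg) (linD lsg) (linZ lsg) => h.
    have h2 : pos ((t / 2)%:C *: (1 : M) - (t / 2)%:C *: sg 1).
      rewrite -scalerBr; apply: posZ; first by case/andP: t2.
      have h3 : ple (sg 1) (1%:C *: (1 : M)); last by rewrite rc1 in h3.
      by apply: sa_ple; [rewrite -ssg star1|apply: le_trans (nsg _) (nrm1 _)].
    have := posD h2 h; set a := (X in pos X -> _); set b := (X in _ -> pos X); have -> // : a = b.
    by rewrite /a /b; ncring.
  have := coef_ge0 ms i h1; rewrite -[- sg g]scaleN1r !(coefD ms) !(coefZ ms) (coef1 ms).
  have -> : coef r i (sg g) = (d i)%:C by apply: (coef_uniq ms); rewrite -mulrA hd mulZr (proj1 (hr i)).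
  have [-> _] := ge0_Re (coef_ge0 ms i (psg _ c1)).
  rewrite mulr1 mulN1r -rmorphD -rmorphB (_ : 0 = 0%:C) // lecC /=; move: Ji; rewrite /J /=; lra.
have ftrE : ftr r (sg g') = (\sum_i complex.Re (coef r i (sg g')))%:C.
  rewrite /ftr rmorph_sum; apply: eq_bigr => i _.
  by have [-> _] := ge0_Re (coef_ge0 ms i (psg _ c1)).
have cge i : 0 <= complex.Re (coef r i (sg g')) := proj2 (ge0_Re (coef_ge0 ms i (psg _ c1))).
have cardJ : #|J|%:R * (t / 2) <= complex.Re (ftr r (sg g')).
  rewrite ftrE /= (bigID J) /= -[leLHS]addr0; apply: lerD; last by apply: sumr_ge0.
  by rewrite mulr_natl -sumr_const; apply: ler_sum => i; exact: dJ.
(* If the cut vanishes there is no eigenvalue above t, and zero columns will do. *)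
have [g'0|g'0] := eqVneq g' 0.
  have J0 i : ~~ J i.
    apply/negP => Ji; have := dJ i Ji; rewrite g'0 (lin0 lsg) (coef0 ms) /=; lra.
  have q0 : q = 0 by rewrite /q big1 // => i Ji; have := J0 i; rewrite Ji.
  exists pq, (fun _ => 0); split => // [i|i|]; rewrite ?nrm0 //; first exact: (usub0 uE).
  rewrite /pq q0 (lin0 lr) scaler0 big1 ?add0r => [|i _]; last by rewrite mulr0.
  by apply: ple0; apply: pos_rc; exact: ltW.
move/eqP: g'0 => g'0; have [M1 [M2 [M10 hM hs hu he]]] := hkey g'0.
have hJ : sle L (nseq k pq) (nseq #|J| 1).
  have := @rho_sum_sle _ M D k v e0 nu me vv nuM nuS g0 g0E L uL nuL fM {i | J i} (fun i => r (val i)).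
  rewrite -(sum_sig J) card_sig; apply => [i|i|i b ib]; [exact: rmin|exact: gr (valP i)|].
  by apply: ro => h; move/eqP: ib; apply; apply: val_inj.
have hs' : sle L (nseq (M1 * k) pq) (nseq (#|J| * M2) (j g')).
  have h1 := sle_smul uL M1 hJ; rewrite !smul_nseq in h1; apply: (sle_trans uL h1).
  have h2 := sle_smul uL #|J| (sle_hom hj jL uL hs); rewrite !smul_nseq (hom1 hj) in h2.
  by rewrite mulnC.
have hun : sle E [:: pq] (nseq C (j g')).
  apply: (unperf hmu uL uE LE muE muL _ _ _ hu _ hs') => //; first by apply: rho_E.
    by rewrite muln_gt0 M10.
  have h1 := sgt g' l r gS (pos_sa c1) ms.
  (* Since eps <= tau(g'), the trace of the model is at most 2 k tau(g'), so #|J| t <= 4 k tau(g').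
     Doubling for [unperf] explains the 8 in the condition on C. *)
  have tr0 : tau g' = (complex.Re (tau g'))%:C -> (2 * (#|J| * M2) <= C * (M1 * k))%N.
    move=> tE; have h2 : complex.Re (ftr r (sg g')) - k%:R * complex.Re (tau g') <= k%:R * eps.
      have := le_trans (ler_norm _) (le_trans (cnm_Re _) h1).
      by rewrite {1}tE ftrE -(rmorph_nat (real_complex R)) -rmorphM -rmorphB.
    rewrite -(ler_nat R) !natrM.
    set x := complex.Re (tau g') in h2 hM he *; set nJ := #|J|%:R in cardJ *.
    have kk0 : 0 <= k%:R :> R by []. have M20 : 0 <= M2%:R :> R by []. have M1k : 0 <= M1%:R * k%:R :> R by [].
    have h3 : nJ * t <= 4 * k%:R * x.
      have := ler_wpM2l kk0 he; move: cardJ h2; lra.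
    rewrite -(ler_pM2r t0).
    have h4 := ler_wpM2l M20 h3; have h5 := ler_wpM2l kk0 hM; have h6 := ler_wpM2l M1k hC.
    have -> : 2 * (nJ * M2%:R) * t = 2 * (M2%:R * (nJ * t)) by ring.
    have -> : C%:R * (M1%:R * k%:R) * t = M1%:R * k%:R * (C%:R * t) by ring.

    apply: le_trans h6; have -> : M1%:R * k%:R * (8 * kc) = 8 * (k%:R * (kc * M1%:R)) by ring.
    have e1 : M2%:R * (4 * k%:R * x) = 4 * (k%:R * (M2%:R * x)) by ring.
    rewrite e1 in h4; lra.
  by apply: tr0; exact: (proj1 (ge0_Re (tau_pos c1))).
have [z [zE hz]] := sle_one uE hun eta0.
have [h [ph hh hcomm _]] := pos_sqrt c1.
have hg : h * g = g * h by have := hcomm g; rewrite c2 => /(_ erefl).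
(* The columns are j(h) z_i with h the root of g', so that conjugating g^4 produces g' g^4, to which
   [pow4_low] applies. *)
have yE i : star (j h * z i) * j (g * g * (g * g)) * (j h * z i) = star (z i) * j (g' * (g * g * (g * g))) * z i.
  have -> : g' * (g * g * (g * g)) = h * (g * g * (g * g)) * h.
    have cM (a b : A) : a * g' = g' * a -> b * g' = g' * b -> a * b * g' = g' * (a * b).
      by move=> ha hb; rewrite -mulrA hb mulrA ha mulrA.
    have c6 : g * g * (g * g) * g' = g' * (g * g * (g * g)) by have := cM _ _ (esym c2) (esym c2) => c7; exact: (cM _ _ c7 c7).
    by rewrite -[RHS]mulrA (hcomm _ c6) [RHS]mulrA hh.
  by rewrite starMr -(homS hj) (pos_sa ph) !(homM hj) !mulrA.
exists pq, (fun i => j h * z i); split => //.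
- move=> i; apply: nrm_sqr_le => //; apply: (@le_trans _ _ (nrm (\sum_i star (z i) * j g' * z i))).
    have -> : star (j h * z i) * (j h * z i) = star (z i) * j g' * z i.
      by rewrite starMr -(homS hj) (pos_sa ph) -hh (homM hj) !mulrA.
    have pz b : pos (star (z b) * j g' * z b) by apply: pos_conj; exact: (hom_pos hj).
    by apply: ple_nrm => //; exact: (ple_term (F := fun b => star (z b) * j g' * z b)).
  have := nrmD (\sum_i star (z i) * j g' * z i - pq) pq; rewrite subrK.
  have npq : nrm pq <= 1 by apply: le_trans (rn _) _; exact: proj_nrm.
  by rewrite expr2; move: hz npq eta1; lra.
- by move=> i; apply: (usubM uE) => //; apply: LE.
rewrite (eq_bigr _ (fun i _ => yE i)).
have h1 : ple (s *^ (\sum_i star (z i) * j g' * z i)) (\sum_i star (z i) * j (g' * (g * g * (g * g))) * z i).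
  rewrite scaler_sumr; apply: ple_sum => i _.
  have := ple_conj (z i) (hom_ple hj (pow4_low (proj1 (andP t2)) pg c1 c2 c3)).
  by have [[lj _ _] _] := hj; rewrite (linZ lj) mulZr mulZl.
have h2 : ple pq (\sum_i star (z i) * j g' * z i + eta%:I).
  apply: ple_approx.
  - by apply: pos_sa; apply: rpos; apply: proj_pos.
  - by rewrite star_sum; apply: eq_bigr => i _; rewrite !starMr starK -(homS hj) (pos_sa c1) mulrA.
  - by rewrite nrmB.
have [s0 s1'] := andP s1.
have h3 := pleZ s0 h2; apply: (ple_trans h3); rewrite scalerDr; apply: pleD => //.
by rewrite rcM /ple rcB; apply: pos_rc; nra.
Qed.
End Columns.

(** * The intertwining columns of one colour *)

Section ColorMain.
Variable R : realType.

Lemma block_system (F : cstarType R) (e : F) : finite_dimensional [set: F] -> pos e -> ple e 1 ->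
  exists K (f : 'I_K -> F) (rep : 'I_K -> 'I_K) (v : 'I_K -> F) (d : 'I_K -> R),
  [/\ msys f, (forall a b, eqv (f a) (f b) -> rep a = rep b),
   [/\ forall a, star (v a) * v a = f (rep a), forall a, v a * star (v a) = f a,
     forall a, f a * v a = v a & forall a, v a * f (rep a) = v a],
   forall a, e * f a = d a *^ f a & forall a, 0 <= d a <= 1].
Proof.
move=> fd pe e1; have [K [f [ms /choice [d hd]]]] := fd_system fd (pos_sa pe).
have mf a := msys_min ms a.
pose rep a := odflt a (lab f (f a)).
have er a : eqv (f a) (f (rep a)).
  have [i [h1 h2]] := lab_ex ms (mf a); rewrite /rep h1 /=.
  by apply: eqv_sym => //; [exact: (proj1 (mf i))|exact: (proj1 (mf a))].
have /choice [v hv] a : exists v, [/\ star v * v = f (rep a), v * star v = f a, f a * v = v & v * f (rep a) = v].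
  exact: (eqv_pi (mf a) (mf (rep a)) (er a)).
exists K, f, rep, v, d; split => //.
- move=> a b ab; rewrite /rep; have /eqP -> : lab f (f a) == lab f (f b).
    by rewrite (lab_eqv ms (mf a) (mf b)); apply/asboolP.
  by have [i [-> _]] := lab_ex ms (mf b).
- by split => a; case: (hv a).
exact: adapted_unit ms hd.
Qed.

Lemma fin_min (I : finType) (r : I -> R) : (forall i, 0 < r i) -> exists e, 0 < e <= 1 /\ forall i, e <= r i.
Proof.
move=> h; exists (\big[Order.min/1]_i r i); split; last first.
  by move=> i; rewrite (bigminD1 i) // ge_min lexx.
apply/andP; split; last by apply: bigmin_le_id.
by apply: lt_bigmin.
Qed.

(** The bound 2 comes from treating real and imaginary parts separately with [cp_contr]. *)
Lemma cp_nrm2 (A B : cstarType R) (f : A -> B) a : completely_positive f -> nrm (f 1) <= 1 -> nrm a <= 1 -> nrm (f a) <= 2.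
Proof.
move=> cf f1 na; have lf := proj1 cf.
have [x [y [sx sy E]]] := re_im a.
have Es : star a = x - 'i *: y.
  rewrite E starD starZ sx sy -scaleNr; congr (_ + _ *: _).
  by apply/eqP; rewrite eq_complex /=; apply/andP; split; apply/eqP; ring.
have n2 (z : A) : nrm (2 *^ z) <= 2 -> nrm z <= 1 by rewrite nrmZ0 //; lra.
have n2a : nrm a + nrm (star a) <= 2 by rewrite nrm_star; lra.
have nx : nrm x <= 1.
  apply: n2; apply: le_trans n2a; apply: le_trans (nrmD _ _); rewrite Es E.
  by have -> : x + 'i *: y + (x - 'i *: y) = 2 *^ x; [rewrite (rcnat 2) mulr2n; ncring|exact: lexx].
have ny : nrm y <= 1.
  apply: n2; apply: le_trans n2a; rewrite -(nrmN (star a)); apply: le_trans (nrmD _ _); rewrite Es E.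
  have -> : x + 'i *: y - (x - 'i *: y) = 'i *: (2 *^ y) by rewrite (rcnat 2) mulr2n; ncring.
  by rewrite [leRHS]nrmZ cnm_i mul1r.
rewrite E (linD lf) (linZ lf); apply: le_trans (nrmD _ _) _; rewrite nrmZ cnm_i mul1r.
have := cp_contr cf f1 sx; have := cp_contr cf f1 sy; lra.
Qed.

Lemma model_map (A M D : cstarType R) (tau : A -> R[i]) (S : seq A) eps (sg : A -> M) k (v : 'I_k -> M) e0 (nu : 'I_k -> 'I_k -> D) :
  qmodel tau S eps sg v e0 ->
  (forall a b c d, nu a b * nu c d = if b == c then nu a d else 0) -> (forall a b, star (nu a b) = nu b a) ->
  let al := fun a => rho v e0 nu (sg a) in let P := \sum_i nu i i in
  [/\ linear al, forall a, al (star a) = star (al a), forall a, nrm (al a) <= nrm a, forall a, pos a -> pos (al a)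
    & projection P] /\
  [/\ forall a, P * al a = al a,
   forall a b, a \in S -> b \in S -> nrm (al (a * b) - al a * al b) <= eps & nrm (al 1 - P) <= eps].
Proof.
move=> hm nuM nuS al P; have [] := hm; set g0 := \sum_i v i * star (v i).
move=> [k0 fM] [me vv] [lsg psg ssg nsg] [gsg sg1] [sgm _].
have g0E : \sum_i v i * star (v i) = g0 by [].
have lr := rho_lin nu me vv; have rM := rho_mul me vv nuM g0E; have rP := rho_g0 nu me vv g0E.
have rn := rho_nrm me vv nuM nuS g0E.
split; split.
- by move=> c x y; rewrite /al lsg lr.
- by move=> a; rewrite /al ssg (rho_star me vv nuS).
- by move=> a; apply: le_trans (rn _) (nsg a).
- by move=> a pa; apply: (rho_pos me vv nuM nuS g0E); apply: psg.
- exact: nu_proj.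
- by move=> a; rewrite /P -rP rM -mulrA (proj1 (gsg a)) (proj1 (gsg a)).
- move=> a b aS bS; rewrite /al rM (proj2 (gsg a)) -(linB lr); apply: le_trans (rn _) _; exact: sgm.
by rewrite /P -rP /al -(linB lr); apply: le_trans (rn _) sg1.
Qed.

Variables (A G : cstarType R) (psi : A -> G) (phi : G -> A).
Hypotheses (fdG : finite_dimensional [set: G]) (hphi : cpc_order_zero phi).
Hypotheses (cpsi : completely_positive psi) (psi1 : ple (psi 1) 1).
Variable tau : A -> R[i].
Hypotheses (sA : simple A) (ht : tracial_state tau) (hu : forall t, tracial_state t -> t = tau).
Local Notation h := (phi 1).
Local Notation e := (psi 1).
Let lphi : linear phi := proj1 (proj1 (proj1 hphi)).

(** The order of quantifiers is the content: a finite set, a number and a tolerance are found from A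
    and the colour alone. Then every sufficiently good model, of any size, in any target with enough
    matrix units, admits the same number C of columns. *)
Lemma color_main m (S0 : seq A) (t d eps : R) (C : nat) : nuclear_dimension_le A m ->
  (forall a, a \in S0 -> nrm a <= 1) ->
  (forall a, a \in S0 -> nrm (a * phi e - phi (psi a)) <= d /\ nrm (phi (psi a) - phi e * a) <= d) ->
  0 < t <= 1 -> 0 < eps <= 1 -> 8 * keyc R m <= C%:R * t ->
  exists TN : seq A * nat * R, 0 < TN.2 <= 1 /\
  forall (D M : cstarType R) (j : A -> D) (sg : A -> M) k (v : 'I_k -> M) e0 (nu : 'I_k -> 'I_k -> D)
    u (mu : 'I_u.+1 -> 'I_u.+1 -> D) (L E : D -> Prop) (S : seq A) (eta' : R),
  unital_star_hom j -> {subset TN.1.1 <= S} -> {subset S0 <= S} -> eta' <= TN.2 -> qmodel tau S eta' sg v e0 ->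
  (forall a b c d, nu a b * nu c d = if b == c then nu a d else 0) -> (forall a b, star (nu a b) = nu b a) ->
  munits mu -> usub L -> usub E -> (forall x, L x -> E x) -> (forall a b, E (mu a b)) ->
  (forall a b x, L x -> mu a b * x = x * mu a b) -> (forall a b, L (nu a b)) -> (forall a, L (j a)) ->
  (TN.1.2 * k <= u.+1)%N ->
  let al := fun a => rho v e0 nu (sg a) in let P := \sum_i nu i i in
  let s := t / 2 * (t / 2 * (t / 2 * (t / 2))) in
  exists W : 'I_C -> D, [/\ forall i, nrm (W i) <= 4, forall i, W i * P = W i, forall i, E (W i),
    forall a i, a \in S0 -> nrm (j a * W i - W i * al a) <= 8 * d + eps
  & ple (s *^ al (phi e * phi e * (phi e * phi e))) (\sum_i star (W i) * W i + (s * t ^+ 2 + eps)%:C *: (1 : D))].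
Proof.
move=> hnd nS0 hd t01 /andP[eps0 eps1] hC.
have pe : pos e := cp_pos cpsi (pos1 A).
have [K [f [rep [v [dd [ms hrep [vsv vvs fv vf] ed d01]]]]]] := block_system fdG pe psi1.
have [[hf _ _] _ _] := ms.
pose g a := phi (f a); pose g' a := cut (t / 2) (g a).
have t2 : 0 <= t / 2 <= 1 by case/andP: t01 => *; lra.
have pg a : pos (g a) by apply: (oz_pos hphi); apply: proj_pos.
have ng a : nrm (g a) <= 1 by apply: (oz_nproj hphi).
have pg' a : pos (g' a) by case: (cutP t2 (pg a) (ng a)).
have ng' a : ple (g' a) 1.
  by case: (cutP t2 (pg a) (ng a)) => _ _ _ _ h5; rewrite -[1]rc1; apply: sa_ple => //; exact: pos_sa.
have /choice [MM hMM] a : exists MM : nat * nat, g' a <> 0 -> [/\ (0 < MM.1)%N,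
    MM.2%:R * complex.Re (tau (g' a)) <= keyc R m * MM.1%:R & sle (@allA _ A) (nseq MM.1 1) (nseq MM.2 (g' a))].
  have [->|/eqP n0] := eqVneq (g' a) 0; first by exists (0%N, 0%N).
  by have [M1 [M2 hM]] := key hnd sA ht hu (pg' a) (ng' a) n0; exists (M1, M2).
have hp a : 0 < (if `[< g' a = 0 >] then 1 else complex.Re (tau (g' a))).
  by case: ifPn => // /asboolPn; apply: (trace_faithful sA ht).
have [eta1 [/andP[eta10 eta11] heta1]] := fin_min hp.
(* All elements on which the model must be nearly multiplicative or have nearly the right trace. *)
pose T : seq A := [seq phi (v a) | a <- enum 'I_K] ++ [seq phi (star (v a)) | a <- enum 'I_K] ++
  [seq g a | a <- enum 'I_K] ++ [seq g' a | a <- enum 'I_K] ++ [seq phi (psi a) | a <- S0] ++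
  [:: h; phi e; h * h; h * h * phi e].
(* A common bound for the multiplicities M1, so that matrix units of size N k serve every block. *)
pose N := (\sum_a (MM a).1)%N.
pose ee := eps / 64 / (K%:R + 1).
have K1 : 0 < K%:R + 1 :> R by rewrite ltr_wpDl.
have ee0 : 0 < ee by rewrite /ee !divr_gt0.
have eeK : K%:R * ee + ee = eps / 64 by rewrite -{2}[ee]mul1r -mulrDl /ee mulrC divfK // lt0r_neq0.
pose eta := Order.min eta1 ee.
have [eta_1 eta_e] : eta <= eta1 /\ eta <= ee by rewrite /eta !ge_min !lexx orbT.
have eta_0 : 0 < eta by rewrite /eta lt_min eta10.
exists (T, N, eta); split; first by rewrite eta_0 (le_trans eta_1).
move=> D M j sg k v0 e0 nu u mu L E S eta' hj TS S0S he hm nuM nuS hmu uL uE LE muE muL nuL jL hN al P s.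
have [[lal sal nal pal pP] [alP am al1]] := model_map hm nuM nuS.
have eta'0 : 0 <= eta' := le_trans (nrm_ge0 _) al1.
have he' : eta' <= ee := le_trans he eta_e.
have memE (f1 : 'I_K -> A) (l1 l2 : seq A) a : f1 a \in l1 ++ [seq f1 a | a <- enum 'I_K] ++ l2.
  by rewrite !mem_cat (map_f _ (mem_enum _ a)) ?orbT.
have T1 a : phi (v a) \in S by apply: TS; exact: (memE (fun a => phi (v a)) [::]).
have T2 a : phi (star (v a)) \in S by apply: TS; exact: (memE (fun a => phi (star (v a)))).
have T3 a : g a \in S.
  by apply: TS; rewrite /T catA; exact: memE.
have T4 a : g' a \in S by apply: TS; rewrite /T !catA -catA -(catA _ [seq g' a | a <- _]); exact: memE.
have T5 a : a \in S0 -> phi (psi a) \in S.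
  by move=> aS; apply: TS; rewrite /T !mem_cat (map_f (fun a => phi (psi a)) aS) !orbT.
have T6 x : x \in [:: h; phi e; h * h; h * h * phi e] -> x \in S.
  by move=> hx; apply: TS; rewrite /T !mem_cat hx !orbT.
have T61 : h \in S by apply: T6; rewrite !in_cons eqxx.
have T62 : phi e \in S by apply: T6; rewrite !in_cons eqxx !orbT.
have T63 : h * h \in S by apply: T6; rewrite !in_cons eqxx !orbT.
have T64 : h * h * phi e \in S by apply: T6; rewrite !in_cons eqxx !orbT.
have [t0 t1] := andP t01.
have s01 : 0 <= s <= 1.
  have h1 (x : R) : 0 <= x <= 1 -> 0 <= t / 2 * x <= 1 by nra.
  by rewrite /s; apply: (h1 _ (h1 _ (h1 _ t2))).
have eps4 : 0 < eps / 4 <= 1 by lra.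
have ng1 a : ple (g a) 1 by rewrite -[1]rc1; apply: sa_ple => //; exact: pos_sa.
have tp (x : A) : pos x -> 0 <= tau x by case: ht => _ h1 _ _ /pos_eltP; apply: h1.
have hc a := spectral_column hj hm tp nuM nuS hmu uL uE LE muE muL nuL jL (pg a) (ng1 a) t01 eps4 hC (T4 a).
have {}hc a : exists py : D * ('I_C -> D), [/\ pos (P - py.1) /\ nrm (P - py.1) <= 1,
   ple (al (g a) * (P - py.1) * al (g a)) (t ^+ 2 *^ P), forall i, nrm (py.2 i) <= 2, forall i, E (py.2 i)
   & ple (s *^ py.1) (\sum_i star (py.2 i) * j (g a * g a * (g a * g a)) * py.2 i + (eps / 4)%:C *: (1 : D))].
  have [|pq [y hy]] := hc a; last by exists (pq, y).
  move=> n0; have [h1 h2 h3] := hMM a n0; exists (MM a).1, (MM a).2; split => //.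
    by apply: leq_trans hN; rewrite leq_mul2r /N (bigD1 a) //= leq_addr orbT.
  by apply: le_trans (le_trans he eta_1) _; have := heta1 a; case: ifPn => // /asboolP.
have {hc} [py hpy] := choice hc.
have Keta : K%:R * eta' <= 1 by have := ler_wpM2l (ler0n R K) he'; move: eeK ee0; lra.
pose y i a := (py a).2 i; pose X0 i := itw j phi rep v (y i) (fun a => al (phi (star (v a)))).
have y2 i a : nrm (y i a) <= 2 by case: (hpy a) => _ _ h1 _ _; exact: h1.
exists (fun i => j h * X0 i * al (phi e)); split.
- move=> i; have -> : 4 = 1 * (2 * 2) * 1 :> R by ring.
  apply: nrmM_le; last by apply: (alv_n hphi nal); apply: ple_nrm_rc => //; rewrite rc1.
  apply: nrmM_le; first by apply: le_trans (hom_nrm hj _) _; apply: le_trans (oz_nrm hphi 1) (nrm1 _).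
  exact: (X0_nrm hj fdG hphi lal sal nal ms vsv vvs fv am Keta T1 T2 _ (y2 i)).
- move=> i; rewrite -mulrA; congr (_ * _); rewrite -[LHS]starK starMr (proj2 pP) -sal alP sal.
  exact: starK.
- move=> i; apply: (usubM uE); last by apply: LE; apply: rho_E.
  apply: (usubM uE); first exact: LE.
  apply: (usub_sum uE) => a; apply: (usubM uE); last by apply: LE; apply: rho_E.
  by apply: (usubM uE); [exact: LE|case: (hpy (rep a)) => _ _ _ h1 _; exact: h1].
- move=> a i aS; have [h1 h2] := hd a aS.
  have nx : nrm (psi a) <= 2.
    by apply: (cp_nrm2 cpsi) (nS0 a aS); apply: ple_nrm_rc => //; rewrite rc1.
  have h3 := inter_color hj fdG hphi lal sal nal ms hrep vsv vvs fv vf am eta'0 Keta T1 T2 T61 T62 pe psi1 (ler0n R 2)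
    (y2 i) (S0S _ aS) (T5 _ aS) (nS0 _ aS) nx h1 h2.
  apply: (le_trans h3); have := ler_wpM2l (ler0n R K) he'; move: eeK ee0 he' eps0; lra.
have [s0 s1] := andP s01; have e40 : 0 <= eps / 4 by case/andP: eps4 => /ltW.
have h3 := lower_color (y := y) hj fdG hphi lal sal nal pal alP ms vsv vvs fv vf am eta'0 Keta T1 T2 T62 pe psi1
  ed d01 T3 T63 T64 (pq := fun c => (py c).1) (fun c => let: And5 h1 _ _ _ _ := hpy c in proj1 h1)
  (fun c => let: And5 h1 _ _ _ _ := hpy c in proj2 h1) (introT andP (conj (ltW t0) t1))
  (fun c => let: And5 _ h1 _ _ _ := hpy c in h1) s0 e40 (fun c => let: And5 _ _ _ _ h1 := hpy c in h1).
apply: (ple_trans h3); apply: pleD; first exact: ple_refl.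
rewrite /ple rcB; apply: pos_rc.
have h4 : 8 * (K%:R + 1) * eta' <= eps / 8.
  by have := ler_wpM2l (ler0n R K) he'; move: eeK ee0 he'; lra.
have h5 : s * (8 * (K%:R + 1) * eta') <= 1 * (eps / 8).
  by apply: ler_pM => //; rewrite !mulr_ge0 // addr_ge0.
by rewrite mulrDr; move: eps0; lra.
Qed.
End ColorMain.

Section Tangent.
Variables (R : realType) (A : cstarType R).
Implicit Types (x : A) (c : R).
Local Notation "t %:I" := (t%:C *: (1 : A)) (at level 1, left associativity, format "t %:I").

(* x^4 - 4 c^3 x + 3 c^4 = (x - c) (x^2 + 2 c x + 3 c^2) (x - c) *)
Lemma pow4_tangent x c : 0 <= c -> pos x -> ple ((4 * c ^+ 3) *^ x) (x * x * (x * x) + (3 * c ^+ 4)%:I).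
Proof.
move=> c0 px; have sx := pos_sa px.
pose q := x * x + c *^ (x + x) + c *^ (c *^ (1 + 1 + 1 : A)).
have pq : pos q.
  apply: posD; first apply: posD; first exact: pos_sqr.
    by apply: posZ => //; apply: posD.
  by do 2!apply: posZ => //; do 2![apply: posD; last exact: pos1]; exact: pos1.
have := pos_conj_sa (w := x - c%:I) _ pq; rewrite starB sx starZr star1 => /(_ erefl).
rewrite /ple; set a := (X in pos X -> _); set b := (X in _ -> pos X); have -> // : a = b.
have z4 : (4 * c ^+ 3) *^ x = c *^ (c *^ (c *^ (x + x + x + x))).
  by rewrite -[x + x]mulr2n -!mulrSr -(rcnat 4) !rcM; congr (_%:C *: _); ring.
have z3 : (3 * c ^+ 4)%:I = c *^ (c *^ (c *^ (c *^ (1 + 1 + 1 : A)))).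
  by rewrite -[(1 + 1 : A)]mulr2n -!mulrSr -(rcnat 3) !rcM; congr (_%:C *: _); ring.
by rewrite /a /b z4 z3 /q; ncring.
Qed.

Lemma bound_seq (S : seq A) : exists M : R, 1 <= M /\ forall a, a \in S -> nrm a <= M.
Proof.
elim: S => [|x S [M [M1 hM]]]; first by exists 1.
exists (M + nrm x); split; first by have := nrm_ge0 x; lra.
move=> a; rewrite in_cons => /orP[/eqP ->|/hM]; first by lra.
by have := nrm_ge0 x; lra.
Qed.
End Tangent.

(** * Iteration in the tensor product *)

Section Tower.
Variables (R : realType) (A Q D : cstarType R) (jA : A -> D) (jQ : Q -> D).
Hypotheses (hA : unital_star_hom jA) (hQ : unital_star_hom jQ) (jC : forall a b, jA a * jQ b = jQ b * jA a).
Variable B : nat -> Q -> Prop.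
Hypotheses (Bup : forall n x, B n x -> B n.+1 x) (Bstar : forall n x, B n x -> B n (star x)).
Hypothesis Bspan : forall n, exists k (mu : 'I_k.+1 -> 'I_k.+1 -> Q), munits mu /\
       forall x, B n x <-> exists c : 'I_k.+1 -> 'I_k.+1 -> R[i], x = \sum_i \sum_j c i j *: mu i j.
Hypothesis Bunits : forall n U, exists n' u (mu : 'I_u.+1 -> 'I_u.+1 -> Q),
      [/\ (n <= n')%N, (U <= u)%N, munits mu, (forall a b, B n' (mu a b))
        & forall a b x, B n x -> mu a b * x = x * mu a b].
Local Notation "t %:I" := (t%:C *: (1 : D)) (at level 1, left associativity, format "t %:I").
Let lA : linear jA. Proof. by case: hA => [[]]. Qed.
Let lQ : linear jQ. Proof. by case: hQ => [[]]. Qed.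

Definition gen (S : D -> Prop) x := forall E, csub E -> (forall y, S y -> E y) -> E x.

Lemma gen_csub S : csub (gen S).
Proof.
split; [|by move=> x y hx hy E cE hS; apply: csubD; [|apply: hx|apply: hy]|
  by move=> a x hx E cE hS; apply: csubZ; [|apply: hx]|
  by move=> x y hx hy E cE hS; apply: csubM; [|apply: hx|apply: hy]|split].
- by move=> E cE _; exact: csub1.
- by move=> x hx E cE hS; apply: csubS; [|apply: hx].
- by move=> u l hu cv E cE hS; apply: (csubL cE _ cv) => n; apply: hu.
Qed.

(* [qq N n] is the image of the relative commutant of N in B n, and [gg N n]
   the C*-algebra that it generates together with the image of A. *)
Definition qq (N : Q -> Prop) n (d : D) := exists b, [/\ B n b, forall x, N x -> b * x = x * b & d = jQ b].
Definition gg N n := gen (fun d => (exists a, d = jA a) \/ qq N n d).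

Lemma gg_csub N n : csub (gg N n). Proof. exact: gen_csub. Qed.
Lemma gg_usub N n : usub (gg N n). Proof. exact/csub_usub/gg_csub. Qed.
Lemma gg_A N n a : gg N n (jA a). Proof. by move=> E _; apply; left; exists a. Qed.
Lemma gg_q N n d : qq N n d -> gg N n d. Proof. by move=> h E _; apply; right. Qed.

Lemma B_mono n m x : (n <= m)%N -> B n x -> B m x.
Proof. by move=> /subnK <-; elim: (m - n)%N => [//|k IH] hx; apply: Bup; apply: IH. Qed.

Lemma qq_mono (N N' : Q -> Prop) n m d : (forall x, N' x -> N x) -> (n <= m)%N -> qq N n d -> qq N' m d.
Proof. by move=> NN nm [b [Bb bN ->]]; exists b; split=> [|x /NN /bN|] //; exact: B_mono nm Bb. Qed.

Lemma gg_mono (N N' : Q -> Prop) n m d : (forall x, N' x -> N x) -> (n <= m)%N -> gg N n d -> gg N' m d.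
Proof.
move=> NN nm hd; apply: hd; first exact: gg_csub.
by move=> y [[a ->]|hy]; [exact: gg_A|apply: gg_q; exact: qq_mono hy].
Qed.

Lemma B_usub n : usub (B n).
Proof.
have [k [mu [[muM muS mu1] hB]]] := Bspan n; split.
- apply/hB; exists (fun i j => (i == j)%:R); rewrite -mu1; apply: eq_bigr => i _.
  rewrite (bigD1 i) //= eqxx scale1r big1 ?addr0 // => l li.
  by rewrite eq_sym (negbTE li) scale0r.
- move=> x y /hB [c ->] /hB [c' ->]; apply/hB; exists (fun i j => c i j + c' i j).
  by rewrite -big_split; apply: eq_bigr => i _; rewrite -big_split; apply: eq_bigr => j _; rewrite scalerDl.
- move=> a x /hB [c ->]; apply/hB; exists (fun i j => a * c i j).
  by rewrite scaler_sumr; apply: eq_bigr => i _; rewrite scaler_sumr; apply: eq_bigr => j _; rewrite scalerA.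
- move=> x y /hB [c ->] /hB [c' ->]; apply/hB; exists (fun i j => \sum_l c i l * c' l j).
  rewrite mulr_suml; apply: eq_bigr => i _; rewrite mulr_suml.
  have E (l : 'I_k.+1) : (c i l *: mu i l) * (\sum_a \sum_j c' a j *: mu a j) = \sum_j (c i l * c' l j) *: mu i j.
    rewrite mulr_sumr (bigD1 l) //= [X in _ + X]big1 ?addr0 => [|a al].
      by rewrite mulr_sumr; apply: eq_bigr => j _; rewrite mulZl mulZr scalerA muM eqxx.
    by rewrite mulr_sumr big1 // => j _; rewrite mulZl mulZr muM eq_sym (negbTE al) !scaler0.
  rewrite (eq_bigr _ (fun l _ => E l)) exchange_big; apply: eq_bigr => j _ /=.
  by rewrite scaler_suml.
exact: Bstar.
Qed.

Lemma qq_usub (N : Q -> Prop) n : (forall x, N x -> N (star x)) -> usub (qq N n).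
Proof.
move=> sN; have uB := B_usub n; split.
- by exists 1; split; [exact: usub1|move=> x _; rewrite mul1r mulr1|rewrite (hom1 hQ)].
- move=> x y [b [h1 h2 ->]] [b' [h1' h2' ->]]; exists (b + b'); split; rewrite ?(linD lQ) //; first exact: usubD.
  by move=> z Nz; rewrite mulrDl mulrDr h2 // h2'.
- move=> a x [b [h1 h2 ->]]; exists (a *: b); split; rewrite ?(linZ lQ) //; first exact: usubZ.
  by move=> z Nz; rewrite mulZl mulZr h2.
- move=> x y [b [h1 h2 ->]] [b' [h1' h2' ->]]; exists (b * b'); split; rewrite ?(homM hQ) //; first exact: usubM.
  by move=> z Nz; rewrite -mulrA h2' // mulrA h2 // mulrA.
- move=> x [b [h1 h2 ->]]; exists (star b); split; rewrite ?(homS hQ) //; first exact: Bstar.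
  move=> z Nz; have := congr1 star (h2 _ (sN _ Nz)).
  by rewrite !starMr !starK.
Qed.

(** The commutant of mu and its adjoint is a C*-algebra, so commutation need only be checked on the
    generators. *)
Lemma gg_comm N n d (mu : Q) : (forall b, B n b -> (forall x, N x -> b * x = x * b) -> mu * b = b * mu /\ star mu * b = b * star mu) ->
  gg N n d -> jQ mu * d = d * jQ mu.
Proof.
move=> hmu hd; pose S (x : D) := x = jQ mu \/ x = jQ (star mu).
have cS : csub (fun d => forall x, S x -> d * x = x * d).
  by apply: csub_comm => x [] ->; [right|left]; rewrite -(homS hQ) ?starK.
symmetry; apply: (hd _ cS); last by left.
move=> y [[a ->] x [] -> //|[b [Bb bN ->]] x [] ->]; have [h1 h2] := hmu b Bb bN.
  by rewrite -!(homM hQ) h1.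
by rewrite -!(homM hQ) h2.
Qed.

Lemma gg_commN (N : Q -> Prop) n d x : (forall x, N x -> N (star x)) -> N x -> gg N n d -> jQ x * d = d * jQ x.
Proof. by move=> sN Nx; apply: gg_comm => b _ bN; rewrite !bN //; exact: sN. Qed.

Lemma hom_munits u (mu : 'I_u -> 'I_u -> Q) : munits mu -> munits (fun a b => jQ (mu a b)).
Proof.
move=> [muM muS mu1]; split.
- by move=> a b c d; rewrite -(homM hQ) muM; case: eqP; rewrite ?(lin0 lQ).
- by move=> a b; rewrite -(homS hQ) muS.
- by rewrite -(lin_sum lQ) mu1 (hom1 hQ).
Qed.

(** Units commuting with stage n commute with all of [gg N n], since A commutes with Q; they are
    therefore available for [unperf] over that algebra. *)
Lemma tower_units n U : exists n' u (mu : 'I_u.+1 -> 'I_u.+1 -> D), [/\ (n <= n')%N, (U <= u)%N, munits mu,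
  forall a b, qq (B n) n' (mu a b) & forall N a b x, gg N n x -> mu a b * x = x * mu a b].
Proof.
have [n' [u [mu [nn' Uu hmu Bmu mub]]]] := Bunits n U; exists n', u, (fun a b => jQ (mu a b)); split => //.
- exact: hom_munits.
- by move=> a b; exists (mu a b); split => // x; exact: mub.
move=> N a b x; apply: gg_comm => c Bc _; have [_ muS _] := hmu.
by rewrite muS !mub.
Qed.

Variable tau : A -> R[i].
Hypotheses (sA : simple A) (ht : tracial_state tau) (hu : forall t, tracial_state t -> t = tau).
Hypothesis qd : quasidiagonal A.
Variable m : nat.
Hypothesis hnd : nuclear_dimension_le A m.

(** The number Mc of columns is the number of colours times the C of [color_main], and is fixed
    before n, S and eps. *)
Lemma main1 : exists Mc, (0 < Mc)%N /\ forall n (S : seq A) (eps : R), 0 < eps ->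
  exists n2 (F : D -> Prop) (P : D) (al : A -> D) (V : 'I_Mc -> D),
  [/\ (n <= n2)%N,
    [/\ star_subalgebra F, finite_dimensional F, (forall x, F x -> qq (B n) n2 x), F P & forall x, F x -> P * x = x /\ x * P = x],
    [/\ projection P, forall a, F (al a) & forall a, al (star a) = star (al a)],
    [/\ forall i, gg (B n) n2 (V i), forall i, V i * P = V i, \sum_i star (V i) * V i = P
      & forall a i, a \in S -> nrm (jA a * V i - V i * al a) <= eps]
  & sle (qq (B n) n2) [:: 1] (nseq 2 P)].
Proof.
pose M := m.+1; pose c : R := M%:R^-1.
have M1 : 1 <= M%:R :> R by rewrite ler1n.
have M0 : 0 < M%:R :> R by lra.
have c0 : 0 < c by rewrite invr_gt0.
have c1 : c <= 1 by rewrite invf_le1.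
have Mc : M%:R * c = 1 by rewrite mulfV // lt0r_neq0.
(* With c = 1/M this makes the loss M s t^2 of all colours equal to s c^3 / 4. *)
pose t := c ^+ 2 / 2; have t0 : 0 < t by rewrite divr_gt0 // exprn_gt0.
have t1 : t <= 1 by rewrite /t expr2; nra.
pose s := t / 2 * (t / 2 * (t / 2 * (t / 2))).
have s0 : 0 < s by rewrite /s !mulr_gt0 // divr_gt0.
have s1 : s <= 1.
  have h1 (x : R) : 0 <= x <= 1 -> 0 <= t / 2 * x <= 1 by nra.
  have t2 : 0 <= t / 2 <= 1 by lra.
  by case/andP: (h1 _ (h1 _ (h1 _ t2))).
have c3 : 0 < c ^+ 3 by rewrite exprn_gt0.
have c31 : c ^+ 3 <= 1 by rewrite exprn_ile1 // ltW.
(* What remains of the main term (3/4) s c^3 after errors of at most s c^3 / 2. *)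
pose r := s * c ^+ 3 / 4; have r0 : 0 < r by rewrite divr_gt0 // mulr_gt0.
have r1 : r <= 1 by rewrite /r; have := mulr_ile1 (ltW s0) (ltW c3) s1 c31; lra.
pose C := (Num.truncn (8 * keyc R m / t)).+1.
have hC : 8 * keyc R m <= C%:R * t by rewrite -ler_pdivrMr // ltW // truncnS_gt.
pose I : finType := ('I_m.+1 * 'I_C)%type.
pose cN := `|ncst #|I| r 4| + 1; have cN0 : 0 < cN by rewrite ltr_wpDl.
exists #|I|; split; first by rewrite card_prod !card_ord.
move=> n S eps eps0.
have [La [La1 hLa]] := bound_seq (S ++ map star S).
have La0 : 0 < La by lra.
(* Scaled to contractions and closed under adjoints, as [cp_summand_gen] and [normalize] need. *)
pose S1 := [seq La^-1 *^ a | a <- S ++ map star S].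
have S1n a : a \in S1 -> nrm a <= 1.
  move=> /mapP[b /hLa hb ->]; rewrite nrmZ0; last by rewrite invr_ge0 ltW.
  by rewrite ler_pdivrMl // mulr1.
have S1s a : a \in S1 -> star a \in S1.
  move=> /mapP[b hb ->]; rewrite starZr; apply: map_f; move: hb; rewrite !mem_cat => /orP[hb|/mapP[x hx ->]].
    by rewrite (map_f star hb) orbT.
  by rewrite starK hx.
pose ep1 := eps / La / cN; have ep10 : 0 < ep1 by rewrite !divr_gt0.
pose e := Num.min (4^-1) (ep1 / 128).
have e0 : 0 < e by rewrite lt_min invr_gt0 ltr0n divr_gt0.
have [e1 e2] : e <= 4^-1 /\ e <= ep1 / 128 by rewrite /e !ge_min !lexx orbT.
pose eps1 := Num.min 1 (Num.min (s * c ^+ 3 / 16 / M%:R) (ep1 / 2)).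
have q0 : 0 < s * c ^+ 3 / 16 / M%:R by rewrite !divr_gt0 // mulr_gt0.
have eps10 : 0 < eps1 by rewrite !lt_min ltr01 q0 divr_gt0.
have [eps11 eps12 eps13] : [/\ eps1 <= 1, eps1 <= s * c ^+ 3 / 16 / M%:R & eps1 <= ep1 / 2].
  by rewrite /eps1; split; rewrite !ge_min ?lexx ?orbT.
pose T := 1 :: S1 ++ [seq star a * a | a <- S1].
have [G [psi [phi [fdG cpsi ozphi happ]]]] := nuc_system hnd (finite_seq T) (exprn_gt0 2 e0).
pose th l := phi l \o psi l.
have cphi l : completely_positive (phi l) := proj1 (proj1 (ozphi l)).
have cth l : completely_positive (th l).
  case: (cphi l) (proj1 (cpsi l)) => lf hf [lg hg]; split; first by move=> a y z; rewrite /th /= lg lf.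
  move=> k X /hg /hf [Y hY]; exists Y; rewrite -hY; by apply/matrixP => i j; rewrite !mxE.
have e01 : 0 <= e <= 1 by lra.
have hth a l : a \in S1 -> nrm (th l a - th l 1 * a) <= 8 * e.
  move=> aS; rewrite -[8 * e]mulr1; apply: (cp_summand_gen cth e01 (lexx 1) (S1n a aS)).
  move=> x hx; apply: happ; rewrite /T /= in_cons mem_cat.
  case: hx => [->|[->|[->|->]]]; rewrite ?eqxx ?aS ?S1s ?orbT //.
  by rewrite (map_f (fun a => star a * a) aS) !orbT.
have hd l a : a \in S1 -> nrm (a * phi l (psi l 1) - phi l (psi l a)) <= 8 * e /\
    nrm (phi l (psi l a) - phi l (psi l 1) * a) <= 8 * e.
  move=> aS; split; last exact: (hth a l aS).
  have := hth _ l (S1s a aS); rewrite -nrm_star starB starMr starK (cp_star (cth l)) starK.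
  have -> : star (th l 1) = th l 1 by rewrite -(cp_star (cth l)) star1.
  by rewrite nrmB.
have t01 : 0 < t <= 1 by rewrite t0.
have eps101 : 0 < eps1 <= 1 by rewrite eps10.
have hcol l := color_main (fdG l) (ozphi l) (proj1 (cpsi l)) (proj2 (cpsi l)) sA ht hu hnd S1n (hd l) t01 eps101 hC.

have {hcol} [TN hTN] := choice hcol.
have [eta [/andP[eta0 eta1] heta]] := fin_min (fun l => proj1 (andP (proj1 (hTN l)))).
pose eta' := eta / 4; have eta'0 : 0 < eta' by rewrite divr_gt0.
pose T2 := S1 ++ flatten [seq (TN l).1.1 | l <- enum 'I_m.+1].
have [Mx [sg [k [v [e0' hm]]]]] := qd_model ht hu T2 (proj1 sA) qd eta'0.
have [[k0 fM] [me vv] _ _ _] := hm.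
have sB x : B n x -> B n (star x) by exact: Bstar.
(* Two successive enlargements: n1 receives the model inside the relative commutant of stage n, and
   n2 the units that commute with everything at n1. *)
have [n1 [u1 [mu1 [nn1 ku1 hmu1 muq1 mug1]]]] := tower_units n k.

have [nu [nuM nuS nuq _ nule]] := corner_units hmu1 (qq_usub n sB) (qq_usub n1 sB) muq1
  (fun a b x h => mug1 (B n) a b x (gg_q h)) k0 (leqW ku1).
pose N := (\sum_l (TN l).1.2)%N.
have [n2 [u2 [mu2 [n12 ku2 hmu2 muq2 mug2]]]] := tower_units n1 (N * k).
have nn2 := leq_trans nn1 n12.
have BB x : B n x -> B n1 x by exact: B_mono.
have LE2 x : gg (B n) n1 x -> gg (B n) n2 x by apply: gg_mono.
have muE a b : gg (B n) n2 (mu2 a b) by apply: gg_q; apply: (qq_mono BB (leqnn _)); exact: muq2.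
have [[lal sal nal pal pP] [alP am al1]] := model_map hm nuM nuS.
set al := (fun a => rho v e0' nu (sg a)) in lal sal nal pal alP am al1.
set P := \sum_i nu i i in pP alP al1 nule.
have S1T2 : {subset S1 <= T2} by move=> x; rewrite mem_cat => ->.
have TT2 l : {subset (TN l).1.1 <= T2}.
  by move=> x hx; rewrite mem_cat; apply/orP; right; apply/flattenP; exists (TN l).1.1 => //; apply: map_f; rewrite mem_enum.
have he l : eta' <= (TN l).2 by have := heta l; rewrite /eta'; lra.
have hN l : ((TN l).1.2 * k <= u2.+1)%N.
  apply: leq_trans (leqW ku2); rewrite leq_mul2r /N (bigD1 l) //= leq_addr orbT //.
have hW l := proj2 (hTN l) D Mx jA sg k v e0' nu u2 mu2 (gg (B n) n1) (gg (B n) n2) T2 eta' hA (TT2 l) S1T2 (he l) hm nuM nuS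
  hmu2 (gg_usub _ _) (gg_usub _ _) LE2 muE (mug2 (B n)) (fun a b => gg_q (nuq a b)) (fun a => @gg_A (B n) n1 a) (hN l).
have {hW} [W0 hW] := choice hW.
pose W (p : I) := W0 p.1 p.2.
have WP p : W p * P = W p by case: (hW p.1) => _ h _ _ _; exact: h.
have nW p : nrm (W p) <= 4 by case: (hW p.1) => h _ _ _ _; exact: h.
have EW p : gg (B n) n2 (W p) by case: (hW p.1) => _ _ h _ _; exact: h.
have iW a p : a \in S1 -> nrm (jA a * W p - W p * al a) <= ep1.
  move=> aS; case: (hW p.1) => _ _ _ h _; have := h a p.2 aS; rewrite -/(W p) => h1; apply: le_trans h1 _.
  by lra.
have lW : ple (r *^ P) (\sum_p star (W p) * W p).
  have pow l : pos (phi l (psi l 1)) by apply: (cp_pos (cth l)); exact: pos1.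
  pose x l := phi l (psi l 1); pose X := \sum_l x l * x l * (x l * x l).
  (* M elements with sum near 1 have fourth powers adding up to at least about M c^4 = c^3. The
     tangent at c proves this although the elements need not commute. *)
  have X1 : ple ((c ^+ 3 * (3 / 4))%:C *: (1 : A)) X.
    have h1 : ple ((4 * c ^+ 3) *^ \sum_l x l) (X + (\sum_(l < m.+1) (3 * c ^+ 4))%:C *: (1 : A)).
      rewrite scaler_sumr /X rmorph_sum scaler_suml -big_split; apply: ple_sum => l _.
      exact: (pow4_tangent (ltW c0) (pow l)).
    have h2 : nrm (\sum_l x l - 1) <= e ^+ 2 by apply: happ; rewrite /T /= in_cons eqxx.
    have sx : star (\sum_l x l) = \sum_l x l by rewrite star_sum; apply: eq_bigr => l _; exact: (pos_sa (pow l)).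
    rewrite nrmB in h2; have h3 := ple_approx (star1 _) sx h2.
    have c40 : 0 <= 4 * c ^+ 3 by rewrite mulr_ge0 // ltW.
    have h4 := ple_trans (pleZ c40 h3) (_ : ple _ (X + (\sum_(l < m.+1) (3 * c ^+ 4) + 4 * c ^+ 3 * e ^+ 2)%:C *: (1 : A))).
    have {h4} h4 : ple ((4 * c ^+ 3)%:C *: (1 : A)) (X + (\sum_(l < m.+1) (3 * c ^+ 4) + 4 * c ^+ 3 * e ^+ 2)%:C *: (1 : A)).
      apply: h4; rewrite scalerDr rcM -rcD addrA; apply: pleD h1 _; exact: ple_refl.
    have E : \sum_(l < m.+1) (3 * c ^+ 4) = 3 * c ^+ 3.
      rewrite sumr_const card_ord -[LHS]mulr_natl; have -> : m.+1%:R * (3 * c ^+ 4) = (M%:R * c) * (3 * c ^+ 3) by rewrite /M; ring.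
      by rewrite Mc mul1r.
    move: h4; rewrite E /ple => h4.
    have -> : X - (c ^+ 3 * (3 / 4))%:C *: (1 : A) =
       (X + (3 * c ^+ 3 + 4 * c ^+ 3 * e ^+ 2)%:C *: (1 : A) - (4 * c ^+ 3)%:C *: (1 : A)) +
       (c ^+ 3 * (4^-1 - 4 * e ^+ 2))%:C *: (1 : A).
      by rewrite -!addrA; congr (_ + _); rewrite rcN rcN rcD rcD; congr (_%:C *: _); field.
    apply: posD => //; apply: pos_rc; rewrite mulr_ge0 //; first exact: ltW.
    rewrite expr2; nra.
  have h1 : ple ((c ^+ 3 * (3 / 4)) *^ al 1) (al X).
    by rewrite /ple -(linZ lal) -(linB lal); apply: pal.
  have h2 : ple P (al 1 + eta'%:I).
    by apply: ple_approx; [exact: (proj2 pP)|rewrite -sal star1|rewrite nrmB].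
  have h3 : ple (s *^ al X) (\sum_p star (W p) * W p + (M%:R * (s * t ^+ 2 + eps1))%:I).
    have -> : \sum_p star (W p) * W p + (M%:R * (s * t ^+ 2 + eps1))%:I =
       \sum_l (\sum_i star (W0 l i) * W0 l i + (s * t ^+ 2 + eps1)%:I).
      rewrite big_split /= pair_bigA sumr_const card_ord; congr (_ + _).
      by rewrite -rcM rcnat.
    rewrite /X (lin_sum lal) scaler_sumr; apply: ple_sum => l _.
    by case: (hW l) => _ _ _ _ h; exact: h.
  have k0' : 0 <= s * (c ^+ 3 * (3 / 4)) by rewrite !mulr_ge0 // ltW.
  have h4 := pleZ k0' h2; have h5 := pleZ (ltW s0) h1; rewrite rcM in h5.
  set TT := \sum_p star (W p) * W p in h3 *.
  (* In units of s c^3 the errors are 1/4 from t, 1/16 from eps1 and 3/16 from the unit of the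
     model. *)
  pose z := s * c ^+ 3 / 2.
  have h6 : ple ((s * (c ^+ 3 * (3 / 4))) *^ P) (TT + z%:I).
    apply: (ple_trans h4); rewrite scalerDr; apply: (@ple_trans _ _ _ (TT + (M%:R * (s * t ^+ 2 + eps1))%:I + (s * (c ^+ 3 * (3 / 4)) * eta')%:I)).
      by apply: pleD; [exact: ple_trans h5 h3|rewrite rcM; exact: ple_refl].
    rewrite -addrA rcD; apply: pleD; first exact: ple_refl.
    rewrite /ple rcB; apply: pos_rc.
    have q1 : M%:R * (s * t ^+ 2) = s * c ^+ 3 / 4.
      have -> : M%:R * (s * t ^+ 2) = (M%:R * c) * (s * c ^+ 3 / 4) by rewrite /t; field.
      by rewrite Mc mul1r.
    have q2 : M%:R * eps1 <= s * c ^+ 3 / 16.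
      by have := ler_wpM2l (ltW M0) eps12; rewrite mulrCA mulfV ?mulr1 // lt0r_neq0.
    have q3 : s * c ^+ 3 * eta' <= s * c ^+ 3 / 4.
      by apply: ler_wpM2l; [rewrite mulr_ge0 // ltW|rewrite /eta'; lra].
    by rewrite mulrDr q1 /z; have := mulr_gt0 s0 c3; lra.
  have := ple_conj_sa (proj2 pP) h6.
  have TP : P * TT * P = TT.
    have PW p : P * star (W p) = star (W p) by have := congr1 star (WP p); rewrite starMr (proj2 pP).
    have -> : P * TT = TT by rewrite [LHS]mulr_sumr; apply: eq_bigr => p _; rewrite mulrA PW.
    by rewrite [LHS]mulr_suml; apply: eq_bigr => p _; rewrite -mulrA WP.
  rewrite mulrDr mulrDl TP !mulZr !mulZl mulr1 !(proj1 pP) => h7.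
  have -> : r *^ P = (s * (c ^+ 3 * (3 / 4))) *^ P - z *^ P.
    by rewrite rcB; congr (_%:C *: _); rewrite /r /z; field.
  by move: h7; rewrite /ple; set a := (X in pos X -> _); set b := (X in _ -> pos X); have -> // : a = b; rewrite /a /b; ncring.
have r01 : 0 < r <= 1 by rewrite r0.
have [kk [pk Pk sP kE ki]] := normalize pP WP r01 lW nW.
have EP : gg (B n) n2 P by apply: gg_q; apply: (usub_sum (qq_usub n2 sB)) => i; exact: qq_mono (nuq i i).
have qqE x : qq (B n) n2 (rho v e0' nu x).
  apply: (qq_mono (fun _ h => h) n12); apply: rho_E => //; exact: qq_usub.
have g0E : \sum_i v i * star (v i) = \sum_i v i * star (v i) by [].
have lr := rho_lin nu me vv; have rM := rho_mul me vv nuM g0E; have rP := rho_g0 nu me vv g0E.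
exists n2, (fun x => exists y, x = rho v e0' nu y), P, al, (fun i => W (enum_val i) * kk); split => //.
- split.
  + split.
    * by exists 0; rewrite (lin0 lr).
    * by move=> x y [a ->] [b ->]; exists (a + b); rewrite (linD lr).
    * by move=> a x [b ->]; exists (a *: b); rewrite (linZ lr).
    * by move=> x y [a ->] [b ->]; rewrite rM; eexists.
    * by move=> x [a ->]; exists (star a); rewrite (rho_star me vv nuS).
  + have [d [ee hee]] := proj1 fM; exists d, (fun i => rho v e0' nu (ee i)) => x [y ->].
    have [cc ->] := hee y Logic.I; exists cc; rewrite (lin_sum lr); apply: eq_bigr => i _; exact: linZ.
  + by move=> x [y ->].
  + by rewrite /P -rP; eexists.
  + move=> x [y ->]; have [gg sg0] := g0_proj me vv g0E.
    have rc := rho_corner nu me vv g0E.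
    rewrite /P -rP !rM gg -(mulrA y) gg; split; rewrite -[LHS]rc -[RHS]rc; first by rewrite !mulrA gg.
    by rewrite (mulrA _ y) -(mulrA _ _ (\sum_i v i * star (v i))) gg.
- split => //; by move=> a; eexists.
- split.
  + move=> i; apply: (csubM (gg_csub _ _)) => //; apply: kE => //; exact: gg_csub.
  + by move=> i; rewrite -mulrA -Pk mulrA WP.
  + by rewrite -(big_enum_val (fun p => star (W p * kk) * (W p * kk))) -[RHS]sP; apply: eq_bigl.
  + move=> a i aS.
    pose b := La^-1 *^ a; have bS : b \in S1 by apply: map_f; rewrite mem_cat aS.
    have -> : a = La *^ b by rewrite rcM mulfV ?rc1 // lt0r_neq0.
    rewrite (linZ lA) (linZ lal) mulZl mulZr -scalerBr nrmZ0; last exact: ltW.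
    rewrite mulrC -ler_pdivlMr //.
    have h := ki (jA b) (al b) ep1 (ltW ep10) _ (fun p => iW b p bS) _ (enum_val i).
    apply: le_trans (h _ _) _.
    * by rewrite alP -[RHS]starK starMr (proj2 pP) -sal alP sal starK.
    * by move=> p; rewrite -(homS hA) -sal; apply: iW; exact: S1s.
    apply: (@le_trans _ _ (cN * ep1)); last by rewrite /ep1 mulrC divfK // lt0r_neq0.
    apply: ler_wpM2r; first exact: ltW.
    by apply: le_trans (ler_norm _) _; rewrite /cN lerDl.
have h1 : sle (qq (B n) n1) [:: 1] (nseq 2 P) by [].
exact: cle_mono (fun x => @qq_mono _ _ _ _ x (fun _ h => h) n12) h1.
Qed.
(** The remainder will be chosen after the columns, so near commutation with them must follow from
    conditions on finitely many elements of A. The elements for which this works form a C*-algebra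
    containing A and stage n. *)
Definition acomm n x := forall eta : R, 0 < eta -> exists (S : seq A) (e : R), 0 < e /\
  forall r : D, star r = r -> nrm r <= 1 -> (forall b, B n b -> r * jQ b = jQ b * r) ->
    (forall a, a \in S -> nrm (r * jA a - jA a * r) <= e) -> nrm (r * x - x * r) <= eta.

Lemma acomm_csub n : csub (acomm n).
Proof.
split.
- by move=> eta eta0; exists [::], 1; split => // r _ _ _ _; rewrite mulr1 mul1r subrr nrm0 ltW.
- move=> x y hx hy eta eta0; have eta2 : 0 < eta / 2 by lra.
  have [S [e [e0 hS]]] := hx _ eta2; have [S' [e' [e0' hS']]] := hy _ eta2.
  exists (S ++ S'), (Num.min e e'); split; first by rewrite lt_min e0.
  move=> r sr nr rB rS; have -> : r * (x + y) - (x + y) * r = (r * x - x * r) + (r * y - y * r) by ncring.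
  have h1 : nrm (r * x - x * r) <= eta / 2.
    by apply: hS => // a aS; apply: (le_trans (rS a _)); rewrite ?mem_cat ?aS // ge_min lexx.
  have h2 : nrm (r * y - y * r) <= eta / 2.
    by apply: hS' => // a aS; apply: (le_trans (rS a _)); rewrite ?mem_cat ?aS ?orbT // ge_min lexx orbT.
  by apply: le_trans (nrmD _ _) _; lra.
- move=> a x hx eta eta0; have c0 : 0 < cnm a + 1 by have := cnm_ge0 a; lra.
  have [S [e [e0 hS]]] := hx (eta / (cnm a + 1)) (divr_gt0 eta0 c0).
  exists S, e; split => // r sr nr rB rS; rewrite mulZl mulZr -scalerBr nrmZ.
  have h := hS r sr nr rB rS; apply: (@le_trans _ _ ((cnm a + 1) * (eta / (cnm a + 1)))).
    by apply: ler_pM => //; [exact: cnm_ge0|exact: nrm_ge0|lra].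
  by rewrite mulrC divfK // lt0r_neq0.
- move=> x y hx hy eta eta0; pose c := nrm x + nrm y + 1.
  have [nx0 ny0] := (nrm_ge0 x, nrm_ge0 y).
  have c0 : 0 < c by rewrite /c; lra.
  have eta2 : 0 < eta / 2 / c by rewrite !divr_gt0.
  have [S [e [e0 hS]]] := hx _ eta2; have [S' [e' [e0' hS']]] := hy _ eta2.
  exists (S ++ S'), (Num.min e e'); split; first by rewrite lt_min e0.
  move=> r sr nr rB rS; have -> : r * (x * y) - (x * y) * r = (r * x - x * r) * y + x * (r * y - y * r) by ncring.
  have h1 : nrm (r * x - x * r) <= eta / 2 / c.
    by apply: hS => // a aS; apply: (le_trans (rS a _)); rewrite ?mem_cat ?aS // ge_min lexx.
  have h2 : nrm (r * y - y * r) <= eta / 2 / c.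
    by apply: hS' => // a aS; apply: (le_trans (rS a _)); rewrite ?mem_cat ?aS ?orbT // ge_min lexx orbT.
  apply: le_trans (nrmD _ _) _; apply: le_trans (lerD (nrmM_le h1 (lexx _)) (nrmM_le (lexx _) h2)) _.
  have h3 : eta / 2 / c * c = eta / 2 by rewrite divfK // lt0r_neq0.
  have : eta / 2 / c * nrm y + nrm x * (eta / 2 / c) <= eta / 2 / c * c by rewrite /c; nra.
  by lra.
split.
- move=> x hx eta eta0; have [S [e [e0 hS]]] := hx _ eta0; exists S, e; split => // r sr nr rB rS.
  by have := hS r sr nr rB rS; rewrite -nrm_star starB !starMr sr nrmB.
- move=> u l hul cv eta eta0; have eta4 : 0 < eta / 4 by lra.
  have [N hN] := cv _ eta4; have eta2 : 0 < eta / 2 by lra.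
  have [S [e [e0 hS]]] := hul N _ eta2; exists S, e; split => // r sr nr rB rS.
  have h1 := hS r sr nr rB rS; have h2 := hN N (leqnn N).
  have -> : r * l - l * r = (r * u N - u N * r) - r * (u N - l) + (u N - l) * r by ncring.
  apply: le_trans (nrmD _ _) _; apply: le_trans (lerD (nrmD _ _) (lexx _)) _; rewrite nrmN.
  have := nrmM_le nr h2; have := nrmM_le h2 nr; lra.
Qed.

Lemma gg_acomm N n k (V : 'I_k -> D) eta : (forall i, gg N n (V i)) -> 0 < eta -> exists (S : seq A) (e : R), 0 < e /\
  forall r : D, star r = r -> nrm r <= 1 -> (forall b, B n b -> r * jQ b = jQ b * r) ->
    (forall a, a \in S -> nrm (r * jA a - jA a * r) <= e) -> forall i, nrm (r * V i - V i * r) <= eta.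
Proof.
move=> hV eta0; have /choice [Se hSe] i : exists Se : seq A * R, 0 < Se.2 /\
   forall r : D, star r = r -> nrm r <= 1 -> (forall b, B n b -> r * jQ b = jQ b * r) ->
    (forall a, a \in Se.1 -> nrm (r * jA a - jA a * r) <= Se.2) -> nrm (r * V i - V i * r) <= eta.
  have h : acomm n (V i).
    apply: hV; first exact: acomm_csub.
    move=> y [[a ->]|[b [Bb _ ->]]] et et0.
      by exists [:: a], et; split => // r _ _ _ h; apply: h; rewrite mem_head.
    by exists [::], 1; split => // r _ _ rB _; rewrite rB // subrr nrm0 ltW.
  by have [S [e hS]] := h _ eta0; exists (S, e).
have [e [/andP[e0 _] he]] := fin_min (fun i => proj1 (hSe i)).
exists (flatten [seq (Se i).1 | i <- enum 'I_k]), e; split => // r sr nr rB rS i.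
apply: (proj2 (hSe i)) => // a aS; apply: le_trans (he i); apply: rS.
by apply/flattenP; exists (Se i).1 => //; apply: map_f; rewrite mem_enum.
Qed.

Lemma sle_mull (E E' : D -> Prop) x K N a b : usub E -> usub E' -> (forall y, E y -> E' y) -> nrm x <= 1 ->
  (forall y, E y -> x * y = y * x) -> sle E (nseq K a) (nseq N b) -> sle E' (nseq K (x * a)) (nseq N (x * b)).
Proof.
move=> uE uE' EE' nx xE h; have h1 := sle_cst uE h.
have h2 : cle E' (fun _ : 'I_K => x * a) (fun _ : 'I_N => x * b).
  move=> e e0; have [V [hE hV]] := h1 e e0; exists V; split => [j i|i i']; first exact: EE'.
  rewrite -[e]mul1r; have := nrmM_le nx (hV i i'); rewrite mulrBr mulr_sumr.
  set s1 := (X in nrm (X - _) <= _ -> _); set s2 := (X in _ -> nrm (X - _) <= _); have -> : s1 = s2.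
    by apply: eq_bigr => j _; rewrite !mulrA xE //; exact: usubS.
  by case: eqP; rewrite ?mulr0.
by have := sle_fam uE' h2; rewrite !codom_cst !card_ord.
Qed.

Lemma qq_gg_comm N N' n n' d x : qq N n d -> (forall b, B n' b -> N b) -> gg N' n' x -> d * x = x * d.
Proof.
move=> [b [_ bN ->]] hN hx; apply: (gg_comm _ hx) => c Bc _.
split; first by apply: bN; exact: hN.
by have := congr1 star (bN _ (hN _ (Bstar Bc))); rewrite !starMr starK.
Qed.

Hypothesis D1 : (1 : D) <> 0.

(** After j rounds the remainder has size at most (M / (M+1))^j. Quantifying over all n lets the
    next round ask p to commute with a later stage. Round 0 is p = 0, hence the condition on j in
    the last clause. *)
Definition level M j := forall n (S : seq A) (eps : R), 0 < eps -> exists n' (p : D) (F : D -> Prop),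
  [/\ (n <= n')%N /\ projection p, gg (B n) n' p,
    [/\ star_subalgebra F, finite_dimensional F, (forall x, F x -> gg (B n) n' x), F p & forall x, F x -> p * x = x /\ x * p = x],
    (forall a, a \in S -> nrm (p * jA a - jA a * p) <= eps /\ exists x, F x /\ nrm (p * jA a * p - x) <= eps)
  & sle (gg (B n) n') (nseq (M.+1 ^ j) (1 - p)) (nseq (M ^ j) 1) /\ ((0 < j)%N -> p <> 0)].

Lemma level0 M : level M 0.
Proof.
move=> n S eps eps0; exists n, 0, (fun x => x = 0); split.
- by split => //; split; rewrite ?mulr0 ?star0.
- exact: (csub0 (gg_csub _ _)).
- split => //.
  + split => //.
    * by move=> x y -> ->; rewrite addr0.
    * by move=> a x ->; rewrite scaler0.
    * by move=> x y -> _; rewrite mul0r.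
    * by move=> x ->; rewrite star0.
  + by exists 0%N, (fun _ => 0) => x ->; exists (fun _ => 0); rewrite big_ord0.
  + by move=> x ->; exact: (csub0 (gg_csub _ _)).
  + by move=> x ->; rewrite mulr0.
- by move=> a _; rewrite !mul0r mulr0 subrr nrm0 ltW //; split => //; exists 0; rewrite subrr nrm0 ltW.
split => //; rewrite !expn0 subr0; apply: sle_refl; exact: gg_usub.
Qed.

Lemma proj_sub (p q : D) : projection p -> projection q -> p * q = 0 -> q * p = 0 -> projection (p + q).
Proof.
move=> [pp sp] [qq' sq] pq qp; split; last by rewrite starD sp sq.
by rewrite mulrDl !mulrDr pp pq qp qq' addr0 add0r.
Qed.

Lemma star_sub_sum (F F' : D -> Prop) : star_subalgebra F -> star_subalgebra F' ->
  (forall x y, F x -> F' y -> x * y = 0 /\ y * x = 0) -> finite_dimensional F -> finite_dimensional F' ->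
  star_subalgebra (fun z => exists x y, [/\ F x, F' y & z = x + y]) /\
  finite_dimensional (fun z => exists x y, [/\ F x, F' y & z = x + y]).
Proof.
move=> [f0 fD fZ fM fS] [g0 gD gZ gM gS] fg [k [e he]] [k' [e' he']]; split; first split.
- by exists 0, 0; rewrite addr0.
- move=> z z' [x [y [Fx Gy ->]]] [x' [y' [Fx' Gy' ->]]]; exists (x + x'), (y + y').
  by split; [exact: fD|exact: gD|rewrite addrACA].
- move=> a z [x [y [Fx Gy ->]]]; exists (a *: x), (a *: y).
  by split; [exact: fZ|exact: gZ|rewrite scalerDr].
- move=> z z' [x [y [Fx Gy ->]]] [x' [y' [Fx' Gy' ->]]]; exists (x * x'), (y * y').
  split; [exact: fM|exact: gM|].
  by rewrite mulrDl !mulrDr (proj1 (fg _ _ Fx Gy')) (proj2 (fg _ _ Fx' Gy)) addr0 add0r.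
- by move=> z [x [y [Fx Gy ->]]]; exists (star x), (star y); split; [exact: fS|exact: gS|rewrite starD].
exists (k + k')%N, (fun i => match fintype.split i with inl a => e a | inr b => e' b end).
move=> z [x [y [/he [c ->] /he' [c' ->] ->]]].
exists (fun i => match fintype.split i with inl a => c a | inr b => c' b end).
rewrite big_split_ord /=; congr (_ + _); apply: eq_bigr => i _.
  by have -> : fintype.split (lshift k' i) = inl i by exact: (unsplitK (inl i)).
by have -> : fintype.split (rshift k i) = inr i by exact: (unsplitK (inr i)).
Qed.

Lemma sle_orth (E : D -> Prop) (p q r : D) : usub E -> projection p -> projection q -> E p -> E q -> p * q = 0 -> q * p = 0 ->
  r * p = p -> r * q = q -> sle E [:: p; q] [:: r].
Proof.
move=> uE [pp sp] [qq' sq] Ep Eq pq qp rp rq e e0.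
exists (fun _ (i : 'I_2) => nth 0 [:: p; q] i); split => [j [[|[|i]] hi]|i i'] //=.
rewrite big_ord_recl big_ord0 addr0 /=.
case: i i' => [[|[|i]] hi] [[|[|i']] hi'] //=; rewrite ?sp ?sq -mulrA ?rp ?rq ?pp ?qq' ?pq ?qp ?subrr ?subr0 nrm0 ltW //.
Qed.

(* A further step replaces the remainder r = 1 - p by a subprojection r' with
   (M + 1) [r'] <= M [r]. *)
Lemma next_level M j : (forall n (S : seq A) (eps : R), 0 < eps ->
  exists n2 (F : D -> Prop) (P : D) (al : A -> D) (V : 'I_M -> D),
  [/\ (n <= n2)%N,
    [/\ star_subalgebra F, finite_dimensional F, (forall x, F x -> qq (B n) n2 x), F P & forall x, F x -> P * x = x /\ x * P = x],
    [/\ projection P, forall a, F (al a) & forall a, al (star a) = star (al a)],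
    [/\ forall i, gg (B n) n2 (V i), forall i, V i * P = V i, \sum_i star (V i) * V i = P
      & forall a i, a \in S -> nrm (jA a * V i - V i * al a) <= eps]
  & sle (qq (B n) n2) [:: 1] (nseq 2 P)]) -> (0 < M)%N -> level (4 * M) j -> level (4 * M) j.+1.
Proof.
move=> hmain M0 IH n S eps eps0.
have sB l x : B l x -> B l (star x) by exact: Bstar.
pose cN : R := `|ncst #|'I_M| 2^-1 1| + 1; have cN0 : 0 < cN by rewrite ltr_wpDl.
have M0' : 0 < M%:R :> R by rewrite ltr0n.
have MN0 : 0 < M%:R * cN by rewrite mulr_gt0.
pose e0 := eps / (4 * (M%:R * cN) + 4).
have q0 : 0 < 4 * (M%:R * cN) + 4 by lra.
have e00 : 0 < e0 by rewrite divr_gt0.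
have e0E : e0 * (4 * (M%:R * cN) + 4) = eps by rewrite divfK // lt0r_neq0.
pose S1 := S ++ map star S.
have S1s a : a \in S1 -> star a \in S1.
  rewrite !mem_cat => /orP[h|/mapP[b h ->]]; first by rewrite (map_f star h) orbT.
  by rewrite starK h.
have [n1 [F1 [P [al [V [nn1 [sF1 fF1 F1q F1P F1u] [pP F1al sal] [EV VP sV iV] hP]]]]]] := hmain n S1 e0 e00.
(* M errors of size eta lose half of the lower bound on the columns. *)
pose eta : R := (2 * M%:R)^-1; have eta0 : 0 < eta by rewrite invr_gt0 mulr_gt0.
have [S' [e' [e'0 hS']]] := gg_acomm EV eta0.
pose e1 := Num.min e' e0; have e10 : 0 < e1 by rewrite lt_min e'0.
have [e1e' e1e0] : e1 <= e' /\ e1 <= e0 by rewrite /e1 !ge_min !lexx orbT.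
(* The earlier rounds are invoked at stage n1 and for the larger set, so that r = 1 - p commutes
   with P and the model and nearly with the V_i. *)
have [n3 [p [F [[n13 pp] Ep [sF fF FE Fp Fu] happ [hle _]]]]] := IH n1 (S' ++ S1) e1 e10.
have [ppp sp] := pp.
pose r := 1 - p; have pr : projection r by apply: projC.
have [rr sr] := pr; have rp : r * p = 0 by rewrite mulrBl mul1r ppp subrr.
have prr : p * r = 0 by rewrite mulrBr mulr1 ppp subrr.
have nr : nrm r <= 1 by apply: proj_nrm.
have rcE x : r * x - x * r = x * p - p * x by rewrite /r mulrBl mulrBr mul1r mulr1; ncring.
have pB b : B n1 b -> jQ b * p = p * jQ b by move=> Bb; exact: (gg_commN (sB n1) Bb Ep).
have rB b : B n1 b -> r * jQ b = jQ b * r.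
  by move=> Bb; apply/eqP; rewrite -subr_eq0 rcE pB // subrr.
have rF x : F1 x -> r * x = x * r by move=> /F1q [b [Bb _ ->]]; exact: rB.
have rA a : a \in S' ++ S1 -> nrm (r * jA a - jA a * r) <= e1.
  by move=> /happ [h _]; rewrite rcE nrmB.
have rV i : nrm (r * V i - V i * r) <= eta.
  by apply: hS' => // a aS; apply: (le_trans (rA a _) e1e'); rewrite mem_cat aS.
have Pr : P * r = r * P by rewrite rF.
have [PP sP] := pP.
pose PR := r * P; have pPR : projection PR.
  by split; [rewrite /PR mulrA -(mulrA r P r) Pr mulrA rr -mulrA PP|rewrite starMr sP sr Pr].
(* Compression puts the new summand inside the remainder; near commutation keeps the sum of the
   W_i^* W_i at least 1/2 on r P. *)
pose W i := r * V i * r.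
have nV i : nrm (V i) <= 1.
  apply: nrm_sqr_le => //; rewrite expr1n; apply: le_trans (proj_nrm pP); rewrite -sV.
  apply: ple_nrm; first exact: pos_cs.
  by apply: (ple_term (F := fun i => star (V i) * V i)) => l; exact: pos_cs.
have nW i : nrm (W i) <= 1.
  by have := nrmM_le (nrmM_le nr (nV i)) nr; rewrite !mulr1.
have WP i : W i * PR = W i by rewrite /W /PR mulrA -(mulrA _ r r) rr -mulrA -Pr mulrA -(mulrA r) VP.
have lW : ple (2^-1 *^ PR) (\sum_i star (W i) * W i).
  set T := \sum_i _; have sT : star T = T.
    by rewrite star_sum; apply: eq_bigr => i _; rewrite starMr starK.
  have PRT : PR * T * PR = T.
    have h i : PR * star (W i) = star (W i) by have := congr1 star (WP i); rewrite starMr (proj2 pPR).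
    have -> : PR * T = T by rewrite [LHS]mulr_sumr; apply: eq_bigr => i _; rewrite mulrA h.
    by rewrite [LHS]mulr_suml; apply: eq_bigr => i _; rewrite -mulrA WP.
  have h : nrm (PR - T) <= 2^-1.
    have -> : PR = \sum_i r * star (V i) * V i * r.
      by rewrite -mulr_suml -(eq_bigr _ (fun i _ => mulrA r (star (V i)) (V i))) -mulr_sumr sV -mulrA Pr mulrA rr.
    rewrite -sumrB; apply: le_trans (nrm_sum_const (e := eta) _) _; last first.
      by rewrite card_ord /eta invfM mulrCA mulfV ?mulr1 // lt0r_neq0.
    move=> i; have -> : r * star (V i) * V i * r - star (W i) * W i = - (r * star (V i) * (r * V i - V i * r) * r).
      rewrite /W !starMr sr; have -> : r * (star (V i) * r) * (r * V i * r) = r * star (V i) * (r * r) * V i * r by ncring.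
      rewrite rr; have -> : - (r * star (V i) * (r * V i - V i * r) * r) = r * star (V i) * V i * (r * r) - r * star (V i) * r * V i * r by ncring.
      by rewrite rr.
    rewrite nrmN; have -> : eta = 1 * 1 * eta * 1 by ring.
    by apply: nrmM_le => //; apply: nrmM_le => //; apply: nrmM_le; rewrite ?nrm_star.
  have := ple_conj_sa (proj2 pPR) (ple_approx (proj2 pPR) sT h).
  rewrite mulrDr mulrDl PRT mulZr mulZl mulr1 !(proj1 pPR) /ple => h1.
  have e2 : PR = 2^-1 *^ PR + 2^-1 *^ PR by rewrite rcD -[LHS]rc1; congr (_%:C *: _); field.
  have -> // : T - 2^-1 *^ PR = T + 2^-1 *^ PR - PR.
  by rewrite {3}e2; ncring.
have r01 : 0 < (2^-1 : R) <= 1 by lra.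
have [k [pk PRk sW kE ki]] := normalize pPR WP r01 lW nW.
pose V' i := W i * k.
have uE3 := gg_usub (B n) n3; have BB x : B n x -> B n1 x by exact: B_mono.
have Ep3 : gg (B n) n3 p by exact: (gg_mono BB (leqnn _) Ep).
have Er3 : gg (B n) n3 r by apply: (csubB (gg_csub _ _)) Ep3; exact: (usub1 uE3).
have F13 x : F1 x -> gg (B n) n3 x by move=> /F1q h; apply: gg_q; exact: qq_mono h.
have EW3 i : gg (B n) n3 (W i).
  by apply: (usubM uE3) => //; apply: (usubM uE3) => //; exact: (gg_mono _ _ (EV i)).
have EPR : gg (B n) n3 PR by apply: (usubM uE3) => //; exact: F13.
have EV3 i : gg (B n) n3 (V' i).
  by apply: (usubM uE3) => //; apply: kE => //; exact: gg_csub.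
have V'P i : V' i * PR = V' i by rewrite /V' -mulrA -PRk mulrA WP.
have rV' i : r * V' i = V' i by rewrite /V' /W !mulrA rr.
have iV' a i : a \in S1 -> nrm (jA a * V' i - V' i * al a) <= cN * (2 * e0).
  have iW b l : b \in S1 -> nrm (jA b * W l - W l * al b) <= 2 * e0.
    move=> bS; have -> : jA b * W l - W l * al b = - ((r * jA b - jA b * r) * V l * r) + r * (jA b * V l - V l * al b) * r.
      by rewrite /W -(mulrA (r * V l)) (rF _ (F1al b)); ncring.
    apply: le_trans (nrmD _ _) _; rewrite nrmN; have -> : 2 * e0 = e0 * 1 * 1 + 1 * e0 * 1 by ring.
    apply: lerD; (apply: nrmM_le => //; apply: nrmM_le => //); last exact: iV.
    by apply: le_trans (rA b _) e1e0; rewrite mem_cat bS orbT.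
  move=> aS; apply: le_trans (ki (jA a) (al a) (2 * e0) _ _ _ _ i) _.
  - by rewrite mulr_ge0 // ltW.
  - have [h1 h2] := F1u _ (F1al a).
    by rewrite /PR -mulrA h1 mulrA -(rF _ (F1al a)) -mulrA h2.
  - by move=> l; exact: iW.
  - by move=> l; rewrite -(homS hA) -sal; apply: iW; exact: S1s.
  apply: ler_wpM2r; first by rewrite mulr_ge0 // ltW.
  by apply: le_trans (ler_norm _) _; rewrite /cN lerDl.
have [n4 [u [mu [n34 Mu hmu muq mug]]]] := tower_units n3 M.
have [nu [nuM nuS nuq _ nule]] := corner_units hmu (qq_usub n3 (sB n3)) (qq_usub n4 (sB n3)) muq
  (fun a b x h => mug (B n3) a b x (gg_q h)) M0 (leqW Mu).
have nuC a b x : gg (B n) n3 x -> nu a b * x = x * nu a b.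
  by move=> hx; apply: (qq_gg_comm (nuq a b) _ hx).
have B3 x : B n x -> B n3 x by apply: B_mono; exact: leq_trans n13.
have n14 := leq_trans n13 n34; have uE4 := gg_usub (B n) n4.
have E34 x : gg (B n) n3 x -> gg (B n) n4 x by exact: gg_mono.
have nu4 a b : gg (B n) n4 (nu a b) by apply: gg_q; exact: (qq_mono B3 (leqnn _) (nuq a b)).
pose i0 : 'I_M := Ordinal M0; pose om := nu i0 i0; pose th i := nu i i0.
(* The matrix units put the columns V'_i in orthogonal positions, so one element has square PR om
   and still intertwines A with the model. *)
pose Om := \sum_i V' i * th i.
have thC i x : gg (B n) n3 x -> th i * x = x * th i by exact: nuC.
have nth1 i : nrm (th i) <= 1.
  apply: nrm_sqr_le => //; rewrite expr1n nuS nuM eqxx; apply: proj_nrm.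
  by split; rewrite ?nuM ?eqxx ?nuS.
have cross i l : star (V' i * th i) * (V' l * th l) = star (V' i) * V' l * (nu i0 i * nu l i0).
  have sV3 : gg (B n) n3 (star (V' i)) by exact: (usubS uE3).
  rewrite (starMr (V' i) (th i)); have -> : star (th i) = nu i0 i by exact: nuS.
  have -> : nu i0 i * star (V' i) * (V' l * th l) = nu i0 i * (star (V' i) * V' l) * th l by rewrite !mulrA.
  by rewrite nuC; [rewrite -mulrA|exact: (usubM uE3)].
have OO : star Om * Om = PR * om.
  rewrite /Om star_sum -sW mulr_suml [RHS]mulr_suml; apply: eq_bigr => i _; rewrite mulr_sumr (bigD1 i) //= big1 ?addr0.
    by rewrite cross nuM eqxx.
  by move=> l li; rewrite cross nuM eq_sym (negbTE li) mulr0.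
have OmP : Om * (PR * om) = Om.
  rewrite /Om mulr_suml; apply: eq_bigr => i _; rewrite -mulrA (mulrA (th i)) (thC _ _ EPR) -mulrA.
  by rewrite /th nuM eqxx mulrA V'P.
have omC x : gg (B n) n3 x -> om * x = x * om by exact: nuC.
pose p' := Om * star Om.
have p'Om : p' * Om = Om by rewrite -mulrA OO OmP.
have pp' : projection p' by split; [rewrite /p' mulrA -/p' p'Om|rewrite starMr starK].
have rOm : r * Om = Om by rewrite /Om mulr_sumr; apply: eq_bigr => i _; rewrite mulrA rV'.
have pOm : p * Om = 0 by rewrite -rOm mulrA prr mul0r.
have pp'0 : p * p' = 0 by rewrite mulrA pOm mul0r.
have p'p0 : p' * p = 0 by have := congr1 star pp'0; rewrite starMr sp (proj2 pp') star0.
have Om4 : gg (B n) n4 Om by apply: (usub_sum uE4) => i; apply: (usubM uE4); [exact: (E34 _ (EV3 i))|exact: nu4].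
have p'4 : gg (B n) n4 p' by apply: (usubM uE4) => //; exact: (usubS uE4).
have PRP : PR * P = PR by rewrite /PR -mulrA PP.
have poP : PR * om * P = PR * om by rewrite -mulrA (omC _ (F13 _ F1P)) mulrA PRP.
have sPo : star (PR * om) = PR * om by rewrite starMr (proj2 pPR) nuS (omC _ EPR).
have nOm : nrm Om <= 1.
  apply: nrm_sqr_le => //; rewrite expr1n OO; have := nrmM_le (proj_nrm pPR) (_ : nrm om <= 1); rewrite mulr1; apply.
  by apply: proj_nrm; split; rewrite ?nuM ?eqxx ?nuS.
have nsOm : nrm (star Om) <= 1 by rewrite nrm_star.
have np' : nrm p' <= 1 by exact: proj_nrm.
have np : nrm p <= 1 by exact: proj_nrm.
pose d2 := M%:R * (cN * (2 * e0)).
have iOm a : a \in S1 -> nrm (jA a * Om - Om * al a) <= d2.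
  move=> aS; have -> : jA a * Om - Om * al a = \sum_i (jA a * V' i - V' i * al a) * th i.
    rewrite /Om mulr_sumr mulr_suml -sumrB; apply: eq_bigr => i _.
    by rewrite mulrBl -!mulrA (thC _ _ (F13 _ (F1al a))).
  rewrite /d2 -[in leRHS](card_ord M); apply: nrm_sum_const => i; rewrite -[cN * _]mulr1.
  by apply: nrmM_le => //; exact: iV'.
pose F2 z := exists x, F1 x /\ z = Om * x * star Om.
have Omx x : F1 x -> star Om * Om * x * star Om = x * star Om.
  move=> Fx; have [h1 h2] := F1u x Fx.
  have c1 : PR * om * x = x * (PR * om).
    have xPR : PR * x = x * PR by rewrite /PR -mulrA h1 mulrA -(rF _ Fx) -mulrA h2.
    by rewrite -(mulrA PR om x) (omC _ (F13 _ Fx)) (mulrA PR x om) xPR -(mulrA x PR om).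
  by have := congr1 star OmP; rewrite (starMr Om) sPo => h; rewrite OO c1 -mulrA h.
have [f0 fD fZ fM fS] := sF1.
have sF2 : star_subalgebra F2.
  split.
  - by exists 0; rewrite mulr0 mul0r.
  - by move=> x y [x' [h1 ->]] [y' [h2 ->]]; exists (x' + y'); split; [exact: fD|rewrite mulrDr mulrDl].
  - by move=> a x [x' [h1 ->]]; exists (a *: x'); split; [exact: fZ|rewrite mulZr mulZl].
  - move=> x y [x' [h1 ->]] [y' [h2 ->]]; exists (x' * y'); split; first exact: fM.
    have -> : Om * x' * star Om * (Om * y' * star Om) = Om * x' * (star Om * Om * y' * star Om) by rewrite !mulrA.
    by rewrite Omx // !mulrA.
  - by move=> x [x' [h1 ->]]; exists (star x'); split; [exact: fS|rewrite !starMr starK mulrA].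
have fF2 : finite_dimensional F2.
  have [d [ee hee]] := fF1; exists d, (fun i => Om * ee i * star Om) => x [y [/hee [cc ->] ->]].
  by exists cc; rewrite mulr_sumr mulr_suml; apply: eq_bigr => i _; rewrite mulZr mulZl.
have pF x : F x -> p * x = x /\ x * p = x by exact: Fu.
have F2r z : F2 z -> p * z = 0 /\ z * p = 0.
  move=> [x [_ ->]]; rewrite !mulrA pOm !mul0r; split => //.
  by rewrite -mulrA -[star Om * p]starK starMr starK sp pOm star0 mulr0.
have [sFF fFF] := star_sub_sum sF sF2 (fun x y Fx Gy => conj
   (etrans (congr1 (fun z => z * y) (esym (proj2 (pF x Fx)))) (etrans (esym (mulrA _ _ _)) (etrans (congr1 (fun z => x * z) (proj1 (F2r y Gy))) (mulr0 _))))
   (etrans (congr1 (fun z => y * z) (esym (proj1 (pF x Fx)))) (etrans (mulrA _ _ _) (etrans (congr1 (fun z => z * x) (proj2 (F2r y Gy))) (mul0r _))))) fF fF2.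
have F2p' : F2 p'.
  exists P; split => //; rewrite /p'; congr (_ * _).
  by rewrite -[in RHS]OmP -mulrA poP OmP.
have F2u x : F2 x -> p' * x = x /\ x * p' = x.
  move=> [y [Fy ->]]; rewrite !mulrA p'Om; split => //.
  rewrite /p' -!mulrA; congr (_ * (_ * _)); rewrite mulrA.
  by have := congr1 star p'Om; rewrite starMr (proj2 pp') /p' mulrA.
have pq := proj_sub pp pp' pp'0 p'p0.
exists n4, (p + p'), (fun z => exists x y, [/\ F x, F2 y & z = x + y]); split.
- by split => //; exact: leq_trans n14.
- by apply: (usubD uE4) => //; exact: E34.
- split => //.
  + move=> z [x [y [Fx [y' [Fy' ->]] ->]]]; apply: (usubD uE4).
      by apply: E34; apply: (gg_mono BB (leqnn _)); exact: FE.
    by apply: (usubM uE4); [apply: (usubM uE4) => //; apply: E34; exact: F13|exact: (usubS uE4)].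
  + by exists p, p'.
  + move=> z [x [y [Fx Fy ->]]]; have [h1 h2] := Fu x Fx; have [h3 h4] := F2u y Fy; have [h5 h6] := F2r y Fy.
    have h7 : p' * x = 0 by rewrite -h1 mulrA p'p0 mul0r.
    have h8 : x * p' = 0 by rewrite -h2 -mulrA pp'0 mulr0.
    have -> : (p + p') * (x + y) = p * x + p' * y + (p * y + p' * x) by ncring.
    have -> : (x + y) * (p + p') = x * p + y * p' + (y * p + x * p') by ncring.
    by rewrite h1 h2 h3 h4 h5 h6 h7 h8 !addr0.
- move=> a aS; have aS1 : a \in S1 by rewrite mem_cat aS.
  have aS2 : a \in S' ++ S1 by rewrite mem_cat aS1 orbT.
  have [h1 [x [Fx h2]]] := happ a aS2.
  have h3 := iOm a aS1; have h4 := iOm (star a) (S1s a aS1).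
  have h5 : nrm (star Om * jA a - al a * star Om) <= d2.
    by move: h4; rewrite -nrm_star starB !starMr -(homS hA) -sal !starK.
  pose z := Om * al a * star Om.
  have h6 : nrm (jA a * p' - z) <= d2.
    have -> : jA a * p' - z = (jA a * Om - Om * al a) * star Om by rewrite /p' /z; ncring.
    by rewrite -[d2]mulr1; apply: nrmM_le.
  have h7 : nrm (p' * jA a - z) <= d2.
    have -> : p' * jA a - z = Om * (star Om * jA a - al a * star Om) by rewrite /p' /z; ncring.
    by rewrite -[d2]mul1r; apply: nrmM_le.
  have Fz : F2 z by exists (al a).
  have d2E : 2 * d2 + e0 <= eps /\ d2 + 3 * e0 <= eps.
    by rewrite -e0E /d2; have := mulr_gt0 MN0 e00; split; lra.
  split.
    have -> : (p + p') * jA a - jA a * (p + p') = (p * jA a - jA a * p) + ((p' * jA a - z) - (jA a * p' - z)) by ncring.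
    apply: le_trans (nrmD _ _) _; apply: le_trans (lerD (lexx _) (nrmD _ _)) _; rewrite nrmN.
    by move: d2E h1 h6 h7 e1e0; lra.
  exists (x + z); split; first by exists x, z.
  have -> : (p + p') * jA a * (p + p') - (x + z) = (p * jA a * p - x) + (p' * jA a * p' - z) + (p * jA a * p' + p' * jA a * p) by ncring.
  have -> : p * jA a * p' = (p * jA a - jA a * p) * p' by rewrite mulrBl -(mulrA (jA a)) pp'0 mulr0 subr0.
  have -> : p' * jA a * p = - (p' * (p * jA a - jA a * p)) by rewrite mulrBr !mulrA p'p0 mul0r sub0r opprK.
  have h8 : nrm (p' * jA a * p' - z) <= 1 * d2.
    have -> : p' * jA a * p' - z = p' * (jA a * p' - z) by rewrite mulrBr (proj1 (F2u z Fz)) (mulrA p' (jA a) p').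
    exact: nrmM_le.
  have h9 := nrmM_le h1 np'; have h10 := nrmM_le np' h1.
  apply: le_trans (nrmD _ _) _; apply: le_trans (lerD (nrmD _ _) (nrmD _ _)) _; rewrite nrmN.
  by move: d2E h2 h8 h9 h10 e1e0; lra.
(* The count: [r] <= 2 [PR] <= 4M [PR om] = 4M [p'], the factors two being those of [hP] and [nule].
   With [r'] + [p'] <= [r] this gives (4M + 1) [r'] <= 4M [r]. *)
have q14 : forall x, qq (B n) n1 x -> gg (B n) n4 x by move=> x h; apply: gg_q; exact: (qq_mono (fun _ h => h) n14 h).
have c1 : sle (gg (B n) n4) [:: r] (nseq 2 PR).
  have := sle_mull (K := 1) (qq_usub n1 (sB n)) uE4 q14 nr _ hP; rewrite mulr1; apply.
  by move=> y [b [Bb _ ->]]; exact: rB.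
have q34 : forall x, qq (B n3) n4 x -> gg (B n) n4 x by move=> x h; apply: gg_q; exact: (qq_mono B3 (leqnn _) h).
have c2 : sle (qq (B n3) n4) [:: \sum_i nu i i] (nseq M om).
  have uq := qq_usub n4 (sB n3).
  have h : cle (qq (B n3) n4) (fun _ : unit => \sum_i nu i i) (fun _ : 'I_M => om).
    apply: (cle_exact (V := fun i _ => nu i0 i)) => [i _|[] []]; first exact: nuq.
    by apply: eq_bigr => i _; rewrite nuS /om !nuM !eqxx.
  by have := sle_fam uq h; rewrite !codom_cst card_unit card_ord.
have c3 : sle (qq (B n3) n4) [:: 1] (nseq (2 * M) om).
  have uq := qq_usub n4 (sB n3); apply: (sle_trans uq nule).
  by have := sle_smul uq 2 c2; rewrite -[[:: _]]/(nseq 1 _) !smul_nseq.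
have c4 : sle (gg (B n) n4) [:: PR] (nseq (2 * M) (PR * om)).
  have := sle_mull (K := 1) (qq_usub n4 (sB n3)) uE4 q34 (proj_nrm pPR) _ c3; rewrite mulr1; apply.
  by move=> y hy; rewrite (qq_gg_comm hy _ EPR).
have c5 : sle (gg (B n) n4) [:: PR * om] [:: p'].
  have h : cle (gg (B n) n4) (fun _ : unit => PR * om) (fun _ : unit => p').
    apply: (cle_exact (V := fun _ _ => Om)) => // [[] []].
    by rewrite big_const card_unit /= addr0 -mulrA p'Om OO.
  by have := sle_fam uE4 h; rewrite !codom_cst card_unit.
have c6 : sle (gg (B n) n4) [:: r] (nseq (4 * M) p').
  apply: (sle_trans uE4 c1).
  have := sle_smul uE4 2 (sle_trans uE4 c4 (_ : sle _ _ (nseq (2 * M) p'))).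
  rewrite -[[:: PR]]/(nseq 1 _) !smul_nseq mulnA; apply.
  by have := sle_smul uE4 (2 * M) c5; rewrite -[[:: PR * om]]/(nseq 1 _) -[[:: p']]/(nseq 1 _) !smul_nseq muln1.
pose r' := 1 - (p + p'); have pr' : projection r' by exact: projC.
have r'E : r' = r - p' by rewrite /r' /r; ncring.
have rp' : r * p' = p' by rewrite /p' mulrA rOm.
have p'r : p' * r = p' by have := congr1 star rp'; rewrite starMr sr (proj2 pp').
have r'4 : gg (B n) n4 r'.
  by rewrite r'E; apply: (csubB (gg_csub _ _)) => //; exact: E34.
have c7 : sle (gg (B n) n4) [:: r'; p'] [:: r].
  have e1' : r' * p' = 0.
    rewrite r'E; have -> : (r - p') * p' = r * p' - p' * p' by ncring.
    by rewrite rp' (proj1 pp') subrr.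
  have e2' : p' * r' = 0.
    rewrite r'E; have -> : p' * (r - p') = p' * r - p' * p' by ncring.
    by rewrite p'r (proj1 pp') subrr.
  have e3' : r * r' = r'.
    rewrite r'E; have -> : r * (r - p') = r * r - r * p' by ncring.
    by rewrite rr rp'.
  exact: sle_orth.
have c8 : sle (gg (B n) n4) [:: r'] [:: r] by apply: sle_trans c7 => //; exact: (sle_catl uE4 [:: r'] [:: p']).
split.
  have c9 : sle (gg (B n) n4) (nseq (4 * M).+1 r') (nseq (4 * M) r).
    rewrite -[_.+1]addn1 nseqD.
    apply: (sle_trans uE4 (sle_cat uE4 (sle_refl uE4 _) (sle_trans uE4 c8 c6))).
    have := sle_smul uE4 (4 * M) c7; rewrite -[[:: r]]/(nseq 1 _) smul_nseq muln1 => h.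
    apply: (sle_trans uE4 _ h); apply: sle_perm => //.
    rewrite perm_sym (perm_trans (perm_smul_cat _ [:: r'] [:: p'])) //.
    by rewrite -[[:: r']]/(nseq 1 _) -[[:: p']]/(nseq 1 _) !smul_nseq !muln1.
  have c10 : sle (gg (B n) n4) (nseq ((4 * M).+1 ^ j) r) (nseq ((4 * M) ^ j) 1).
    by apply: cle_mono hle => x; exact: gg_mono.
  have h1 := sle_smul uE4 ((4 * M).+1 ^ j) c9; rewrite !smul_nseq in h1.
  have h2 := sle_smul uE4 (4 * M) c10; rewrite !smul_nseq in h2.
  by rewrite expnSr expnS; apply: (sle_trans uE4 h1); rewrite mulnC.
(* If the new projection were 0, then r = 1 would lie below copies of p' = 0, and the unit of D
   would vanish. *)
move=> _ h0.
have p0 : p = 0 by rewrite -ppp -[LHS]addr0 -pp'0 -mulrDr h0 mulr0.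
have p'0 : p' = 0 by move: h0; rewrite p0 add0r.
apply: D1; apply: nrm_small => e e_0.
have [z [_ hz]] := sle_one uE4 c6 e_0; move: hz; rewrite p'0 /r p0 subr0 big1 => [|i _]; last by rewrite mulr0 mul0r.
by rewrite sub0r nrmN.
Qed.

(** * Finite stages as matrices over A, simplicity of the tensor product, and small remainders *)

Local Notation L := (gg (fun _ => False)).
Hypothesis jA_inj : forall a, jA a = 0 -> a = 0.

(** Suppose |b| = 1 and s = |jA b|^2 < 1. The cut y of b^* b at s is mapped to an element whose
    square is both positive and negative, so y = 0 by injectivity, and b^* b <= s is a
    contradiction. *)
Lemma jA_nrm a : nrm (jA a) = nrm a.
Proof.
apply/eqP; rewrite eq_le (hom_nrm hA) /= leNgt; apply/negP => h.
have na : 0 < nrm a by apply: le_lt_trans h; exact: nrm_ge0.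
pose b := (nrm a)^-1 *^ a; have nb : nrm b = 1 by rewrite nrmZ0 ?invr_ge0 ?nrm_ge0 // mulVf // lt0r_neq0.
pose t := nrm (jA b); have t0 : 0 <= t := nrm_ge0 _.
have t1 : t < 1 by rewrite /t (linZ lA) nrmZ0 ?invr_ge0 ?nrm_ge0 // mulrC ltr_pdivrMr // mul1r.
pose s := t ^+ 2; have s01 : 0 <= s <= 1 by rewrite /s expr2; nra.
have s1 : s < 1 by rewrite /s expr2; nra.
have nx : nrm (star b * b) = 1 by rewrite nrm_cs nb expr1n.
have nx1 : nrm (star b * b) <= 1 by rewrite nx.
have [c1 c2 c3 c4 _] := cutP s01 (pos_cs b) nx1; set y := cut s _ in c1 c2 c3 c4.
pose X := jA (star b * b); have X1 : pos (s%:I - X).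
  apply: nrm_pos; first by rewrite /X -(homS hA) starMr starK.
  by rewrite /X (homM hA) (homS hA) nrm_cs.
have Y1 := hom_pos hA c1.
have c3' : jA y * (X - s%:I) = jA y * jA y.
  by rewrite -!(homM hA) -c3 (homM hA) (linB lA) (linZ lA) (hom1 hA).
have YX : jA y * (s%:I - X) = (s%:I - X) * jA y.
  by rewrite mulrBl mulrBr mulZl mulZr mulr1 mul1r -!(homM hA) c2.
have h1 := pos_mulC Y1 X1 YX.
have h2 : jA y * jA y = 0.
  apply: pos_anti; first exact: pos_sqr (pos_sa Y1).
  by rewrite -c3' -mulrN opprB.
have y0 : y = 0.
  by apply: jA_inj; apply: cs_eq0; rewrite (pos_sa Y1).
rewrite y0 addr0 in c4; have h3 := ple_nrm (pos_cs b) c4; rewrite nx in h3.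
have h4 := nrm1Z A (proj1 (andP s01)); lra.
Qed.

(** Isometry makes the preimages of a sufficiently fast subsequence Cauchy in A. *)
Lemma jA_closed u l : (forall k, exists a, u k = jA a) -> cvA u l -> exists a, l = jA a.
Proof.
move=> /choice [a ha] cv.
have /choice [N hN] n : exists N, forall k, (N <= k)%N -> nrm (u k - l) <= n.+1%:R^-1 by apply: cv; rewrite invr_gt0.
pose K n := (\sum_(i < n.+1) N i)%N.
have NK n : (N n <= K n)%N by rewrite /K big_ord_recr /= leq_addl.
have [|e e0|a' ha'] := @cvA_cauchy _ A (fun n => a (K n)) (fun n => 2 / n.+1%:R).
- move=> n m' nm; rewrite -jA_nrm (linB lA) -!ha; have -> : 2 / n.+1%:R = n.+1%:R^-1 + n.+1%:R^-1 :> R by ring.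
  apply: (@nrm_tri _ _ _ l); last by rewrite nrmB; exact: hN.
  apply: le_trans (hN m' _ (NK m')) _; by rewrite lef_pV2 ?posrE // ler_nat.
- exists (Num.truncn (2 / e)); rewrite ler_pdivrMr // mulrC -ler_pdivrMr //.
  exact: ltW (truncnS_gt _).
exists a'; apply: (@cvA_unique _ _ (fun n => jA (a (K n)))).
  move=> e e0; exists (Num.truncn e^-1) => n hn; rewrite -ha; apply: le_trans (hN n _ (NK n)) _.
  rewrite invf_ple ?posrE //; apply: ltW; apply: lt_le_trans (truncnS_gt _) _; by rewrite ler_nat.
by move=> e /ha' [n0 h]; exists n0 => n /h; apply: le_trans; rewrite -(linB lA) jA_nrm.
Qed.

Section Coordinates.
Variables (n k : nat) (mu : 'I_k.+1 -> 'I_k.+1 -> Q).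
Hypotheses (hmu : munits mu) (Bmu : forall x, B n x <-> exists c : 'I_k.+1 -> 'I_k.+1 -> R[i], x = \sum_i \sum_j c i j *: mu i j).
Local Notation E i j := (jQ (mu i j)).
Let EM a b c d : E a b * E c d = if b == c then E a d else 0.
Proof. by case: (hom_munits hmu) => h _ _; exact: h. Qed.
Let E1 : \sum_i E i i = 1. Proof. by case: (hom_munits hmu). Qed.
Let ES a b : star (E a b) = E b a. Proof. by case: (hom_munits hmu). Qed.

(** The (i, j) entry of d over the matrix units of stage n, repeated along the diagonal. *)
Definition crd i j (d : D) := \sum_l E l i * d * E j l.

(** The elements with all entries in the image of A form a C*-algebra containing the generators: a
    finite stage consists of matrices over A. *)
Lemma crd_gg d i j : L n d -> exists a, crd i j d = jA a.
Proof.
move=> hd; pose G d := forall i j, exists a, crd i j d = jA a; suff : G d by apply.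
have EjA a p q : crd p q (jA a) = if p == q then jA a else 0.
  rewrite /crd; have E' l : E l p * jA a * E q l = if p == q then jA a * E l l else 0.
    by rewrite -jC -mulrA EM; case: eqP; rewrite ?mulr0.
  rewrite (eq_bigr _ (fun l _ => E' l)); case: eqP => _; first by rewrite -mulr_sumr E1 mulr1.
  by rewrite big1.
have GA a : G (jA a).
  by move=> p q; rewrite EjA; case: eqP => _; [exists a|exists 0; rewrite (lin0 lA)].
apply: hd; last first.
  move=> y [[a ->]|[b [/Bmu [c ->] _ ->]]]; first exact: GA.
  move=> p q; exists (c p q *: (1 : A)); rewrite (linZ lA) (hom1 hA) /crd.
  have E' l : E l p * jQ (\sum_i \sum_j c i j *: mu i j) * E q l = c p q *: E l l.
    rewrite (lin_sum lQ) mulr_sumr mulr_suml (bigD1 p) //= [X in _ + X]big1 ?addr0 => [|s sp].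
      rewrite (lin_sum lQ) mulr_sumr mulr_suml (bigD1 q) //= [X in _ + X]big1 ?addr0 => [|t tq].
        by rewrite (linZ lQ) mulZr mulZl EM eqxx EM eqxx.
      by rewrite (linZ lQ) mulZr mulZl EM eqxx EM (negbTE tq) scaler0.
    rewrite (lin_sum lQ) mulr_sumr mulr_suml big1 // => t _.
    by rewrite (linZ lQ) mulZr mulZl EM eq_sym (negbTE sp) mul0r scaler0.
  by rewrite (eq_bigr _ (fun l _ => E' l)) -scaler_sumr E1.
split.
- by move=> p q; rewrite -(hom1 hA); exact: GA.
- move=> x y hx hy p q; have [[a ha] [b hb]] := (hx p q, hy p q); exists (a + b).
  by rewrite (linD lA) -ha -hb /crd -big_split; apply: eq_bigr => l _; rewrite mulrDr mulrDl.
- move=> c x hx p q; have [a ha] := hx p q; exists (c *: a).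
  by rewrite (linZ lA) -ha /crd scaler_sumr; apply: eq_bigr => l _; rewrite mulZr mulZl.
- move=> x y hx hy p q; have /choice [a ha] := fun s => hx p s; have /choice [b hb] := fun s => hy s q.
  exists (\sum_s a s * b s); rewrite (lin_sum lA).
  have E' s : jA (a s * b s) = \sum_l E l p * x * E s s * y * E q l.
    rewrite (homM hA) -ha -hb /crd mulr_suml; apply: eq_bigr => l _; rewrite mulr_sumr (bigD1 l) //= big1 ?addr0.
      rewrite !mulrA -(mulrA (E l p * x) (E s l)) EM eqxx //.
    by move=> t tl; rewrite !mulrA -(mulrA (E l p * x) (E s l)) EM eq_sym (negbTE tl) mulr0 !mul0r.
  rewrite (eq_bigr _ (fun s _ => E' s)) exchange_big; apply: eq_bigr => l _ /=.
  by rewrite -!mulr_suml -mulr_sumr E1 mulr1 mulrA.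
split.
- move=> x hx p q; have [a ha] := hx q p; exists (star a).
  by rewrite (homS hA) -ha /crd star_sum; apply: eq_bigr => l _; rewrite !starMr !ES mulrA.
move=> u l hul cv p q; apply: (@jA_closed (fun s => crd p q (u s))) => [s|]; first exact: hul.
move=> e e0; have [N hN] := cv (e / k.+1%:R) (divr_gt0 e0 (ltr0Sn _ _)); exists N => s /hN h.
have -> : crd p q (u s) - crd p q l = \sum_t E t p * (u s - l) * E q t.
  by rewrite /crd -sumrB; apply: eq_bigr => t _; rewrite mulrBr mulrBl.
have nE a b : nrm (E a b) <= 1.
  apply: nrm_sqr_le => //; rewrite expr1n ES EM eqxx; apply: proj_nrm.
  by split; rewrite ?EM ?eqxx ?ES.
apply: le_trans (nrm_sum_const (e := e / k.+1%:R) _) _.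
  by move=> t; rewrite -[e / _]mulr1 -[e / _]mul1r; apply: nrmM_le => //; exact: nrmM_le.
by rewrite card_ord mulrC divfK.
Qed.

(** A vanishing diagonal entry says that (y E_ii)^* (y E_ii) = 0 for the root y of d, so y kills
    every diagonal unit. *)
Lemma crd_faithful d : pos d -> (forall i, crd i i d = 0) -> d = 0.
Proof.
move=> pd h; have [y [py hy _ _]] := pos_sqrt pd.
suff y0 : y = 0 by rewrite -hy y0 mul0r.
rewrite -[y]mulr1 -E1 mulr_sumr big1 // => i _.
apply: cs_eq0; rewrite starMr ES (pos_sa py).
have := congr1 (fun x => E i i * x * E i i) (h i); rewrite mulr0 mul0r /crd mulr_sumr mulr_suml (bigD1 i) //= big1 ?addr0.
  have -> : E i i * (E i i * d * E i i) * E i i = (E i i * E i i) * d * (E i i * E i i) by rewrite !mulrA.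
  by rewrite EM eqxx -hy !mulrA.
by move=> l li; rewrite !mulrA EM eq_sym (negbTE li) !mul0r.
Qed.
End Coordinates.

Hypothesis Ldense : forall d e, 0 < e -> exists n k (a : 'I_k -> A) (b : 'I_k -> Q),
  (forall i, B n (b i)) /\ nrm (\sum_i jA (a i) * jQ (b i) - d) <= e.

Lemma L_mono n n' d : (n <= n')%N -> L n d -> L n' d.
Proof. exact: gg_mono. Qed.
Lemma L_q n b : B n b -> L n (jQ b).
Proof. by move=> Bb; apply: gg_q; exists b; split. Qed.

Lemma L_approx d e : 0 < e -> exists n x, L n x /\ nrm (x - d) <= e.
Proof.
move=> /(Ldense d) [n [k [a [b [Bb h]]]]]; exists n, (\sum_i jA (a i) * jQ (b i)); split => //.
have uL := gg_usub (fun _ => False) n.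
by apply: (usub_sum uL) => i; apply: (usubM uL); [exact: gg_A|exact: L_q].
Qed.

Lemma L_approx_fam k (d : 'I_k -> D) e : 0 < e -> exists n (x : 'I_k -> D),
  (forall i, L n (x i)) /\ forall i, nrm (x i - d i) <= e.
Proof.
move=> e0; have /choice [x hx] i : exists x : nat * D, L x.1 x.2 /\ nrm (x.2 - d i) <= e.
  by have [n [x hx]] := L_approx (d i) e0; exists (n, x).
exists (\max_i (x i).1)%N, (fun i => (x i).2); split => i; last by case: (hx i).
by apply: L_mono (proj1 (hx i)); exact: (leq_bigmax_cond i).
Qed.

Lemma cube_neq0 (x : D) : pos x -> x <> 0 -> x * x * x <> 0.
Proof.
move=> px x0 h; apply: x0; apply: cs_eq0; rewrite (pos_sa px); apply: cs_eq0.
by rewrite starMr (pos_sa px) mulrA h mul0r.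
Qed.

(** For the cut u of g one has u g u = u^3 + e u^2, and g <= x + e. This transfers a cut of an
    approximant to the approximated element. *)
Lemma cut_cube (e : R) (g x : D) : 0 <= e <= 1 -> pos g -> nrm g <= 1 -> star x = x -> nrm (g - x) <= e ->
  ple (cut e g * cut e g * cut e g) (cut e g * x * cut e g).
Proof.
move=> e01 pg ng sx h; have [c1 c2 c3 _ _] := cutP e01 pg ng; set y := cut e g in c1 c2 c3 *.
have h1 := ple_conj_sa (pos_sa c1) (ple_approx (pos_sa pg) sx h).
have E : y * g * y = y * y * y + e *^ (y * y).
  have -> : y * y * y = y * (g - e%:I) * y by rewrite c3.
  ncring.
move: h1; rewrite E mulrDr mulrDl mulZr mulZl mulr1 /ple.
by set a := (X in pos X -> _); set b := (X in _ -> pos X); have -> // : a = b; rewrite /a /b; ncring.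
Qed.

(** A nonzero ideal contains, by [cut_cube], a nonzero positive element of a finite stage. One of
    its diagonal entries is a nonzero element of A in the ideal, and simplicity of A puts 1
    there. *)
Lemma tower_simple : simple D.
Proof.
split => // I [cI I0 ID IZ IM].
have [->|/eqP nI] := eqVneq I [set 0]; [by left|right].
have [d [Id d0]] : exists d, I d /\ d <> 0.
  apply: contrapT => h; apply: nI; apply/seteqP; split => x /=; last by move=> ->.
  by move=> Ix; apply: contrapT => x0; apply: h; exists x.
have Iclosed x : (forall e, 0 < e -> exists2 w, I w & nrm (w - x) <= e) -> I x.
  by move=> h; rewrite (proj1 (closure_id I) cI); apply/closureP.
pose d1 := (2 * nrm d)^-1 *^ d; have nd := nrm_gt0 d0.
have nd1 : nrm d1 = 2^-1.
  rewrite nrmZ0; last by rewrite invr_ge0 mulr_ge0 // ltW.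
  by rewrite invfM -mulrA mulVf ?mulr1 // lt0r_neq0.
have Id1 : I d1 by apply: IZ.
pose x := star d1 * d1; have Ix : I x by case: (IM d1 (star d1) Id1).
pose e : R := 32^-1; have e0 : 0 < e by rewrite invr_gt0.
have [n [c [Lc hc]]] := L_approx d1 e0.
have nc : nrm c <= 2^-1 + e by have := nrmD (c - d1) d1; rewrite subrK nd1; lra.
pose g := star c * c; have pg : pos g := pos_cs c.
have ng : nrm g <= 1.
  by rewrite nrm_cs expr2; have := nrm_ge0 c; move: nc; rewrite /e; nra.
have gx : nrm (g - x) <= 2 * e.
  have -> : g - x = star c * (c - d1) + star (c - d1) * d1 by rewrite starB /g /x; ncring.
  apply: le_trans (nrmD _ _) _.
  have h1 := nrmM_le (eq_ind_r (fun t => t <= 2^-1 + e) nc (nrm_star c)) hc.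
  have h2 := nrmM_le (eq_ind_r (fun t => t <= e) hc (nrm_star (c - d1))) (eq_ind_r (fun t => t <= 2^-1) (lexx 2^-1) nd1).
  by move: h1 h2; rewrite /e; lra.
have e2 : 0 <= 2 * e <= 1 by rewrite /e; lra.
have [c1 c2 c3 c4 c5] := cutP e2 pg ng; set u := cut _ g in c1 c2 c3 c4 c5.
have nx : nrm x = 4^-1 by rewrite nrm_cs nd1 expr2 -invfM -natrM.
have u0 : u <> 0.
  move=> u0; rewrite u0 addr0 in c4; have h1 := ple_nrm pg c4.
  have h2 := nrm1Z D (proj1 (andP e2)); have := nrmD (x - g) g; rewrite subrK nx nrmB.
  by move: h1 h2 gx; rewrite /e; lra.
have sx : star x = x by rewrite starMr starK.
pose y := u * u * u; have py : pos y by apply: pos_conj_sa => //; exact: pos_sa.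
have Iy : I y.
  apply: Iclosed => t t0; have [V hV] := cle1_ple py (cut_cube e2 pg ng sx gx) t0.
  have [_ hV2] := hV; have := hV2 tt tt; rewrite eqxx (bigD1 tt) //= big1 ?addr0 => [h|[] //].
  exists (star (V tt tt) * (u * x * u) * V tt tt) => //.
  have h1 : I (u * x * u) by apply: (proj1 (IM _ _ _)); apply: (proj2 (IM _ _ _)).
  by apply: (proj1 (IM _ _ _)); apply: (proj2 (IM _ _ _)).
have cL := gg_csub (fun _ => False) n.
have Lg : L n g by apply: (csubM cL) => //; exact: (csubS cL).
have Lu : L n u by exact: (cut_csub cL e2 pg ng Lg).
have Ly : L n y by do 2!apply: (csubM cL) => //.
have [k [mu [hmu Bmu]]] := Bspan n.
have [i hi] : exists i, crd mu i i y <> 0.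
  apply: contrapT => h; apply: (cube_neq0 c1 u0); apply: (crd_faithful hmu py) => i.
  by apply: contrapT => hi; apply: h; exists i.
have [a ha] := crd_gg hmu Bmu i i Ly.
have Isum (K : finType) (f : K -> D) : (forall l, I (f l)) -> I (\sum_l f l).
  by move=> h; elim/big_rec: _ => // l z _; apply: ID.
have Ia : I (jA a).
  rewrite -ha; apply: Isum => l; apply: (proj1 (IM _ _ _)); exact: (proj2 (IM _ _ _)).
have a0 : star a * a <> 0.
  by move=> /cs_eq0 a0; apply: hi; rewrite ha a0 (lin0 lA).
have [N [z hz]] := simple_full sA (pos_cs a) a0.
have I1 : I 1.
  rewrite -(hom1 hA) -hz (lin_sum lA); apply: Isum => l; rewrite !(homM hA).
  by apply: (proj1 (IM _ _ _)); apply: (proj2 (IM _ _ _)); exact: (proj2 (IM _ _ _)).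
by apply/seteqP; split => // w _; rewrite -[w]mul1r; case: (IM 1 w I1).
Qed.

(** The element c belongs to no finite stage, whereas [unperf] needs comparisons within one. So c^2
    is replaced by a cut x of an approximant, and the witnesses of fullness in D are approximated
    along with it. *)
Lemma full_cut (c : D) : simple D -> pos c -> c <> 0 -> nrm c <= 2^-1 -> exists n k x,
  [/\ L n x, pos x, nrm x <= 1, ple (x * x * x) (x * (c * c) * x) & sle (L n) [:: 1] (nseq k (x * x * x))].
Proof.
move=> sD pc c0 nc; have sc := pos_sa pc; pose C := c * c.
have pC : pos C := pos_sqr sc.
have C0 : C <> 0 by move=> h; apply: c0; apply: cs_eq0; rewrite sc.
have nC : nrm C <= 1 by have := nrmM_le nc nc; rewrite -/C; lra.
have [k [z hz]] := simple_full sD (pos_conj_sa (pos_sa pC) pC) (cube_neq0 pC C0).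
have [Zm [Zm1 hZm]] := bound_seq [seq z i | i <- enum 'I_k].
have {}hZm i : nrm (z i) <= Zm by apply: hZm; apply: map_f; rewrite mem_enum.
pose K : R := k%:R + 1; have K0 : 0 < K by rewrite ltr_wpDl.
have K1 : k%:R <= K by rewrite /K; lra.
have k0 : 0 <= k%:R :> R by [].
(* The perturbed sum differs from 1 by at most 6/64 + 1/16, below 1/2; the 6 comes from |x^3 - C^3|
   <= 6 s. *)
pose del := (16 * (K * (2 * Zm + 1)))^-1; pose s := (64 * (K * (Zm + 1) ^+ 2))^-1.
have K1' : 1 <= K by rewrite /K lerDr.
have d0 : 0 < del by rewrite invr_gt0 !mulr_gt0 //; lra.
have s0 : 0 < s by rewrite invr_gt0 !mulr_gt0 // ?exprn_gt0 //; lra.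
have inv16 (X q : R) : 0 < X -> X * (q * X)^-1 = q^-1.
  by move=> X0; rewrite invfM mulrCA mulfV ?mulr1 // lt0r_neq0.
have dE : K * (2 * Zm + 1) * del = 16^-1 by apply: inv16; rewrite mulr_gt0 //; lra.
have sE : K * (Zm + 1) ^+ 2 * s = 64^-1 by apply: inv16; rewrite mulr_gt0 // exprn_gt0 //; lra.
have d1 : del <= 1.
  by rewrite /del invf_le1 ?mulr_gt0 //; last lra; nra.
have s1 : s <= 1.
  rewrite /s invf_le1; last by rewrite !mulr_gt0 // ?exprn_gt0 //; lra.
  have h : 1 <= (Zm + 1) ^+ 2 by rewrite expr2; nra.
  by nra.
have [n1 [zt [Lz hzt]]] := L_approx_fam z d0.
have s2 : 0 < s / 2 by lra.
have [n2 [ct [Lc hct]]] := L_approx c s2.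
pose n := maxn n1 n2; pose Ct := star ct * ct; have cL := gg_csub (fun _ => False) n.
have Lct : L n ct by apply: L_mono Lc; exact: leq_maxr.
have Lzt i : L n (zt i) by apply: L_mono (Lz i); exact: leq_maxl.
have pCt : pos Ct := pos_cs ct.
have nct : nrm ct <= 2^-1 + s / 2 by have := nrmD (ct - c) c; rewrite subrK; lra.
have nCt : nrm Ct <= 1 by rewrite nrm_cs expr2; have := nrm_ge0 ct; nra.
have hC : nrm (Ct - C) <= s.
  have -> : Ct - C = star ct * (ct - c) + (star ct - c) * c by rewrite /Ct /C; ncring.
  apply: le_trans (nrmD _ _) _.
  have h1 : nrm (star ct * (ct - c)) <= (2^-1 + s / 2) * (s / 2) by apply: nrmM_le; rewrite ?nrm_star.
  have h2 : nrm ((star ct - c) * c) <= s / 2 * 2^-1 by apply: nrmM_le => //; rewrite -nrm_star starB starK sc.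
  by nra.
have s01 : 0 <= s <= 1 by lra.
have [c1 _ _ _ c5] := cutP s01 pCt nCt; pose x := cut s Ct.
have [_ hx] := cut_rest s01 pCt nCt; rewrite -/x in c1 c5 hx.
have xC : nrm (x - C) <= 2 * s.
  by rewrite nrmB in hx; have := nrm_tri hx hC; lra.
have x3 : nrm (x * x * x - C * C * C) <= 6 * s.
  have -> : x * x * x - C * C * C = (x - C) * x * x + C * (x - C) * x + C * C * (x - C) by ncring.
  apply: le_trans (nrmD _ _) _; apply: le_trans (lerD (nrmD _ _) (lexx _)) _.
  have h1 : nrm ((x - C) * x * x) <= 2 * s * 1 * 1 by do 2!apply: nrmM_le => //.
  have h2 : nrm (C * (x - C) * x) <= 1 * (2 * s) * 1 by do 2!apply: nrmM_le => //.
  have h3 : nrm (C * C * (x - C)) <= 1 * 1 * (2 * s) by do 2!apply: nrmM_le => //.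
  by lra.
have nC3 : nrm (C * C * C) <= 1.
  by have h : nrm (C * C * C) <= 1 * 1 * 1 by [do 2!apply: nrmM_le => //]; rewrite !mulr1 in h.
have Lx : L n x by apply: (cut_csub cL s01 pCt nCt); apply: (csubM cL) => //; exact: (csubS cL).
have px3 : pos (x * x * x) by apply: pos_conj_sa => //; exact: pos_sa.
pose Y := \sum_i star (zt i) * (x * x * x) * zt i.
have pY : pos Y by apply: pos_sum => i _; exact: pos_conj.
have nzt i : nrm (zt i) <= Zm + 1.
  by have := nrmD (zt i - z i) (z i); rewrite subrK; have := hzt i; have := hZm i; lra.
have Y1 : nrm (1 - Y) <= 2^-1.
  rewrite -hz /Y -sumrB; pose ee := (Zm + 1) * (6 * s) * (Zm + 1) + (del * 1 * (Zm + 1) + Zm * 1 * del).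
  apply: le_trans (nrm_sum_const (e := ee) _) _ => [i|].
    rewrite nrmB; set X3 := x * x * x in x3 *; set C3 := C * C * C in x3 nC3 *.
    have -> : star (zt i) * X3 * zt i - star (z i) * C3 * z i = star (zt i) * (X3 - C3) * zt i +
        (star (zt i - z i) * C3 * zt i + star (z i) * C3 * (zt i - z i)) by rewrite starB; ncring.
    apply: le_trans (nrmD _ _) _; apply: lerD.
      by apply: nrmM_le => //; apply: nrmM_le => //; rewrite nrm_star.
    apply: le_trans (nrmD _ _) _; apply: lerD.
      by apply: nrmM_le => //; apply: nrmM_le => //; rewrite nrm_star.
    by apply: nrmM_le => //; apply: nrmM_le => //; rewrite nrm_star.
  rewrite card_ord; have ee0 : 0 <= ee by rewrite /ee !addr_ge0 // !mulr_ge0 //; lra.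
  apply: le_trans (ler_wpM2r ee0 K1) _.
  have -> : K * ee = 6 * (K * (Zm + 1) ^+ 2 * s) + K * (2 * Zm + 1) * del by rewrite /ee; ring.
  by rewrite dE sE; lra.
have hY : ple 2^-1%:I Y.
  have := ple_approx (star1 _) (pos_sa pY) Y1; rewrite /ple => h.
  have -> // : Y - 2^-1%:I = Y + 2^-1%:I - 1.
  have h1 : (1 : D) = 2^-1%:I + 2^-1%:I by rewrite rcD -[LHS]rc1; congr (_%:C *: _); field.
  by rewrite [X in _ = _ - X]h1; ncring.
have h2 : 0 < (2^-1 : R) by rewrite invr_gt0.
have [kk [kYk pkk _ kE]] := invsqrt h2 hY.
have LY : L n Y.
  by apply: (csub_sum cL) => i; do 4?[apply: (csubM cL) => //]; exact: (csubS cL).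
exists n, k, x; split => //; first exact: (cut_cube s01 pCt nCt (pos_sa pC) hC).
have uL := gg_usub (fun _ => False) n.
have h : cle (L n) (fun _ : unit => (1 : D)) (fun _ : 'I_k => x * x * x).
  apply: (cle_exact (V := fun i _ => zt i * kk)) => [i _|[] []]; first by apply: (csubM cL) => //; exact: (kE _ cL LY).
  rewrite -kYk /Y mulr_sumr mulr_suml; apply: eq_bigr => i _.
  by rewrite starMr (pos_sa pkk) !mulrA.
by have := sle_fam uL h; rewrite !codom_cst card_unit card_ord.
Qed.

(** Bernoulli's inequality for (1 + 1/M)^j, cleared of denominators, at j = M (c+1). *)
Lemma expn_growth M c : (0 < M)%N -> exists j, (0 < j)%N /\ (c * M ^ j <= M.+1 ^ j)%N.
Proof.
move=> M0; have h j : (M ^ j * (M + j) <= M * M.+1 ^ j)%N.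
  elim: j => [|j IH]; first by rewrite !expn0 addn0 mul1n muln1.
  rewrite !expnS; have : (M.+1 * (M ^ j * (M + j)) <= M.+1 * (M * M.+1 ^ j))%N by rewrite leq_mul2l IH orbT.
  by nia.
exists (M * c.+1)%N; split; first by rewrite muln_gt0 M0.
rewrite -(leq_pmul2l M0); apply: leq_trans (h _); rewrite mulnA mulnC leq_mul2l; apply/orP; right.
by rewrite mulnS; lia.
Qed.

(** After enough rounds (M+1)^j [r] <= k M^j [x^3] with 2 k M^j <= (M+1)^j, so [unperf] with C = 1
    gives [r] <= [x^3]. Since x^3 <= x b^2 x with b a multiple of c, the polar part of b x v0 r
    realises the equivalence inside the hereditary subalgebra of c. *)
Lemma small_rest M n (S : seq A) (eps : R) (c : D) : (0 < M)%N -> (forall j, level M j) -> simple D ->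
  pos c -> c <> 0 -> 0 < eps -> exists n' (p : D) (F : D -> Prop),
  [/\ [/\ projection p, p <> 0 & gg (B n) n' p],
    [/\ star_subalgebra F, finite_dimensional F, (forall x, F x -> gg (B n) n' x), F p & forall x, F x -> p * x = x /\ x * p = x],
    (forall a, a \in S -> nrm (p * jA a - jA a * p) <= eps /\ exists x, F x /\ nrm (p * jA a * p - x) <= eps)
  & exists V y, star V * V = 1 - p /\ V * star V = c * y * c].
Proof.
move=> M0 hlev sD pc c0 eps0; pose lam := (2 * nrm c)^-1; pose b := lam *^ c.
have nc := nrm_gt0 c0.
have lam0 : 0 < lam by rewrite invr_gt0 mulr_gt0.
have nb : nrm b <= 2^-1.
  by rewrite nrmZ0 ?(ltW lam0) // /lam invfM -mulrA mulVf ?mulr1 // lt0r_neq0.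
have pb : pos b by apply: posZ => //; exact: ltW.
have b0 : b <> 0.
  move=> h; apply: c0; have : lam^-1 *^ b = 0 by rewrite h scaler0.
  by rewrite rcM mulVf ?rc1 // lt0r_neq0.
have [n0 [k [x [Lx px nx x3 hx]]]] := full_cut sD pb b0 nb.
have [j [j0 hj]] := expn_growth (2 * k) M0.
pose N := maxn n n0; have nN : (n <= N)%N := leq_maxl _ _.
have [n' [p [F [[Nn' pp] Ep [sF fF FE Fp Fu] happ [hle hp]]]]] := hlev j N S eps eps0.
have BN y : B n y -> B N y by exact: B_mono.
have gN y : gg (B N) n' y -> gg (B n) n' y by apply: gg_mono.
have gL y : gg (B N) n' y -> L n' y by apply: gg_mono.
have uL := gg_usub (fun _ => False) n'.
pose r := 1 - p; have pr : projection r := projC pp; have [rr sr] := pr.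
have n0n' : (n0 <= n')%N := leq_trans (leq_maxr n n0) Nn'.
have h1 : sle (L n') (nseq (M.+1 ^ j) r) (nseq (M ^ j * k) (x * x * x)).
  apply: (sle_trans uL (cle_mono gL hle)).
  have h : sle (L n') [:: 1] (nseq k (x * x * x)) by apply: cle_mono hx => y; exact: L_mono.
  by have := sle_smul uL (M ^ j) h; rewrite -[[:: 1]]/(nseq 1 _) !smul_nseq muln1.
have [n'' [u [mu [nn'' Uu hmu muq mug]]]] := tower_units n' (M.+1 ^ j).
have Lr : L n' r by apply: (csubB (gg_csub _ _)); [exact: (usub1 uL)|exact: gL].
have Lx3 : L n' (x * x * x) by do 2![apply: (usubM uL); last exact: L_mono Lx]; exact: L_mono Lx.
have uL' := gg_usub (fun _ => False) n''.
have h2 : sle (L n'') [:: r] (nseq 1 (x * x * x)).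
  apply: (unperf hmu uL uL' (fun y => @L_mono n' n'' y nn'') _ (mug (fun _ => False)) Lr Lx3 _ (leqW Uu) _ h1).
  - by move=> s t; apply: gg_q; apply: (qq_mono _ (leqnn _) (muq s t)).
  - by rewrite expn_gt0.
  - by rewrite mul1n (leq_trans _ hj) // mulnAC mulnA.
have i2 : 0 < (2^-1 : R) by rewrite invr_gt0.
have [v [_]] := sle_one uL' h2 i2; rewrite big_ord_recl big_ord0 addr0; set v0 := v ord0 => hv.
pose w := b * x * v0 * r; pose q := star v0 * (x * x * x) * v0.
have lw : ple (2^-1 *^ r) (\sum_(i : unit) star w * w).
  have -> : \sum_(i : unit) star w * w = r * (star v0 * (x * (b * b) * x) * v0) * r.
    by rewrite (bigD1 tt) //= big1 ?addr0 => [|[] //]; rewrite /w !starMr sr (pos_sa pb) (pos_sa px) !mulrA.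
  have sq : star q = q by rewrite /q !starMr !starK (pos_sa px) !mulrA.
  (* An approximation within 1/2 already bounds the compression below by r / 2, and [normalize]
     makes it exact. *)
  have h3 := ple_conj_sa sr (ple_approx sr sq (eq_ind_r (fun t => t <= 2^-1) hv (nrmB r q))).
  have h4 := ple_conj_sa sr (ple_conj v0 x3).
  apply: (ple_trans _ h4); move: h3.
  have -> : r * (q + 2^-1%:I) * r = r * q * r + 2^-1 *^ (r * r) by ncring.
  rewrite -/q !rr /ple => h3.
  have e2 : r = 2^-1 *^ r + 2^-1 *^ r by rewrite rcD -[LHS]rc1; congr (_%:C *: _); field.
  move: h3; set a1 := (X in pos X -> _); set a2 := (X in _ -> pos X); have -> // : a1 = a2.
  by rewrite /a1 /a2 {4}e2; ncring.
have wr (i : unit) : w * r = w by rewrite /w -mulrA rr.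
have r01 : 0 < (2^-1 : R) <= 1 by lra.
have [kk [pk rk sk _ _]] := normalize pr wr r01 lw (fun _ => lexx (nrm w)).
exists n', p, F; split => //.
- by split => //; [exact: hp|exact: gN].
- by split => // y /FE; exact: gN.
exists (w * kk), ((lam * lam) *^ (x * v0 * r * kk * star (x * v0 * r * kk))); split.
  by move: sk; rewrite (bigD1 tt) //= big1 ?addr0 // => [[]].
by rewrite /w /b !mulZl starZr !starMr (pos_sa pc) !(mulZl, mulZr) rcM !mulrA.
Qed.

(** The finite set is approximated by sums of a (x) b with b at a stage n. As F lies in an algebra
    commuting with stage n, the products of F with stage n form the required finite-dimensional
    subalgebra with unit p. *)
Lemma tower_taf : TAF D.
Proof.
have sD := tower_simple; split => // S e c fS e0 /pos_eltP pc c0.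
have [Mc [Mc0 hmain]] := main1.
pose M := (4 * Mc)%N; have M0 : (0 < M)%N by rewrite muln_gt0.
have hlev j : level M j by elim: j => [|j IH]; [exact: level0|exact: next_level].
have [s hs] := (finite_seqP S).1 fS.
have e8 : 0 < e / 8 by rewrite divr_gt0.
have /choice [t ht'] (d : D) : exists t : nat * seq (A * Q), (forall ab, ab \in t.2 -> B t.1 ab.2) /\
   nrm (\sum_(ab <- t.2) jA ab.1 * jQ ab.2 - d) <= e / 8.
  have [n [k [a [b [Bb h]]]]] := Ldense d e8.
  exists (n, [seq (a i, b i) | i <- enum 'I_k]); split => [ab /mapP[i _ ->] /=|]; first exact: Bb.
  by rewrite big_map big_enum.
pose n := (\max_(d <- s) (t d).1)%N; pose SA := [seq ab.1 | ab <- flatten [seq (t d).2 | d <- s]].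
pose K : R := 1 + \sum_(d <- s) \sum_(ab <- (t d).2) nrm (jQ ab.2).
have K0 : 0 < K.
  by rewrite ltr_pwDl // sumr_ge0 // => d _; rewrite sumr_ge0 // => ab _; exact: nrm_ge0.
have Kd d : d \in s -> \sum_(ab <- (t d).2) nrm (jQ ab.2) <= K.
  move=> ds; rewrite /K (big_rem d) //= addrCA lerDl addr_ge0 // sumr_ge0 // => d' _.
  by rewrite sumr_ge0 // => ab _; exact: nrm_ge0.
(* K bounds the total norm of the Q-coefficients of each approximant, so errors on the A-parts add
   up to at most e / 8. *)
pose eps := e / 8 / K; have eps0 : 0 < eps by rewrite divr_gt0.
have [n' [p [F [[pp p0 Ep] [[F0 FD FZ FM FS] fF FE Fp Fu] happ [V [y [VV Vc]]]]]]] :=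
  small_rest n SA M0 hlev sD pc c0 eps0.
have [ppp sp] := pp.
have sB l z : B l z -> B l (star z) by exact: Bstar.
have gB z b : gg (B n) n' z -> B n b -> jQ b * z = z * jQ b by move=> hz Bb; exact: (gg_commN (sB n) Bb hz).
have [k [mu [[muM muS mu1] Bmu]]] := Bspan n.
have Bm i l : B n (mu i l).
  apply/Bmu; exists (fun a b => ((a == i) && (b == l))%:R).
  rewrite (bigD1 i) //= (bigD1 l) //= !eqxx scale1r big1 => [|b bl]; last by rewrite (negbTE bl) andbF scale0r.
  rewrite big1 ?addr0 // => a ai; rewrite big1 // => b _; by rewrite (negbTE ai) scale0r.
(* Coefficients in F over the matrix units of stage n, a description that makes the products and the
   dimension explicit. *)
pose G z := exists f : 'I_k.+1 -> 'I_k.+1 -> D, (forall i l, F (f i l)) /\ z = \sum_i \sum_l f i l * jQ (mu i l).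
have Fsum (I : finType) (f : I -> D) : (forall i, F (f i)) -> F (\sum_i f i).
  by move=> hf; elim/big_rec: _ => // i z _; exact: FD.
have GD z z' : G z -> G z' -> G (z + z').
  move=> [f [hf ->]] [g [hg ->]]; exists (fun i l => f i l + g i l); split=> [i l|]; first exact: FD.
  by rewrite -big_split; apply: eq_bigr => i _; rewrite -big_split; apply: eq_bigr => l _; rewrite mulrDl.
have G0 : G 0.
  by exists (fun _ _ => 0); split => //; rewrite big1 // => i _; rewrite big1 // => l _; rewrite mul0r.
have Gb x b : F x -> B n b -> G (x * jQ b).
  move=> Fx /Bmu [cc ->]; exists (fun i l => cc i l *: x); split=> [i l|]; first exact: FZ.
  rewrite (lin_sum lQ) mulr_sumr; apply: eq_bigr => i _; rewrite (lin_sum lQ) mulr_sumr.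
  by apply: eq_bigr => l _; rewrite (linZ lQ) mulZr mulZl.
have Gp x : F x -> G x.
  by move=> Fx; rewrite -[x]mulr1 -(hom1 hQ); apply: Gb => //; exact: (usub1 (B_usub n)).
have comm i l x : F x -> jQ (mu i l) * x = x * jQ (mu i l) by move=> /FE hx; apply: gB.
have GM z z' : G z -> G z' -> G (z * z').
  move=> [f [hf ->]] [g [hg ->]]; exists (fun i l => \sum_j f i j * g j l); split=> [i l|].
    by apply: Fsum => j; exact: FM.
  rewrite mulr_suml; apply: eq_bigr => i _; rewrite mulr_suml.
  have E j : f i j * jQ (mu i j) * (\sum_a \sum_l g a l * jQ (mu a l)) = \sum_l f i j * g j l * jQ (mu i l).
    rewrite mulr_sumr (bigD1 j) //= [X in _ + X]big1 ?addr0 => [|a aj].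
      rewrite mulr_sumr; apply: eq_bigr => l _.
      by rewrite mulrA -(mulrA (f i j)) comm // mulrA -mulrA -(homM hQ) muM eqxx.
    rewrite mulr_sumr big1 // => l _; rewrite mulrA -(mulrA (f i j)) comm // mulrA -mulrA -(homM hQ) muM.
    by rewrite eq_sym (negbTE aj) (lin0 lQ) mulr0.
  rewrite (eq_bigr _ (fun j _ => E j)) exchange_big; apply: eq_bigr => l _ /=.
  by rewrite mulr_suml.
exists p, G; split => //.
- split; first split => //.
  + move=> a z [f [hf ->]]; exists (fun i l => a *: f i l); split=> [i l|]; first exact: FZ.
    by rewrite scaler_sumr; apply: eq_bigr => i _; rewrite scaler_sumr; apply: eq_bigr => l _; rewrite mulZl.
  + move=> z [f [hf ->]]; exists (fun i l => star (f l i)); split=> [i l|]; first exact: FS.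
    rewrite star_sum (eq_bigr (fun i => \sum_l star (f i l) * jQ (mu l i))) => [|i _]; first exact: exchange_big.
    by rewrite star_sum; apply: eq_bigr => l _; rewrite starMr -(homS hQ) muS comm //; exact: FS.
  + have [d [ee hee]] := fF.
    pose I : finType := ('I_k.+1 * 'I_k.+1 * 'I_d)%type.
    exists #|I|, (fun a => let: (i, l, s') := (enum_val a : I) in ee s' * jQ (mu i l)) => z [f [hf ->]].
    have /choice [cc hcc] (il : 'I_k.+1 * 'I_k.+1) : exists cc : 'I_d -> R[i], f il.1 il.2 = \sum_a cc a *: ee a.
      exact: hee.
    exists (fun a => let: (i, l, s') := (enum_val a : I) in cc (i, l) s').
    rewrite (eq_bigr (fun a => (fun x : I => cc (x.1.1, x.1.2) x.2 *: (ee x.2 * jQ (mu x.1.1 x.1.2))) (enum_val a))); last first.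
      by move=> a _; case: (enum_val a) => [[i l] s'].
    rewrite -(big_enum_val (fun x : I => cc (x.1.1, x.1.2) x.2 *: (ee x.2 * jQ (mu x.1.1 x.1.2)))) /=.
    rewrite [RHS](eq_bigl xpredT) // -(pair_bigA _ (fun (il : 'I_k.+1 * 'I_k.+1) a => cc (il.1, il.2) a *: (ee a * jQ (mu il.1 il.2)))) /=.
    rewrite -(pair_bigA _ (fun i l => \sum_a cc (i, l) a *: (ee a * jQ (mu i l)))) /=.
    apply: eq_bigr => i _; apply: eq_bigr => l _; rewrite (hcc (i, l)) mulr_suml.
    by apply: eq_bigr => a _; rewrite mulZl.
- split; first exact: Gp.
  move=> z [f [hf ->]]; split.
    rewrite mulr_sumr; apply: eq_bigr => i _; rewrite mulr_sumr; apply: eq_bigr => l _.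
    by rewrite mulrA (proj1 (Fu _ (hf i l))).
  rewrite mulr_suml; apply: eq_bigr => i _; rewrite mulr_suml; apply: eq_bigr => l _.
  by rewrite -mulrA comm // mulrA (proj2 (Fu _ (hf i l))).
- move=> b; rewrite hs /= => bs; have [Bt htb] := ht' b.
  have Bn ab : ab \in (t b).2 -> B n ab.2.
    by move=> /Bt; apply: B_mono; by rewrite /n (big_rem b bs) /= leq_max leqnn.
  have SAb ab : ab \in (t b).2 -> ab.1 \in SA.
    by move=> hab; apply: map_f; apply/flattenP; exists (t b).2 => //; apply: map_f.
  set bt := \sum_(ab <- _) _ in htb.
  have np : nrm p <= 1 := proj_nrm pp.
  have KE : K * eps = e / 8 by rewrite /eps mulrC divfK // lt0r_neq0.
  have sumle (f : A * Q -> D) : (forall ab, ab \in (t b).2 -> nrm (f ab) <= eps * nrm (jQ ab.2)) ->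
     nrm (\sum_(ab <- (t b).2) f ab) <= e / 8.
    move=> hf; apply: le_trans (nrm_sum _ _ _) _; rewrite big_seq.
    apply: le_trans (ler_sum _ hf) _; rewrite -big_seq -mulr_sumr -KE mulrC.
    by apply: ler_wpM2r; [exact: ltW|exact: Kd].
  have h1 : nrm (p * bt - bt * p) <= e / 8.
    rewrite mulr_sumr mulr_suml -sumrB; apply: sumle => ab hab.
    have -> : p * (jA ab.1 * jQ ab.2) - jA ab.1 * jQ ab.2 * p = (p * jA ab.1 - jA ab.1 * p) * jQ ab.2.
      by rewrite -(mulrA _ _ p) (gB _ _ Ep (Bn _ hab)); ncring.
    by apply: nrmM_le => //; exact: (proj1 (happ _ (SAb _ hab))).
  have /choice [xx hxx] (ab : A * Q) : exists x, F x /\ (ab \in (t b).2 -> nrm (p * jA ab.1 * p - x) <= eps).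
    case: (boolP (ab \in (t b).2)) => hab; last by exists 0.
    by have [_ [x [Fx hx]]] := happ _ (SAb _ hab); exists x.
  split.
    rewrite nrm_lt; have -> : p * b - b * p = (p * bt - bt * p) - (p * (bt - b) - (bt - b) * p) by ncring.
    apply: le_lt_trans (nrmD _ _) _; rewrite nrmN; apply: le_lt_trans (lerD h1 (nrmD _ _)) _; rewrite nrmN.
    have := nrmM_le np htb; have := nrmM_le htb np; lra.
  exists (\sum_(ab <- (t b).2) xx ab * jQ ab.2).
    rewrite big_seq; elim/big_rec: _ => // ab z hab; apply: GD; apply: Gb; [exact: (proj1 (hxx ab))|exact: Bn].
  have h2 : nrm (p * bt * p - \sum_(ab <- (t b).2) xx ab * jQ ab.2) <= e / 8.
    rewrite mulr_sumr mulr_suml -sumrB; apply: sumle => ab hab.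
    have -> : p * (jA ab.1 * jQ ab.2) * p - xx ab * jQ ab.2 = (p * jA ab.1 * p - xx ab) * jQ ab.2.
      by rewrite mulrA -(mulrA _ _ p) (gB _ _ Ep (Bn _ hab)); ncring.
    by apply: nrmM_le => //; exact: (proj2 (hxx ab)).
  rewrite nrm_lt; have -> : p * b * p - \sum_(ab <- (t b).2) xx ab * jQ ab.2 =
     (p * bt * p - \sum_(ab <- (t b).2) xx ab * jQ ab.2) - p * (bt - b) * p by ncring.
  apply: le_lt_trans (nrmD _ _) _; rewrite nrmN.
  have := nrmM_le (nrmM_le np htb) np; lra.
exists (V * star V); last by exists V.
(* The usual fact on partial isometries, here used to see that V V^* is a projection. *)
have Vp : V * (1 - p) = V.
  apply/eqP; rewrite -subr_eq0; apply/eqP; apply: cs_eq0.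
  have [h1 h2] := projC pp.
  have -> : star (V * (1 - p) - V) * (V * (1 - p) - V) =
    (1 - p) * (star V * V) * (1 - p) - (1 - p) * (star V * V) - (star V * V) * (1 - p) + star V * V.
    by rewrite starB starMr h2; ncring.
  by rewrite VV !h1; ncring.
split; first by split; [rewrite mulrA -(mulrA V) VV Vp|rewrite starMr starK].
by apply: subset_closure; exists y.
Qed.

End Tower.

Lemma tensor_dense (R : realType) (A Q D : cstarType R) (jA : A -> D) (jQ : Q -> D) (B : nat -> Q -> Prop) (d : D) (e : R) :
  unital_star_hom jQ -> dense [set z : D | exists n (a : 'I_n -> A) (b : 'I_n -> Q), z = elementary_sum jA jQ a b] ->
  (forall n x, B n x -> B n.+1 x) -> (forall x (d : R), 0 < d -> exists n y, B n y /\ nrm (y - x) <= d) ->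
  0 < e -> exists n k (a : 'I_k -> A) (b : 'I_k -> Q),
    (forall i, B n (b i)) /\ nrm (\sum_i jA (a i) * jQ (b i) - d) <= e.
Proof.
move=> hQ dns Bup Bdense; have lQ : linear jQ by case: hQ => [[]].
move=> e0; have e2 : 0 < e / 2 by rewrite divr_gt0.
have [w [k [a [b ->]]] hw] := dense_approx d dns e2.
pose K := \sum_i nrm (jA (a i)) + 1.
have K0 : 0 < K by rewrite ltr_wpDl // sumr_ge0 // => i _; exact: nrm_ge0.
have /choice [y hy] i : exists y : nat * Q, B y.1 y.2 /\ nrm (y.2 - b i) <= e / 2 / K.
  by have [n [y [By hy]]] := Bdense (b i) _ (divr_gt0 e2 K0); exists (n, y).
exists (\max_i (y i).1)%N, k, a, (fun i => (y i).2); split.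
  by move=> i; apply: (B_mono Bup) (proj1 (hy i)); exact: (leq_bigmax_cond i).
have h : nrm (\sum_i jA (a i) * jQ (y i).2 - elementary_sum jA jQ a b) <= e / 2.
  rewrite /elementary_sum -sumrB; apply: le_trans (nrm_sum _ _ _) _.
  apply: (@le_trans _ _ (\sum_i nrm (jA (a i)) * (e / 2 / K))).
    apply: ler_sum => i _; rewrite -mulrBr -(linB lQ); apply: nrmM_le => //.
    exact: le_trans (hom_nrm hQ _) (proj2 (hy i)).
  rewrite -mulr_suml -[leRHS](divfK (lt0r_neq0 K0)) mulrC; apply: ler_wpM2l.
    by rewrite divr_ge0 ?ltW.
  by rewrite /K lerDl.
by have := nrm_tri h hw; rewrite -mulrDl -mulr2n -[e *+ 2]mulr_natr mulfK.
Qed.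

Theorem corollary2p4 (R : realType) (A Q AQ : cstarType R)
    (jA : A -> AQ) (jQ : Q -> AQ) :
  separable A -> simple A -> monotracial A -> finite_nuclear_dimension A ->
  quasidiagonal A ->
  universal_UHF Q -> cstar_tensor_product jA jQ ->
  TAF AQ.
Proof.
move=> _ sA [tau [ht hu]] [m hnd] qd uQ [[hA hQ jC inj] dns _].
have {}hu t : tracial_state t -> t = tau by move=> /hu.
have [B [Bup Bstar Bdense Bspan Bunits]] := universal_units uQ.
have Q1 : (1 : Q) <> 0.
  have [[B' [hB' _ _]] _] := uQ; have [k [e [le eM eS e1 [ei _]]]] := hB' 0%N => h.
  have he : mxrep e by split.
  have := ei 1%:M 0; rewrite e1 (rep0 he) => /(_ h); apply/eqP; exact: oner_neq0.
(* The clause on tensors is applied to a (x) 1; the one-term family 1 is linearly independent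
   because Q is nonzero. *)
have jA_inj a : jA a = 0 -> a = 0.
  move=> ja; apply: (inj 1%N (fun _ => a) (fun _ => 1)) ord0.
    move=> c; rewrite big_ord_recl big_ord0 addr0 => h i; rewrite ord1; apply/eqP.
    move/eqP: h; rewrite scaler_eq0 => /orP[//|/eqP]; exact: (fun h => False_ind _ (Q1 h)).
  by rewrite /elementary_sum big_ord_recl big_ord0 addr0 ja mul0r.
have D1 : (1 : AQ) <> 0.
  by move=> h; apply: (proj1 sA); apply: jA_inj; rewrite (hom1 hA).
exact: (tower_taf hA hQ jC Bup Bstar Bspan Bunits sA ht hu qd hnd D1 jA_inj (fun d e => tensor_dense d hQ dns Bup Bdense)).
Qed.
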